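(* Let $M_m$ be a von Mangoldt plane such that $G_m<0$ at some point and $\liminf_{r\to\infty}m(r)>0$. Then: (1) $M_m$ contains a line and has total curvature $-\infty$; (2) if $m'$ has a zero, then neither $A_m$ nor $\mathfrak C_m$ is connected; (3) $M_m\setminus A_m$ is a bounded subset of $M_m$; (4) the ball of poles of $M_m$ has positive radius.
   Context: For a smooth function $m\colon[0,\infty)\to[0,\infty)$ with $m(0)=0$, $m'(0)=1$, $m>0$ on $(0,\infty)$ and smooth odd extension, $M_m$ is $\mathbb R^2$ with metric $dr^2+m(r)^2d\theta^2$ (polar coordinates about origin $o$), curvature $G_m=-m''/m$; von Mangoldt means $G_m$ non-increasing in $r$. Total curvature is $\int_{M_m}G_m\,dA=2\pi\int_0^\infty G_m(r)m(r)\,dr$. A ray is a unit speed geodesic on $[0,\infty)$ minimizing between any two of its points; a line is a unit speed geodesic on $\mathbb R$ minimizing between any two of its points; a pole is a point from which every geodesic is a ray; the set of poles is a closed ball centered at $o$. $\mathfrak C_m$ is the set of points $q$ such that every unit tangent vector at $q$ makes angle $\le\pi/2$ with some ray from $q$. A ray $\gamma$ with $\gamma(0)\ne o$ points away from infinity if it makes angle $<\pi/2$ at $\gamma(0)$ with the segment from $\gamma(0)$ to $o$; $A_m\subset M_m\setminus\{o\}$ is the set of points from which a ray pointing away from infinity starts. *)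

(* Defs.v *)
From mathcomp Require Import all_boot all_order all_algebra.
From mathcomp Require Import all_classical all_reals all_analysis.
Set Implicit Arguments. Unset Strict Implicit. Unset Printing Implicit Defensive.
Import Order.TTheory GRing.Theory Num.Theory.
Import numFieldNormedType.Exports.
Local Open Scope classical_set_scope.
Local Open Scope ring_scope.

Section VonMangoldt.
Variable R : realType.
Implicit Types (m : R -> R) (p q v w : R * R).

(* m is given on all of R as its (smooth, odd) extension. *)
Definition smooth_fun (f : R -> R) : Prop :=
  forall (n : nat) (x : R), derivable (derive1n n f) x 1.

Definition admissible_profile m : Prop :=
  [/\ smooth_fun m, (forall x, m (- x) = - m x), m 0 = 0,
      derive1 m 0 = 1 & (forall r, 0 < r -> 0 < m r)].

(* Gaussian curvature G_m(r) = - m''(r)/m(r) for r > 0; at r = 0 its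
   (continuous) value  lim_{r->0} -m''/m = - m'''(0). *)
Definition Gm m (r : R) : R :=
  if r == 0 then - derive1n 3 m 0 else - derive1n 2 m r / m r.

Definition von_Mangoldt m : Prop :=
  forall r s, 0 <= r -> r <= s -> Gm m s <= Gm m r.

Definition total_curvature m : \bar R :=
  ((2 * pi)%:E * \int[@lebesgue_measure R]_(r in `[(0%R : R), +oo[) (Gm m r * m r)%:E)%E.

Definition edot p q : R := p.1 * q.1 + p.2 * q.2.
Definition enorm p : R := Num.sqrt (edot p p).
Definition origin : R * R := (0, 0).

(* The metric dr^2 + m(r)^2 dtheta^2 written in Cartesian coordinates:
   radial components are unchanged, angular components are scaled by m(r)/r;
   at the origin the metric is Euclidean (m'(0) = 1). *)
Definition gm m p v w : R :=
  if p == origin then edot v w else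
  let r := enorm p in
  let vr := edot p v / r in
  let wr := edot p w / r in
  let vt := (v.1 - vr * (p.1 / r), v.2 - vr * (p.2 / r)) in
  let wt := (w.1 - wr * (p.1 / r), w.2 - wr * (p.2 / r)) in
  vr * wr + (m r / r) ^+ 2 * edot vt wt.

Definition vel (c : R -> R * R) (t : R) : R * R :=
  (derive1 (fun s => (c s).1) t, derive1 (fun s => (c s).2) t).

Definition C1_curve (c : R -> R * R) : Prop :=
  (forall t, derivable (fun s => (c s).1) t 1 /\ derivable (fun s => (c s).2) t 1)
  /\ continuous (vel c).

Definition curve_length m (c : R -> R * R) (a b : R) : \bar R :=
  (\int[@lebesgue_measure R]_(t in `[a%R, b%R]) (Num.sqrt (gm m (c t) (vel c t) (vel c t)))%:E)%E.

Definition rdist m p q : \bar R :=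
  ereal_inf [set l | exists (c : R -> R * R) (a b : R),
     [/\ a <= b, C1_curve c, c a = p, c b = q & l = curve_length m c a b]].

(* Unit speed geodesic (M_m is complete, so geodesics are defined on all of R):
   a curve which is locally distance-preserving, i.e. unit speed and locally
   minimizing. *)
Definition geodesic m (c : R -> R * R) : Prop :=
  forall t, exists2 e : R, 0 < e & forall s u, `|s - t| < e -> `|u - t| < e ->
     rdist m (c s) (c u) = (`|s - u|)%:E.

Definition ray m (c : R -> R * R) : Prop :=
  geodesic m c /\ forall s t, 0 <= s -> 0 <= t -> rdist m (c s) (c t) = (`|s - t|)%:E.

Definition line m (c : R -> R * R) : Prop :=
  geodesic m c /\ forall s t, rdist m (c s) (c t) = (`|s - t|)%:E.

Definition pole m p : Prop :=
  forall c, geodesic m c -> c 0 = p -> ray m c.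

Definition Cset m : set (R * R) :=
  [set q | forall v, gm m q v v = 1 ->
     exists c, [/\ ray m c, c 0 = q & 0 <= gm m q v (vel c 0)]].

(* A_m: points q <> o from which a ray pointing away from infinity starts, i.e.
   whose initial velocity makes angle < pi/2 with the segment from q to o
   (the meridian, with initial direction -q). *)
Definition Aset m : set (R * R) :=
  [set q | q <> origin /\
     exists c, [/\ ray m c, c 0 = q & 0 < gm m q (vel c 0) (- q)]].

End VonMangoldt.

(* Main.v *)
(* Let f := m'/m and let W be the antiderivative of -1/m^2 on (0, oo) with
   W - f -> 0 at 0.  The von Mangoldt condition says that m'^2 - m m'' is
   non-increasing, hence at most 1, so W <= f everywhere and f - W is
   non-decreasing; with G < 0 somewhere and m bounded below at infinity, m'' is
   eventually bounded below by a positive constant, so m and m' tend to infinity,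
   W is bounded below and the total curvature is -oo.

   Geodesics are only given as local isometries of the distance.  Comparing
   lengths of consecutive short chords shows that they are C1 of unit speed; the
   first variation formula along rotations gives the Clairaut constant nu, and
   along radial shifts r'' = nu^2 m'/m^3.  If nu = 0 the geodesic is a straight
   line through the origin; if nu > 0, then with respect to the angle theta the
   function W(r) has derivative U = -r'/nu and second derivative -f(r).

   Poles: U and W are compared with the solutions of y'' + y = 0.  As |U| <= 1/nu
   and W is bounded below, a geodesic from a point p with W(|p|) > - inf W sweeps
   less than pi.  Two geodesics from p to the same point with sweep less than pi
   coincide, by Sturm comparison of the difference of their W(r) with sine.  So
   each geodesic from p agrees with the minimal segments and is a ray.

   Line: for some k one has 2 (r - k) <= m for r >= k, which makes
   (r - k) cos (2 theta) a 1-Lipschitz function outside the k-disk.  Hence almost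
   minimal paths from (n, 0) to (-n, 0) cross the second axis in a bounded set,
   and a subsequential limit (by Tychonoff) is a line.  Its incoming part, rotated
   and reflected, shows that all far points are in both sets A and C.

   Disconnectedness: no ray starts tangentially or inwards on the first critical
   parallel r = r1.  There W - W(r1) >= f for r <= r1, so an inward geodesic with
   nu <> 0 stays inside until it has swept pi, and after that is not minimal by
   reflection.  For nu = 0, m'^2 + (m/m(r1))^2 <= 1 on [0, r1] gives
   pi m(r1) <= 2 r1, so half of the parallel is no longer than the diameter.  A
   tangential geodesic is the parallel itself, which is bounded.  As A and C have
   points on both sides of this parallel, they are not connected. *)
Require Import Defs.
From mathcomp Require Import all_boot all_order all_algebra.
From mathcomp Require Import all_classical all_reals all_analysis.
From mathcomp Require Import measurable_realfun.
From mathcomp Require Import ring lra.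
Set Implicit Arguments. Unset Strict Implicit. Unset Printing Implicit Defensive.
Import Order.TTheory GRing.Theory Num.Theory.
Import numFieldNormedType.Exports.
Local Open Scope classical_set_scope.
Local Open Scope ring_scope.

(** * Calculus on the real line *)

Section Derivatives.
Variable R : realType.
Implicit Types (f g : R -> R) (a b x t : R).

(** W generalises Binet's substitution u = 1/r. The quantity m'^2 - m m'' is identically 1 exactly
    when the curvature is constant; then W = m'/m, and W(r) solves y'' + y = 0 in the angle. The von
    Mangoldt condition turns this identity into inequalities of fixed sign, so comparison with sine
    and cosine over an angle pi takes the place of Jacobi fields and of the exponential map. The
    obstacle is that no geodesic equation is given: a geodesic is only a curve of points at
    prescribed distances. The Cartesian metric is used as a Lipschitz metric, so at scale h the
    distance is the norm of a frozen metric up to a relative error O(h). The parallelogram law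
    bounds a squared norm and thus loses a square root: consecutive chords differ in direction by
    O(sqrt h), which still sums over dyadic scales and gives C1. The differential equations then
    come from comparing distances with those of a rotated or radially shifted copy of the curve,
    with the upper bound of the first variation at both ends. Polar coordinates break down at the
    origin, where exactly the geodesics with nu = 0 pass; these are treated in Cartesian form. *)

Lemma derD f g t a b : is_derive t 1 f a -> is_derive t 1 g b ->
  is_derive t 1 (fun s => f s + g s) (a + b).
Proof. move=> ? ?; exact: is_deriveD. Qed.
Lemma derN f t a : is_derive t 1 f a -> is_derive t 1 (fun s => - f s) (- a).
Proof. move=> ?; exact: is_deriveN. Qed.
Lemma derM f g t a b : is_derive t 1 f a -> is_derive t 1 g b ->
  is_derive t 1 (fun s => f s * g s) (a * g t + f t * b).
Proof.
move=> ? ?; apply: (is_derive_eq (is_deriveM _ _)).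
by rewrite /GRing.scale /= addrC mulrC.
Qed.
Lemma derV f t a : f t != 0 -> is_derive t 1 f a ->
  is_derive t 1 (fun s => (f s)^-1) (- a / f t ^+ 2).
Proof.
move=> h0 h; apply: (is_derive_eq (is_deriveV h0 h)).
by rewrite /GRing.scale /= mulNr mulrC mulNr.
Qed.
Lemma derX f t a n : is_derive t 1 f a ->
  is_derive t 1 (fun s => f s ^+ n.+1) (n.+1%:R * f t ^+ n * a).
Proof.
move=> h; rewrite (_ : (fun s => _) = f ^+ n.+1); last by rewrite exprfctE.
exact: is_deriveX.
Qed.
Lemma dercomp f g t a b : is_derive (g t) 1 f a -> is_derive t 1 g b ->
  is_derive t 1 (fun s => f (g s)) (a * b).
Proof. move=> ? ?; exact: is_derive1_comp. Qed.
Lemma dercst (c : R) t : is_derive t 1 (fun=> c) 0.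
Proof. exact: is_derive_cst. Qed.
Lemma derid t : is_derive t 1 (fun s => s) 1.
Proof. exact: is_derive_id. Qed.
Lemma dersin g t b : is_derive t 1 g b ->
  is_derive t 1 (fun s => sin (g s)) (cos (g t) * b).
Proof. by move=> h; apply: (dercomp (is_derive_sin _) h). Qed.
Lemma dercos g t b : is_derive t 1 g b ->
  is_derive t 1 (fun s => cos (g s)) (- sin (g t) * b).
Proof. by move=> h; apply: (dercomp (is_derive_cos _) h). Qed.
Lemma dersqrt g t b : 0 < g t -> is_derive t 1 g b ->
  is_derive t 1 (fun s => Num.sqrt (g s)) ((2 * Num.sqrt (g t))^-1 * b).
Proof. by move=> h0 h; apply: (dercomp (is_derive1_sqrt h0) h). Qed.

Lemma der_eq f t a b : is_derive t 1 f a -> a = b -> is_derive t 1 f b.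
Proof. by move=> ? <-. Qed.
End Derivatives.

Ltac der1 :=
  lazymatch goal with
  | |- is_derive _ _ (fun _ => ?c) _ => notypeclasses refine (@dercst _ c _)
  | |- is_derive _ _ (fun s => s) _ => notypeclasses refine (@derid _ _)
  | |- is_derive _ _ (fun s => @?f s + @?g s) _ =>
      notypeclasses refine (@derD _ f g _ _ _ _ _)
  | |- is_derive _ _ (fun s => - (@?f s)) _ => notypeclasses refine (@derN _ f _ _ _)
  | |- is_derive _ _ (fun s => (@?f s)^-1) _ =>
      notypeclasses refine (@derV _ f _ _ _ _)
  | |- is_derive _ _ (fun s => @?f s * @?g s) _ =>
      notypeclasses refine (@derM _ f g _ _ _ _ _)
  | |- is_derive _ _ (fun s => (@?f s) ^+ _) _ =>
      notypeclasses refine (@derX _ f _ _ _ _)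
  | |- is_derive _ _ (fun s => sin (@?f s)) _ =>
      notypeclasses refine (@dersin _ f _ _ _)
  | |- is_derive _ _ (fun s => cos (@?f s)) _ =>
      notypeclasses refine (@dercos _ f _ _ _)
  | |- is_derive _ _ (fun s => Num.sqrt (@?f s)) _ =>
      notypeclasses refine (@dersqrt _ f _ _ _ _)
  end; cbv beta.
Ltac der := repeat (first [eassumption | der1]).
(* Differentiates syntactically, leaving the equality of the two derivatives
   as the last goal. *)
Ltac derc := notypeclasses refine (@der_eq _ _ _ _ _ _ _); [der|cbv beta; cbv beta].

Section RealFunctions.
Variable R : realType.
Implicit Types (f g : R -> R) (a b x t : R).

Lemma contP f x : {for x, continuous f} <->
  forall e, 0 < e -> exists2 d, 0 < d & forall y, `|y - x| < d -> `|f y - f x| < e.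
Proof.
split.
  move=> /cvgrPdist_lt h e e0; have := h e e0.
  move=> /nbhs_ballP [d /= d0 hd]; exists d => // y yx.
  by rewrite distrC; apply: hd; rewrite /ball /= distrC.
move=> h; apply/cvgrPdist_lt => e e0; have [d d0 hd] := h e e0.
apply/nbhs_ballP; exists d => //= y; rewrite /ball /= => yx.
by rewrite distrC; apply: hd; rewrite distrC.
Qed.

Lemma der_cont f x a : is_derive x 1 f a -> {for x, continuous f}.
Proof. by move=> [h _]; apply/differentiable_continuous/derivable1_diffP. Qed.

Lemma derP f x a : is_derive x 1 f a <->
  forall e, 0 < e -> exists2 d, 0 < d &
    forall y, `|y - x| < d -> `|f y - f x - (y - x) * a| <= e * `|y - x|.
Proof.
have E (h : R) : h != 0 -> `|h^-1 *: (f (h *: 1 + x) - f x) - a| =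
    `|f (x + h) - f x - h * a| / `|h|.
  move=> h0; rewrite /GRing.scale /= mulr1 (addrC h x).
  by rewrite -normfV -normrM; congr (`|_|); field.
split.
  move=> hd e e0.
  have := @ex_derive _ _ _ _ _ _ _ hd => /cvg_ex [l hl].
  have la : l = a by have [_ <-] := hd; rewrite /derive; apply/esym/cvg_lim.
  subst l; move: hl => /cvgrPdist_lt /(_ e e0).
  move=> /nbhs_ballP [d /= d0 hd'].
  exists d => // y yx; have [->|ne] := eqVneq y x.
    by rewrite !subrr mul0r subr0 normr0 mulr0.
  have h0 : y - x != 0 by rewrite subr_eq0.
  have := hd' (y - x); rewrite /ball /= sub0r normrN => /(_ yx h0).
  rewrite distrC E // subrKC ltr_pdivrMr ?normr_gt0 //; exact: ltW.
move=> h; have hl : (fun h : R => h^-1 *: (f (h *: 1 + x) - f x)) @ 0^' --> a.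
  apply/cvgrPdist_lt => e e0; have [d d0 hd] := h (e/2) ltac:(lra).
  apply/nbhs_ballP; exists d => //= y.
  rewrite /ball /= sub0r normrN => yd y0; rewrite distrC E //.
  have := hd (x + y); rewrite (addrC x) addrK addrC => /(_ yd) hh.
  rewrite ltr_pdivrMr ?normr_gt0 //; apply: le_lt_trans hh _.
  by rewrite ltr_pM2r ?normr_gt0 //; lra.
split; first by apply/cvg_ex; exists a.
exact/cvg_lim.
Qed.

Lemma der_uniq f x a b : is_derive x 1 f a -> is_derive x 1 f b -> a = b.
Proof. by move=> [_ <-] [_ <-]. Qed.

Lemma der_near f g x a : (exists2 d, 0 < d & forall y, `|y - x| < d -> f y = g y) ->
  is_derive x 1 f a -> is_derive x 1 g a.
Proof.
move=> [d d0 h] /derP hf; apply/derP => e e0; have [d' d'0 hd'] := hf e e0.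
exists (Num.min d d'); first by rewrite lt_min d0.
move=> y; rewrite lt_min => /andP[yd yd']; rewrite -!h ?subrr ?normr0 //; exact: hd'.
Qed.

Lemma cont_within f a b : (forall x, a <= x -> x <= b -> {for x, continuous f}) ->
  {within `[a, b], continuous f}.
Proof.
move=> h; apply: continuous_in_subspaceT => x; rewrite inE /= in_itv /= => /andP[].
exact: h.
Qed.

Lemma mvt f df a b : a < b -> (forall x, a < x -> x < b -> is_derive x 1 f (df x)) ->
  (forall x, a <= x -> x <= b -> {for x, continuous f}) ->
  exists c, [/\ a < c, c < b & f b - f a = df c * (b - a)].
Proof.
move=> ab hd hc; have [|c] := @MVT _ f df a b ab _ (cont_within hc).
  by move=> x; rewrite in_itv /= => /andP[]; exact: hd.
by rewrite in_itv /= => /andP[? ?] ?; exists c.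
Qed.

Lemma mono_le f df a b : a <= b -> (forall x, a < x -> x < b -> is_derive x 1 f (df x)) ->
  (forall x, a <= x -> x <= b -> {for x, continuous f}) ->
  (forall x, a < x -> x < b -> 0 <= df x) -> f a <= f b.
Proof.
rewrite le_eqVlt => /predU1P[->//|ab] hd hc h.
have [c [ac cb E]] := mvt ab hd hc.
by rewrite -subr_ge0 E mulr_ge0 ?h ?subr_ge0 ?ltW.
Qed.

Lemma mono_lt f df a b : a < b -> (forall x, a < x -> x < b -> is_derive x 1 f (df x)) ->
  (forall x, a <= x -> x <= b -> {for x, continuous f}) ->
  (forall x, a < x -> x < b -> 0 < df x) -> f a < f b.
Proof.
move=> ab hd hc h; have [c [ac cb E]] := mvt ab hd hc.
by rewrite -subr_gt0 E mulr_gt0 ?h ?subr_gt0.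
Qed.

Lemma der0_cst f a b : a <= b -> (forall x, a < x -> x < b -> is_derive x 1 f 0) ->
  (forall x, a <= x -> x <= b -> {for x, continuous f}) -> f a = f b.
Proof.
rewrite le_eqVlt => /predU1P[->//|ab] hd hc.
have [c [ac cb /eqP]] := @mvt f (fun=> 0) _ _ ab hd hc.
by rewrite mul0r subr_eq0 => /eqP.
Qed.

Lemma der_lip f df a b K : a <= b -> (forall x, a < x -> x < b -> is_derive x 1 f (df x)) ->
  (forall x, a <= x -> x <= b -> {for x, continuous f}) ->
  (forall x, a < x -> x < b -> `|df x| <= K) -> `|f b - f a| <= K * (b - a).
Proof.
rewrite le_eqVlt => /predU1P[->|ab] hd hc h; first by rewrite !subrr normr0 mulr0.
have [c [ac cb ->]] := mvt ab hd hc.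
by rewrite normrM (gtr0_norm (_ : 0 < b - a)) ?subr_gt0 // ler_pM2r ?subr_gt0 // h.
Qed.

Lemma two_bounds a b : 0 < a -> 0 < b -> exists k, [/\ 0 < k, k < a & k < b].
Proof.
move=> a0 b0; exists (Num.min a b / 2).
have : 0 < Num.min a b by rewrite lt_min a0.
have : Num.min a b <= a by rewrite ge_min lexx.
have : Num.min a b <= b by rewrite ge_min lexx orbT.
by move: (Num.min a b) => c ? ? ?; split; lra.
Qed.

Lemma ivt f a b v : a <= b -> (forall x, a <= x -> x <= b -> {for x, continuous f}) ->
  f a <= v -> v <= f b -> exists c, [/\ a <= c, c <= b & f c = v].
Proof.
move=> ab hc h1 h2; have [|c] := @IVT _ f a b v ab (cont_within hc).
  by rewrite ge_min le_max h1 h2 orbT.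
by rewrite in_itv /= => /andP[? ?] ?; exists c.
Qed.

Lemma evt_max f a b : a <= b -> (forall x, a <= x -> x <= b -> {for x, continuous f}) ->
  exists c, [/\ a <= c, c <= b & forall x, a <= x -> x <= b -> f x <= f c].
Proof.
move=> ab hc; have [c] := EVT_max ab (cont_within hc).
rewrite in_itv /= => /andP[? ?] h; exists c; split => // x ? ?.
by apply: h; rewrite in_itv /=; apply/andP.
Qed.

Lemma evt_min f a b : a <= b -> (forall x, a <= x -> x <= b -> {for x, continuous f}) ->
  exists c, [/\ a <= c, c <= b & forall x, a <= x -> x <= b -> f c <= f x].
Proof.
move=> ab hc; have [c] := EVT_min ab (cont_within hc).
rewrite in_itv /= => /andP[? ?] h; exists c; split => // x ? ?.
by apply: h; rewrite in_itv /=; apply/andP.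
Qed.

Lemma cont_bounded f a b : (forall x, a <= x -> x <= b -> {for x, continuous f}) ->
  exists2 K, 0 <= K & forall x, a <= x -> x <= b -> `|f x| <= K.
Proof.
move=> hc; have [ab|ba] := leP a b; last first.
  by exists 0 => // x ax xb; have := le_lt_trans (le_trans ax xb) ba; rewrite ltxx.
have [c [_ _ h]] := @evt_max (fun x => `|f x|) a b ab
  (fun x h1 h2 => cvg_norm (hc x h1 h2)).
by exists `|f c|.
Qed.

Lemma der_max f (c a d : R) : 0 < d -> is_derive c 1 f a ->
  (forall x, `|x - c| < d -> f x <= f c) -> a = 0.
Proof.
move=> d0 /derP h hm; apply/eqP/negP => /negP a0.
have [e e0 he] := h (`|a| / 2) ltac:(rewrite divr_gt0 ?normr_gt0 //).
have m0 : 0 < Num.min d e / 2 by rewrite divr_gt0 // lt_min d0.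
have Mm : Num.min d e / 2 < Num.min d e by rewrite -ltr_pdivlMr // ?invr_gt0 // ?ltr_pdivrMr //; lra.
have [md me] : Num.min d e / 2 < d /\ Num.min d e / 2 < e.
  by move: (Mm); rewrite lt_min => /andP[].
set k := Num.min d e / 2 in m0 Mm md me.
have ns : `|Num.sg a| = 1 by rewrite normr_sg a0.
(* In the direction of the sign of [a] the function would rise above its maximum by at least
   [k |a| / 2]. *)
pose y := c + k * Num.sg a.
have Ey : y - c = k * Num.sg a by rewrite /y addrAC subrr add0r.
have ny : `|y - c| = k by rewrite Ey normrM ns mulr1 gtr0_norm.
have := he y; rewrite ny => /(_ me); have := hm y; rewrite ny => /(_ md) h1.
rewrite Ey -mulrA -normrEsg => h2.
have : k * `|a| <= `|a| / 2 * k.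
  apply: le_trans h2; rewrite distrC; apply: le_trans (ler_norm _); lra.
have : 0 < `|a| by rewrite normr_gt0.
nra.
Qed.

End RealFunctions.

Section Antiderivative.
Variable R : realType.
Notation mu := (@lebesgue_measure R).

Lemma antiderivative_right (h : R -> R) (a : R) : continuous h ->
  exists F : R -> R, forall x : R, a < x -> is_derive x 1 F (h x).
Proof.
move=> hc; exists (fun x => (\int[mu]_(t in [set` `[a, x]]) (h t))%R) => x ax.
have xx : x < x + 1 by rewrite ltrDl.
have hi : mu.-integrable `[a, x + 1] (EFin \o h).
  apply: continuous_compact_integrable; first exact: segment_compact.
  by apply: cont_within => y _ _; exact: hc.
have [h1 h2] := continuous_FTC1_closed xx hi ax (hc x).
by constructor; [exact: h1|rewrite -derive1E].
Qed.

(** The integral is differentiable only to the right of its base point, so the base point is moved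
    to the left of both [x] and 0; subtracting the value at 0 makes all base points agree. *)
Lemma antiderivative (h : R -> R) : continuous h ->
  exists H : R -> R, forall x : R, is_derive x 1 H (h x).
Proof.
move=> hc; have /choice [F hF] := fun a => antiderivative_right a hc.
pose n (x : R) := `|x| + 1.
have n_ge (x y : R) : `|y| <= `|x| -> - n x < y.
  move=> yx; have := ler_norm (- y); rewrite normrN /n; lra.
have agree (a b x : R) : a < x -> b < x -> a < 0 -> b < 0 ->
    F a x - F a 0 = F b x - F b 0.
  move=> ax bx a0 b0; apply/eqP; rewrite -subr_eq0 opprB addrACA addrC -subr_eq0.
  pose E y := F a y - F b y.
  have dE y : a < y -> b < y -> is_derive y 1 E 0.
    move=> ay by'; apply: (@der_eq _ _ _ (h y + - h y)); last by rewrite subrr.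
    by apply: derD; [|apply: derN]; exact: hF.
  have Ex : E x = E 0.
    have [x0|x0] := leP x 0; [|symmetry]; apply: der0_cst; rewrite ?(ltW x0) //.
    - by move=> y xy _; apply: dE; lra.
    - by move=> y xy _; apply: der_cont (dE _ _ _); lra.
    - by move=> y xy _; apply: dE; lra.
    - by move=> y xy _; apply: der_cont (dE _ _ _); lra.
  by move: Ex; rewrite /E => Ex; apply/eqP; lra.
exists (fun x => F (- n x) x - F (- n x) 0) => x.
(* A single base point, lower by 1, serves all [y] within distance 1 of [x]. *)
apply: (@der_near _ (fun y => F (- (n x + 1)) y - F (- (n x + 1)) 0)).
  exists 1 => // y yx; have n0 (z : R) : 0 <= `|z| by [].
  have nyx : `|y| <= `|x| + 1.
    by have := ler_normD (y - x) x; rewrite subrK; lra.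
  apply: agree; rewrite /n.
  - have := ler_norm (- y); rewrite normrN; lra.
  - have := ler_norm (- y); rewrite normrN; lra.
  - have := n0 x; lra.
  - have := n0 y; lra.
have hx : is_derive x 1 (F (- (n x + 1))) (h x).
  by apply: hF; have := ler_norm (- x); rewrite normrN /n; lra.
derc; ring.
Qed.

Lemma integral_antiderivative (h H : R -> R) (a b : R) : a <= b -> continuous h ->
  (forall x : R, is_derive x 1 H (h x)) ->
  (\int[mu]_(t in `[a, b]) (h t)%:E)%E = (H b - H a)%:E.
Proof.
rewrite le_eqVlt => /predU1P[<-|ab] hc hH.
  by rewrite set_itv1 integral_set1 subrr.
rewrite (@continuous_FTC2 _ h H) //; first by apply: cont_within => y _ _; exact: hc.
  split.
  - by move=> x _; exact: (@ex_derive _ _ _ _ _ _ _ (hH x)).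
  - by apply: cvg_at_right_filter; exact: der_cont (hH a).
  - by apply: cvg_at_left_filter; exact: der_cont (hH b).
by move=> x _; rewrite derive1E; have [_ ->] := hH x.
Qed.

End Antiderivative.

(** * The metric *)

Section EuclideanPlane.
Variable R : realType.
Implicit Types (p q v w : R * R).

Lemma edotC v w : edot v w = edot w v.
Proof. by rewrite /edot; ring. Qed.
Lemma edotBl u v w : edot (u - v) w = edot u w - edot v w.
Proof. by rewrite /edot /=; ring. Qed.
Lemma edot_ge0 v : 0 <= edot v v.
Proof. by rewrite /edot -!expr2 addr_ge0 ?sqr_ge0. Qed.
Lemma enorm_ge0 v : 0 <= enorm v.
Proof. exact: sqrtr_ge0. Qed.
Lemma sqr_enorm v : enorm v ^+ 2 = edot v v.
Proof. by rewrite sqr_sqrtr // edot_ge0. Qed.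
Lemma enorm0 : enorm (0 : R * R) = 0.
Proof. by rewrite /enorm /edot /= mul0r addr0 sqrtr0. Qed.
Lemma enorm_eq0 v : (enorm v == 0) = (v == 0).
Proof.
rewrite sqrtr_eq0 (_ : (_ <= 0) = (edot v v == 0)); last by rewrite eq_le edot_ge0 andbT.
rewrite /edot -!expr2 paddr_eq0 ?sqr_ge0 // !sqrf_eq0.
by case: v.
Qed.
Lemma enorm_gt0 v : (0 < enorm v) = (v != 0).
Proof. by rewrite lt_neqAle enorm_ge0 andbT eq_sym enorm_eq0. Qed.
Lemma enormN v : enorm (- v) = enorm v.
Proof. by rewrite /enorm /edot /= !mulrNN. Qed.
Lemma enormB v w : enorm (v - w) = enorm (w - v).
Proof. by rewrite -enormN opprB. Qed.

Lemma cauchy_schwarz v w : `|edot v w| <= enorm v * enorm w.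
Proof.
rewrite -ler_sqr ?nnegrE ?mulr_ge0 ?enorm_ge0 //.
rewrite exprMn !sqr_enorm real_normK ?num_real // -subr_ge0.
(* Lagrange's identity: the defect is the square of the cross product. *)
apply: (le_trans (sqr_ge0 (v.1 * w.2 - v.2 * w.1))).
by rewrite le_eqVlt; apply/orP; left; apply/eqP; rewrite /edot; ring.
Qed.

Lemma edot_le v w : edot v w <= enorm v * enorm w.
Proof. exact: le_trans (ler_norm _) (cauchy_schwarz v w). Qed.

Lemma enormD v w : enorm (v + w) <= enorm v + enorm w.
Proof.
rewrite -ler_sqr ?nnegrE ?addr_ge0 ?enorm_ge0 //.
rewrite sqrrD !sqr_enorm; have := edot_le v w.
by rewrite /edot /= => h; move: h; lra.
Qed.

Lemma enormZ (a : R) v : enorm (a * v.1, a * v.2) = `|a| * enorm v.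
Proof.
rewrite /enorm (_ : edot _ _ = a ^+ 2 * edot v v); last by rewrite /edot /=; ring.
by rewrite sqrtrM ?sqr_ge0 // sqrtr_sqr.
Qed.

Lemma enormB_tri u v w : enorm (u - w) <= enorm (u - v) + enorm (v - w).
Proof. by rewrite -(subrK v u) -addrA; apply: le_trans (enormD _ _) _; rewrite addrK. Qed.

Lemma enorm_dist v w : `|enorm v - enorm w| <= enorm (v - w).
Proof.
have h1 := enormD (v - w) w; have h2 := enormD (w - v) v.
rewrite !subrK in h1 h2; rewrite enormB in h2.
by rewrite ler_norml; apply/andP; split; move: h1 h2; lra.
Qed.

Lemma norm1_le_enorm v : `|v.1| <= enorm v.
Proof. by rewrite -sqrtr_sqr ler_sqrt ?edot_ge0 // /edot -!expr2 lerDl sqr_ge0. Qed.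
Lemma norm2_le_enorm v : `|v.2| <= enorm v.
Proof. by rewrite -sqrtr_sqr ler_sqrt ?edot_ge0 // /edot -!expr2 lerDr sqr_ge0. Qed.
Lemma enorm_le_sum v : enorm v <= `|v.1| + `|v.2|.
Proof.
rewrite -ler_sqr ?nnegrE ?addr_ge0 ?enorm_ge0 // sqr_enorm /edot.
rewrite -!expr2 -(real_normK (num_real v.1)).
rewrite -(real_normK (num_real v.2)); have := normr_ge0 v.1; have := normr_ge0 v.2; nra.
Qed.
End EuclideanPlane.

(* The iterated derivatives are sealed: unification would otherwise unfold them. *)
Fact derivs_subproof (R : realType) (f : R -> R) :
  {g : nat -> R -> R | forall n, g n = derive1n n f}.
Proof. by exists (fun n => derive1n n f). Qed.
Definition derivs (R : realType) (f : R -> R) : nat -> R -> R := sval (derivs_subproof f).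
Lemma derivsE (R : realType) (f : R -> R) n : derivs f n = derive1n n f.
Proof. exact: (svalP (derivs_subproof f)). Qed.

(** * The profile and the angular factor m(r)/r *)

Section Profile.
Variable R : realType.
Variable m : R -> R.
Hypothesis Hm : admissible_profile m.
Notation m1 := (derivs m 1).
Notation m2 := (derivs m 2).
Notation m3 := (derivs m 3).

Lemma profile_der n (x : R) : is_derive x 1 (derivs m n) (derivs m n.+1 x).
Proof.
have [hs _ _ _ _] := Hm; rewrite !derivsE derive1nS derive1E; exact: derivableP (hs n x).
Qed.
Lemma der_m (x : R) : is_derive x 1 m (m1 x).
Proof. by have := profile_der 0 x; rewrite derivsE derive1n0. Qed.
Lemma der_m1 (x : R) : is_derive x 1 m1 (m2 x).
Proof. exact: profile_der. Qed.
Lemma der_m2 (x : R) : is_derive x 1 m2 (m3 x).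
Proof. exact: profile_der. Qed.
Lemma cont_profile (n : nat) : continuous (derivs m n).
Proof. by move=> x; exact: der_cont (profile_der n x). Qed.
Lemma cont_m : continuous m.
Proof. by move=> x; exact: der_cont (der_m x). Qed.

Lemma m_gt0 (r : R) : 0 < r -> 0 < m r.
Proof. by have [_ _ _ _ h] := Hm; exact: h. Qed.
Lemma m_0 : m 0 = 0. Proof. by case: Hm. Qed.
Lemma m1_0 : m1 0 = 1. Proof. by case: Hm => _ _ _ h _; rewrite derivsE derive1n1. Qed.
Lemma m_odd (r : R) : m (- r) = - m r. Proof. by case: Hm. Qed.

Lemma m1_even (r : R) : m1 (- r) = m1 r.
Proof.
have h1 : is_derive r 1 (fun s => m (- s)) (m1 (- r) * (- 1)).
  exact: (dercomp (der_m _) (derN (derid _))).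
have h2 : is_derive r 1 (fun s => m (- s)) (- m1 r).
  rewrite (_ : (fun s => m (- s)) = (fun s => - m s)); last by apply/funext=> s; exact: m_odd.
  exact: (derN (der_m _)).
by have := der_uniq h1 h2; rewrite mulrN1 => /oppr_inj.
Qed.

Lemma m2_0 : m2 0 = 0.
Proof.
have h1 : is_derive (0 : R) 1 (fun s => m1 (- s)) (m2 (- 0) * (- 1)).
  exact: (dercomp (der_m1 _) (derN (derid _))).
have h2 : is_derive (0 : R) 1 (fun s => m1 (- s)) (m2 0).
  rewrite (_ : (fun s => m1 (- s)) = m1); last by apply/funext=> s; exact: m1_even.
  exact: der_m1.
by have := der_uniq h1 h2; rewrite oppr0 mulrN1; lra.
Qed.

(* The metric scales angular components by this factor. *)
Definition stretch (r : R) : R := if r == 0 then 1 else m r / r.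

Lemma stretch_even (r : R) : stretch (- r) = stretch r.
Proof. by rewrite /stretch oppr_eq0; case: eqP => // _; rewrite m_odd invrN mulrNN. Qed.

Lemma stretch_gt0 (r : R) : 0 <= r -> 0 < stretch r.
Proof.
rewrite /stretch; case: eqP => // /eqP r0 rge0.
have rgt : 0 < r by rewrite lt_neqAle eq_sym r0.
by rewrite divr_gt0 // m_gt0.
Qed.

Lemma stretch_m (r : R) : r * stretch r = m r.
Proof.
rewrite /stretch; case: eqP => [->|/eqP r0]; first by rewrite mul0r m_0.
by rewrite mulrC divfK.
Qed.

(** The second bound concerns the numerator of [(m/r)' = (m' r - m)/r^2]. Both follow from the
    boundedness of [m''], and together they make [m/r] Lipschitz up to 0. *)
Lemma m_taylor (K : R) : 0 <= K -> exists2 C : R, 0 <= C & forall r : R, 0 <= r -> r <= K ->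
  `|m r - r| <= C * r ^+ 2 /\ `|m1 r * r - m r| <= 2 * C * r ^+ 2.
Proof.
move=> K0; have [C C0 hC] := @cont_bounded _ m2 0 K (fun x _ _ => @cont_profile 2 x).
exists C => // r r0 rK.
have h1 (s : R) : 0 <= s -> s <= r -> `|m1 s - 1| <= C * s.
  move=> s0 sr; have := @der_lip _ m1 m2 0 s C s0 (fun x _ _ => der_m1 x)
    (fun x _ _ => @cont_profile 1 x); rewrite m1_0 subr0; apply => x x0 xs.
  by apply: hC; lra.
have h2 : `|m r - r| <= C * r ^+ 2.
  have := @der_lip _ (fun s => m s - s) (fun s => m1 s - 1) 0 r (C * r) r0.
  rewrite m_0 !subr0 expr2 mulrA; apply.
  - by move=> x _ _; have := der_m x => h; derc.
  - move=> x _ _; apply: (@der_cont _ _ _ (m1 x - 1)).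
    by have := der_m x => h; derc.
  - move=> x x0 xr; apply: le_trans (h1 x _ _) _; rewrite ?(ltW x0) ?(ltW xr) //.
    by rewrite ler_wpM2l // ltW.
split=> //.
rewrite (_ : m1 r * r - m r = (m1 r - 1) * r - (m r - r)); last by ring.
apply: le_trans (ler_normB _ _) _; rewrite normrM (ger0_norm r0).
have := h1 r r0 (lexx r); move: h2.
set A := `|_|; set B := `|_| => ? ?; nra.
Qed.

Lemma stretch_lip (K : R) : 0 <= K -> exists2 C : R, 0 <= C & forall r s : R,
  0 <= r -> r <= K -> 0 <= s -> s <= K ->
  `|stretch r - stretch s| <= C * `|r - s|.
Proof.
move=> K0; have [C C0 hC] := m_taylor K0; exists (2 * C); first lra.
have key (r s : R) : 0 <= s -> s <= r -> r <= K ->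
    `|stretch r - stretch s| <= 2 * C * (r - s).
  rewrite le_eqVlt => /predU1P[<-|s0] sr rK.
    rewrite subr0 {2}/stretch eqxx /stretch; case: eqP => [->|/eqP r0].
      by rewrite subrr normr0 mulr0.
    have rgt : 0 < r by rewrite lt_neqAle eq_sym r0.
    rewrite (_ : m r / r - 1 = (m r - r) / r); last by field.
    rewrite normrM normfV (gtr0_norm rgt) ler_pdivrMr //.
    have [h _] := hC r sr rK; apply: le_trans h _.
    by have := mulr_ge0 C0 (sqr_ge0 r); lra.
  have dS (x : R) : 0 < x -> is_derive x 1 stretch ((m1 x * x - m x) / x ^+ 2).
    move=> x0; apply: (@der_near _ (fun y => m y / y)).
      exists x => // y yx; rewrite /stretch; case: eqP => // y0.
      by move: yx; rewrite y0 sub0r normrN gtr0_norm // ltxx.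
    have xn : x != 0 by rewrite gt_eqF.
    by have h := der_m x; derc; field.
  apply: (@der_lip _ stretch (fun x => (m1 x * x - m x) / x ^+ 2)) => //.
  - by move=> x sx _; apply: dS; lra.
  - by move=> x sx _; apply: der_cont (dS x _); lra.
  - move=> x sx xr; have x0 : 0 < x by lra.
    rewrite normrM normfV (ger0_norm (sqr_ge0 _)) ler_pdivrMr ?exprn_gt0 //.
    by have [] := hC x ltac:(lra) ltac:(lra).
move=> r s r0 rK s0 sK; have [sr|rs] := leP s r.
  by rewrite (ger0_norm (_ : 0 <= r - s)) ?subr_ge0 //; exact: key.
rewrite distrC (distrC r) (ger0_norm (_ : 0 <= s - r)) ?subr_ge0 ?(ltW rs) //.
exact: key (ltW rs) sK.
Qed.

Lemma stretch_cont : continuous stretch.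
Proof.
move=> x; have K0 : 0 <= `|x| + 1 by rewrite addr_ge0.
have [C C0 hC] := stretch_lip K0.
have E (y : R) : stretch y = stretch `|y|.
  by have [y0|y0] := ger0P y; rewrite ?stretch_even.
apply/contP => e e0; exists (Num.min 1 (e / (C + 1))).
  by rewrite lt_min ltr01 divr_gt0 // ltr_wpDl.
move=> y; rewrite lt_min => /andP[y1 ye]; rewrite E (E x).
have ny : `|y| <= `|x| + 1 by have := ler_normD (y - x) x; rewrite subrK; lra.
apply: le_lt_trans (hC `|y| `|x| _ ny _ _) _ => //; first by rewrite lerDl.
apply: le_lt_trans (ler_wpM2l C0 (ler_dist_dist y x)) _.
move: ye; rewrite ltr_pdivlMr ?ltr_wpDl // => ye; have := normr_ge0 (y - x); nra.
Qed.

Lemma stretch_lb (K : R) : 0 <= K -> exists2 k : R, 0 < k &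
  forall r : R, 0 <= r -> r <= K -> k <= stretch r.
Proof.
move=> K0; have [c [c0 cK hc]] := @evt_min _ stretch 0 K K0 (fun x _ _ => @stretch_cont x).
by exists (stretch c) => //; exact: stretch_gt0.
Qed.
Lemma stretch_ub (K : R) : 0 <= K -> exists2 k : R, 0 < k &
  forall r : R, 0 <= r -> r <= K -> stretch r <= k.
Proof.
move=> K0; have [c [c0 cK hc]] := @evt_max _ stretch 0 K K0 (fun x _ _ => @stretch_cont x).
by exists (stretch c) => //; exact: stretch_gt0.
Qed.
End Profile.

(** * The metric tensor and its Lipschitz bounds *)

Section Metric.
Variable R : realType.
Variable m : R -> R.
Hypothesis Hm : admissible_profile m.
Implicit Types (p q v w : R * R).
Notation u := (stretch m).

(** A form without case distinction: at the origin the factor [1 - u ^+ 2] is 0, which removes the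
    radial term, so points near and at the origin are handled uniformly. *)
Lemma gmE p v w : gm m p v w = u (enorm p) ^+ 2 * edot v w +
  (1 - u (enorm p) ^+ 2) * (edot p v / enorm p) * (edot p w / enorm p).
Proof.
rewrite /gm; case: eqP => [->|/eqP p0].
  by rewrite enorm0 /stretch eqxx expr1n subrr mul1r !mul0r addr0.
have r0 : enorm p != 0 by rewrite enorm_eq0.
rewrite /stretch (negbTE r0) /=; move: (sqr_enorm p); rewrite /edot /= => h.
have h1 : (p.1 / enorm p) ^+ 2 + (p.2 / enorm p) ^+ 2 = 1.
  by rewrite !expr_div_n -mulrDl !expr2 -h expr2 divff // mulf_neq0.
move: h1; set a := m _ / _; set e := _^-1; clearbody a e.
move: p v w {h r0 p0} => [p1 p2] [v1 v2] [w1 w2] /= h1.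
apply/eqP; rewrite -subr_eq0 [X in X == 0](_ : _ =
  a ^+ 2 * (p1 * v1 + p2 * v2) * (p1 * w1 + p2 * w2) * e ^+ 2 *
  ((p1 * e) ^+ 2 + (p2 * e) ^+ 2 - 1)); last by ring.
by rewrite h1 subrr mulr0.
Qed.

Lemma gmC p v w : gm m p v w = gm m p w v.
Proof. by rewrite !gmE edotC; ring. Qed.
Lemma gmDl p v1 v2 w : gm m p (v1 + v2) w = gm m p v1 w + gm m p v2 w.
Proof. by rewrite !gmE /edot /=; ring. Qed.
Lemma gmDr p w v1 v2 : gm m p w (v1 + v2) = gm m p w v1 + gm m p w v2.
Proof. by rewrite gmC gmDl !(gmC p w). Qed.
Lemma gmZl p (a : R) v w : gm m p (a * v.1, a * v.2) w = a * gm m p v w.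
Proof. by rewrite !gmE /edot /=; ring. Qed.
Lemma gmZr p (a : R) v w : gm m p w (a * v.1, a * v.2) = a * gm m p w v.
Proof. by rewrite gmC gmZl gmC. Qed.
Lemma gmNl p v w : gm m p (- v) w = - gm m p v w.
Proof. by rewrite !gmE /edot /=; ring. Qed.

Lemma radial_le p v : (edot p v / enorm p) ^+ 2 <= edot v v.
Proof.
have [->|p0] := eqVneq p 0; first by rewrite enorm0 invr0 mulr0 expr0n edot_ge0.
have r0 : 0 < enorm p by rewrite enorm_gt0.
rewrite expr_div_n ler_pdivrMr ?exprn_gt0 // -sqr_enorm -exprMn.
rewrite -(real_normK (num_real (edot p v))) ler_sqr ?nnegrE ?mulr_ge0 ?enorm_ge0 //.
by rewrite mulrC cauchy_schwarz.
Qed.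

Lemma gm_ge_radial p v : (edot p v / enorm p) ^+ 2 <= gm m p v v.
Proof.
rewrite gmE; have := radial_le p v; have := sqr_ge0 (u (enorm p)).
move: (u _ ^+ 2) (edot v v) (_ / _) => a b c; nra.
Qed.

Lemma gm_ge0 p v : 0 <= gm m p v v.
Proof. exact: le_trans (sqr_ge0 _) (gm_ge_radial p v). Qed.

Lemma gm_lb (K : R) : 0 <= K -> exists2 k : R, 0 < k & forall p v, enorm p <= K ->
  k * edot v v <= gm m p v v.
Proof.
move=> K0; have [k k0 hk] := stretch_lb Hm K0.
exists (Num.min 1 (k ^+ 2)); first by rewrite lt_min ltr01 exprn_gt0.
move=> p v pK; have hu := hk _ (enorm_ge0 p) pK.
rewrite gmE; have := radial_le p v.
have h1 : Num.min 1 (k ^+ 2) <= 1 by rewrite ge_min lexx.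
have h2 : Num.min 1 (k ^+ 2) <= u (enorm p) ^+ 2.
  rewrite ge_min; apply/orP; right; rewrite ler_sqr // nnegrE; lra.
have := edot_ge0 v; have := sqr_ge0 (edot p v / enorm p).
move: h1 h2; move: (Num.min _ _) (u _ ^+ 2) (edot v v) (edot p v / enorm p) => l a b c.
move=> l1 la c0 b0 cb.
rewrite (_ : a * b + (1 - a) * c * c = a * (b - c ^+ 2) + c ^+ 2); last by ring.
have := ler_wpM2r (_ : 0 <= b - c ^+ 2) la; have := ler_wpM2r c0 l1.
by rewrite subr_ge0 => h1 h2; have := h2 cb; lra.
Qed.

Lemma gm_ub (K : R) : 0 <= K -> exists2 k : R, 0 < k & forall p v, enorm p <= K ->
  gm m p v v <= k * edot v v.
Proof.
move=> K0; have [k k0 hk] := stretch_ub Hm K0.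
exists (1 + k ^+ 2); first by rewrite addr_gt0 ?exprn_gt0.
move=> p v pK; have hu := hk _ (enorm_ge0 p) pK.
have h2 : u (enorm p) ^+ 2 <= k ^+ 2.
  have := stretch_gt0 Hm (enorm_ge0 p) => u0.
  by rewrite ler_sqr // nnegrE ltW.
rewrite gmE; have := radial_le p v; have := sqr_ge0 (u (enorm p)).
have := edot_ge0 v; have := sqr_ge0 (edot p v / enorm p).
move: h2; move: (k ^+ 2) (u _ ^+ 2) (edot v v) (edot p v / enorm p) => l a b c.
by nra.
Qed.

(** The radial component of a vector jumps at the origin, but it enters the metric with the factor
    [1 - u(r)^2 = O(r)], which restores the Lipschitz bound. *)
Lemma gm_lip (K : R) : 0 <= K -> exists2 C : R, 0 <= C & forall p q v,
  enorm p <= K -> enorm q <= K ->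
  `|gm m p v v - gm m q v v| <= C * enorm (p - q) * edot v v.
Proof.
move=> K0; have [C C0 hC] := stretch_lip Hm K0; have [k k0 hk] := stretch_ub Hm K0.
have h0 (r s : R) : 0 <= r -> r <= K -> 0 <= s -> s <= K ->
    `|(1 - u r ^+ 2) - (1 - u s ^+ 2)| <= 2 * k * C * `|r - s|.
  move=> r0 rK s0 sK; rewrite (_ : _ - _ = (u s - u r) * (u r + u s)); last by ring.
  have := hC r s r0 rK s0 sK; rewrite normrM distrC => h.
  have := stretch_gt0 Hm r0; have := stretch_gt0 Hm s0 => us ur.
  have := hk r r0 rK; have := hk s s0 sK => uks ukr.
  rewrite (ger0_norm (_ : 0 <= u r + u s)) ?addr_ge0 ?(ltW us) ?(ltW ur) //.
  move: h (normr_ge0 (u s - u r)); set A := `|_|; set B := `|_| => h A0.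
  have := ler_wpM2l (_ : 0 <= A) (_ : u r + u s <= 2 * k).
  by move=> /(_ A0 ltac:(lra)); have := ler_wpM2l (ltW k0) h; lra.
pose D := 2 * k * C; have D0 : 0 <= D by rewrite /D !mulr_ge0 // ltW.
exists (6 * D); first lra.
suff key p q v : enorm p <= K -> enorm q <= enorm p ->
    `|gm m p v v - gm m q v v| <= 6 * D * enorm (p - q) * edot v v.
  move=> p q v pK qK; have [h|/ltW h] := leP (enorm q) (enorm p); first exact: key.
  by rewrite distrC enormB; exact: key.
move=> pK qp; have qK := le_trans qp pK.
rewrite !gmE; set r := enorm p; set s := enorm q.
pose a := edot p v / r; pose b := edot q v / s.
have Ha : a ^+ 2 <= edot v v by exact: radial_le.
have Hb : b ^+ 2 <= edot v v by exact: radial_le.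
have hr := h0 r s (enorm_ge0 _) pK (enorm_ge0 _) qK.
(* Comparison with radius 0, where the factor is 1, yields [|Q| <= D s]. *)
have hs := h0 s 0 (enorm_ge0 _) qK (lexx _) K0.
rewrite {2}/stretch eqxx expr1n subrr !subr0 (ger0_norm (enorm_ge0 _)) -/D -/s in hs.
rewrite -/D in hr.
have rs : `|r - s| <= enorm (p - q) by exact: enorm_dist.
set P := 1 - u r ^+ 2 in hr *; set Q := 1 - u s ^+ 2 in hr hs *.
have Er : r * a = edot p v.
  have [r0|r0] := eqVneq r 0.
    have : p == 0 by rewrite -enorm_eq0 -/r r0.
    by move=> /eqP ->; rewrite r0 mul0r /edot /= !mul0r addr0.
  by rewrite /a mulrC divfK.
have Es : s * b = edot q v.
  have [s0|s0] := eqVneq s 0.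
    have : q == 0 by rewrite -enorm_eq0 -/s s0.
    by move=> /eqP ->; rewrite s0 mul0r /edot /= !mul0r addr0.
  by rewrite /b mulrC divfK.
have hsab : `|s * (a - b)| <= 2 * enorm (p - q) * enorm v.
  rewrite (_ : s * (a - b) = (s - r) * a + edot (p - q) v); last first.
    by rewrite edotBl -Er -Es; ring.
  apply: le_trans (ler_normD _ _) _; have := cauchy_schwarz (p - q) v.
  have a_le : `|a| <= enorm v by rewrite -sqrtr_sqr ler_sqrt // edot_ge0.
  rewrite normrM (distrC s); have := ler_pM (normr_ge0 _) (normr_ge0 _) rs a_le.
  lra.
have ab : `|a + b| <= 2 * enorm v.
  have a_le : `|a| <= enorm v by rewrite -sqrtr_sqr ler_sqrt // edot_ge0.
  have b_le : `|b| <= enorm v by rewrite -sqrtr_sqr ler_sqrt // edot_ge0.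
  by apply: le_trans (ler_normD _ _) _; lra.
have -> : u r ^+ 2 = 1 - P by rewrite /P; ring.
have -> : u s ^+ 2 = 1 - Q by rewrite /Q; ring.
rewrite -/a -/b.
(* In the second summand the bound [|Q| <= D s] pays for the division by [s] in
   [|a - b| <= 2 |p - q| |v| / s]. *)
rewrite (_ : _ - _ = - (P - Q) * (edot v v - a ^+ 2) + Q * ((a - b) * (a + b))); last by ring.
have ev : edot v v = enorm v ^+ 2 by rewrite sqr_enorm.
have t1 : `|- (P - Q) * (edot v v - a ^+ 2)| <= D * enorm (p - q) * edot v v.
  rewrite normrM normrN (ger0_norm (_ : 0 <= edot v v - a ^+ 2)) ?subr_ge0 //.
  apply: ler_pM; rewrite ?subr_ge0 //; last by rewrite gerBl sqr_ge0.
  by apply: le_trans hr _; rewrite ler_wpM2l.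
have t2 : `|Q * ((a - b) * (a + b))| <= 4 * D * enorm (p - q) * edot v v.
  rewrite !normrM.
  have s0 : 0 <= s by exact: enorm_ge0.
  have g1 : D * `|s * (a - b)| * `|a + b| <= D * (2 * enorm (p - q) * enorm v) * (2 * enorm v).
    by apply: ler_pM; [exact: mulr_ge0|exact: normr_ge0|exact: ler_wpM2l|exact: ab].
  rewrite normrM (ger0_norm s0) in g1.
  have g2 : `|Q| * (`|a - b| * `|a + b|) <= D * s * (`|a - b| * `|a + b|).
    by rewrite ler_wpM2r // mulr_ge0.
  by apply: le_trans g2 _; rewrite ev; lra.
apply: le_trans (ler_normD _ _) _.
have := mulr_ge0 (mulr_ge0 D0 (enorm_ge0 (p - q))) (edot_ge0 v); lra.
Qed.

Definition gnorm p v : R := Num.sqrt (gm m p v v).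

Lemma gnorm_ge0 p v : 0 <= gnorm p v.
Proof. exact: sqrtr_ge0. Qed.
Lemma sqr_gnorm p v : gnorm p v ^+ 2 = gm m p v v.
Proof. by rewrite sqr_sqrtr // gm_ge0. Qed.
Lemma gnormZ p (a : R) v : gnorm p (a * v.1, a * v.2) = `|a| * gnorm p v.
Proof.
rewrite /gnorm gmZl gmZr mulrA -expr2 sqrtrM ?sqr_ge0 // sqrtr_sqr //.
Qed.
Lemma gnorm0 p : gnorm p 0 = 0.
Proof. by rewrite /gnorm gmE /edot /= !(mulr0, mul0r, addr0) sqrtr0. Qed.
Lemma gnormN p v : gnorm p (- v) = gnorm p v.
Proof. by rewrite /gnorm gmNl gmC gmNl opprK. Qed.

Lemma gnorm_ge_radial p v : `|edot p v / enorm p| <= gnorm p v.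
Proof. by rewrite -sqrtr_sqr ler_sqrt ?gm_ge0 // gm_ge_radial. Qed.

Lemma gm_cs p v w : `|gm m p v w| <= gnorm p v * gnorm p w.
Proof.
rewrite -ler_sqr ?nnegrE ?mulr_ge0 ?gnorm_ge0 // exprMn !sqr_gnorm.
rewrite real_normK ?num_real //.
have h (t : R) : 0 <= gm m p v v + 2 * t * gm m p v w + t ^+ 2 * gm m p w w.
  have := gm_ge0 p (v + (t * w.1, t * w.2)).
  by rewrite gmDl !gmDr !gmZl !gmZr (gmC p w v); lra.
have := gm_ge0 p v; have := gm_ge0 p w.
move: h; move: (gm m p v v) (gm m p v w) (gm m p w w) => A B C h C0 A0.
have [C00|C00] := eqVneq C 0.
  have B0 : B = 0.
    apply/eqP/negP => /negP B0.
    have := h (- (A + 1) / (2 * B)); rewrite C00 mulr0 addr0.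
    by rewrite (_ : 2 * _ * B = - (A + 1)); [lra|field].
  by rewrite B0 C00 expr0n mulr0.
have Cp : 0 < C by rewrite lt_neqAle eq_sym C00.
have := h (- B / C); rewrite (_ : _ + _ = A - B ^+ 2 / C); last by field.
by rewrite subr_ge0 ler_pdivrMr.
Qed.

Lemma gnorm_lb (K : R) : 0 <= K -> exists2 k : R, 0 < k & forall p v, enorm p <= K ->
  enorm v <= k * gnorm p v.
Proof.
move=> K0; have [k k0 hk] := gm_lb K0; exists (Num.sqrt k)^-1.
  by rewrite invr_gt0 sqrtr_gt0.
move=> p v pK; rewrite mulrC ler_pdivlMr ?sqrtr_gt0 // /enorm -sqrtrM ?edot_ge0 //.
by rewrite ler_sqrt ?gm_ge0 // mulrC hk.
Qed.
Lemma gnorm_ub (K : R) : 0 <= K -> exists2 k : R, 0 < k & forall p v, enorm p <= K ->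
  gnorm p v <= k * enorm v.
Proof.
move=> K0; have [k k0 hk] := gm_ub K0; exists (Num.sqrt k).
  by rewrite sqrtr_gt0.
move=> p v pK; rewrite /gnorm /enorm -sqrtrM ?(ltW k0) //.
by rewrite ler_sqrt ?mulr_ge0 ?edot_ge0 ?(ltW k0) // hk.
Qed.

(** The error is multiplicative, so that the comparison passes from speeds to lengths of curves. *)
Lemma gnorm_cmp (K : R) : 0 <= K -> exists2 C : R, 0 <= C & forall p q v,
  enorm p <= K -> enorm q <= K ->
  gnorm q v <= (1 + C * enorm (p - q)) * gnorm p v.
Proof.
move=> K0; have [C C0 hC] := gm_lip K0; have [k k0 hk] := gm_lb K0.
exists (C / k); first by rewrite divr_ge0 // ltW.
move=> p q v pK qK.
have d0 := enorm_ge0 (p - q).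
have Ck : 0 <= C / k by rewrite divr_ge0 // ltW.
have f0 : 0 <= 1 + C / k * enorm (p - q) by apply: addr_ge0 => //; exact: mulr_ge0.
have g0 := mulr_ge0 f0 (gnorm_ge0 p v).
rewrite -ler_sqr ?nnegrE ?gnorm_ge0 // exprMn !sqr_gnorm.
have h1 : gm m q v v <= gm m p v v + C * enorm (p - q) * edot v v.
  by have := hC p q v pK qK; rewrite ler_norml => /andP[? ?]; lra.
have h2 : C * enorm (p - q) * edot v v <= C / k * enorm (p - q) * gm m p v v.
  rewrite (_ : C * _ * _ = C / k * enorm (p - q) * (k * edot v v)); last first.
    by field; rewrite gt_eqF.
  by apply: ler_wpM2l; [exact: mulr_ge0|exact: hk].
have := gm_ge0 p v; move: h1 h2; set X := C / k * _ => h1 h2 G0.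
have X0 : 0 <= X by exact: mulr_ge0.
nra.
Qed.
End Metric.

(** * Length and distance *)

Section Curves.
Variable R : realType.
Variable m : R -> R.
Hypothesis Hm : admissible_profile m.
Implicit Types (p q : R * R) (c v : R -> R * R) (S : R -> R).

Definition C1data c v : Prop :=
  [/\ forall t : R, is_derive t 1 (fun s => (c s).1) (v t).1,
      forall t : R, is_derive t 1 (fun s => (c s).2) (v t).2,
      continuous (fun t => (v t).1) & continuous (fun t => (v t).2)].

Lemma C1data_vel c v : C1data c v -> vel c = v.
Proof.
move=> [h1 h2 _ _]; apply/funext => t; rewrite /vel !derive1E.
by have [_ ->] := h1 t; have [_ ->] := h2 t; case: (v t).
Qed.

Lemma C1_curveP c : C1_curve c <-> exists v, C1data c v.
Proof.
split=> [[h1 h2]|[v hv]].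
  exists (vel c); split.
  - by move=> t; rewrite /vel /= derive1E; have [h _] := h1 t; exact: (derivableP h).
  - by move=> t; rewrite /vel /= derive1E; have [_ h] := h1 t; exact: (derivableP h).
  - by move=> t; exact: (cvg_comp (vel c) fst (h2 t) cvg_fst).
  - by move=> t; exact: (cvg_comp (vel c) snd (h2 t) cvg_snd).
split.
  by move=> t; case: hv => h1 h2 _ _; split; [have [] := h1 t | have [] := h2 t].
rewrite (C1data_vel hv); case: hv => _ _ h3 h4 t.
have E : v = fun s => ((v s).1, (v s).2) by apply/funext => s; case: (v s).
rewrite E; exact: (cvg_pair (h3 t) (h4 t)).
Qed.

Lemma C1data_speed c v : C1data c v -> continuous (fun t => gnorm m (c t) (v t)).
Proof.
move=> [h1 h2 h3 h4] t0.
rewrite /continuous_at /gnorm; apply: continuous_cvg; first exact: sqrt_continuous.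
have K0 : 0 <= enorm (c t0) + 1 by rewrite addr_ge0 // enorm_ge0.
have [C C0 hC] := gm_lip Hm K0.
have cc : (fun t => enorm (c t - c t0)) @ t0 --> (0 : R).
  have c1 := der_cont (h1 t0); have c2 := der_cont (h2 t0).
  rewrite -enorm0 -(subrr (c t0)) /enorm.
  apply: continuous_cvg; first exact: sqrt_continuous.
  rewrite /edot /=; apply: cvgD; apply: cvgM;
    by apply: cvgB; first [exact: c1|exact: c2|exact: cvg_cst].
have vv : (fun t => edot (v t) (v t)) @ t0 --> edot (v t0) (v t0).
  rewrite /edot; apply: cvgD; apply: cvgM; by first [exact: h3|exact: h4].
have q0 : (fun t => gm m (c t0) (v t) (v t)) @ t0 --> gm m (c t0) (v t0) (v t0).
  have e : (fun t => edot (c t0) (v t) / enorm (c t0)) @ t0 -->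
      edot (c t0) (v t0) / enorm (c t0).
    rewrite /edot; apply: cvgM; last exact: cvg_cst.
    by apply: cvgD; apply: cvgM; first [exact: cvg_cst|exact: h3|exact: h4].
  rewrite gmE (_ : (fun t => _) = fun t => stretch m (enorm (c t0)) ^+ 2 * edot (v t) (v t) +
    (1 - stretch m (enorm (c t0)) ^+ 2) * (edot (c t0) (v t) / enorm (c t0)) *
    (edot (c t0) (v t) / enorm (c t0))); last by apply/funext => t; rewrite gmE.
  apply: cvgD; apply: cvgM => //; try exact: cvg_cst.
  by apply: cvgM => //; exact: cvg_cst.
rewrite -[X in _ --> X](addr0).
rewrite (_ : (fun t => _) = fun t => gm m (c t0) (v t) (v t) +
  (gm m (c t) (v t) (v t) - gm m (c t0) (v t) (v t))); last by apply/funext=> t; ring.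
apply: cvgD => //.
have b : (fun t => C * enorm (c t - c t0) * edot (v t) (v t)) @ t0 --> (0 : R).
  rewrite (_ : 0 = C * 0 * edot (v t0) (v t0)); last by rewrite mulr0 mul0r.
  by apply: cvgM => //; apply: cvgM => //; exact: cvg_cst.
have bn : (fun t => - (C * enorm (c t - c t0) * edot (v t) (v t))) @ t0 --> (0 : R).
  by rewrite -oppr0; exact: cvgN.
apply: (squeeze_cvgr _ bn b).
have : \forall t \near t0, enorm (c t - c t0) < 1.
  move/cvgrPdist_lt: cc => /(_ 1 ltr01); apply: filterS => t.
  by rewrite sub0r normrN (ger0_norm (enorm_ge0 _)).
apply: filterS => t ht; rewrite -ler_norml; apply: hC; last by rewrite lerDl.
by have := enormD (c t - c t0) (c t0); rewrite subrK; lra.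
Qed.

(** Lengths are increments of a primitive of the speed; estimates of lengths thereby become
    monotonicity statements and need no further integrals. *)
Definition arclen c v S := forall t : R, is_derive t 1 S (gnorm m (c t) (v t)).

Lemma arclen_ex c v : C1data c v -> exists S, arclen c v S.
Proof. by move=> h; apply: antiderivative; exact: C1data_speed. Qed.

Lemma arclen_length c v S (a b : R) : C1data c v -> arclen c v S -> a <= b ->
  curve_length m c a b = (S b - S a)%:E.
Proof.
move=> h hS ab; rewrite /curve_length (C1data_vel h).
exact: (integral_antiderivative ab (C1data_speed h) hS).
Qed.

Definition path_of_length p q (l : R) : Prop := exists c v S (a b : R),
  [/\ C1data c v, arclen c v S, a <= b & [/\ c a = p, c b = q & S b - S a = l]].

Lemma rdistE p q : rdist m p q =
  ereal_inf [set l%:E | l in [set l : R | path_of_length p q l]].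
Proof.
rewrite /rdist; congr ereal_inf; apply/seteqP; split=> [l|x [l [c [v [S [a [b]]]]]]].
  move=> [c [a [b [ab /C1_curveP [v hv] ca cb ->]]]].
  have [S hS] := arclen_ex hv; exists (S b - S a); last by rewrite (arclen_length hv hS).
  by exists c, v, S, a, b.
move=> [hv hS ab [ca cb <-]] <-; exists c, a, b; split=> //.
  by apply/C1_curveP; exists v.
by rewrite (arclen_length hv hS).
Qed.

Lemma arclen_mono c v S (a b : R) : arclen c v S -> a <= b -> S a <= S b.
Proof.
move=> hS ab; apply: (@mono_le _ S (fun t => gnorm m (c t) (v t))) => //.
  by move=> t _ _; exact: der_cont (hS t).
by move=> *; exact: gnorm_ge0.
Qed.

(** Calibration: [L S - F] is non-decreasing. Lower bounds for lengths, and hence for distances,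
    come from suitable choices of [F]. *)
Lemma arclen_geM c v S (F dF : R -> R) (a b L : R) : arclen c v S -> a <= b ->
  (forall t, a <= t -> t <= b -> is_derive t 1 F (dF t)) ->
  (forall t, a <= t -> t <= b -> dF t <= L * gnorm m (c t) (v t)) ->
  F b - F a <= L * (S b - S a).
Proof.
move=> hS ab hF hle; rewrite -subr_ge0.
rewrite (_ : _ - _ = (L * S b - F b) - (L * S a - F a)); last by ring.
rewrite subr_ge0.
notypeclasses refine (@mono_le _ (fun t => L * S t - F t) (fun t => L * gnorm m (c t) (v t) - dF t) _ _ _ _ _ _); first by [].
- move=> t at' tb; have h1 := hS t; have h2 := hF t (ltW at') (ltW tb).
  by derc; ring.
- move=> t at' tb; apply: (@der_cont _ _ _ (L * gnorm m (c t) (v t) - dF t)).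
  by have h1 := hS t; have h2 := hF t at' tb; derc; ring.
- by move=> t at' tb; rewrite subr_ge0; apply: hle; exact: ltW.
Qed.

Lemma arclen_ge c v S (F dF : R -> R) (a b : R) : arclen c v S -> a <= b ->
  (forall t, a <= t -> t <= b -> is_derive t 1 F (dF t)) ->
  (forall t, a <= t -> t <= b -> dF t <= gnorm m (c t) (v t)) ->
  F b - F a <= S b - S a.
Proof.
move=> hS ab hF hle; rewrite -[leRHS]mul1r; apply: arclen_geM hS ab hF _ => t ? ?.
by rewrite mul1r; exact: hle.
Qed.

Lemma arclen_le c v S (a b K : R) : arclen c v S -> a <= b ->
  (forall t, a < t -> t < b -> gnorm m (c t) (v t) <= K) ->
  S b - S a <= K * (b - a).
Proof.
move=> hS ab hle.
have := @der_lip _ S (fun t => gnorm m (c t) (v t)) a b K ab (fun t _ _ => hS t)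
  (fun t _ _ => der_cont (hS t)).
move=> h; apply: le_trans (ler_norm _) (h _) => t at' tb.
by rewrite (ger0_norm (gnorm_ge0 _ _ _)); exact: hle.
Qed.

(** The radius is not differentiable where the curve meets the origin, so the calibrating function
    is [sqrt (|c|^2 + e^2)], with [e] tending to 0. *)
Lemma arclen_radius c v S (a b : R) : C1data c v -> arclen c v S -> a <= b ->
  `|enorm (c b) - enorm (c a)| <= S b - S a.
Proof.
move=> hv hS ab.
have key (s : R) (e : R) : `|s| = 1 -> 0 < e ->
    s * (Num.sqrt (edot (c b) (c b) + e ^+ 2) - Num.sqrt (edot (c a) (c a) + e ^+ 2))
    <= S b - S a.
  move=> s1 e0; pose Q t := edot (c t) (c t) + e ^+ 2.
  have Q0 t : 0 < Q t by rewrite ltr_wpDl ?edot_ge0 ?exprn_gt0.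
  have := @arclen_ge c v S (fun t => s * Num.sqrt (Q t))
    (fun t => s * (edot (c t) (v t) / Num.sqrt (Q t))) a b hS ab.
  rewrite -mulrBr; apply.
    move=> t _ _; have [h1 h2 _ _] := hv; have d1 := h1 t; have d2 := h2 t.
    rewrite /Q /edot; derc; first exact: Q0.
    by field; rewrite gt_eqF // sqrtr_gt0; exact: Q0.
  move=> t _ _; apply: le_trans (ler_norm _) _; rewrite normrM s1 mul1r.
  apply: le_trans (gnorm_ge_radial _ _ _).
  have [c0|c0] := eqVneq (c t) 0.
    by rewrite c0 /edot /= !mul0r addr0 !mul0r normr0.
  have r0 : 0 < enorm (c t) by rewrite enorm_gt0.
  rewrite !normrM ler_wpM2l // !normfV ler_pV2 ?inE ?unitfE ?normr_gt0 ?normr_eq0 ?gt_eqF //;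
    rewrite ?sqrtr_gt0 ?Q0 //.
  rewrite !ger0_norm ?enorm_ge0 ?sqrtr_ge0 // /enorm ler_sqrt ?lerDl ?sqr_ge0 //.
  exact: ltW.
have bd x (e : R) : 0 < e -> enorm x <= Num.sqrt (edot x x + e ^+ 2) <= enorm x + e.
  move=> e0; have x0 := enorm_ge0 x; apply/andP; split.
    by rewrite /enorm ler_sqrt ?addr_ge0 ?edot_ge0 ?sqr_ge0 // lerDl sqr_ge0.
  rewrite -[leRHS]ger0_norm ?addr_ge0 ?(ltW e0) // -sqrtr_sqr ler_sqrt ?sqr_ge0 //.
  rewrite sqrrD sqr_enorm; nra.
rewrite ler_norml; apply/andP; split; apply/ler_addgt0Pr => e e0.
  have := key (-1) e; rewrite normrN1 => /(_ erefl e0).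
  have /andP[? ?] := bd (c a) e e0; have /andP[? ?] := bd (c b) e e0; lra.
have := key 1 e; rewrite normr1 => /(_ erefl e0).
have /andP[? ?] := bd (c a) e e0; have /andP[? ?] := bd (c b) e e0; lra.
Qed.

End Curves.

(** * The distance and its symmetries *)

Section Distance.
Variable R : realType.
Variable m : R -> R.
Hypothesis Hm : admissible_profile m.
Implicit Types (p q x : R * R) (c v : R -> R * R) (S : R -> R) (s t : R).
Notation path := (path_of_length m).

(** A time change that rests outside [[0, 1]]: composed with it, a path starts and ends with zero
    velocity, so that concatenations stay C1. *)
Lemma clock : exists phi w : R -> R,
  [/\ forall t, is_derive t 1 phi (w t), continuous w, forall t, 0 <= w t,
      forall t, t <= 0 -> phi t = 0 /\ w t = 0 &
      forall t, 1 <= t -> phi t = 1 /\ w t = 0].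
Proof.
(* The positive part of [t (1 - t)]. *)
pose w (t : R) := (t * (1 - t) + `|t * (1 - t)|) / 2.
have cw : continuous w.
  move=> t; have h : {for t, continuous (fun t : R => t * (1 - t))}.
    exact: der_cont (derM (derid t) (derD (dercst 1 t) (derN (derid t)))).
  by apply: cvgM; [apply: cvgD; [exact: h|exact: cvg_norm h]|exact: cvg_cst].
have w0 t : 0 <= w t by have := ler_norm (- (t * (1 - t))); rewrite normrN /w; lra.
have wl t : t <= 0 -> w t = 0.
  by move=> t0; rewrite /w ler0_norm ?subrr ?mul0r //; nra.
have wr t : 1 <= t -> w t = 0.
  by move=> t0; rewrite /w ler0_norm ?subrr ?mul0r //; nra.
have [H hH] := antiderivative cw.
have cH t : {for t, continuous H} := der_cont (hH t).
have Hl t : t <= 0 -> H t = H 0.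
  move=> t0; apply: der0_cst => // s _ s0.
  by have := hH s; rewrite wl // ltW.
have Hr t : 1 <= t -> H t = H 1.
  move=> t0; apply/esym/der0_cst => // s s1 _.
  by have := hH s; rewrite wr // ltW.
have H01 : H 0 < H 1.
  apply: (@mono_lt _ H w) => // t t0 t1; have : 0 < t * (1 - t) by rewrite mulr_gt0 // subr_gt0.
  by move=> h; rewrite /w ger0_norm; lra.
have N0 : H 1 - H 0 != 0 by rewrite gt_eqF // subr_gt0.
exists (fun t => (H t - H 0) / (H 1 - H 0)), (fun t => w t / (H 1 - H 0)); split.
- by move=> t; have h := hH t; derc; field.
- by move=> t; apply: cvgM; [exact: cw|exact: cvg_cst].
- by move=> t; rewrite divr_ge0 // subr_ge0 ltW.
- by move=> t t0; rewrite Hl // subrr wl // !mul0r.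
- by move=> t t0; rewrite Hr // divff // wr // mul0r.
Qed.

Lemma path_resting p q (l : R) : path p q l -> exists c v S,
  [/\ C1data c v, arclen m c v S, forall t, t <= 0 -> c t = p /\ v t = 0,
      forall t, 1 <= t -> c t = q /\ v t = 0 & S 1 - S 0 = l].
Proof.
move=> [c [v [S [a [b [[h1 h2 h3 h4] hS ab [ca cb <-]]]]]]].
have [phi [w [hphi hw w0 phl phr]]] := clock.
pose tau t := a + (b - a) * phi t.
have htau t : is_derive t 1 tau ((b - a) * w t).
  by have h := hphi t; rewrite /tau; derc; ring.
have ctau : continuous tau by move=> t; exact: der_cont (htau t).
pose k t := (b - a) * w t.
have k0 t : 0 <= k t by rewrite mulr_ge0 // subr_ge0.
have ck : continuous k by move=> t; apply: cvgM; [exact: cvg_cst|exact: hw].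
exists (fun t => c (tau t)), (fun t => (k t * (v (tau t)).1, k t * (v (tau t)).2)).
exists (fun t => S (tau t)); split.
- split=> /=.
  + by move=> t; apply: der_eq (dercomp (h1 (tau t)) (htau t)) _; rewrite mulrC.
  + by move=> t; apply: der_eq (dercomp (h2 (tau t)) (htau t)) _; rewrite mulrC.
  + move=> t; apply: cvgM; first exact: ck.
    exact: (continuous_comp (ctau t) (h3 (tau t))).
  + move=> t; apply: cvgM; first exact: ck.
    exact: (continuous_comp (ctau t) (h4 (tau t))).
- move=> t; apply: der_eq (dercomp (hS (tau t)) (htau t)) _.
  by rewrite gnormZ (ger0_norm (k0 t)) mulrC.
- move=> t t0; have [E1 E2] := phl t t0.
  by rewrite /tau /k E1 E2 !mulr0 addr0 ca !mul0r.
- move=> t t0; have [E1 E2] := phr t t0.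
  by rewrite /tau /k E1 E2 !mulr0 mulr1 subrKC cb !mul0r.
have [E1 _] := phr 1 (lexx _); have [E2 _] := phl 0 (lexx _).
by rewrite /tau E1 E2 mulr0 addr0 mulr1 subrKC.
Qed.

Lemma path_cat p q x (l1 l2 : R) : path p x l1 -> path x q l2 -> path p q (l1 + l2).
Proof.
move=> /path_resting [c1 [v1 [S1 [[a1 a2 a3 a4] hS1 l1' r1 <-]]]].
move=> /path_resting [c2 [v2 [S2 [[b1 b2 b3 b4] hS2 l2' r2 <-]]]].
have d1 (t : R) : is_derive t 1 (fun s => s - 1) 1 by derc; ring.
have cd : continuous (fun s : R => s - 1) by move=> t; exact: der_cont (d1 t).
(* For [t <= 1] the second path rests at [x], for [t >= 1] the first one does; so the sum minus [x]
   is the concatenation, without cases. *)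
exists (fun t => c1 t + c2 (t - 1) - x), (fun t => v1 t + v2 (t - 1)).
exists (fun t => S1 t + S2 (t - 1)), 0, 2; split=> //.
- split=> /=.
  + move=> t; have e1 := a1 t.
    have e2 := dercomp (g := fun s => s - 1) (b1 (t - 1)) (d1 t).
    by derc; ring.
  + move=> t; have e1 := a2 t.
    have e2 := dercomp (g := fun s => s - 1) (b2 (t - 1)) (d1 t).
    by derc; ring.
  + move=> t; apply: cvgD; first exact: a3.
    exact: (continuous_comp (cd t) (b3 (t - 1))).
  + move=> t; apply: cvgD; first exact: a4.
    exact: (continuous_comp (cd t) (b4 (t - 1))).
- move=> t; have e1 := hS1 t; have e2 := dercomp (g := fun s => s - 1) (hS2 (t - 1)) (d1 t).
  derc; rewrite mulr1; have [t1|t1] := leP t 1.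
    have [-> ->] := l2' (t - 1) ltac:(lra).
    by rewrite gnorm0 addrK !addr0.
  have [-> ->] := r1 t (ltW t1).
  by rewrite gnorm0 !add0r [x + _]addrC addrK.
have [-> _] := l1' 0 (lexx _); have [-> _] := l2' (0 - 1) ltac:(lra).
have [-> _] := r1 2 ltac:(lra); have [-> _] := r2 (2 - 1) ltac:(lra).
rewrite addrK addrC addKr; split=> //.
have e1 : S1 2 = S1 1.
  apply/esym/der0_cst; [lra| |by move=> t _ _; exact: der_cont (hS1 t)] => t t1 _.
  by have := hS1 t; have [-> ->] := r1 t (ltW t1); rewrite gnorm0.
have e2 : S2 (0 - 1) = S2 0.
  apply: der0_cst; [lra| |by move=> t _ _; exact: der_cont (hS2 t)] => t _ t1.
  by have := hS2 t; have [-> ->] := l2' t (ltW t1); rewrite gnorm0.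
by rewrite e1 e2 (_ : 2 - 1 = 1 :> R); ring.
Qed.

Lemma path_rev p q (l : R) : path p q l -> path q p l.
Proof.
move=> [c [v [S [a [b [[h1 h2 h3 h4] hS ab [ca cb <-]]]]]]].
have d1 (t : R) : is_derive t 1 (fun s => - s) (- 1) by derc.
have cd : continuous (fun s : R => - s) by move=> t; exact: der_cont (d1 t).
exists (fun t => c (- t)), (fun t => - v (- t)), (fun t => - S (- t)), (- b), (- a).
split; rewrite ?lerN2 ?opprK //; last by split=> //; ring.
- split=> /=.
  + by move=> t; apply: der_eq (dercomp (h1 (- t)) (d1 t)) _; rewrite mulrN1.
  + by move=> t; apply: der_eq (dercomp (h2 (- t)) (d1 t)) _; rewrite mulrN1.
  + move=> t; apply: cvgN; exact: (continuous_comp (cd t) (h3 (- t))).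
  + move=> t; apply: cvgN; exact: (continuous_comp (cd t) (h4 (- t))).
move=> t; have e1 := dercomp (hS (- t)) (d1 t); derc.
by rewrite gnormN; ring.
Qed.

Lemma path_segment p q : exists l, path p q l.
Proof.
pose c (t : R) : R * R := (p.1 + t * (q.1 - p.1), p.2 + t * (q.2 - p.2)).
have hv : C1data c (fun=> q - p).
  by split=> /= t; try exact: cst_continuous; derc; ring.
have [S hS] := arclen_ex Hm hv.
exists (S 1 - S 0), c, (fun=> q - p), S, 0, 1; split=> //; split=> //.
  by rewrite /c !mul0r !addr0; case: (p).
by rewrite /c !mul1r !subrKC; case: (q).
Qed.

Lemma path_ge0 p q (l : R) : path p q l -> 0 <= l.
Proof.
move=> [c [v [S [a [b [_ hS ab [_ _ <-]]]]]]].
by rewrite subr_ge0; exact: arclen_mono hS ab.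
Qed.

Definition D p q : R := inf [set l : R | path p q l].

Lemma D_has_inf p q : has_inf [set l : R | path p q l].
Proof.
split; first by have [l h] := path_segment p q; exists l.
by exists 0 => l /path_ge0.
Qed.

Lemma rdist_D p q : rdist m p q = (D p q)%:E.
Proof.
rewrite (rdistE Hm); have [h1 h2] := D_has_inf p q.
by rewrite ereal_inf_EFin.
Qed.

Lemma D_le_path p q (l : R) : path p q l -> D p q <= l.
Proof. by move=> h; apply: ge_inf => //; case: (D_has_inf p q). Qed.

Lemma D_ge p q (d : R) : (forall l, path p q l -> d <= l) -> d <= D p q.
Proof. by move=> h; apply: lb_le_inf => //; case: (D_has_inf p q). Qed.

Lemma D_adherent p q (e : R) : 0 < e -> exists2 l, path p q l & l < D p q + e.
Proof. by move=> e0; exact: (inf_adherent e0 (D_has_inf p q)). Qed.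

Lemma D_ge0 p q : 0 <= D p q.
Proof. by apply: D_ge => l /path_ge0. Qed.

Lemma D_sym p q : D p q = D q p.
Proof.
by apply/eqP; rewrite eq_le; apply/andP; split; apply: D_ge => l /path_rev /D_le_path.
Qed.

Lemma D_tri x p q : D p q <= D p x + D x q.
Proof.
rewrite -lerBlDr; apply: D_ge => l1 h1; rewrite lerBlDr -lerBlDl; apply: D_ge => l2 h2.
by rewrite lerBlDl; apply: D_le_path; exact: path_cat h1 h2.
Qed.

Lemma D_refl p : D p p = 0.
Proof.
apply/eqP; rewrite eq_le D_ge0 andbT; have [l [c [v [S [a [b [h hS _ _]]]]]]] := path_segment p p.
apply: D_le_path; have h0 : C1data (fun=> p) (fun=> (0 : R * R)).
  by split=> /= t; try exact: cst_continuous; exact: dercst.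
exists (fun=> p), (fun=> 0), (fun=> 0), 0, 0; split=> //; last by rewrite subrr.
by move=> t /=; rewrite gnorm0; exact: dercst.
Qed.

Lemma D_arclen c v S (s t : R) : C1data c v -> arclen m c v S -> s <= t ->
  D (c s) (c t) <= S t - S s.
Proof. by move=> hv hS st; apply: D_le_path; exists c, v, S, s, t. Qed.

Lemma D_le_speed c v (K s t : R) : C1data c v -> s <= t ->
  (forall r, s < r -> r < t -> gnorm m (c r) (v r) <= K) -> D (c s) (c t) <= K * (t - s).
Proof.
move=> hv st h; have [S hS] := arclen_ex Hm hv.
exact: le_trans (D_arclen hv hS st) (arclen_le hS st h).
Qed.

Lemma D_ge_radius p q : `|enorm p - enorm q| <= D p q.
Proof.
apply: D_ge => l [c [v [S [a [b [hv hS ab [<- <- <-]]]]]]].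
by rewrite distrC; exact: (arclen_radius hv hS ab).
Qed.

(** For [a^2 + b^2 = 1] this is a rotation if [s = 1] and a reflection if [s = -1]; using a point of
    the circle avoids the choice of an angle. *)
Definition orth (a b s : R) p : R * R := (a * p.1 - s * b * p.2, b * p.1 + s * a * p.2).

Lemma edot_orth (a b s : R) p q : a ^+ 2 + b ^+ 2 = 1 -> s ^+ 2 = 1 ->
  edot (orth a b s p) (orth a b s q) = edot p q.
Proof.
move=> h hs; rewrite /edot /=.
rewrite (_ : _ + _ = (a ^+ 2 + b ^+ 2) * (p.1 * q.1 + s ^+ 2 * (p.2 * q.2))); last by ring.
by rewrite h hs !mul1r.
Qed.

Lemma gm_orth (a b s : R) (p v w : R * R) : a ^+ 2 + b ^+ 2 = 1 -> s ^+ 2 = 1 ->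
  gm m (orth a b s p) (orth a b s v) (orth a b s w) = gm m p v w.
Proof. by move=> h hs; rewrite !gmE /enorm !edot_orth. Qed.

Lemma orth_C1 (a b s : R) c v : C1data c v ->
  C1data (fun t => orth a b s (c t)) (fun t => orth a b s (v t)).
Proof.
move=> [h1 h2 h3 h4]; split=> /= t.
- by have e1 := h1 t; have e2 := h2 t; derc; ring.
- by have e1 := h1 t; have e2 := h2 t; derc; ring.
- by apply: cvgB; apply: cvgM; first [exact: cvg_cst|exact: h3|exact: h4].
- by apply: cvgD; apply: cvgM; first [exact: cvg_cst|exact: h3|exact: h4].
Qed.

Lemma orthK (a b s : R) p : a ^+ 2 + b ^+ 2 = 1 -> s ^+ 2 = 1 ->
  orth a (- s * b) s (orth a b s p) = p.
Proof.
move=> h hs; rewrite [RHS]surjective_pairing /orth /=; congr pair.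
  rewrite (_ : _ - _ = (a ^+ 2 + s ^+ 2 * b ^+ 2) * p.1 + (s ^+ 2 - 1) * (s * a * b * p.2)); last by ring.
  by rewrite hs !mul1r h subrr mul0r addr0 mul1r.
rewrite (_ : _ + _ = s ^+ 2 * (a ^+ 2 + b ^+ 2) * p.2); last by ring.
by rewrite hs h !mul1r.
Qed.

Lemma D_orth (a b s : R) p q : a ^+ 2 + b ^+ 2 = 1 -> s ^+ 2 = 1 ->
  D (orth a b s p) (orth a b s q) = D p q.
Proof.
have key (a' b' s' : R) p' q' : a' ^+ 2 + b' ^+ 2 = 1 -> s' ^+ 2 = 1 ->
    D (orth a' b' s' p') (orth a' b' s' q') <= D p' q'.
  move=> h hs; apply: D_ge => l [c [v [S [x [y [hv hS xy [<- <- <-]]]]]]].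
  apply: D_le_path; exists (fun t => orth a' b' s' (c t)), (fun t => orth a' b' s' (v t)).
  exists S, x, y; split=> //; first exact: orth_C1.
  by move=> t; rewrite /gnorm gm_orth //; exact: hS.
move=> h hs; apply/eqP; rewrite eq_le key //=.
have h' : a ^+ 2 + (- s * b) ^+ 2 = 1 by rewrite exprMn sqrrN hs mul1r.
by have := key a (- s * b) s (orth a b s p) (orth a b s q) h' hs; rewrite !orthK.
Qed.

Lemma enorm_orth (a b s : R) p : a ^+ 2 + b ^+ 2 = 1 -> s ^+ 2 = 1 ->
  enorm (orth a b s p) = enorm p.
Proof. by move=> h hs; rewrite /enorm edot_orth. Qed.

End Distance.

(** * The distance compared with a frozen norm *)

Section LocalComparison.
Variable R : realType.
Variable m : R -> R.
Hypothesis Hm : admissible_profile m.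
Implicit Types (p q z : R * R) (c v : R -> R * R) (S : R -> R) (s t : R).
Notation D := (D m).

(** The straight segment is the test path. Together with [D_lower] this says that at small scale the
    distance is the norm frozen at a nearby [z], up to a relative error linear in the scale. *)
Lemma D_upper (K : R) : 0 <= K -> exists2 C : R, 0 <= C & forall p q z,
  enorm p <= K -> enorm q <= K -> enorm z <= K ->
  D p q <= (1 + C * (enorm (p - z) + enorm (q - p))) * gnorm m z (q - p).
Proof.
move=> K0; have [C C0 hC] := gnorm_cmp Hm K0; exists C => // p q z pK qK zK.
pose c (t : R) : R * R := (p.1 + t * (q.1 - p.1), p.2 + t * (q.2 - p.2)).
have hv : C1data c (fun=> q - p).
  by split=> /= t; try exact: cst_continuous; derc; ring.
have e0 : c 0 = p by rewrite /c !mul0r !addr0 -surjective_pairing.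
have e1 : c 1 = q by rewrite /c !mul1r !subrKC -surjective_pairing.
rewrite -{1}e0 -{1}e1 -[leRHS]mulr1 -[X in _ * X](subr0 1).
apply: (D_le_speed Hm hv ler01) => t t0 t1.
have ct : enorm (c t) <= K.
  rewrite (_ : c t = ((1 - t) * p.1, (1 - t) * p.2) + (t * q.1, t * q.2)); last first.
    by rewrite /c; congr pair => /=; ring.
  apply: le_trans (enormD _ _) _; rewrite !enormZ !ger0_norm ?(ltW t0) //; last lra.
  by have := ler_wpM2l (ltW t0) qK; have := ler_wpM2l (_ : 0 <= 1 - t) pK; lra.
apply: le_trans (hC z (c t) (q - p) zK ct) _.
rewrite ler_wpM2r ?gnorm_ge0 // lerD2l ler_wpM2l // enormB.
apply: le_trans (enormB_tri (c t) p z) _; rewrite addrC lerD2l.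
rewrite (_ : c t - p = (t * (q - p).1, t * (q - p).2)); last by
  rewrite /c; case: (p) => p1 p2; congr pair => /=; ring.
rewrite enormZ gtr0_norm // ler_piMl ?enorm_ge0 //; exact: ltW.
Qed.

Lemma arclen_enorm (K : R) : 0 <= K -> exists2 k : R, 0 < k &
  forall c v S (a b : R), C1data c v -> arclen m c v S -> a <= b ->
    (forall t, a <= t -> t <= b -> enorm (c t) <= K) ->
    enorm (c b - c a) <= k * (S b - S a).
Proof.
move=> K0; have [k k0 hk] := gnorm_lb Hm K0; exists k => // c v S a b hv hS ab hK.
set w := c b - c a.
have [w0|w0] := eqVneq (enorm w) 0.
  by rewrite w0 mulr_ge0 ?(ltW k0) // subr_ge0 (arclen_mono hS).
have wp : 0 < enorm w by rewrite lt_neqAle eq_sym w0 enorm_ge0.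
have := @arclen_geM _ m c v S (fun t => edot w (c t)) (fun t => edot w (v t)) a b
  (enorm w * k) hS ab.
have -> : edot w (c b) - edot w (c a) = enorm w * enorm w.
  by rewrite -expr2 sqr_enorm /w /edot /=; ring.
rewrite -mulrA ler_pM2l //; apply.
  move=> t _ _; have [h1 h2 _ _] := hv; have d1 := h1 t; have d2 := h2 t.
  by rewrite /edot; derc; ring.
move=> t at' tb; apply: le_trans (edot_le _ _) _; rewrite -mulrA ler_wpM2l ?enorm_ge0 //.
exact: hk (hK t at' tb).
Qed.

(** Calibration by the linear function [gm m z w] with [w = q - p]: Cauchy-Schwarz for the metric
    frozen at [z] bounds its growth along any path. *)
Lemma D_lower (K : R) : 0 <= K -> exists2 C : R, 0 <= C & forall p q z,
  enorm p <= K -> enorm q <= K -> enorm z <= K -> D p q <= 1 ->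
  gnorm m z (q - p) <= (1 + C * (enorm (p - z) + D p q)) * D p q.
Proof.
(* Almost minimal paths have length at most 2, so they may leave the disk of radius [K] but not that
   of radius [K + 2]. *)
move=> K0; have K20 : 0 <= K + 2 by rewrite addr_ge0.
have [C C0 hC] := gnorm_cmp Hm K20; have [k k0 hk] := arclen_enorm K20.
exists (C * (1 + k)); first by rewrite mulr_ge0 // addr_ge0 // ltW.
move=> p q z pK qK zK d1; set w := q - p.
have zK2 : enorm z <= K + 2 by lra.
have main l : path_of_length m p q l -> l <= 2 ->
    gnorm m z w <= (1 + C * (enorm (p - z) + k * l)) * l.
  move=> [c [v [S [a [b [hv hS ab [ca cb <-]]]]]]] l2.
  have rad t : a <= t -> t <= b -> enorm (c t) <= K + 2.
    move=> at' tb; have := arclen_radius hv hS at'; rewrite ca => h.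
    have := arclen_mono hS tb; have := ler_norm (enorm (c t) - enorm p); lra.
  have [w0|w0] := eqVneq (gnorm m z w) 0.
    have l0 : 0 <= S b - S a by rewrite subr_ge0 (arclen_mono hS).
    rewrite w0 mulr_ge0 // addr_ge0 // mulr_ge0 // addr_ge0 ?enorm_ge0 //.
    by rewrite mulr_ge0 // ltW.
  have wp : 0 < gnorm m z w by rewrite lt_neqAle eq_sym w0 gnorm_ge0.
  have := @arclen_geM _ m c v S (fun t => gm m z w (c t)) (fun t => gm m z w (v t)) a b
    (gnorm m z w * (1 + C * (enorm (p - z) + k * (S b - S a)))) hS ab.
  have -> : gm m z w (c b) - gm m z w (c a) = gnorm m z w * gnorm m z w.
    by rewrite -expr2 sqr_gnorm /w -ca -cb !gmE /edot /=; ring.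
  rewrite -mulrA ler_pM2l //; apply.
    move=> t _ _; have [h1 h2 _ _] := hv; have e1 := h1 t; have e2 := h2 t.
    rewrite (_ : (fun t => _) = fun t => gm m z w (1, 0) * (c t).1 + gm m z w (0, 1) * (c t).2); last first.
      by apply/funext => s; rewrite !gmE /edot /=; ring.
    by derc; rewrite !gmE /edot /=; ring.
  move=> t at' tb; apply: le_trans (ler_norm _) _; apply: le_trans (gm_cs _ _ _ _) _.
  rewrite -mulrA ler_wpM2l ?gnorm_ge0 //.
  have ctK := rad t at' tb.
  apply: le_trans (hC (c t) z (v t) ctK zK2) _.
  rewrite ler_wpM2r ?gnorm_ge0 // lerD2l ler_wpM2l //.
  apply: le_trans (enormB_tri (c t) p z) _; rewrite addrC lerD2l -ca.
  have := hk c v S a t hv hS at' (fun s h1 h2 => rad s h1 (le_trans h2 tb)).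
  move=> h; apply: le_trans h _; rewrite ler_wpM2l ?(ltW k0) // lerD2r.
  exact: arclen_mono hS tb.
have d0 : 0 <= D p q by exact: D_ge0.
set A := enorm (p - z) in main *; have A0 : 0 <= A by exact: enorm_ge0.
have : gnorm m z w <= (1 + C * (A + k * D p q)) * D p q.
  apply/ler_addgt0Pr => e e0.
  (* [M] bounds the growth of the right-hand side per unit of the slack [f] above the infimum. *)
  pose M := 1 + C * (A + 3 * k).
  have M0 : 0 < M by rewrite ltr_wpDr // mulr_ge0 // addr_ge0 // mulr_ge0 // ltW.
  pose f := Num.min 1 (e / M).
  have f0 : 0 < f by rewrite lt_min ltr01 divr_gt0.
  have f1 : f <= 1 by rewrite ge_min lexx.
  have fe : f * M <= e by rewrite -ler_pdivlMr // ge_min lexx orbT.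
  have [l hl lD] := D_adherent Hm p q f0.
  have l0 := path_ge0 hl.
  apply: le_trans (main l hl ltac:(lra)) _.
  have Ck : 0 <= C * k by rewrite mulr_ge0 // ltW.
  have CA : 0 <= C * A by rewrite mulr_ge0.
  apply: (@le_trans _ _ ((1 + C * (A + k * (D p q + f))) * (D p q + f))).
    have lD' := ltW lD.
    have := ler_wpM2l CA lD'.
    have : l * l <= (D p q + f) * (D p q + f) by apply: ler_pM.
    move=> /(ler_wpM2l Ck); lra.
  apply: (@le_trans _ _ ((1 + C * (A + k * D p q)) * D p q + f * M)); last by rewrite lerD2l.
  have h1 : f * D p q <= f by rewrite ler_piMr // ltW.
  have h2 : f * f <= f by rewrite ler_piMr // ltW.
  have := ler_wpM2l Ck h1; have := ler_wpM2l Ck h2; rewrite /M; lra.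
move=> h; apply: le_trans h _; rewrite ler_wpM2r // lerD2l.
have := mulr_ge0 C0 A0; have := mulr_ge0 C0 d0; have := mulr_ge0 (mulr_ge0 C0 A0) (ltW k0); lra.
Qed.

Lemma D_bilip (K : R) : 0 <= K -> exists2 k : R, 0 < k & forall p q,
  enorm p <= K -> enorm q <= K ->
  D p q <= k * enorm (q - p) /\ enorm (q - p) <= k * D p q.
Proof.
move=> K0; have [C1 C10 h1] := D_upper K0; have [C2 C20 h2] := D_lower K0.
have [k1 k10 hk1] := gnorm_ub Hm K0; have [k2 k20 hk2] := gnorm_lb Hm K0.
pose a := (1 + C1 * (2 * K)) * k1; pose b := k2 * (1 + C2).
have a0 : 0 < a by rewrite mulr_gt0 // ltr_wpDr // !mulr_ge0.
have b0 : 0 < b by rewrite mulr_gt0 // ltr_wpDr.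
exists (a + b + 2 * K); first by rewrite ltr_wpDr ?addr_gt0 // mulr_ge0.
move=> p q pK qK.
have e0 := enorm_ge0 (q - p); have d0 := D_ge0 Hm p q.
have eK : enorm (q - p) <= 2 * K.
  by have := enormD q (- p); rewrite enormN; lra.
split.
  apply: (@le_trans _ _ (a * enorm (q - p))); last first.
    by rewrite ler_wpM2r //; lra.
  apply: le_trans (h1 p q p pK qK pK) _; rewrite subrr enorm0 add0r -mulrA.
  apply: ler_pM; rewrite ?gnorm_ge0 ?hk1 //.
    by rewrite addr_ge0 // mulr_ge0.
  by rewrite lerD2l ler_wpM2l.
have [d1|/ltW d1] := leP (D p q) 1; last first.
  apply: (le_trans eK); apply: (@le_trans _ _ (2 * K * D p q)).
    by rewrite ler_peMr // mulr_ge0.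
  by rewrite ler_wpM2r //; lra.
apply: (@le_trans _ _ (b * D p q)); last by rewrite ler_wpM2r //; lra.
apply: le_trans (hk2 p (q - p) pK) _; rewrite /b -mulrA ler_pM2l //.
apply: le_trans (h2 p q p pK qK pK d1) _; rewrite subrr enorm0 add0r ler_wpM2r //.
by rewrite lerD2l ler_piMr.
Qed.

End LocalComparison.

(** * Regularity of local isometries *)

Section HalfHolder.
Variable R : realType.
Implicit Types (f g : R -> R) (s t x y z : R).

Definition slope f s t := (f t - f s) / (t - s).

Lemma slopeC f s t : slope f s t = slope f t s.
Proof. by rewrite /slope -[in LHS]opprB -[t - s]opprB invrN mulrNN. Qed.

(** Only adjacent chords of comparable length are compared, since for these the parallelogram law is
    effective; other pairs are reached by repeated halving. *)
Definition half_holder f (C a b : R) := forall s y t, a < s -> s < y -> y < t -> t < b ->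
  t - s <= 4 * (y - s) -> t - s <= 4 * (t - y) ->
  `|slope f s y - slope f y t| <= C * Num.sqrt (t - s).

Variable C : R.
Hypothesis C0 : 0 <= C.

(** Each halving of the longer interval costs [C sqrt h], and [sqrt (h/2) <= 3/4 sqrt h]; the
    geometric series gives the factor 4. *)
Lemma half_holder_left f (a b s y t : R) : half_holder f C a b ->
  a < s -> s < y -> y < t -> t < b ->
  `|slope f s t - slope f s y| <= 4 * C * Num.sqrt (t - s).
Proof.
move=> hf.
have A s' y' t' : a < s' -> s' < y' -> y' < t' -> t' < b ->
    t' - s' <= 4 * (y' - s') -> t' - s' <= 4 * (t' - y') ->
    `|slope f s' t' - slope f s' y'| <= C * Num.sqrt (t' - s').
  move=> as_ sy yt tb h1 h2; have := hf s' y' t' as_ sy yt tb h1 h2.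
  apply: le_trans; rewrite (_ : slope f s' t' - _ =
    (t' - y') / (t' - s') * (slope f y' t' - slope f s' y')); last first.
    by rewrite /slope; field; rewrite !subr_eq0 !gt_eqF //; lra.
  rewrite normrM distrC ler_piMl // ger0_norm.
    by rewrite ler_pdivrMr; lra.
  by rewrite divr_ge0; lra.
have half (h : R) : 0 <= h -> Num.sqrt (h / 2) <= 3 / 4 * Num.sqrt h.
  move=> h0; rewrite -[leRHS]ger0_norm ?mulr_ge0 ?sqrtr_ge0 // -sqrtr_sqr.
  by rewrite ler_sqrt ?sqr_ge0 // exprMn sqr_sqrtr //; lra.
move=> as_ sy yt tb.
(* [n] counts the halvings after which [t] becomes comparable with [y]. *)
have [n] : exists n, t - s <= 2 ^+ n * (y - s).
  have [n hn] : exists n, (t - s) / (y - s) < 2 ^+ n.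
    exists (Num.truncn ((t - s) / (y - s))).+1.
    have z0 : 0 <= (t - s) / (y - s) by rewrite divr_ge0; lra.
    have /andP[_ h] := truncn_itv z0; apply: lt_trans h _.
    by rewrite -natrX ltr_nat ltn_expl.
  by exists n; move: hn; rewrite ltr_pdivrMr ?subr_gt0 //; exact: ltW.
elim: n t yt tb => [|n IH] t yt tb hn.
  by move: hn; rewrite expr0 mul1r => hn; exfalso; lra.
have h0 : 0 <= t - s by lra.
have S0 := sqrtr_ge0 (t - s); have CS : 0 <= C * Num.sqrt (t - s) by rewrite mulr_ge0.
pose z := s + (t - s) / 2.
have zs : z - s = (t - s) / 2 by rewrite /z; ring.
have [c1|c1] := leP (t - s) (4 * (y - s)).
  have [c2|c2] := leP (t - s) (4 * (t - y)).
    by apply: le_trans (A s y t _ _ _ _ _ _) _ => //; lra.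
  (* Here [y] is too close to [t] for a direct comparison, so both chords are compared with the
     chord to the midpoint [z]. *)
  have B1 := A s z t as_ ltac:(lra) ltac:(lra) tb ltac:(lra) ltac:(lra).
  have [B3 B4 B5] : [/\ s < z, z < y & y - s <= 4 * (z - s)] by clear -zs sy yt c2; split; lra.
  have B2 := A s z y as_ B3 B4 (lt_trans yt tb) B5 ltac:(clear -zs sy yt c2; lra).
  have ss : Num.sqrt (y - s) <= Num.sqrt (t - s) by rewrite ler_sqrt //; lra.
  have := ler_wpM2l C0 ss => Css.
  rewrite (_ : _ - _ = (slope f s t - slope f s z) - (slope f s y - slope f s z)); last by ring.
  by apply: le_trans (ler_normB _ _) _; lra.
have zy : y < z by lra.
have B1 := A s z t as_ ltac:(lra) ltac:(lra) tb ltac:(lra) ltac:(lra).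
have B2 := IH z zy ltac:(lra) ltac:(rewrite exprS in hn; lra).
have := half _ h0; rewrite -zs => /(ler_wpM2l C0) B3.
rewrite (_ : _ - _ = (slope f s t - slope f s z) + (slope f s z - slope f s y)); last by ring.
by apply: le_trans (ler_normD _ _) _; lra.
Qed.

Lemma half_holder_right f (a b s y t : R) : half_holder f C a b ->
  a < s -> s < y -> y < t -> t < b ->
  `|slope f s t - slope f y t| <= 4 * C * Num.sqrt (t - s).
Proof.
move=> hf as_ sy yt tb; pose g (x : R) := - f (- x).
have sg x z : slope g (- x) (- z) = slope f z x.
  rewrite /slope /g !opprK; congr (_ / _); ring.
have hg : half_holder g C (- b) (- a).
  move=> s' y' t' h1 h2 h3 h4 h5 h6.
  have := hf (- t') (- y') (- s') ltac:(lra) ltac:(lra) ltac:(lra) ltac:(lra) ltac:(lra) ltac:(lra).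
  by rewrite -!sg !opprK distrC [- s' + t']addrC.
have := half_holder_left hg (_ : - b < - t) (_ : - t < - y) (_ : - y < - s) (_ : - s < - a).
by rewrite !ltrN2 !sg (_ : - s - - t = t - s); [apply|ring].
Qed.

Lemma half_holder_center f (a b t x y h : R) : half_holder f C a b ->
  0 < h -> a < t - h -> t + h < b -> x != t -> y != t -> `|x - t| <= h -> `|y - t| <= h ->
  `|slope f t x - slope f t y| <= 10 * C * Num.sqrt h.
Proof.
move=> hf h0 ha hb.
have S0 := sqrtr_ge0 h; have CS : 0 <= C * Num.sqrt h by rewrite mulr_ge0.
have r z : t < z -> z <= t + h -> `|slope f t z - slope f t (t + h)| <= 4 * C * Num.sqrt h.
  move=> tz; rewrite le_eqVlt => /predU1P[->|zh].
    by rewrite subrr normr0; lra.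
  have := half_holder_left hf (_ : a < t) tz zh hb; rewrite addrAC subrr add0r distrC.
  by apply; lra.
have l z : z < t -> t - h <= z -> `|slope f t z - slope f t (t - h)| <= 4 * C * Num.sqrt h.
  move=> tz; rewrite le_eqVlt => /predU1P[->|zh].
    by rewrite subrr normr0; lra.
  have := half_holder_right hf ha zh tz (_ : t < b); rewrite opprB addrCA subrr addr0 distrC.
  by rewrite !(slopeC _ t); apply; lra.
have c : `|slope f t (t - h) - slope f t (t + h)| <= 2 * C * Num.sqrt h.
  have := hf (t - h) t (t + h) ha; move=> /(_ ltac:(lra) ltac:(lra) hb ltac:(lra) ltac:(lra)).
  rewrite slopeC => h1; apply: le_trans h1 _; rewrite -mulrA mulrCA ler_wpM2l //.
  rewrite -[leRHS]ger0_norm ?mulr_ge0 // -sqrtr_sqr ler_sqrt ?sqr_ge0 // exprMn.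
  by rewrite sqr_sqrtr; lra.
have main z : z != t -> `|z - t| <= h -> `|slope f t z - slope f t (t + h)| <= 6 * C * Num.sqrt h.
  rewrite neq_lt ler_norml => /orP[zt|tz] /andP[z1 z2].
    have B := l z zt ltac:(lra).
    rewrite (_ : _ - _ = (slope f t z - slope f t (t - h)) + (slope f t (t - h) - slope f t (t + h))); last by ring.
    by apply: le_trans (ler_normD _ _) _; lra.
  by apply: le_trans (r z tz _) _; lra.
have main' z : z != t -> `|z - t| <= h ->
   (t < z -> `|slope f t z - slope f t (t + h)| <= 4 * C * Num.sqrt h) /\
   (z < t -> `|slope f t z - slope f t (t - h)| <= 4 * C * Num.sqrt h).
  by rewrite ler_norml => zt /andP[z1 z2]; split=> ?; [apply: r|apply: l] => //; lra.
move=> xt yt xh yh; have [X1 X2] := main' x xt xh; have [Y1 Y2] := main' y yt yh.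
have Mx := main x xt xh; have My := main y yt yh.
have E p : `|slope f t x - slope f t y| <= `|slope f t x - p| + `|slope f t y - p|.
  by rewrite (_ : _ - slope f t y = (slope f t x - p) - (slope f t y - p)) ?ler_normB //; ring.
move: xt; rewrite neq_lt => /orP[xt|tx].
  move: yt; rewrite neq_lt => /orP[yt|ty].
    by apply: le_trans (E (slope f t (t - h))) _; have := X2 xt; have := Y2 yt; clear -CS; lra.
  by apply: le_trans (E (slope f t (t + h))) _; have := Y1 ty; clear -CS Mx My; lra.
by apply: le_trans (E (slope f t (t + h))) _; have := X1 tx; clear -CS Mx My; lra.
Qed.

(** The intervals of radius [L sqrt h] around the slopes over [[t, t + h]] meet pairwise, so the
    supremum of their lower ends lies in all of them. Points on either side of [t] are reached
    through [half_holder_center]. *)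
Lemma half_holder_slope_limit f (a b t e : R) : half_holder f C a b -> 0 < e ->
  a < t - e -> t + e < b -> exists d : R, forall y, y != t -> `|y - t| < e ->
  `|d - slope f t y| <= 20 * C * Num.sqrt `|y - t|.
Proof.
move=> hf e0 ae eb; pose L := 10 * C; have L0 : 0 <= L by rewrite mulr_ge0.
pose E := [set z | exists2 h, 0 < h < e & z = slope f t (t + h) - L * Num.sqrt h].
have cross h k : 0 < h < e -> 0 < k < e ->
    slope f t (t + h) - L * Num.sqrt h <= slope f t (t + k) + L * Num.sqrt k.
  move=> /andP[h0 he] /andP[k0 ke]; wlog hk : h k h0 he k0 ke / h <= k.
    move=> W; have [/W|/ltW kh] := leP h k; first exact.
    have nh : t + h != t by rewrite gt_eqF // ltrDl.
    have nk : t + k != t by rewrite gt_eqF // ltrDl.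
    have A1 : a < t - h by lra.
    have A2 : t + h < b by lra.
    have := half_holder_center hf h0 A1 A2 nh nk.
    rewrite ![t + _ - t]addrAC !subrr !add0r (gtr0_norm h0) (gtr0_norm k0) => /(_ (lexx _) kh).
    rewrite ler_norml => /andP[_]; rewrite -/L; have := mulr_ge0 L0 (sqrtr_ge0 k); lra.
  have nh : t + h != t by rewrite gt_eqF // ltrDl.
  have nk : t + k != t by rewrite gt_eqF // ltrDl.
  have A1 : a < t - k by lra.
  have A2 : t + k < b by lra.
  have := half_holder_center hf k0 A1 A2 nh nk.
  rewrite ![t + _ - t]addrAC !subrr !add0r (gtr0_norm h0) (gtr0_norm k0) => /(_ hk (lexx _)).
  rewrite ler_norml => /andP[_]; rewrite -/L; have := mulr_ge0 L0 (sqrtr_ge0 h); lra.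
have Ene : E !=set0 by exists (slope f t (t + e / 2) - L * Num.sqrt (e / 2)), (e / 2) => //; apply/andP; lra.
have Eub k : 0 < k < e -> ubound E (slope f t (t + k) + L * Num.sqrt k).
  by move=> hk _ [h hh ->]; exact: cross.
have Esup : has_sup E.
  by split=> //; exists (slope f t (t + e / 2) + L * Num.sqrt (e / 2)); apply: Eub; apply/andP; lra.
exists (sup E) => y yt ye; set h := `|y - t| in ye *.
have h0 : 0 < h by rewrite normr_gt0 subr_eq0.
have hh : 0 < h < e by rewrite h0.
have B1 : sup E <= slope f t (t + h) + L * Num.sqrt h by apply: ge_sup => //; exact: Eub.
have B2 : slope f t (t + h) - L * Num.sqrt h <= sup E.
  by apply: ub_le_sup; [case: Esup | exists h].
have nh : t + h != t by rewrite gt_eqF // ltrDl.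
have A1 : a < t - h by lra.
have A2 : t + h < b by lra.
have := half_holder_center hf h0 A1 A2 yt nh (lexx _).
rewrite [t + h - t]addrAC subrr add0r (gtr0_norm h0) => /(_ (lexx _)).
rewrite !ler_norml -/L => /andP[? ?]; rewrite (_ : 20 * C = 2 * L); last by rewrite /L; ring.
by apply/andP; move: B1 B2; lra.
Qed.

Lemma half_holder_C1 f (t0 e : R) : 0 < e -> half_holder f C (t0 - 2 * e) (t0 + 2 * e) ->
  exists g, forall t, `|t - t0| < e -> is_derive t 1 f (g t) /\ {for t, continuous g}.
Proof.
move=> e0 hf; pose L := 20 * C + 1; have L0 : 0 < L by rewrite ltr_wpDl // mulr_ge0.
have lim t : `|t - t0| < e -> exists d, forall y, y != t -> `|y - t| < e ->
    `|d - slope f t y| <= L * Num.sqrt `|y - t|.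
  rewrite ltr_norml => /andP[t1 t2].
  have A1 : t0 - 2 * e < t - e by lra.
  have A2 : t + e < t0 + 2 * e by lra.
  have [d hd] := half_holder_slope_limit hf e0 A1 A2.
  exists d => y yt ye; apply: le_trans (hd y yt ye) _.
  by rewrite ler_wpM2r ?sqrtr_ge0 // /L; lra.
have ex t : exists d, `|t - t0| < e -> forall y, y != t -> `|y - t| < e ->
    `|d - slope f t y| <= L * Num.sqrt `|y - t|.
  have [h|h] := ltP `|t - t0| e; last by exists 0.
  by have [d hd] := lim t h; exists d.
have [g hg] := choice ex; exists g => t te.
have small (k : R) : 0 < k -> exists2 d, 0 < d & forall x, 0 <= x -> x < d -> L * Num.sqrt x < k.
  move=> k0; exists ((k / L) ^+ 2); first by rewrite exprn_gt0 // divr_gt0.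
  move=> x x0 xd; rewrite mulrC -ltr_pdivlMr //.
  rewrite -[ltRHS]ger0_norm ?divr_ge0 ?(ltW k0) ?(ltW L0) // -sqrtr_sqr.
  by rewrite ltr_sqrt // exprn_gt0 // divr_gt0.
split.
  apply/derP => k k0; have [d d0 hd] := small k k0.
  exists (Num.min d e); first by rewrite lt_min d0.
  move=> y; rewrite lt_min => /andP[yd ye].
  have [->|yt] := eqVneq y t; first by rewrite !subrr mul0r subrr normr0 mulr0.
  have yt' : y - t != 0 by rewrite subr_eq0.
  rewrite (_ : f y - f t - _ = (slope f t y - g t) * (y - t)); last by rewrite /slope; field.
  rewrite normrM ler_wpM2r // distrC; apply: le_trans (hg t te y yt ye) _.
  by apply/ltW/hd.
apply/contP => k k0; have [d d0 hd] := small (k / 2) ltac:(lra).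
exists (Num.min d (e - `|t - t0|)); first by rewrite lt_min d0 subr_gt0.
move=> y; rewrite lt_min => /andP[yd ye].
have [->|yt] := eqVneq y t; first by rewrite subrr normr0.
have y0 : `|y - t0| < e by have := ler_normD (y - t) (t - t0); rewrite subrKA; lra.
have yte : `|y - t| < e by have := normr_ge0 (t - t0); lra.
have B1 := hg t te y yt yte.
(* The slope of the chord between [t] and [y] is close to both [g t] and [g y], hence [g] is
   continuous. *)
have B2 := hg y y0 t ltac:(by rewrite eq_sym) ltac:(by rewrite distrC).
have B3 := hd _ (normr_ge0 (y - t)) yd; rewrite slopeC distrC in B2.
rewrite (_ : g y - g t = (slope f t y - g t) - (slope f t y - g y)); last by ring.
apply: le_lt_trans (ler_normB _ _) _; rewrite (distrC _ (g t)); move: B2; rewrite distrC (distrC t); lra.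
Qed.

End HalfHolder.

(** * Chords of local isometries *)

Section LocalIsometry.
Variable R : realType.
Variable m : R -> R.
Hypothesis Hm : admissible_profile m.
Implicit Types (p q z : R * R) (c : R -> R * R) (s t : R).
Notation D := (D m).

Definition liso_at c t := exists2 e : R, 0 < e &
  forall s u, `|s - t| < e -> `|u - t| < e -> D (c s) (c u) = `|s - u|.

Lemma geodesicP c : geodesic m c <-> forall t, liso_at c t.
Proof.
split=> h t; have [e e0 he] := h t; exists e => // s u hs hu.
  by have := he s u hs hu; rewrite rdist_D // => -[].
by rewrite rdist_D // he.
Qed.

Lemma liso_near c t : liso_at c t ->
  exists2 e : R, 0 < e & forall s, `|s - t| < e -> liso_at c s.
Proof.
move=> [e e0 he]; exists e => // s hs; exists (e - `|s - t|); first by rewrite subr_gt0.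
by move=> x y hx hy; apply: he;
  [have := ler_normD (x - s) (s - t)|have := ler_normD (y - s) (s - t)]; rewrite subrKA; lra.
Qed.

Lemma liso_rev c t : liso_at c t -> liso_at (fun s => c (- s)) (- t).
Proof.
move=> [e e0 he]; exists e => // s u hs hu.
have E (x y : R) : - x - y = - (x - - y) by ring.
by rewrite he; rewrite ?E ?normrN // opprK.
Qed.

(** Common constants near [t0]: [D_upper] and [D_lower] with distances replaced by time differences
    and the metric frozen at any nearby point of the curve. *)
Lemma liso_frame c t0 : liso_at c t0 -> exists e K k C : R,
  [/\ 0 < e, 0 <= K, 0 < k, 0 <= C & forall s u, `|s - t0| < e -> `|u - t0| < e ->
    [/\ enorm (c s) <= K, D (c s) (c u) = `|s - u|, enorm (c u - c s) <= k * `|s - u| &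
      forall r, `|r - t0| < e ->
       gnorm m (c r) (c u - c s) <= (1 + C * (`|s - r| + `|u - s|)) * `|u - s| /\
       `|u - s| <= (1 + C * (`|s - r| + `|u - s|)) * gnorm m (c r) (c u - c s)]].
Proof.
move=> [e e0 he]; pose K := enorm (c t0) + 1.
have K0 : 0 <= K by rewrite addr_ge0 // enorm_ge0.
have [k k0 hk] := D_bilip Hm K0; have [C1 C10 h1] := D_upper Hm K0.
have [C2 C20 h2] := D_lower Hm K0.
(* The bound 1/2 keeps distances at most 1, as [D_lower] requires. *)
pose d := Num.min e (1 / 2); have d0 : 0 < d by rewrite lt_min e0 /=; lra.
exists d, K, k, ((C1 + C2) * (1 + k)).
have k1 : 0 < 1 + k by lra.
split=> //; first by rewrite mulr_ge0 ?addr_ge0 // ltW.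
have dK s : `|s - t0| < d -> `|s - t0| < e /\ enorm (c s) <= K.
  rewrite lt_min => /andP[se s2]; split=> //.
  have := D_ge_radius Hm (c s) (c t0); rewrite he ?subrr ?normr0 //.
  by move=> h; have := ler_norm (enorm (c s) - enorm (c t0)); rewrite /K; lra.
move=> s u hs hu; have [se sK] := dK s hs; have [ue uK] := dK u hu.
have Dsu : D (c s) (c u) = `|s - u| := he s u se ue.
have lip r x : `|r - t0| < d -> `|x - t0| < d -> enorm (c x - c r) <= k * `|r - x|.
  move=> hr hx; have [re rK] := dK r hr; have [xe xK] := dK x hx.
  by have [_] := hk (c r) (c x) rK xK; rewrite he.
split=> //; first exact: lip.
move=> r hr; have [re rK] := dK r hr.
have su1 : `|u - s| <= 1.
  have := ler_normB (u - t0) (s - t0); rewrite opprB subrKA.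
  by move: hs hu; rewrite !lt_min => /andP[_ ?] /andP[_ ?]; lra.
have A1 := lip _ _ hr hs; have A2 := lip _ _ hs hu; rewrite (distrC r) in A1; rewrite distrC in A2.
have n1 := normr_ge0 (s - r); have n2 := normr_ge0 (u - s).
rewrite distrC in Dsu; split.
  apply: le_trans (h2 _ _ _ sK uK rK _) _; rewrite Dsu // ler_wpM2r // lerD2l.
  have := ler_wpM2l C20 A1.
  have := mulr_ge0 C20 n1; have := mulr_ge0 C20 n2; have := mulr_ge0 C10 n1; have := mulr_ge0 C10 n2.
  have := mulr_ge0 (mulr_ge0 C20 n2) (ltW k0).
  have := mulr_ge0 (mulr_ge0 C10 n2) (ltW k0); have := mulr_ge0 (mulr_ge0 C10 n1) (ltW k0); lra.
rewrite -{1}Dsu; apply: le_trans (h1 _ _ _ sK uK rK) _.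
rewrite ler_wpM2r ?gnorm_ge0 // lerD2l.
have := ler_wpM2l C10 A1; have := ler_wpM2l C10 A2.
have := mulr_ge0 C20 n1; have := mulr_ge0 C20 n2; have := mulr_ge0 C10 n1; have := mulr_ge0 C10 n2.
have := mulr_ge0 (mulr_ge0 C20 n2) (ltW k0); have := mulr_ge0 (mulr_ge0 C20 n1) (ltW k0).
have := mulr_ge0 (mulr_ge0 C10 n2) (ltW k0); have := mulr_ge0 (mulr_ge0 C10 n1) (ltW k0); lra.
Qed.

(* By the parallelogram law, two consecutive chords of an almost straight path
   have almost the same direction. *)
Lemma gm_parallelogram z (P Q : R * R) (a b X Y : R) : 0 < a -> 0 < b -> 0 <= X ->
  gnorm m z P <= X * a -> gnorm m z Q <= X * b -> Y * (a + b) <= gnorm m z (P + Q) -> 0 <= Y ->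
  gm m z (P.1 / a - Q.1 / b, P.2 / a - Q.2 / b) (P.1 / a - Q.1 / b, P.2 / a - Q.2 / b) <=
  (X ^+ 2 - Y ^+ 2) * (a + b) ^+ 2 / (a * b).
Proof.
move=> a0 b0 X0 hP hQ hPQ Y0.
have sq A B : 0 <= A -> A <= B -> A ^+ 2 <= B ^+ 2 :> R.
  by move=> A0 AB; rewrite ler_sqr // nnegrE //; apply: le_trans A0 AB.
have := sq _ _ (gnorm_ge0 _ _ _) hP; have := sq _ _ (gnorm_ge0 _ _ _) hQ.
have := sq _ _ (mulr_ge0 Y0 (addr_ge0 (ltW a0) (ltW b0))) hPQ; rewrite !sqr_gnorm.
have -> : (P.1 / a - Q.1 / b, P.2 / a - Q.2 / b) =
    ((a^-1) * P.1, a^-1 * P.2) + ((- b^-1) * Q.1, - b^-1 * Q.2).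
  by congr pair => /=; ring.
rewrite !gmDl !gmDr !gmZl !gmZr (gmC m z Q P).
move: (gm m z P P) (gm m z Q Q) (gm m z P Q) => p q r h1 h2 h3.
have an : a != 0 by rewrite gt_eqF.
have bn : b != 0 by rewrite gt_eqF.
have ab : 0 < a * b by rewrite mulr_gt0.
rewrite ler_pdivlMr // (_ : _ * (a * b) = b / a * p + a / b * q - 2 * r); last first.
  by field; rewrite an bn.
have : b / a * p <= b / a * (X * a) ^+ 2 by rewrite ler_wpM2l // divr_ge0 // ltW.
have : a / b * q <= a / b * (X * b) ^+ 2 by rewrite ler_wpM2l // divr_ge0 // ltW.
have -> : b / a * (X * a) ^+ 2 = X ^+ 2 * (a * b) by field.
have -> : a / b * (X * b) ^+ 2 = X ^+ 2 * (a * b) by field.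
lra.
Qed.
End LocalIsometry.

(** * Unit speed and first variation *)

Section Regularity.
Variable R : realType.
Variable m : R -> R.
Hypothesis Hm : admissible_profile m.
Implicit Types (p q z w : R * R) (c : R -> R * R) (s t : R).
Notation D := (D m).
Notation liso_at := (liso_at m).

Lemma gm_sqrD z (P Q : R * R) : gm m z (P + Q) (P + Q) =
  gm m z P P + 2 * gm m z P Q + gm m z Q Q.
Proof. by rewrite gmDl !gmDr (gmC m z Q P); ring. Qed.

(** The parallelogram bound with [X, Y = 1 +- 2 C h], where [h = a + b]: here [X^2 - Y^2 = 8 C h],
    and comparable lengths give [h^2 <= 16 a b], whence 128. As the bound is on a squared norm,
    slopes are only Hoelder of exponent 1/2. *)
Lemma chords_close z (P Q : R * R) (a b C : R) : 0 <= C -> 0 < a -> 0 < b ->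
  2 * C * (a + b) <= 1 -> a + b <= 4 * a -> a + b <= 4 * b ->
  gnorm m z P <= (1 + 2 * C * (a + b)) * a -> gnorm m z Q <= (1 + 2 * C * (a + b)) * b ->
  a + b <= (1 + 2 * C * (a + b)) * gnorm m z (P + Q) ->
  gm m z (P.1 / a - Q.1 / b, P.2 / a - Q.2 / b) (P.1 / a - Q.1 / b, P.2 / a - Q.2 / b) <=
  128 * C * (a + b).
Proof.
move=> C0 a0 b0; have [h] : exists h, h = a + b by exists (a + b).
move=> hab Ch h1 h2 hP hQ hPQ; rewrite -hab in Ch h1 h2 hP hQ hPQ *.
have h0 : 0 < h by rewrite hab addr_gt0.
have C2h : 0 <= C * h by rewrite mulr_ge0 // ltW.
have g0 := gnorm_ge0 m z (P + Q).
have hPQ' : (1 - 2 * C * h) * (a + b) <= gnorm m z (P + Q).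
  rewrite -hab; move: (gnorm m z (P + Q)) g0 hPQ => g g0 hPQ.
  have : (1 - 2 * C * h) * h <= (1 - 2 * C * h) * ((1 + 2 * C * h) * g).
    by rewrite ler_wpM2l // subr_ge0.
  have : 0 <= (2 * C * h) ^+ 2 * g by rewrite mulr_ge0 // sqr_ge0.
  clear; lra.
have X0 : 0 <= 1 + 2 * C * h by clear -C2h; lra.
have Y0 : 0 <= 1 - 2 * C * h by rewrite subr_ge0.
apply: le_trans (gm_parallelogram a0 b0 X0 hP hQ hPQ' Y0) _.
rewrite -hab ler_pdivrMr ?mulr_gt0 //.
have ab : h ^+ 2 <= 16 * (a * b).
  have : h * h <= 4 * a * (4 * b) by apply: ler_pM; rewrite ?(ltW h0).
  clear; lra.
have -> : (1 + 2 * C * h) ^+ 2 - (1 - 2 * C * h) ^+ 2 = 8 * C * h by ring.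
have -> : 128 * C * h * (a * b) = 8 * C * h * (16 * (a * b)) by ring.
by rewrite ler_wpM2l // -mulrA mulr_ge0.
Qed.

Lemma liso_half_holder c t0 : liso_at c t0 -> exists e C : R, [/\ 0 < e, 0 <= C,
  half_holder (fun s => (c s).1) C (t0 - 2 * e) (t0 + 2 * e) &
  half_holder (fun s => (c s).2) C (t0 - 2 * e) (t0 + 2 * e)].
Proof.
move=> /(liso_frame Hm) [e [K [k [C [e0 K0 k0 C0 hf]]]]].
have [k2 k20 hk2] := gnorm_lb Hm K0.
(* [e / 2] keeps the times inside the frame; the other bound yields [2 C (t - s) <= 1] because
   [t - s <= 4 d]. *)
pose d := Num.min (e / 2) (1 / (8 * (C + 1))).
have C8 : 0 < 8 * (C + 1) by lra.
have d0 : 0 < d by rewrite lt_min !divr_gt0.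
have de : d <= e / 2 by rewrite ge_min lexx.
have dC : d * (8 * (C + 1)) <= 1 by rewrite -ler_pdivlMr // ge_min lexx orbT.
exists d, (k2 * Num.sqrt (128 * C)).
suff main s y t : t0 - 2 * d < s -> s < y -> y < t -> t < t0 + 2 * d ->
    t - s <= 4 * (y - s) -> t - s <= 4 * (t - y) ->
    enorm (slope (fun s => (c s).1) s y - slope (fun s => (c s).1) y t,
           slope (fun s => (c s).2) s y - slope (fun s => (c s).2) y t)
    <= k2 * Num.sqrt (128 * C) * Num.sqrt (t - s).
  split=> //; first by rewrite mulr_ge0 ?sqrtr_ge0 // ltW.
    move=> s y t *; apply: le_trans (main s y t _ _ _ _ _ _) => //.
    exact: (norm1_le_enorm (_, _)).
  move=> s y t *; apply: le_trans (main s y t _ _ _ _ _ _) => //.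
  exact: (norm2_le_enorm (_, _)).
move=> s1 sy yt t1 h1 h2.
have hs : `|s - t0| < e by rewrite ltr_norml; apply/andP; clear -s1 sy yt t1 de; lra.
have hy : `|y - t0| < e by rewrite ltr_norml; apply/andP; clear -s1 sy yt t1 de; lra.
have ht : `|t - t0| < e by rewrite ltr_norml; apply/andP; clear -s1 sy yt t1 de; lra.
have [_ _ _ F1] := hf s y hs hy; have [E1 _] := F1 y hy.
have [yK _ _ F2] := hf y t hy ht; have [E2 _] := F2 y hy.
have [_ _ _ F3] := hf s t hs ht; have [_ E3] := F3 y hy.
have a0 : 0 < y - s by rewrite subr_gt0.
have b0 : 0 < t - y by rewrite subr_gt0.
have hab : t - s = (y - s) + (t - y) by ring.
have h0 : 0 < t - s by rewrite hab addr_gt0.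
rewrite (distrC s y) !(gtr0_norm a0) in E1.
rewrite subrr normr0 add0r (gtr0_norm b0) in E2.
rewrite (distrC s y) (gtr0_norm a0) (gtr0_norm h0) in E3.
have Ch : 2 * C * (t - s) <= 1.
  have hd : t - s <= 4 * d by clear -s1 t1; lra.
  have := ler_wpM2l C0 hd; clear -dC d0; move: dC; lra.
have Ca := mulr_ge0 C0 (ltW a0); have Cb := mulr_ge0 C0 (ltW b0).
have := @chords_close (c y) (c y - c s) (c t - c y) (y - s) (t - y) C C0 a0 b0.
rewrite -hab => /(_ Ch h1 h2) main.
rewrite (_ : (_, _) = ((c y - c s).1 / (y - s) - (c t - c y).1 / (t - y),
                       (c y - c s).2 / (y - s) - (c t - c y).2 / (t - y))); last by [].
apply: le_trans (hk2 (c y) _ yK) _; rewrite -mulrA ler_wpM2l ?(ltW k20) //.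
have C128 : 0 <= 128 * C by exact: mulr_ge0.
rewrite -(sqrtrM _ C128) ler_sqrt; last exact: mulr_ge0 C128 (ltW h0).
apply: main.
- apply: le_trans E1 _; rewrite ler_wpM2r ?(ltW a0) //; clear -Ca Cb; lra.
- apply: le_trans E2 _; rewrite ler_wpM2r ?(ltW b0) //; clear -Ca Cb; lra.
- rewrite [c y - c s + _]addrC subrKA; apply: le_trans E3 _.
  rewrite ler_wpM2r ?gnorm_ge0 //; clear -Ca Cb; lra.
Qed.

Lemma liso_C1_near c t0 : liso_at c t0 -> exists2 e : R, 0 < e & forall t, `|t - t0| < e ->
  [/\ is_derive t 1 (fun s => (c s).1) (vel c t).1,
      is_derive t 1 (fun s => (c s).2) (vel c t).2,
      {for t, continuous (fun s => (vel c s).1)} &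
      {for t, continuous (fun s => (vel c s).2)}].
Proof.
move=> /liso_half_holder [e [C [e0 C0 h1 h2]]].
have [g1 hg1] := half_holder_C1 C0 e0 h1; have [g2 hg2] := half_holder_C1 C0 e0 h2.
have vE t : `|t - t0| < e -> vel c t = (g1 t, g2 t).
  move=> ht; have [[_ d1] _] := hg1 t ht; have [[_ d2] _] := hg2 t ht.
  by rewrite /vel !derive1E d1 d2.
have near t : `|t - t0| < e -> exists2 d : R, 0 < d & forall s, `|s - t| < d -> `|s - t0| < e.
  move=> ht; exists (e - `|t - t0|); first by rewrite subr_gt0.
  by move=> s hs; have := ler_normD (s - t) (t - t0); rewrite subrKA; lra.
exists e => [|t ht]; first exact: e0.
rewrite (vE t ht); have [d1 k1] := hg1 t ht; have [d2 k2] := hg2 t ht.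
have [d d0 hd] := near t ht.
have tr (f g : R -> R) : (forall s, `|s - t0| < e -> f s = g s) ->
    {for t, continuous g} -> {for t, continuous f}.
  move=> fg /contP hg; apply/contP => k kpos; have [d' d'0 hd'] := hg k kpos.
  exists (Num.min d d'); first by rewrite lt_min d0.
  move=> y; rewrite lt_min => /andP[yd yd']; rewrite !fg //; first exact: hd'.
  exact: hd.
split; [exact: d1|exact: d2|apply: tr k1|apply: tr k2] => s /vE.
  exact: (congr1 fst).
exact: (congr1 snd).
Qed.

Lemma liso_C1 c t : liso_at c t ->
  [/\ is_derive t 1 (fun s => (c s).1) (vel c t).1,
      is_derive t 1 (fun s => (c s).2) (vel c t).2,
      {for t, continuous (fun s => (vel c s).1)} &
      {for t, continuous (fun s => (vel c s).2)}].
Proof.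
by move=> /liso_C1_near [e e0 he]; apply: he; rewrite subrr normr0.
Qed.

Lemma gnormD z (v w : R * R) : gnorm m z (v + w) <= gnorm m z v + gnorm m z w.
Proof.
rewrite -ler_sqr ?nnegrE ?addr_ge0 ?gnorm_ge0 // sqrrD !sqr_gnorm gmDl !gmDr (gmC m z w v).
by have := le_trans (ler_norm _) (gm_cs m z v w); lra.
Qed.

Lemma vel_expansion c t : liso_at c t -> forall k : R, 0 < k -> exists2 d : R, 0 < d &
  forall h, `|h| < d ->
  enorm (c (t + h) - c t - (h * (vel c t).1, h * (vel c t).2)) <= k * `|h|.
Proof.
move=> /liso_C1 [/derP d1 /derP d2 _ _] k k0.
have [e1 e10 h1] := d1 (k / 2) ltac:(lra); have [e2 e20 h2] := d2 (k / 2) ltac:(lra).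
exists (Num.min e1 e2); first by rewrite lt_min e10.
move=> h; rewrite lt_min => /andP[he1 he2]; apply: le_trans (enorm_le_sum _) _ => /=.
have := h1 (t + h); have := h2 (t + h); rewrite [t + h - t]addrAC subrr add0r.
by move=> /(_ he2) ? /(_ he1) ?; lra.
Qed.

(** A chord of duration [h] has norm [h] up to [O(h^2)] and equals [h] times the velocity up to
    [o(h)]. *)
Lemma liso_speed c t : liso_at c t -> gm m (c t) (vel c t) (vel c t) = 1.
Proof.
move=> hl; have [e [K [k [C [e0 K0 k0 C0 hf]]]]] := liso_frame Hm hl.
have [k1 k10 hk1] := gnorm_ub Hm K0.
have ht : `|t - t| < e by rewrite subrr normr0.
have [tK _ _ _] := hf t t ht ht.
set N := gnorm m (c t) (vel c t).
suff : N = 1 by move=> h; rewrite -sqr_gnorm -/N h expr1n.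
apply/eqP; rewrite -subr_eq0 -normr_eq0 eq_le normr_ge0 andbT.
apply/ler_addgt0Pr => eta eta0; rewrite add0r.
have ek : 0 < eta / (3 * k1) by rewrite divr_gt0 // mulr_gt0.
have [d d0 hd] := vel_expansion hl ek.
pose h := Num.min (Num.min (e / 2) (d / 2)) (Num.min (eta / (3 * (C + 1))) (1 / (C + 1))).
have C1 : 0 < C + 1 by lra.
have h0 : 0 < h by rewrite !lt_min !divr_gt0 // mulr_gt0.
have he : h < e by apply: (@le_lt_trans _ _ (e / 2)); [rewrite !ge_min lexx|lra].
have hd' : h < d by apply: (@le_lt_trans _ _ (d / 2)); [rewrite !ge_min lexx orbT|lra].
have hC : h * (3 * (C + 1)) <= eta.
  by rewrite -ler_pdivlMr ?mulr_gt0 // !ge_min lexx !orbT.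
have hC1 : h * (C + 1) <= 1.
  by rewrite -ler_pdivlMr // !ge_min lexx !orbT.
have Ch : 0 <= C * h by rewrite mulr_ge0 // ltW.
have hth : `|t + h - t| < e by rewrite addrAC subrr add0r gtr0_norm.
have [_ _ _ F] := hf t (t + h) ht hth; have [F1 F2] := F t ht.
rewrite subrr normr0 add0r addrAC subrr add0r (gtr0_norm h0) in F1 F2.
have := hd h; rewrite (gtr0_norm h0) => /(_ hd') rem.
set V := (h * (vel c t).1, h * (vel c t).2) in rem.
have NV : gnorm m (c t) V = h * N by rewrite gnormZ gtr0_norm.
have r1 := le_trans (hk1 (c t) _ tK) (ler_wpM2l (ltW k10) rem).
set rr := c (t + h) - c t - V in r1.
have E1 : c (t + h) - c t = V + rr by rewrite /rr addrCA subrr addr0.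
have E2 : V = (c (t + h) - c t) + (- rr) by rewrite E1 addrK.
have T1 := gnormD (c t) V rr; rewrite -E1 NV in T1.
have T2 := gnormD (c t) (c (t + h) - c t) (- rr); rewrite -E2 NV gnormN in T2.
have r2 : k1 * (eta / (3 * k1) * h) = eta / 3 * h by field; rewrite gt_eqF.
rewrite r2 in r1.
set G := gnorm m (c t) (c (t + h) - c t) in F1 F2 T1 T2.
have G2 : G <= 2 * h.
  by apply: le_trans F1 _; rewrite ler_wpM2r ?(ltW h0) //; clear -hC1 h0; lra.
have CG := ler_wpM2l Ch G2.
have Chh : C * h * h <= eta / 3 * h.
  by rewrite ler_wpM2r ?(ltW h0) //; clear -hC h0; lra.
rewrite ler_norml; apply/andP; split.
  have : (1 - eta) * h <= N * h by clear -T1 T2 r1 F1 F2 CG Chh G2; lra.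
  by rewrite ler_pM2r //; clear; lra.
have : N * h <= (1 + eta) * h by clear -T1 T2 r1 F1 F2 CG Chh G2; lra.
by rewrite ler_pM2r //; clear; lra.
Qed.

(** The corner is cut: the shifted point is joined by a straight segment to the point of the curve
    reached by going back a time [h = kappa e]. The squared norm of this segment is about
    [h^2 + 2 e h G + e^2 |w|^2], and a large fixed [kappa] makes the last term negligible against
    [e eta], while the metric errors are [O(e^2)]. *)
Lemma liso_first_variation c t w (eta : R) : liso_at c t -> 0 < eta ->
  exists kappa e0 : R, [/\ 0 < kappa, 0 < e0 & forall e, 0 < e -> e < e0 ->
  D (c (t - kappa * e)) (c t + (e * w.1, e * w.2)) <=
  kappa * e + e * (gm m (c t) (vel c t) w + eta)].
Proof.
move=> hl eta0; have [d [K [k [C [d0 K0 k0 C0 hf]]]]] := liso_frame Hm hl.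
have K1 : 0 <= K + enorm w by rewrite addr_ge0 // enorm_ge0.
have [C1 C10 hC1] := D_upper Hm K1.
have ht : `|t - t| < d by rewrite subrr normr0.
have [tK _ _ _] := hf t t ht ht.
set G := gm m (c t) (vel c t) w; set nw := gnorm m (c t) w.
have nw0 : 0 <= nw by exact: gnorm_ge0.
have [k1 k10 hk1] := gnorm_ub Hm K0.
pose eta1 := eta / (4 * (k1 * (nw + 1))).
have kn : 0 < k1 * (nw + 1) by rewrite mulr_gt0 //; lra.
have eta10 : 0 < eta1 by rewrite divr_gt0 // mulr_gt0.
have [dv dv0 hdv] := vel_expansion hl eta10.
(* With this choice the quadratic term contributes [e^2 |w|^2 / (2 h) <= e eta / 4]. *)
pose kappa := 2 * nw ^+ 2 / eta + 1.
have kappa0 : 0 < kappa by rewrite ltr_wpDl // divr_ge0 ?(ltW eta0) // mulr_ge0 // sqr_ge0.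
have kw : nw ^+ 2 <= eta / 2 * kappa.
  by rewrite /kappa mulrDr mulr1 -[leLHS]addr0 lerD //; [rewrite le_eqVlt; apply/orP; left; apply/eqP; field; rewrite gt_eqF|lra].
pose ew := enorm w; have ew0 : 0 <= ew by exact: enorm_ge0.
pose B1 := C * kappa ^+ 2 + C ^+ 2 * kappa ^+ 3.
have B10 : 0 <= B1 by rewrite addr_ge0 // mulr_ge0 ?sqr_ge0 // exprn_ge0 // ltW.
pose a := C1 * (2 * k * kappa + ew).
have a0 : 0 <= a by rewrite mulr_ge0 // addr_ge0 // mulr_ge0 ?(ltW kappa0) // mulr_ge0 // ltW.
pose M := B1 + a * (kappa + `|G| + eta + B1) + 1.
have X0 : 0 <= kappa + `|G| + eta + B1 by have := normr_ge0 G; clear -kappa0 eta0 B10; lra.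
have M0 : 0 < M by rewrite /M; have := mulr_ge0 a0 X0; clear -B10; lra.
pose e0 := Num.min (Num.min 1 (d / kappa)) (Num.min (dv / kappa) (eta / (4 * M))).
exists kappa, e0; split=> //.
  by rewrite !lt_min ltr01 !divr_gt0 // mulr_gt0.
move=> e e_gt0; rewrite !lt_min => /andP[/andP[e1 ed] /andP[edv eM]].
rewrite ltr_pdivlMr // in ed; rewrite ltr_pdivlMr // in edv.
rewrite ltr_pdivlMr ?mulr_gt0 // in eM.
pose h := kappa * e; rewrite -/h.
have h0 : 0 < h by rewrite mulr_gt0.
have hd : `|t - h - t| < d by rewrite addrAC subrr add0r normrN gtr0_norm // /h mulrC.
have [hK _ F0 F] := hf (t - h) t hd ht; have [F1 _] := F t ht.
rewrite addrAC subrr add0r normrN opprB addrCA subrr addr0 (gtr0_norm h0) in F0 F1.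
set Q := c t - c (t - h) in F0 F1.
have NQ : gnorm m (c t) Q ^+ 2 <= (1 + 2 * C * h) ^+ 2 * h ^+ 2.
  have Ch : 0 <= C * h by rewrite mulr_ge0 // ltW.
  rewrite -exprMn ler_sqr ?nnegrE ?gnorm_ge0 //.
    by apply: le_trans F1 _; rewrite ler_wpM2r ?(ltW h0) //; clear -Ch; lra.
  by rewrite mulr_ge0 ?(ltW h0) //; clear -Ch; lra.
have QW : gm m (c t) Q w <= h * (G + eta / 4).
  have := hdv (- h); rewrite normrN (gtr0_norm h0) => /(_ _).
  move=> /(_ ltac:(rewrite /h mulrC; exact: edv)) rem.
  pose r : R * R := c (t - h) - c t - (- h * (vel c t).1, - h * (vel c t).2).
  have EQ : Q = (h * (vel c t).1, h * (vel c t).2) + - r.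
    rewrite /Q /r [LHS]surjective_pairing; congr pair => /=; ring.
  rewrite EQ gmDl gmZl mulrDr lerD2l.
  apply: le_trans (ler_norm _) _; apply: le_trans (gm_cs _ _ _ _) _.
  rewrite gnormN -/nw; have := le_trans (hk1 (c t) r tK) (ler_wpM2l (ltW k10) rem).
  move=> /(ler_wpM2r nw0) hr; apply: le_trans hr _.
  have -> : h * (eta / 4) = k1 * (eta1 * h) * (nw + 1).
    have n1 : nw + 1 != 0 by rewrite gt_eqF //; clear -nw0; lra.
    have n2 : k1 != 0 by rewrite gt_eqF.
    by rewrite /eta1; field; rewrite n1 n2.
  have p0 : 0 <= k1 * (eta1 * h) by rewrite mulr_ge0 ?(ltW k10) // mulr_ge0 // ltW.
  by rewrite ler_wpM2l // lerDl.
set W : R * R := (e * w.1, e * w.2).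
have nW : enorm W = e * ew by rewrite enormZ gtr0_norm.
have cW : enorm (c t + W) <= K + ew.
  apply: le_trans (enormD _ _) _; rewrite nW lerD // ler_piMl //; exact: ltW.
have tK' : enorm (c t) <= K + ew by rewrite ler_wpDr.
have hK' : enorm (c (t - h)) <= K + ew by rewrite ler_wpDr.
have E : c t + W - c (t - h) = Q + W by rewrite /Q addrAC.
have main := hC1 _ _ (c t) hK' cW tK'; rewrite E in main.
set N := gnorm m (c t) (Q + W) in main.
have N0 : 0 <= N by exact: gnorm_ge0.
have N2 : N ^+ 2 <= (1 + 2 * C * h) ^+ 2 * h ^+ 2 + 2 * e * (h * (G + eta / 4)) + e ^+ 2 * nw ^+ 2.
  rewrite sqr_gnorm gm_sqrD -sqr_gnorm.
  have -> : gm m (c t) Q W = e * gm m (c t) Q w by rewrite gmZr.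
  have -> : gm m (c t) W W = e ^+ 2 * nw ^+ 2.
    by rewrite gmZr gmZl /nw sqr_gnorm; ring.
  by have := ler_wpM2l (ltW e_gt0) QW; clear -NQ; lra.
have N1 : N <= h + e * (e * B1) * 2 + e * (G + eta / 2).
  have : N * (2 * h) <= (h + e * (e * B1) * 2 + e * (G + eta / 2)) * (2 * h); last first.
    by rewrite ler_pM2r // mulr_gt0.
  (* Takes the place of a square root of the bound on [N ^+ 2]. *)
  have sq : N * (2 * h) <= N ^+ 2 + h ^+ 2 by have := sqr_ge0 (N - h); clear; lra.
  apply: (le_trans sq); rewrite -/h.
  have t1 : e ^+ 2 * nw ^+ 2 <= e * h * (eta / 2).
    by have := ler_wpM2l (sqr_ge0 e) kw; rewrite /h; clear; lra.
  have t2 : (1 + 2 * C * h) ^+ 2 * h ^+ 2 <= h ^+ 2 + 4 * e * (e * B1) * h.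
    have -> : (1 + 2 * C * h) ^+ 2 * h ^+ 2 = h ^+ 2 + 4 * h * (C * h ^+ 2 + C ^+ 2 * h ^+ 3) by ring.
    rewrite lerD2l (_ : 4 * e * (e * B1) * h = 4 * h * (e ^+ 2 * B1)); last by ring.
    have q : C * h ^+ 2 + C ^+ 2 * h ^+ 3 <= e ^+ 2 * B1.
      rewrite /B1 /h mulrDr; apply: lerD.
        by rewrite le_eqVlt; apply/orP; left; apply/eqP; ring.
      rewrite (_ : C ^+ 2 * (kappa * e) ^+ 3 = e * (e ^+ 2 * (C ^+ 2 * kappa ^+ 3))); last by ring.
      rewrite ler_piMl ?(ltW e1) // mulr_ge0 ?sqr_ge0 //.
      by rewrite mulr_ge0 ?sqr_ge0 // exprn_ge0 // ltW.
    by apply: ler_wpM2l q; rewrite mulr_ge0 // ltW.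
  by clear -N2 t1 t2; lra.
apply: (le_trans main).
have f1 : C1 * (enorm (c (t - h) - c t) + enorm (Q + W)) <= a * e.
  rewrite /a -mulrA ler_wpM2l // enormB.
  have := enormD Q W; rewrite nW; move: F0; rewrite -/Q => F0.
  by have := F0; rewrite /h; clear; lra.
have aN := ler_wpM2r N0 f1.
have e2 : e * e <= e by rewrite ler_piMl // ltW.
have eB : e * (e * B1) <= e * B1 by have := ler_wpM2r B10 e2; clear; lra.
have : a * e * N <= a * e * (e * (kappa + `|G| + eta + 2 * B1)).
  apply: ler_wpM2l; first exact: mulr_ge0 a0 (ltW e_gt0).
  apply: (le_trans N1).
  have := ler_wpM2l (ltW e_gt0) (ler_norm G).
  by have := mulr_gt0 e_gt0 eta0; rewrite /h; clear -eB; lra.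
have M2 : e * (e * (2 * M)) <= e * (eta / 2) by rewrite ler_wpM2l ?(ltW e_gt0) //; clear -eM; lra.
rewrite /M in M2.
have p1 := mulr_ge0 (mulr_ge0 a0 (ltW e_gt0)) (mulr_ge0 (ltW e_gt0) (normr_ge0 G)).
have p2 := mulr_ge0 (mulr_ge0 a0 (ltW e_gt0)) (mulr_ge0 (ltW e_gt0) (ltW kappa0)).
have p3 := mulr_ge0 (mulr_ge0 a0 (ltW e_gt0)) (mulr_ge0 (ltW e_gt0) (ltW eta0)).
have p4 := mulr_ge0 (mulr_ge0 a0 (ltW e_gt0)) (mulr_ge0 (ltW e_gt0) B10).
have p5 := mulr_ge0 (ltW e_gt0) (mulr_ge0 (ltW e_gt0) B10).
have p6 := mulr_gt0 e_gt0 e_gt0.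
by clear -N1 f1 aN M2 p1 p2 p3 p4 p5 p6 e2 eB; lra.
Qed.

Lemma liso_first_variation_rev c t w (eta : R) : liso_at c t -> 0 < eta ->
  exists kappa e0 : R, [/\ 0 < kappa, 0 < e0 & forall e, 0 < e -> e < e0 ->
  D (c t + (e * w.1, e * w.2)) (c (t + kappa * e)) <=
  kappa * e + e * (- gm m (c t) (vel c t) w + eta)].
Proof.
move=> hl eta0; have hr := liso_rev hl.
have [kappa [e0 [k0 e00 h]]] := liso_first_variation w hr eta0.
exists kappa, e0; split=> // e h1 h2; rewrite D_sym //.
have := h e h1 h2; rewrite opprB !opprK [kappa * e + t]addrC => hh; apply: (le_trans hh).
have -> : vel (fun s => c (- s)) (- t) = - vel c t.
  have [d1 d2 _ _] := liso_C1 hl; have [e1 e2 _ _] := liso_C1 hr.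
  have dn : is_derive (- t) 1 (fun s : R => - s) (- 1) by derc.
  rewrite -[t]opprK in d1 d2.
  have f1 := der_uniq e1 (dercomp (g := fun s => - s) d1 dn).
  have f2 := der_uniq e2 (dercomp (g := fun s => - s) d2 dn).
  rewrite opprK in f1 f2.
  by rewrite [LHS]surjective_pairing f1 f2 !mulrN1.
by rewrite gmNl.
Qed.
End Regularity.

(** * Conservation laws of geodesics *)

Section Conservation.
Variable R : realType.
Variable m : R -> R.
Hypothesis Hm : admissible_profile m.
Implicit Types (p q z w : R * R) (c : R -> R * R) (s t : R).
Notation D := (D m).
Notation liso_at := (liso_at m).
Notation m1 := (derivs m 1).
Notation m2 := (derivs m 2).

(** The vector field generating the rotations. *)
Definition quarter p : R * R := (- p.2, p.1).
Definition cross p q : R := p.1 * q.2 - p.2 * q.1.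

(* The Clairaut constant g(c', d/dtheta) = m(r)^2 theta'. *)
Definition clairaut c t := stretch m (enorm (c t)) ^+ 2 * cross (c t) (vel c t).

Lemma clairautE c t : clairaut c t = gm m (c t) (vel c t) (quarter (c t)).
Proof. by rewrite gmE /clairaut /quarter /cross /edot /=; ring. Qed.

Lemma small_rotation (e : R) : 0 < e -> e <= 1 -> exists a b : R,
  [/\ a ^+ 2 + b ^+ 2 = 1 & forall (sg : R) p, `|sg| = 1 ->
   enorm (orth a (sg * b) 1 p - (p + (e * (sg * (quarter p).1), e * (sg * (quarter p).2))))
   <= 4 * e ^+ 2 * enorm p].
Proof.
move=> e0 e1; have d0 : 0 < 1 + e ^+ 2 / 4 by rewrite ltr_wpDr // divr_ge0 // sqr_ge0.
have dn : 4 + e ^+ 2 != 0 by rewrite gt_eqF // ltr_wpDr // sqr_ge0.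
(* The rational parametrisation of the circle, [e / 2] being the tangent of the half angle. *)
exists ((1 - e ^+ 2 / 4) / (1 + e ^+ 2 / 4)), (e / (1 + e ^+ 2 / 4)).
split; first by field.
set a := _ / _; set b := e / _ => sg p sg1.
have ha : `|a - 1| <= e ^+ 2.
  have -> : a - 1 = - ((e ^+ 2 / 2) / (1 + e ^+ 2 / 4)) by rewrite /a; field.
  rewrite normrN ger0_norm ?divr_ge0 ?(ltW d0) ?sqr_ge0 // ler_pdivrMr //.
  have := sqr_ge0 e; have := sqr_ge0 (e ^+ 2); lra.
have hb : `|e - b| <= e ^+ 2.
  have -> : e - b = (e * (e ^+ 2 / 4)) / (1 + e ^+ 2 / 4) by rewrite /b; field.
  have ee : e * e ^+ 2 <= e ^+ 2 by rewrite ler_piMl // sqr_ge0.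
  have e3 : 0 <= e * e ^+ 2 by rewrite mulr_ge0 ?sqr_ge0 // ltW.
  rewrite ger0_norm; last by rewrite divr_ge0 ?(ltW d0) // mulrA divr_ge0.
  rewrite ler_pdivrMr //; have := sqr_ge0 e; have := sqr_ge0 (e ^+ 2); lra.
apply: le_trans (enorm_le_sum _) _ => /=.
have n1 := norm1_le_enorm p; have n2 := norm2_le_enorm p.
have B x y (X : R) : `|x| <= e ^+ 2 -> `|y| <= X -> `|x * y| <= e ^+ 2 * X.
  by move=> hx hy; rewrite normrM; apply: ler_pM.
have t1 := B _ _ _ ha n1; have t2 := B _ _ _ hb n2.
have t3 := B _ _ _ ha n2; have t4 := B _ _ _ hb n1.
have u1 : `|a * p.1 - 1 * (sg * b) * p.2 - (p.1 + e * (sg * - p.2))| <= 2 * e ^+ 2 * enorm p.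
  rewrite (_ : _ - _ = (a - 1) * p.1 + sg * ((e - b) * p.2)); last by ring.
  by apply: le_trans (ler_normD _ _) _; rewrite [`|sg * _|]normrM sg1 mul1r; lra.
have u2 : `|sg * b * p.1 + 1 * a * p.2 - (p.2 + e * (sg * p.1))| <= 2 * e ^+ 2 * enorm p.
  rewrite (_ : _ - _ = (a - 1) * p.2 + - (sg * ((e - b) * p.1))); last by ring.
  by apply: le_trans (ler_normD _ _) _; rewrite normrN [`|sg * _|]normrM sg1 mul1r; lra.
by lra.
Qed.

(** The arc from [s] to [t], rotated by a small angle, still has its ends at distance [t - s].
    Joined to slightly earlier and later points of the curve by the first variation, it competes
    with the minimal arc between them; this gives [sg * (clairaut c s - clairaut c t) >= 0] for both
    signs. *)
Lemma liso_clairaut c t0 : liso_at c t0 -> exists2 e : R, 0 < e &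
  forall s t, `|s - t0| < e -> `|t - t0| < e -> clairaut c s = clairaut c t.
Proof.
move=> hl; have [d [K [k [C [d0 K0 k0 C0 hf]]]]] := liso_frame Hm hl.
have [d' d'0 hd'] := liso_near hl.
have K50 : 0 <= 6 * K + 1 by lra.
have [k1 k10 hk1] := D_bilip Hm K50.
exists (Num.min d d'); first by rewrite lt_min d0.
suff main s t (sg : R) : `|s - t0| < Num.min d d' -> `|t - t0| < Num.min d d' -> s < t ->
    `|sg| = 1 -> 0 <= sg * (clairaut c s - clairaut c t).
  move=> s t hs ht; wlog st : s t hs ht / s < t.
    move=> W; have [st|st|->] := ltgtP s t; [exact: W|exact/esym/W|by []].
  have h1 := main s t 1 hs ht st (normr1 _).
  have h2 := main s t (-1) hs ht st (normrN1 _).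
  by clear -h1 h2; apply/eqP; rewrite eq_le; apply/andP; split; lra.
rewrite !lt_min => /andP[sd sd'] /andP[td td'] st sg1.
have ls := hd' s sd'; have lt_ := hd' t td'.
apply/ler_addgt0Pr => eta eta0.
have e40 : 0 < eta / 4 by clear -eta0; lra.
have [ka1 [e1 [ka10 e10 h1]]] :=
  liso_first_variation Hm (sg * (quarter (c s)).1, sg * (quarter (c s)).2) ls e40.
have [ka2 [e2 [ka20 e20 h2]]] :=
  liso_first_variation_rev Hm (sg * (quarter (c t)).1, sg * (quarter (c t)).2) lt_ e40.
rewrite !gmZr -!clairautE /= in h1 h2.
pose ds := d - `|s - t0|; pose dt := d - `|t - t0|.
have ds0 : 0 < ds by rewrite subr_gt0. have dt0 : 0 < dt by rewrite subr_gt0.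
(* [B e^2] bounds the distance from a rotated point to its first-order shift. *)
pose B := k1 * (4 * K); have B0 : 0 <= B by rewrite mulr_ge0 ?(ltW k10) // mulr_ge0.
pose e := Num.min (Num.min (Num.min (e1 / 2) (e2 / 2)) (Num.min (ds / (2 * ka1)) (dt / (2 * ka2))))
   (Num.min 1 (eta / (4 * (B + 1)))).
have B1 : 0 < 4 * (B + 1) by clear -B0; lra.
have ka1' : 0 < 2 * ka1 by rewrite mulr_gt0.
have ka2' : 0 < 2 * ka2 by rewrite mulr_gt0.
have e_gt0 : 0 < e by rewrite !lt_min ltr01 !divr_gt0.
have [ee1 [ee2 [es [et [el1 eB]]]]] : e < e1 /\ e < e2 /\ ka1 * e < ds /\ ka2 * e < dt /\
    e <= 1 /\ e * (4 * (B + 1)) <= eta.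
  split; first by apply: (@le_lt_trans _ _ (e1 / 2)); [rewrite !ge_min lexx|clear -e10; lra].
  split; first by apply: (@le_lt_trans _ _ (e2 / 2)); [rewrite !ge_min lexx ?orbT|clear -e20; lra].
  have A (x y : R) : 0 < x -> 0 < y -> e <= y / (2 * x) -> x * e < y.
    move=> x0 y0; rewrite ler_pdivlMr ?mulr_gt0 // => h.
    by clear -h y0; lra.
  split; first by apply: A => //; rewrite !ge_min lexx ?orbT.
  split; first by apply: A => //; rewrite !ge_min lexx ?orbT.
  split; first by rewrite !ge_min lexx ?orbT.
  by rewrite -ler_pdivlMr // !ge_min lexx ?orbT.
have [a [b [ab hrot]]] := small_rotation e_gt0 el1.
have abs : a ^+ 2 + (sg * b) ^+ 2 = 1.
  by rewrite exprMn -(real_normK (num_real sg)) sg1 expr1n mul1r.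
have hs1 : `|s - ka1 * e - t0| < d.
  have := ler_normB (s - t0) (ka1 * e); rewrite addrAC => h; apply: le_lt_trans h _.
  by rewrite (gtr0_norm (mulr_gt0 ka10 e_gt0)) -ltrBrDl.
have ht1 : `|t + ka2 * e - t0| < d.
  have := ler_normD (t - t0) (ka2 * e); rewrite addrAC => h; apply: le_lt_trans h _.
  by rewrite (gtr0_norm (mulr_gt0 ka20 e_gt0)) -ltrBrDl.
have [sK E1 _ _] := hf s t sd td; have [tK _ _ _] := hf t t td td.
have [_ E2 _ _] := hf _ _ hs1 ht1.
have st0 : 0 < t - s by rewrite subr_gt0.
have k1e := mulr_gt0 ka10 e_gt0; have k2e := mulr_gt0 ka20 e_gt0.
rewrite distrC gtr0_norm in E1 => //.
rewrite distrC (_ : t + _ - _ = (t - s) + ka1 * e + ka2 * e) in E2; last by ring.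
rewrite gtr0_norm in E2; last by apply: addr_gt0 => //; exact: addr_gt0.
have close p : enorm p <= K ->
    D (p + (e * (sg * (quarter p).1), e * (sg * (quarter p).2))) (orth a (sg * b) 1 p) <= B * e ^+ 2.
  move=> pK; set q := p + _.
  have or : enorm (orth a (sg * b) 1 p) = enorm p by rewrite enorm_orth ?expr1n.
  have qK : enorm q <= 6 * K + 1.
    have := hrot sg p sg1; rewrite -/q => hq.
    have := enormD (q - orth a (sg * b) 1 p) (orth a (sg * b) 1 p); rewrite subrK or enormB.
    have e21 : e ^+ 2 <= 1 by rewrite expr_le1 // ltW.
    have := ler_wpM2r (enorm_ge0 p) e21; clear -hq pK K0; lra.
  have oK : enorm (orth a (sg * b) 1 p) <= 6 * K + 1 by rewrite or; clear -pK K0; lra.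
  have [h _] := hk1 q _ qK oK; apply: le_trans h _.
  rewrite /B -!mulrA ler_pM2l //; apply: le_trans (hrot sg p sg1) _.
  have := ler_wpM2l (sqr_ge0 e) pK; clear; lra.
have cs := close _ sK; have ct := close _ tK; rewrite D_sym // in ct.
have := h1 e e_gt0 ee1; have := h2 e e_gt0 ee2.
have Eo := D_orth Hm (c s) (c t) abs (expr1n _ 2); rewrite E1 in Eo.
set P1 := c s + _ in cs *; set P2 := c t + _ in ct *.
set O1 := orth _ _ _ (c s) in cs Eo *; set O2 := orth _ _ _ (c t) in ct Eo *.
have := D_tri Hm P1 (c (s - ka1 * e)) (c (t + ka2 * e)).
have := D_tri Hm O1 P1 (c (t + ka2 * e)).
have := D_tri Hm O2 O1 (c (t + ka2 * e)).
have := D_tri Hm P2 O2 (c (t + ka2 * e)).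
rewrite E2 Eo.
move=> T1 T2 T3 T4 V2 V1.
have Q : 0 <= e * (sg * (clairaut c s - clairaut c t) + eta / 2 + 2 * B * e).
  clear -T1 T2 T3 T4 V1 V2 cs ct.
  lra.
rewrite pmulr_rge0 // in Q; clear -Q eB e_gt0; lra.
Qed.

Lemma clamp_dist (a b x y : R) : a <= b ->
  `|Num.max a (Num.min x b) - Num.max a (Num.min y b)| <= `|x - y|.
Proof.
move=> ab; have key (u v : R) : u <= v ->
    `|Num.max a (Num.min u b) - Num.max a (Num.min v b)| <= v - u.
  move=> uv; rewrite ler_norml.
  case: (leP u b) => ub; case: (leP v b) => vb.
  - by case: (leP a u) => ?; case: (leP a v) => ?; apply/andP; lra.
  - by rewrite (max_idPr ab); case: (leP a u) => ?; apply/andP; lra.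
  - by exfalso; lra.
  - by rewrite (max_idPr ab); apply/andP; lra.
have [xy|/ltW yx] := leP x y.
  by rewrite (distrC x) (ger0_norm (_ : 0 <= y - x)) ?subr_ge0 //; exact: key.
by rewrite distrC (ger0_norm (_ : 0 <= x - y)) ?subr_ge0 //; exact: key.
Qed.

Lemma clamp_id (a b x : R) : a <= x -> x <= b -> Num.max a (Num.min x b) = x.
Proof. by move=> ax xb; rewrite (min_idPl xb); apply/max_idPr. Qed.

Lemma clamp_itv (a b x : R) : a <= b ->
  a <= Num.max a (Num.min x b) /\ Num.max a (Num.min x b) <= b.
Proof. by move=> ab; split; rewrite ?le_max ?lexx // ge_max ab ge_min lexx orbT. Qed.

Lemma clamp_cont (f : R -> R) (a b : R) : a <= b ->
  (forall t, a <= t -> t <= b -> forall e, 0 < e -> exists2 d, 0 < d &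
     forall s, a <= s -> s <= b -> `|s - t| < d -> `|f s - f t| < e) ->
  continuous (fun t => f (Num.max a (Num.min t b))).
Proof.
move=> ab hf t; apply/contP => e e0; have [l1 l2] := clamp_itv t ab.
have [d d0 hd] := hf _ l1 l2 e e0; exists d => // y yt.
have [l3 l4] := clamp_itv y ab; apply: hd => //.
exact: le_lt_trans (clamp_dist _ _ ab) yt.
Qed.

(** Paths are C1 on all of R by definition, so a piece known on [[a, b]] only is continued with
    constant derivative on either side. *)
Lemma C1_extension (f g : R -> R) (a b : R) : a <= b ->
  (forall t, a <= t -> t <= b -> is_derive t 1 f (g t)) ->
  (forall t, a <= t -> t <= b -> {for t, continuous g}) ->
  exists F G : R -> R, [/\ forall t, is_derive t 1 F (G t), continuous G &
    forall t, a <= t -> t <= b -> F t = f t /\ G t = g t].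
Proof.
move=> ab hf hg; pose G t := g (Num.max a (Num.min t b)).
have cG : continuous G.
  apply: clamp_cont => // t at' tb e e0; have /contP h := hg t at' tb.
  by have [d d0 hd] := h e e0; exists d => // s _ _; exact: hd.
have [F hF] := antiderivative cG.
exists (fun t => F t + (f a - F a)), G; split=> //.
  by move=> t; have h := hF t; derc; ring.
move=> t at' tb; rewrite /G clamp_id //; split=> //.
have : f a - F a = f t - F t; last by lra.
apply: (@der0_cst _ (fun x => f x - F x)) => //.
  move=> x ax xt; have xb := le_trans (ltW xt) tb.
  have h1 := hf x (ltW ax) xb; have := hF x; rewrite /G clamp_id // ?(ltW ax) // => h2.
  by derc; ring.
move=> x ax xt; have xb := le_trans xt tb.
apply: cvgB; first exact: der_cont (hf x ax xb).
exact: der_cont (hF x).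
Qed.

Lemma D_le_speed_local c (v : R -> R * R) (K s t : R) : s <= t ->
  (forall r, s <= r -> r <= t ->
    [/\ is_derive r 1 (fun x => (c x).1) (v r).1,
        is_derive r 1 (fun x => (c x).2) (v r).2,
        {for r, continuous (fun x => (v x).1)} & {for r, continuous (fun x => (v x).2)}]) ->
  (forall r, s < r -> r < t -> gnorm m (c r) (v r) <= K) -> D (c s) (c t) <= K * (t - s).
Proof.
move=> st hd hK.
have [F1 [G1 [hF1 hG1 E1]]] := @C1_extension (fun x => (c x).1) (fun x => (v x).1) s t st
  (fun r h1 h2 => let: And4 a _ _ _ := hd r h1 h2 in a)
  (fun r h1 h2 => let: And4 _ _ a _ := hd r h1 h2 in a).
have [F2 [G2 [hF2 hG2 E2]]] := @C1_extension (fun x => (c x).2) (fun x => (v x).2) s t st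
  (fun r h1 h2 => let: And4 _ a _ _ := hd r h1 h2 in a)
  (fun r h1 h2 => let: And4 _ _ _ a := hd r h1 h2 in a).
have Ec r : s <= r -> r <= t -> (F1 r, F2 r) = c r /\ (G1 r, G2 r) = v r.
  move=> h1 h2; have [-> ->] := E1 r h1 h2; have [-> ->] := E2 r h1 h2.
  by rewrite -!surjective_pairing.
have [Es _] := Ec s (lexx _) st; have [Et _] := Ec t st (lexx _).
rewrite -Es -Et; apply: (@D_le_speed _ _ Hm (fun r => (F1 r, F2 r)) (fun r => (G1 r, G2 r))) => //.
move=> r sr rt; have [-> ->] := Ec r (ltW sr) (ltW rt); exact: hK.
Qed.

End Conservation.

(** * The geodesic equation for the radius *)

Section RadialEquation.
Variable R : realType.
Variable m : R -> R.
Hypothesis Hm : admissible_profile m.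
Implicit Types (p q z w : R * R) (c : R -> R * R) (s t : R).
Notation D := (D m).
Notation liso_at := (liso_at m).
Notation m1 := (derivs m 1).
Notation m2 := (derivs m 2).
Notation clairaut := (clairaut m).

Definition rvel c t := edot (c t) (vel c t) / enorm (c t).

Lemma enorm_neq0 p : p <> 0 -> 0 < enorm p.
Proof. by move=> /eqP p0; rewrite enorm_gt0. Qed.

Lemma gm_polar p v : p <> 0 -> gm m p v v =
  (edot p v / enorm p) ^+ 2 + (m (enorm p) / enorm p ^+ 2 * cross p v) ^+ 2.
Proof.
move=> /enorm_neq0 r0; rewrite gmE -(stretch_m Hm).
move: (sqr_enorm p); set r := enorm p in r0 *; set u := stretch m r => E.
have rn : r != 0 by rewrite gt_eqF.
have L : edot p p * edot v v = edot p v ^+ 2 + cross p v ^+ 2.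
  by rewrite /edot /cross; ring.
have -> : edot v v = (edot p v ^+ 2 + cross p v ^+ 2) / r ^+ 2.
  by rewrite -L -E mulrC mulKf // expf_neq0.
by field.
Qed.

Lemma der_enorm c t (v : R * R) : c t <> 0 -> is_derive t 1 (fun s => (c s).1) v.1 ->
  is_derive t 1 (fun s => (c s).2) v.2 ->
  is_derive t 1 (fun s => enorm (c s)) (edot (c t) v / enorm (c t)).
Proof.
move=> /enorm_neq0 r0 d1 d2; rewrite /enorm /edot; derc.
  by rewrite -sqrtr_gt0.
have rn : enorm (c t) != 0 by rewrite gt_eqF.
rewrite -/(edot (c t) (c t)) -/(enorm (c t)); by field.
Qed.

Lemma liso_der_rad c t : liso_at c t -> c t <> 0 ->
  is_derive t 1 (fun s => enorm (c s)) (rvel c t).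
Proof. by move=> /(liso_C1 Hm) [d1 d2 _ _] c0; exact: der_enorm. Qed.

Lemma liso_cont c t : liso_at c t ->
  {for t, continuous (fun s => (c s).1)} /\ {for t, continuous (fun s => (c s).2)}.
Proof.
by move=> /(liso_C1 Hm) [d1 d2 _ _]; split; [exact: der_cont d1|exact: der_cont d2].
Qed.

Lemma enorm_cont c t : {for t, continuous (fun s => (c s).1)} ->
  {for t, continuous (fun s => (c s).2)} -> {for t, continuous (fun s => enorm (c s))}.
Proof.
move=> h1 h2; rewrite /enorm; apply: continuous_cvg; first exact: sqrt_continuous.
by rewrite /edot; apply: cvgD; apply: cvgM; first [exact: h1|exact: h2].
Qed.

Lemma liso_cont_rad c t : liso_at c t -> {for t, continuous (fun s => enorm (c s))}.
Proof. by move=> /liso_cont [h1 h2]; exact: enorm_cont. Qed.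

Lemma liso_cont_rvel c t : liso_at c t -> c t <> 0 -> {for t, continuous (rvel c)}.
Proof.
move=> hl c0; have [d1 d2 h3 h4] := liso_C1 Hm hl.
have h1 := der_cont d1; have h2 := der_cont d2.
have h5 := liso_cont_rad hl.
rewrite /rvel /edot; apply: cvgM; last first.
  by apply: cvgV; [rewrite gt_eqF // enorm_neq0|exact: h5].
exact: (cvgD (cvgM h1 h3) (cvgM h2 h4)).
Qed.

Lemma clairaut_m c t : c t <> 0 ->
  cross (c t) (vel c t) / enorm (c t) ^+ 2 = clairaut c t / m (enorm (c t)) ^+ 2.
Proof.
move=> /enorm_neq0 r0; rewrite /clairaut -(stretch_m Hm) exprMn.
have := stretch_gt0 Hm (ltW r0) => u0.
by field; rewrite !gt_eqF.
Qed.

Lemma liso_energy c t : liso_at c t -> c t <> 0 ->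
  rvel c t ^+ 2 + clairaut c t ^+ 2 / m (enorm (c t)) ^+ 2 = 1.
Proof.
move=> hl c0; rewrite -(liso_speed Hm hl) gm_polar // -/(rvel c t); congr (_ + _).
rewrite (_ : m _ / _ * _ = cross (c t) (vel c t) / enorm (c t) ^+ 2 * m (enorm (c t))); last by ring.
rewrite clairaut_m //.
have := m_gt0 Hm (enorm_neq0 c0) => m0.
by field; rewrite gt_eqF.
Qed.

Lemma m_sqr_taylor (a b : R) : 0 < a -> a <= b -> exists2 B : R, 0 <= B & forall r e,
  2 * a <= r -> r <= b -> `|e| <= a ->
  `|m (r + e) ^+ 2 - m r ^+ 2 - 2 * e * (m r * m1 r)| <= B * e ^+ 2.
Proof.
move=> a0 ab; pose f (r : R) := m r ^+ 2; pose f1 (r : R) := 2 * m r * m1 r.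
pose f2 (r : R) := 2 * (m1 r ^+ 2 + m r * m2 r).
have df (r : R) : is_derive r 1 f (f1 r).
  by have d := der_m Hm r; rewrite /f /f1; derc; ring.
have df1 (r : R) : is_derive r 1 f1 (f2 r).
  by have d := der_m Hm r; have d' := der_m1 Hm r; rewrite /f1 /f2; derc; ring.
have cf2 : continuous f2.
  move=> r; have c0 := @cont_m _ _ Hm r; have c1 := @cont_profile _ _ Hm 1 r.
  have c2 := @cont_profile _ _ Hm 2 r.
  apply: cvgM; first exact: cvg_cst.
  apply: cvgD; first by apply: (cvgM c1 c1).
  exact: (cvgM c0 c2).
have [B B0 hB] := @cont_bounded _ f2 a (b + a) (fun x _ _ => cf2 x).
have lip x y : a <= x -> x <= y -> y <= b + a -> `|f1 y - f1 x| <= B * (y - x).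
  move=> ax xy yb; apply: (@der_lip _ f1 f2) => //.
  - by move=> z _ _; exact: der_cont (df1 z).
  - by move=> z xz zy; apply: hB; lra.
exists B => // r e ar rb ea; move: (ea); rewrite ler_norml => /andP[e1 e2].
have E g : f1 r * e = g -> `|f (r + e) - f r - g| <= B * e ^+ 2 ->
  `|m (r + e) ^+ 2 - m r ^+ 2 - 2 * e * (m r * m1 r)| <= B * e ^+ 2.
  by move=> <-; rewrite /f /f1 (_ : 2 * m r * m1 r * e = 2 * e * (m r * m1 r)); last ring.
apply: (E _ erefl).
have [e0|e0|->] := ltgtP e 0; last by rewrite addr0 mulr0 subr0 subrr normr0 expr0n mulr0.
- have lt_ : r + e < r by lra.
  have [x [x1 x2 Ex]] := mvt lt_ (fun y _ _ => df y) (fun y _ _ => der_cont (df y)).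
  rewrite (_ : _ - f r - _ = e * (f1 x - f1 r)); last first.
    have -> : f (r + e) - f r = - (f1 x * (r - (r + e))) by rewrite -Ex opprB.
    by ring.
  rewrite normrM (ltr0_norm e0) distrC.
  have := lip x r ltac:(lra) (ltW x2) ltac:(lra) => h.
  apply: (@le_trans _ _ (- e * (B * (r - x)))); first by rewrite ler_wpM2l //; lra.
  have : 0 <= B * (- e) * (- e - (r - x)) by rewrite mulr_ge0 // ?mulr_ge0 //; lra.
  lra.
- have lt_ : r < r + e by lra.
  have [x [x1 x2 Ex]] := mvt lt_ (fun y _ _ => df y) (fun y _ _ => der_cont (df y)).
  rewrite (_ : _ - f r - _ = e * (f1 x - f1 r)); last first.
    by rewrite Ex; ring.
  rewrite normrM (gtr0_norm e0).
  have := lip r x ltac:(lra) (ltW x1) ltac:(lra) => h.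
  apply: (@le_trans _ _ (e * (B * (x - r)))); first by rewrite ler_wpM2l //; lra.
  have : 0 <= B * e * (e - (x - r)) by rewrite mulr_ge0 // ?mulr_ge0 //; lra.
  lra.
Qed.

Lemma gm_radial p v : p <> 0 -> gm m p v (p.1 / enorm p, p.2 / enorm p) = edot p v / enorm p.
Proof.
move=> /enorm_neq0 r0; rewrite gmE; move: (sqr_enorm p).
set r := enorm p in r0 *; set u := stretch m r => E; have rn : r != 0 by rewrite gt_eqF.
have -> : edot p (p.1 / r, p.2 / r) = r.
  by rewrite /edot /= !mulrA -mulrDl -/(edot p p) -E expr2 mulfK.
have -> : edot v (p.1 / r, p.2 / r) = edot p v / r by rewrite /edot /=; field.
by field.
Qed.

Definition radial_acc c t := clairaut c t ^+ 2 * m1 (enorm (c t)) / m (enorm (c t)) ^+ 3.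

(* Speed of the radially shifted curve r -> r + e. *)
Lemma gm_shift c t (e : R) : liso_at c t -> c t <> 0 -> 0 < enorm (c t) + e ->
  let r := enorm (c t) in let r' := rvel c t in
  let ce := ((c t).1 + e * ((c t).1 / r), (c t).2 + e * ((c t).2 / r)) in
  let ve := ((vel c t).1 + e * ((vel c t).1 / r - (c t).1 * r' / r ^+ 2),
             (vel c t).2 + e * ((vel c t).2 / r - (c t).2 * r' / r ^+ 2)) in
  gm m ce ve ve = 1 + (m (r + e) ^+ 2 - m r ^+ 2) * (clairaut c t ^+ 2 / m r ^+ 4).
Proof.
move=> hl c0 re r r' ce ve; have r0 : 0 < r := enorm_neq0 c0.
have rn : r != 0 by rewrite gt_eqF.
have ren : r + e != 0 by rewrite gt_eqF.
have E : r ^+ 2 = edot (c t) (c t) by exact: sqr_enorm.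
have Er : edot (c t) (vel c t) = r * r' by rewrite /r' /rvel -/r mulrC divfK.
have nce : enorm ce = r + e.
  have -> : ce = ((1 + e / r) * (c t).1, (1 + e / r) * (c t).2).
    by rewrite /ce; congr pair; ring.
  rewrite enormZ -/r ger0_norm; first by field.
  by rewrite (_ : 1 + e / r = (r + e) / r); [rewrite divr_ge0 // ltW|field].
have ce0 : ce <> 0 by move=> h; move: re; rewrite -nce h enorm0 ltxx.
rewrite gm_polar // nce.
have -> : edot ce ve / (r + e) = r'.
  have -> : edot ce ve = (1 + e / r) * ((1 + e / r) * edot (c t) (vel c t) - e * r' / r ^+ 2 * edot (c t) (c t)).
    by rewrite /ce /ve /edot /=; field.
  by rewrite Er -E; field; rewrite rn ren.
have -> : cross ce ve = (1 + e / r) ^+ 2 * cross (c t) (vel c t).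
  by rewrite /ce /ve /cross /=; field.
have m0 : m r != 0 by rewrite gt_eqF // (m_gt0 Hm).
have := clairaut_m c0; rewrite -/r => Ecl.
have -> : cross (c t) (vel c t) = clairaut c t / m r ^+ 2 * r ^+ 2.
  by rewrite -Ecl; field.
have := liso_energy hl c0; rewrite -/r -/r' => En.
have -> : r' ^+ 2 = 1 - clairaut c t ^+ 2 / m r ^+ 2 by rewrite -En; ring.
by field; rewrite m0 rn ren.
Qed.

(** The comparison used for the Clairaut constant, with a radial shift in place of the rotation. The
    shift is no isometry: it changes the speed to [1 + e sg radial_acc + O(e^2)], and this is the
    source of the term [(t - s) * F]. *)
Lemma liso_radial_variation c t0 : liso_at c t0 -> c t0 <> 0 ->
  exists2 d : R, 0 < d & forall s t (sg F : R), `|s - t0| < d -> `|t - t0| < d -> s < t ->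
    `|sg| = 1 -> (forall x, s <= x -> x <= t -> sg * radial_acc c x <= F) ->
    sg * (rvel c t - rvel c s) <= (t - s) * F.
Proof.
move=> hl c0; have rho0 := enorm_neq0 c0; set rho := enorm (c t0) in rho0.
have [d1 d10 hd1] := liso_near hl.
have [d2 d20 hd2] := liso_clairaut Hm hl.
have /contP crad := liso_cont_rad hl; have [d3 d30 hd3] := crad (rho / 2) ltac:(lra).
have [d4 d40 hiso] := hl.
pose nu := clairaut c t0.
(* Radii stay in [[rho / 2, 3 rho / 2]] and the shift is at most [rho / 4], so shifted curves avoid
   the origin. *)
have [B B0 hB] := @m_sqr_taylor (rho / 4) (3 * rho / 2) ltac:(lra) ltac:(lra).
have [x0 [x01 x02 hx0]] := @evt_min _ m (rho / 2) (3 * rho / 2) ltac:(lra)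
  (fun x _ _ => @cont_m _ _ Hm x).
set mu := m x0 in hx0; have mu0 : 0 < mu by apply: (m_gt0 Hm); lra.
pose A := nu ^+ 2 / mu ^+ 4 * B; have A0 : 0 <= A.
  by rewrite mulr_ge0 // divr_ge0 ?sqr_ge0 // exprn_ge0 // ltW.
pose d := Num.min (Num.min d1 d2) (Num.min d3 d4).
exists d; first by rewrite !lt_min d10 d20 d30 d40.
have near x : `|x - t0| < d -> [/\ liso_at c x, clairaut c x = nu, rho / 2 <= enorm (c x),
    enorm (c x) <= 3 * rho / 2 & `|x - t0| < d4].
  rewrite !lt_min => /andP[/andP[h1 h2] /andP[h3 h4]].
  have := hd3 x h3; rewrite -/rho ltr_norml => /andP[h5 h6].
  split; [exact: hd1|apply: hd2; by rewrite ?subrr ?normr0| | |exact: h4].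
    by clear -h5; lra.
  by clear -h6; lra.
move=> s t sg F hs ht st sg1 hF.
have [ls Es s_lo s_hi hs4] := near s hs; have [lt_ Et t_lo t_hi ht4] := near t ht.
have btw x : s <= x -> x <= t -> `|x - t0| < d.
  by move: hs ht; rewrite !ltr_norml => /andP[a1 _] /andP[_ b2] sx xt; apply/andP; clear -a1 b2 sx xt; lra.
have nz x : rho / 2 <= enorm (c x) -> c x <> 0.
  by move=> h e; move: h; rewrite e enorm0; clear -rho0; lra.
apply/ler_addgt0Pr => eta eta0; have e40 : 0 < eta / 4 by clear -eta0; lra.
pose er p : R * R := (sg * (p.1 / enorm p), sg * (p.2 / enorm p)).
have [ka1 [e1 [ka10 e10 h1]]] := liso_first_variation Hm (er (c s)) ls e40.
have [ka2 [e2 [ka20 e20 h2]]] := liso_first_variation_rev Hm (er (c t)) lt_ e40.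
have ger x : rho / 2 <= enorm (c x) -> gm m (c x) (vel c x) (er (c x)) = sg * rvel c x.
  move=> h; rewrite /rvel -(gm_radial _ (nz x h)); exact: (gmZr m (c x) sg ((c x).1 / enorm (c x), (c x).2 / enorm (c x)) (vel c x)).
rewrite (ger s s_lo) in h1; rewrite (ger t t_lo) in h2.
pose ds := d4 - `|s - t0|; pose dt := d4 - `|t - t0|.
have ds0 : 0 < ds by rewrite subr_gt0. have dt0 : 0 < dt by rewrite subr_gt0.
have T0 : 0 < t - s by rewrite subr_gt0.
pose e := Num.min (Num.min (Num.min (e1 / 2) (e2 / 2)) (Num.min (ds / (2 * ka1)) (dt / (2 * ka2))))
   (Num.min (rho / 4) (eta / (2 * (A * (t - s) + 1)))).
have AT : 0 <= A * (t - s) by rewrite mulr_ge0 // ltW.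
have B1 : 0 < 2 * (A * (t - s) + 1) by clear -AT; lra.
have ka1' : 0 < 2 * ka1 by rewrite mulr_gt0.
have ka2' : 0 < 2 * ka2 by rewrite mulr_gt0.
have e_gt0 : 0 < e by rewrite !lt_min !divr_gt0.
have [ee1 [ee2 [es [et [el1 eB]]]]] : e < e1 /\ e < e2 /\ ka1 * e < ds /\ ka2 * e < dt /\
    e <= rho / 4 /\ e * (2 * (A * (t - s) + 1)) <= eta.
  split; first by apply: (@le_lt_trans _ _ (e1 / 2)); [rewrite !ge_min lexx|clear -e10; lra].
  split; first by apply: (@le_lt_trans _ _ (e2 / 2)); [rewrite !ge_min lexx ?orbT|clear -e20; lra].
  have Q (x y : R) : 0 < x -> 0 < y -> e <= y / (2 * x) -> x * e < y.
    move=> x0' y0; rewrite ler_pdivlMr ?mulr_gt0 // => h.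
    by clear -h y0; lra.
  split; first by apply: Q => //; rewrite !ge_min lexx ?orbT.
  split; first by apply: Q => //; rewrite !ge_min lexx ?orbT.
  split; first by rewrite !ge_min lexx ?orbT.
  by rewrite -ler_pdivlMr // !ge_min lexx ?orbT.
have k1e := mulr_gt0 ka10 e_gt0; have k2e := mulr_gt0 ka20 e_gt0.
have hs1 : `|s - ka1 * e - t0| < d4.
  have := ler_normB (s - t0) (ka1 * e); rewrite addrAC => h; apply: le_lt_trans h _.
  by rewrite (gtr0_norm k1e) -ltrBrDl.
have ht1 : `|t + ka2 * e - t0| < d4.
  have := ler_normD (t - t0) (ka2 * e); rewrite addrAC => h; apply: le_lt_trans h _.
  by rewrite (gtr0_norm k2e) -ltrBrDl.
have E2 := hiso _ _ hs1 ht1.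
rewrite distrC (_ : t + _ - _ = (t - s) + ka1 * e + ka2 * e) in E2; last by ring.
rewrite gtr0_norm in E2; last by apply: addr_gt0 => //; exact: addr_gt0.
have sge : `|sg * e| = e by rewrite normrM sg1 mul1r gtr0_norm.
pose ce x : R * R := ((c x).1 + sg * e * ((c x).1 / enorm (c x)),
                      (c x).2 + sg * e * ((c x).2 / enorm (c x))).
pose ve x : R * R := ((vel c x).1 + sg * e * ((vel c x).1 / enorm (c x) - (c x).1 * rvel c x / enorm (c x) ^+ 2),
             (vel c x).2 + sg * e * ((vel c x).2 / enorm (c x) - (c x).2 * rvel c x / enorm (c x) ^+ 2)).
have Dshift : D (ce s) (ce t) <= (1 + e * F + A * e ^+ 2) * (t - s).
  apply: (@D_le_speed_local _ _ Hm ce ve); first exact: ltW.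
    move=> x sx xt; have [lx _ x_lo _ _] := near x (btw x sx xt).
    have [k1 k2 k3 k4] := liso_C1 Hm lx; have k5 := liso_der_rad lx (nz x x_lo).
    have k6 := liso_cont_rvel lx (nz x x_lo).
    have c1 := der_cont k1; have c2 := der_cont k2; have c5 := der_cont k5.
    have rn : enorm (c x) != 0 by apply: lt0r_neq0; apply: enorm_neq0; exact: nz.
    have rn2 : enorm (c x) ^+ 2 != 0 by rewrite expf_neq0.
    have v5 : (fun y => (enorm (c y))^-1) @ x --> (enorm (c x))^-1 by apply: cvgV.
    have v6 : (fun y => (enorm (c y) ^+ 2)^-1) @ x --> (enorm (c x) ^+ 2)^-1.
      exact: (cvgV rn2 (cvgM c5 c5)).
    split.
    - change (is_derive x 1 (fun y => (c y).1 + sg * e * ((c y).1 / enorm (c y)))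
        ((vel c x).1 + sg * e * ((vel c x).1 / enorm (c x) - (c x).1 * rvel c x / enorm (c x) ^+ 2))).
      by derc; field.
    - change (is_derive x 1 (fun y => (c y).2 + sg * e * ((c y).2 / enorm (c y)))
        ((vel c x).2 + sg * e * ((vel c x).2 / enorm (c x) - (c x).2 * rvel c x / enorm (c x) ^+ 2))).
      by derc; field.
    - rewrite /ve /=; apply: cvgD; first exact: k3.
      apply: cvgM; first exact: cvg_cst.
      apply: cvgB; first exact: (cvgM k3 v5).
      by apply: cvgM; [exact: (cvgM c1 k6)|exact: v6].
    - rewrite /ve /=; apply: cvgD; first exact: k4.
      apply: cvgM; first exact: cvg_cst.
      apply: cvgB; first exact: (cvgM k4 v5).
      by apply: cvgM; [exact: (cvgM c2 k6)|exact: v6].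
  move=> x /ltW sx /ltW xt; have [lx Ex x_lo x_hi _] := near x (btw x sx xt).
  have hsg : `|sg * e| <= rho / 4 by rewrite sge.
  have rp : 0 < enorm (c x) + sg * e.
    by move: hsg; rewrite ler_norml => /andP[h _]; clear -h x_lo rho0; lra.
  have G := gm_shift lx (nz x x_lo) rp; cbv zeta in G.
  have Fx := hF x sx xt; rewrite /radial_acc Ex in Fx.
  have T := hB (enorm (c x)) (sg * e) ltac:(clear -x_lo; lra) x_hi hsg.
  rewrite ler_norml in T; have /andP[_ T2] := T; rewrite Ex in G.
  have mr : mu <= m (enorm (c x)) by exact: hx0.
  have m0 := lt_le_trans mu0 mr.
  have m4 : nu ^+ 2 / m (enorm (c x)) ^+ 4 <= nu ^+ 2 / mu ^+ 4.
    apply: ler_wpM2l; first exact: sqr_ge0.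
    rewrite lef_pV2; [exact: (lerXn2r 4 (ltW mu0) (ltW m0) mr)|exact: (exprn_gt0 4 m0)|].
    exact: (exprn_gt0 4 mu0).
  have q0 : 0 <= nu ^+ 2 / m (enorm (c x)) ^+ 4.
    exact: divr_ge0 (sqr_ge0 _) (exprn_ge0 4 (ltW m0)).
  have gb : gm m (ce x) (ve x) (ve x) <= 1 + 2 * (e * F + A * e ^+ 2).
    rewrite G lerD2l.
    have E3 : 2 * (sg * e) * (m (enorm (c x)) * m1 (enorm (c x))) * (nu ^+ 2 / m (enorm (c x)) ^+ 4)
      = 2 * e * (sg * (nu ^+ 2 * m1 (enorm (c x)) / m (enorm (c x)) ^+ 3)).
      by field; rewrite gt_eqF.
    have s2 : (sg * e) ^+ 2 = e ^+ 2 by rewrite -(real_normK (num_real (sg * e))) sge.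
    rewrite s2 in T2.
    have := ler_wpM2r q0 T2; rewrite mulrBl E3 => h3.
    have := ler_wpM2l (mulr_ge0 (ler0n R 2) (ltW e_gt0)) Fx => h4.
    have := ler_wpM2r (mulr_ge0 B0 (sqr_ge0 e)) m4 => h5.
    have h6 : 0 <= A * e ^+ 2 by exact: mulr_ge0 A0 (sqr_ge0 e).
    rewrite /A in h6 *; clear -h3 h4 h5 h6; lra.
  have g0 : 0 <= gm m (ce x) (ve x) (ve x) by exact: gm_ge0.
  set y := e * F + A * e ^+ 2 in gb *.
  have -> : 1 + e * F + A * e ^+ 2 = 1 + y by rewrite /y; ring.
  have y1 : 0 <= 1 + y by clear -g0 gb; lra.
  (* The speed is bounded through [1 + 2 y <= (1 + y)^2]. *)
  rewrite -ler_sqr ?nnegrE ?gnorm_ge0 // sqr_gnorm.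
  by apply: (le_trans gb); have := sqr_ge0 y; clear; lra.
have := h1 e e_gt0 ee1; have := h2 e e_gt0 ee2.
have Ece x : (c x + (e * (er (c x)).1, e * (er (c x)).2)) = ce x.
  by rewrite /ce /er [LHS]surjective_pairing; congr pair => /=; ring.
rewrite !Ece => V2 V1.
have T1 := D_tri Hm (ce s) (c (s - ka1 * e)) (c (t + ka2 * e)).
have T2 := D_tri Hm (ce t) (ce s) (c (t + ka2 * e)).
rewrite E2 in T1.
have Q : 0 <= e * ((t - s) * F + eta / 2 + e * (A * (t - s)) - sg * (rvel c t - rvel c s)).
  clear -T1 T2 V1 V2 Dshift; lra.
rewrite pmulr_rge0 // in Q; clear -Q eB e_gt0; lra.
Qed.

(** The variation inequality for both signs, with [F] within [e] of the value at [t], squeezes the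
    difference quotient. *)
Lemma liso_radial c t : liso_at c t -> c t <> 0 ->
  is_derive t 1 (rvel c) (radial_acc c t).
Proof.
move=> hl c0; have r0 := enorm_neq0 c0.
have [d d0 hd] := liso_radial_variation hl c0.
have [d2 d20 hd2] := liso_clairaut Hm hl.
have cacc : {for t, continuous (radial_acc c)}.
  have crad := liso_cont_rad hl.
  have cm : {for t, continuous (fun x => m (enorm (c x)))}.
    exact: (continuous_comp crad (@cont_m _ _ Hm _)).
  have cm1 : {for t, continuous (fun x => m1 (enorm (c x)))}.
    exact: (continuous_comp crad (@cont_profile _ _ Hm 1 _)).
  have h : {for t, continuous (fun x => clairaut c t ^+ 2 * m1 (enorm (c x)) / m (enorm (c x)) ^+ 3)}.
    apply: cvgM; first by apply: cvgM; [exact: cvg_cst|exact: cm1].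
    apply: cvgV; first by rewrite expf_neq0 // gt_eqF // (m_gt0 Hm).
    exact: (cvgM cm (cvgM cm cm)).
  move/contP: h => h; apply/contP => e e0; have [k k0 hk] := h e e0.
  exists (Num.min k d2); first by rewrite lt_min k0.
  move=> y; rewrite lt_min => /andP[yk yd]; rewrite /radial_acc (hd2 y t) //; first exact: hk.
  by rewrite subrr normr0.
apply/derP => e e0; have /contP := cacc; move=> /(_ e e0) [k k0 hk].
exists (Num.min k d); first by rewrite lt_min k0.
have tt : `|t - t| < d by rewrite subrr normr0.
move=> y; rewrite lt_min => /andP[yk yd].
have bd (sg x : R) : `|sg| = 1 -> `|x - t| <= `|y - t| -> sg * radial_acc c x <= sg * radial_acc c t + e.
  move=> sg1 hx; have := hk x (le_lt_trans hx yk) => h.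
  rewrite addrC -lerBlDr -mulrBr; apply: le_trans (ler_norm _) _.
  by rewrite normrM sg1 mul1r ltW.
have [yt|ty|->] := ltgtP y t; last by rewrite !subrr mul0r subr0 normr0 mulr0.
- have H (sg : R) : `|sg| = 1 -> sg * (rvel c t - rvel c y) <= (t - y) * (sg * radial_acc c t + e).
    move=> sg1; apply: (hd y t sg) => // x yx xt; apply: bd => //.
    by rewrite !ler0_norm ?subr_le0 // ?(ltW yt) //; lra.
  have h1 := H 1 (normr1 _); have h2 := H (-1) (normrN1 _).
  rewrite [X in e * X]ltr0_norm ?subr_lt0 // ler_norml; apply/andP; split; lra.
- have H (sg : R) : `|sg| = 1 -> sg * (rvel c y - rvel c t) <= (y - t) * (sg * radial_acc c t + e).
    move=> sg1; apply: (hd t y sg) => // x tx xy; apply: bd => //.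
    by rewrite !ger0_norm ?subr_ge0 // ?(ltW ty) //; lra.
  have h1 := H 1 (normr1 _); have h2 := H (-1) (normrN1 _).
  rewrite [X in e * X]gtr0_norm ?subr_gt0 // ler_norml; apply/andP; split; lra.
Qed.

End RadialEquation.

(** * Straight lines and polar angles *)

Section PolarForm.
Variable R : realType.
Variable m : R -> R.
Hypothesis Hm : admissible_profile m.
Implicit Types (c : R -> R * R) (s t : R).
Notation D := (D m).
Notation liso_at := (liso_at m).
Notation m1 := (derivs m 1).
Notation clairaut := (clairaut m).

Lemma clairaut_cst c (a b : R) : (forall t, a < t -> t < b -> liso_at c t) ->
  forall s t, a < s -> s < b -> a < t -> t < b -> clairaut c s = clairaut c t.
Proof.
move=> hl; have key s t : a < s -> s <= t -> t < b -> clairaut c s = clairaut c t.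
  move=> as_ st tb.
  have d x : s <= x -> x <= t -> is_derive x 1 (clairaut c) 0.
    move=> sx xt; have [e e0 he] := liso_clairaut Hm (hl x (lt_le_trans as_ sx) (le_lt_trans xt tb)).
    apply: (der_near _ (dercst (clairaut c x) x)); exists e => // y yx.
    by apply: he; rewrite ?subrr ?normr0.
  by apply: der0_cst => // x *; [apply: d; exact: ltW|exact: der_cont (d x _ _)].
move=> s t as_ sb at_ tb; have [st|/ltW ts] := leP s t; first exact: key.
by apply/esym/key.
Qed.

Lemma liso_clairaut0_vel c t : liso_at c t -> clairaut c t = 0 ->
  [/\ cross (c t) (vel c t) = 0, edot (vel c t) (vel c t) = 1 &
      c t = (edot (c t) (vel c t) * (vel c t).1, edot (c t) (vel c t) * (vel c t).2)].
Proof.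
move=> hl /eqP; rewrite /clairaut mulf_eq0 sqrf_eq0 gt_eqF ?stretch_gt0 ?enorm_ge0 //=.
move=> /eqP c0; have v1 : edot (vel c t) (vel c t) = 1.
  have := liso_speed Hm hl; have [z|/eqP z] := eqVneq (c t) 0.
    by rewrite z gmE enorm0 /stretch eqxx expr1n subrr mul1r !mul0r addr0.
  rewrite gm_polar // c0 mulr0 expr0n addr0 => h.
  have r0 := enorm_neq0 z; have rn : enorm (c t) != 0 by rewrite gt_eqF.
  have L : edot (c t) (c t) * edot (vel c t) (vel c t) =
     edot (c t) (vel c t) ^+ 2 + cross (c t) (vel c t) ^+ 2 by rewrite /edot /cross; ring.
  have E := sqr_enorm (c t).
  apply: (@mulfI _ (edot (c t) (c t))); first by rewrite -E expf_neq0.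
  rewrite L c0 expr0n addr0 mulr1 -E -[RHS]mulr1 -h; by field.
split=> //; rewrite [LHS]surjective_pairing; congr pair.
  have : edot (c t) (vel c t) * (vel c t).1 = (c t).1 * edot (vel c t) (vel c t) - (vel c t).2 * cross (c t) (vel c t).
    by rewrite /edot /cross; ring.
  by rewrite c0 v1 mulr0 subr0 mulr1.
have : edot (c t) (vel c t) * (vel c t).2 = (c t).2 * edot (vel c t) (vel c t) + (vel c t).1 * cross (c t) (vel c t).
  by rewrite /edot /cross; ring.
by rewrite c0 v1 mulr0 addr0 mulr1.
Qed.

Lemma liso_near_clairaut c t : liso_at c t -> exists2 e : R, 0 < e &
  forall s, `|s - t| < e -> liso_at c s /\ clairaut c s = clairaut c t.
Proof.
move=> hl; have [d d0 hd] := liso_near hl; have [e e0 he] := liso_clairaut Hm hl.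
exists (Num.min d e); first by rewrite lt_min d0.
move=> s; rewrite lt_min => /andP[h1 h2]; split; first exact: hd.
by apply: he; rewrite ?subrr ?normr0.
Qed.

(** Away from the origin this is [(r r')' = r'^2 + r r''] with [r' ^ 2 = 1] and [r'' = 0]. At the
    origin the radius is not differentiable, and the expansion of the curve together with the
    continuity of its velocity is used. *)
Lemma liso_clairaut0_edot c t : liso_at c t -> clairaut c t = 0 ->
  is_derive t 1 (fun s => edot (c s) (vel c s)) 1.
Proof.
move=> hl c0; have [_ v1 _] := liso_clairaut0_vel hl c0.
have [z|/eqP z] := eqVneq (c t) 0; last first.
  have d1 := liso_der_rad Hm hl z; have d2 := liso_radial Hm hl z.
  have E : (fun s => edot (c s) (vel c s)) = fun s => rvel c s * enorm (c s).
    apply/funext => s; rewrite /rvel; have [->|/eqP h] := eqVneq (c s) 0.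
      by rewrite enorm0 mulr0 /edot /= !mul0r addr0.
    by rewrite divfK // gt_eqF // enorm_neq0.
  rewrite E; derc; rewrite /radial_acc c0 expr0n !mul0r add0r -expr2.
  by have := liso_energy Hm hl z; rewrite c0 expr0n mul0r addr0.
have [_ _ k1 k2] := liso_C1 Hm hl; have [e e0 he] := liso_near_clairaut hl.
apply/derP => eta eta0.
have eh : 0 < eta / 2 by lra.
have [d1 d10 hd1] := vel_expansion Hm hl eh.
move/contP: k1 => /(_ (eta / 4) ltac:(lra)) [d2 d20 hd2].
move/contP: k2 => /(_ (eta / 4) ltac:(lra)) [d3 d30 hd3].
exists (Num.min (Num.min e d1) (Num.min d2 d3)); first by rewrite !lt_min e0 d10 d20 d30.
move=> y; rewrite !lt_min => /andP[/andP[ye yd1] /andP[yd2 yd3]].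
have [ly] := he y ye; rewrite c0 => cy; have [_ vy _] := liso_clairaut0_vel ly cy.
have := hd1 (y - t) yd1; rewrite subrKC z subr0; set rem := c y - _ => hrem.
have nv : enorm (vel c y) = 1 by rewrite /enorm vy sqrtr1.
have nt : enorm (vel c t) = 1 by rewrite /enorm v1 sqrtr1.
rewrite (_ : edot (0 : R * R) (vel c t) = 0) ?subr0; last by rewrite /edot /= !mul0r addr0.
have alg (P V W : R * R) (h : R) : edot P W - h * edot V V =
    edot (P - (h * V.1, h * V.2)) W + h * edot V (W - V) by rewrite /edot /=; ring.
have := alg (c y) (vel c t) (vel c y) (y - t); rewrite v1 => ->; rewrite -/rem.
apply: le_trans (ler_normD _ _) _.
have t1 := cauchy_schwarz rem (vel c y); rewrite nv mulr1 in t1.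
have t2 := cauchy_schwarz (vel c t) (vel c y - vel c t); rewrite nt mul1r in t2.
have t3 := enorm_le_sum (vel c y - vel c t).
have t4 := hd2 y yd2; have t5 := hd3 y yd3.
have t6 : `|edot (vel c t) (vel c y - vel c t)| <= eta / 2.
  apply: (le_trans t2); apply: (le_trans t3); move: t4 t5 => /=.
  by clear; lra.
rewrite normrM; have := ler_wpM2l (normr_ge0 (y - t)) t6; clear -t1 hrem; lra.
Qed.

(** Here [S = t - t0] and the curve is [S] times its velocity, so the quotient by [t - t0] is
    constant on each side of [t0]; continuity of the velocity carries the direction across the
    origin. *)
Lemma liso_clairaut0_line c (a b : R) : a < b -> (forall t, a < t -> t < b -> liso_at c t) ->
  (forall t, a < t -> t < b -> clairaut c t = 0) ->
  exists (t0 : R) (u : R * R), enorm u = 1 /\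
  forall t, a < t -> t < b -> c t = ((t - t0) * u.1, (t - t0) * u.2).
Proof.
move=> ab hl h0; pose S t := edot (c t) (vel c t).
pose mid := (a + b) / 2; have am : a < mid by rewrite /mid; lra.
have mb : mid < b by rewrite /mid; lra.
have dS t : a < t -> t < b -> is_derive t 1 S 1.
  by move=> at_ tb; apply: liso_clairaut0_edot; [exact: hl|exact: h0].
pose t0 := mid - S mid.
have S_lin s t : a < s -> s <= t -> t < b -> S s - s = S t - t.
  move=> as_ st tb; apply: (@der0_cst _ (fun x => S x - x)) => // x sx xt.
    have d := dS x (lt_trans as_ sx) (lt_trans xt tb); by derc; ring.
  have d := dS x (lt_le_trans as_ sx) (le_lt_trans xt tb).
  by apply: (@der_cont _ _ _ 0); derc; ring.
have SE t : a < t -> t < b -> S t = t - t0.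
  move=> at_ tb; rewrite /t0; have [h|/ltW h] := leP t mid.
    by have := S_lin t mid at_ h mb; lra.
  by have := S_lin mid t am h tb; lra.
have cE t : a < t -> t < b -> c t = ((t - t0) * (vel c t).1, (t - t0) * (vel c t).2).
  by move=> at_ tb; have [_ _] := liso_clairaut0_vel (hl t at_ tb) (h0 t at_ tb); rewrite -/(S t) SE.
have side (f g : R -> R) s t : (forall x, a < x -> x < b -> is_derive x 1 f (g x)) ->
    (forall x, a < x -> x < b -> f x = (x - t0) * g x) ->
    a < s -> s <= t -> t < b -> (forall x, s <= x -> x <= t -> x != t0) -> g s = g t.
  move=> df fE as_ st tb nz.
  have gE x : s <= x -> x <= t -> g x = f x / (x - t0).
    move=> sx xt; rewrite fE ?(lt_le_trans as_ sx) ?(le_lt_trans xt tb) //.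
    by field; rewrite subr_eq0 nz.
  have dq x : s <= x -> x <= t -> is_derive x 1 (fun y => f y / (y - t0)) 0.
    move=> sx xt; have ax := lt_le_trans as_ sx; have xb := le_lt_trans xt tb.
    have d := df x ax xb; have n : x - t0 != 0 by rewrite subr_eq0 nz.
    derc; rewrite (fE x ax xb); by field.
  rewrite !gE //; apply: (@der0_cst _ (fun y => f y / (y - t0))) => // x sx xt.
    by apply: dq; exact: ltW.
  exact: der_cont (dq x sx xt).
have cst (f g : R -> R) : (forall x, a < x -> x < b -> is_derive x 1 f (g x)) ->
    (forall x, a < x -> x < b -> f x = (x - t0) * g x) ->
    (forall x, a < x -> x < b -> {for x, continuous g}) ->
    forall t, a < t -> t < b -> g t = g mid.
  move=> df fE cg.
  have toT0 t : a < t0 -> t0 < b -> a < t -> t < b -> g t = g t0.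
    move=> a0 b0 at_ tb; have [tt|tt|->//] := ltgtP t t0.
      apply/eqP; rewrite -subr_eq0 -normr_eq0 eq_le normr_ge0 andbT.
      apply/ler_addgt0Pr => e e0; rewrite add0r.
      have /contP /(_ e e0) [d d0 hd] := cg t0 a0 b0.
      pose y := Num.max t (t0 - d / 2).
      have yt : t <= y by rewrite le_max lexx.
      have yt0 : y < t0 by rewrite gt_max tt /=; lra.
      have yd : t0 - d / 2 <= y by rewrite le_max lexx orbT.
      rewrite (side f g t y df fE) ?(lt_trans yt0) //; last first.
        by move=> x _ xy; rewrite lt_eqF // (le_lt_trans xy).
      by apply/ltW/hd; rewrite ltr0_norm; lra.
    apply/eqP; rewrite -subr_eq0 -normr_eq0 eq_le normr_ge0 andbT.
    apply/ler_addgt0Pr => e e0; rewrite add0r.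
    have /contP /(_ e e0) [d d0 hd] := cg t0 a0 b0.
    pose y := Num.min t (t0 + d / 2).
    have yt : y <= t by rewrite ge_min lexx.
    have yt0 : t0 < y by rewrite lt_min tt /=; lra.
    have yd : y <= t0 + d / 2 by rewrite ge_min lexx orbT.
    rewrite -(side f g y t df fE) ?(lt_trans a0) //; last first.
      by move=> x yx _; rewrite gt_eqF // (lt_le_trans yt0).
    by apply/ltW/hd; rewrite gtr0_norm; lra.
  move=> t at_ tb; have [/andP[a0 b0]|out] := boolP ((a < t0) && (t0 < b)).
    by rewrite toT0 // toT0.
  have nz x : a < x -> x < b -> x != t0.
    by move=> ax xb; apply: contraNneq out => <-; rewrite ax.
  have [h|/ltW h] := leP t mid.
    apply: (side f g) => // x tx xm; apply: nz; [exact: lt_le_trans tx|exact: le_lt_trans mb].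
  apply/esym/(side f g) => // x mx xt; apply: nz; [exact: lt_le_trans mx|exact: le_lt_trans tb].
exists t0, (vel c mid).
have [_ vm _] := liso_clairaut0_vel (hl mid am mb) (h0 mid am mb).
split; first by rewrite /enorm vm sqrtr1.
have e1 := cst (fun x => (c x).1) (fun x => (vel c x).1)
  (fun x h1 h2 => let: And4 k _ _ _ := liso_C1 Hm (hl x h1 h2) in k)
  (fun x h1 h2 => congr1 fst (cE x h1 h2))
  (fun x h1 h2 => let: And4 _ _ k _ := liso_C1 Hm (hl x h1 h2) in k).
have e2 := cst (fun x => (c x).2) (fun x => (vel c x).2)
  (fun x h1 h2 => let: And4 _ k _ _ := liso_C1 Hm (hl x h1 h2) in k)
  (fun x h1 h2 => congr1 snd (cE x h1 h2))
  (fun x h1 h2 => let: And4 _ _ _ k := liso_C1 Hm (hl x h1 h2) in k).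
by move=> t at_ tb; rewrite cE // e1 // e2.
Qed.

(** The angle is obtained by integrating the angular speed. The direction [(X, Y)] and
    [(cos th, sin th)] solve the same linear system, so the components [F] and [G] of one in the
    rotating frame of the other are constant. *)
Lemma liso_polar c (a b rho nu : R) : a < b ->
  continuous (fun t => (c t).1) -> continuous (fun t => (c t).2) ->
  (forall t, c t <> 0) -> (forall t, a < t -> t < b -> liso_at c t) ->
  (forall t, a < t -> t < b -> clairaut c t = nu) ->
  0 < rho -> c a = (rho, 0) ->
  exists th : R -> R, [/\ th a = 0, continuous th,
    forall t, is_derive t 1 th (nu / m (enorm (c t)) ^+ 2) &
    forall t, a <= t -> t <= b -> c t = (enorm (c t) * cos (th t), enorm (c t) * sin (th t))].
Proof.
move=> ab c1 c2 nz hl hnu rho0 ca.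
have crad t : {for t, continuous (fun s => enorm (c s))} by exact: (enorm_cont (c1 t) (c2 t)).
have m0 t : m (enorm (c t)) != 0 by rewrite gt_eqF // (m_gt0 Hm) // enorm_neq0.
have cang : continuous (fun t => nu / m (enorm (c t)) ^+ 2).
  move=> t; apply: cvgM; first exact: cvg_cst.
  apply: cvgV; first by rewrite expf_neq0.
  have cm : {for t, continuous (fun x => m (enorm (c x)))}.
    exact: (continuous_comp (crad t) (@cont_m _ _ Hm _)).
  exact: (cvgM cm cm).
have [T hT] := antiderivative cang.
pose th t := T t - T a.
have dth t : is_derive t 1 th (nu / m (enorm (c t)) ^+ 2).
  by have d := hT t; rewrite /th; derc; ring.
exists th; split=> //; first by rewrite /th subrr.
  by move=> t; exact: der_cont (dth t).
have ra : enorm (c a) = rho.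
  by rewrite ca /enorm /edot /= mulr0 addr0 -expr2 sqrtr_sqr gtr0_norm.
pose X t := (c t).1 / enorm (c t); pose Y t := (c t).2 / enorm (c t).
have cX : continuous X.
  move=> t; apply: cvgM; first exact: c1.
  by apply: cvgV; [rewrite gt_eqF // enorm_neq0|exact: crad].
have cY : continuous Y.
  move=> t; apply: cvgM; first exact: c2.
  by apply: cvgV; [rewrite gt_eqF // enorm_neq0|exact: crad].
have dX t : a < t -> t < b -> is_derive t 1 X (- Y t * (nu / m (enorm (c t)) ^+ 2)).
  move=> at_ tb; have lt_ := hl t at_ tb; have [d1 d2 _ _] := liso_C1 Hm lt_.
  have d3 := liso_der_rad Hm lt_ (nz t); have rn : enorm (c t) != 0.
    by rewrite gt_eqF // enorm_neq0.
  have E := sqr_enorm (c t); rewrite /X; derc.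
  rewrite -(hnu t at_ tb) -(clairaut_m Hm (nz t)) /Y /rvel.
  apply/eqP; rewrite -subr_eq0 [X in X == 0](_ : _ =
    (vel c t).1 * (enorm (c t) ^+ 2 - edot (c t) (c t)) / enorm (c t) ^+ 3).
    by rewrite E subrr mulr0 mul0r.
  by rewrite /edot /cross; field.
have dY t : a < t -> t < b -> is_derive t 1 Y (X t * (nu / m (enorm (c t)) ^+ 2)).
  move=> at_ tb; have lt_ := hl t at_ tb; have [d1 d2 _ _] := liso_C1 Hm lt_.
  have d3 := liso_der_rad Hm lt_ (nz t); have rn : enorm (c t) != 0.
    by rewrite gt_eqF // enorm_neq0.
  have E := sqr_enorm (c t); rewrite /Y; derc.
  rewrite -(hnu t at_ tb) -(clairaut_m Hm (nz t)) /X /rvel.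
  apply/eqP; rewrite -subr_eq0 [X in X == 0](_ : _ =
    (vel c t).2 * (enorm (c t) ^+ 2 - edot (c t) (c t)) / enorm (c t) ^+ 3).
    by rewrite E subrr mulr0 mul0r.
  by rewrite /edot /cross; field.
have ccos : continuous (fun t => cos (th t)).
  by move=> t; have d := dth t; apply: der_cont (dercos d).
have csin : continuous (fun t => sin (th t)).
  by move=> t; have d := dth t; apply: der_cont (dersin d).
pose F t := X t * cos (th t) + Y t * sin (th t).
pose G t := Y t * cos (th t) - X t * sin (th t).
have th0 : th a = 0 by rewrite /th subrr.
have Xa : X a = 1 by rewrite /X ra ca divff // gt_eqF.
have Ya : Y a = 0 by rewrite /Y ra ca mul0r.
move=> t at_ tb.
have Ft : F t = 1.
  transitivity (F a); last by rewrite /F th0 cos0 sin0 Xa Ya; ring.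
  have dF (x : R) : a < x -> x < t -> is_derive x 1 F 0.
    move=> ax xt; have d1 := dX x ax (lt_le_trans xt tb); have d2 := dY x ax (lt_le_trans xt tb).
    by have d3 := dth x; rewrite /F; derc; ring.
  have cF (x : R) : a <= x -> x <= t -> {for x, continuous F}.
    move=> _ _; exact: (cvgD (cvgM (cX x) (ccos x)) (cvgM (cY x) (csin x))).
  exact: esym (der0_cst at_ dF cF).
have Gt : G t = 0.
  transitivity (G a); last by rewrite /G th0 cos0 sin0 Xa Ya; ring.
  have dG (x : R) : a < x -> x < t -> is_derive x 1 G 0.
    move=> ax xt; have d1 := dX x ax (lt_le_trans xt tb); have d2 := dY x ax (lt_le_trans xt tb).
    by have d3 := dth x; rewrite /G; derc; ring.
  have cG (x : R) : a <= x -> x <= t -> {for x, continuous G}.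
    move=> _ _; exact: (cvgB (cvgM (cY x) (ccos x)) (cvgM (cX x) (csin x))).
  exact: esym (der0_cst at_ dG cG).
have cs := cos2Dsin2 (th t).
have EX : X t = cos (th t).
  rewrite -[LHS]mulr1 -cs -[RHS]mulr1 -Ft -[RHS]subr0 -(mulr0 (sin (th t))) -Gt /F /G; ring.
have EY : Y t = sin (th t).
  rewrite -[LHS]mulr1 -cs -[RHS]mulr1 -Ft -[RHS]addr0 -(mulr0 (cos (th t))) -Gt /F /G; ring.
have rn : enorm (c t) != 0 by rewrite gt_eqF // enorm_neq0.
rewrite -EX -EY /X /Y [LHS]surjective_pairing; congr pair; by field.
Qed.

End PolarForm.

(** * Von Mangoldt profiles *)

Section VonMangoldtProfile.
Variable R : realType.
Variable m : R -> R.
Hypothesis Hm : admissible_profile m.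
Hypothesis Hv : von_Mangoldt m.
Notation m1 := (derivs m 1).
Notation m2 := (derivs m 2).
Notation m3 := (derivs m 3).
Implicit Types (r s : R).

(** Equal to [- m^2 (m'/m)']; its derivative is [m^2] times that of the curvature. *)
Definition wronsk r := m1 r ^+ 2 - m r * m2 r.
Definition slope_ratio r := m1 r / m r.

Lemma m_neq0 r : 0 < r -> m r != 0.
Proof. by move=> r0; rewrite gt_eqF // (m_gt0 Hm). Qed.

Lemma der_wronsk r : is_derive r 1 wronsk (m1 r * m2 r - m r * m3 r).
Proof.
have d0 := der_m Hm r; have d1 := der_m1 Hm r; have d2 := der_m2 Hm r.
rewrite /wronsk; move: d0 d1 d2.
move: (derivs m 1) (derivs m 2) (derivs m 3) => a b c d0 d1 d2.
by derc; ring.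
Qed.

Lemma der_slope_ratio r : 0 < r -> is_derive r 1 slope_ratio (- wronsk r / m r ^+ 2).
Proof.
move=> r0; have n0 := m_neq0 r0.
have d0 := der_m Hm r; have d1 := der_m1 Hm r.
rewrite /slope_ratio /wronsk; move: d0 d1.
move: (derivs m 1) (derivs m 2) => a b d0 d1.
by derc; field.
Qed.

Lemma der_le0_nonincreasing (f : R -> R) (x a : R) : is_derive x 1 f a ->
  (forall y, x <= y -> f y <= f x) -> a <= 0.
Proof.
move=> /derP h hf; rewrite leNgt; apply/negP => a0.
have [d d0 hd] := h (a / 2) ltac:(lra).
have := hd (x + d / 2); rewrite addrAC subrr add0r gtr0_norm; last lra.
move=> /(_ ltac:(lra)); rewrite ler_norml => /andP[h1 _].
have := hf (x + d / 2) ltac:(lra).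
have : 0 < d * a by rewrite mulr_gt0.
lra.
Qed.

Lemma wronsk_noninc r : 0 < r -> m1 r * m2 r - m r * m3 r <= 0.
Proof.
move=> r0; have n0 := m_neq0 r0; have mp := m_gt0 Hm r0.
have d : is_derive r 1 (fun x => - m2 x / m x) ((m1 r * m2 r - m r * m3 r) / m r ^+ 2).
  have d0 := der_m Hm r; have d2 := der_m2 Hm r; move: d0 d2.
  move: (derivs m 1) (derivs m 2) (derivs m 3) => a b c d0 d2.
  by derc; field.
have := der_le0_nonincreasing d.
rewrite pmulr_lle0 ?invr_gt0 ?exprn_gt0 //; apply=> y ry.
have := Hv (ltW r0) ry; rewrite /Gm -!derivsE !gt_eqF //; exact: lt_le_trans ry.
Qed.

Lemma wronsk_le1 r : 0 <= r -> wronsk r <= 1.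
Proof.
move=> r0; have -> : 1 = wronsk 0 by rewrite /wronsk (m_0 Hm) (m1_0 Hm) expr1n mul0r subr0.
rewrite -[leLHS]opprK -[leRHS]opprK lerN2.
notypeclasses refine (@mono_le _ (fun x => - wronsk x) (fun x => - (m1 x * m2 x - m x * m3 x)) _ _ _ _ _ _); first by [].
- by move=> x _ _; exact: derN (der_wronsk x).
- by move=> x _ _; exact: der_cont (derN (der_wronsk x)).
- by move=> x x0 _; rewrite oppr_ge0; exact: wronsk_noninc.
Qed.

(** The derivative of [wronsk] is [O(r)], hence [1 - wronsk = O(r^2)]. This bounds the derivative
    [(1 - wronsk)/m^2] of [m'/m - W] near 0, so that [W] can be normalised to lie below [m'/m]. *)
Lemma wronsk_near0 : exists2 C : R, 0 <= C & forall r, 0 < r -> r <= 1 ->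
  1 - wronsk r <= C * m r ^+ 2.
Proof.
have [C3 C30 h3] := @cont_bounded _ m3 0 1 (fun x _ _ => @cont_profile _ _ Hm 3 x).
have [C1 C10 h1] := @cont_bounded _ m1 0 1 (fun x _ _ => @cont_profile _ _ Hm 1 x).
have lip (f g : R -> R) (K r : R) : f 0 = 0 -> (forall x : R, is_derive x 1 f (g x)) ->
    (forall x, 0 <= x -> x <= 1 -> `|g x| <= K) -> 0 <= r -> r <= 1 -> `|f r| <= K * r.
  move=> f0 df gK r0 r1.
  have := @der_lip _ f g 0 r K r0 (fun x _ _ => df x) (fun x _ _ => der_cont (df x)).
  rewrite f0 !subr0; apply => x x0 xr; apply: gK; lra.
have Lm r : 0 <= r -> r <= 1 -> `|m r| <= C1 * r.
  by move=> r0 r1; exact: (lip m m1 C1 r (m_0 Hm) (der_m Hm) h1 r0 r1).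
have Lm2 r : 0 <= r -> r <= 1 -> `|m2 r| <= C3 * r.
  by move=> r0 r1; exact: (lip m2 m3 C3 r (m2_0 Hm) (der_m2 Hm) h3 r0 r1).
have [k k0 hk] := stretch_lb Hm ler01.
exists (2 * C1 * C3 / k ^+ 2); first by rewrite divr_ge0 ?sqr_ge0 // !mulr_ge0.
move=> r r0 r1.
have B : 1 - wronsk r <= 2 * C1 * C3 * r * r.
  have := @der_lip _ wronsk (fun x => m1 x * m2 x - m x * m3 x) 0 r (2 * C1 * C3 * r) (ltW r0)
    (fun x _ _ => der_wronsk x) (fun x _ _ => der_cont (der_wronsk x)).
  have -> : wronsk 0 = 1 by rewrite /wronsk (m_0 Hm) (m1_0 Hm) expr1n mul0r subr0.
  rewrite subr0 distrC => h; apply: le_trans (ler_norm _) _; apply: h => x x0 xr.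
  have xr1 := ltW (lt_le_trans xr r1).
  apply: le_trans (ler_normB _ _) _; rewrite !normrM.
  have a1 : `|m1 x| * `|m2 x| <= C1 * (C3 * x).
    by apply: ler_pM => //; [exact: h1 (ltW x0) xr1|exact: Lm2 (ltW x0) xr1].
  have a2 : `|m x| * `|m3 x| <= C1 * x * C3.
    by apply: ler_pM => //; [exact: Lm (ltW x0) xr1|exact: h3 (ltW x0) xr1].
  have := ler_wpM2l (mulr_ge0 C10 C30) (ltW xr); clear -a1 a2; lra.
apply: (le_trans B).
have mk : k * r <= m r by rewrite -(stretch_m Hm) mulrC ler_pM2l // hk // ltW.
have m2k : k ^+ 2 * r ^+ 2 <= m r ^+ 2.
  by rewrite -exprMn ler_sqr ?nnegrE // ?mulr_ge0 ?(ltW k0) ?(ltW r0) // ltW // (m_gt0 Hm).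
rewrite [leRHS]mulrAC ler_pdivlMr ?exprn_gt0 //.
have := ler_wpM2l (mulr_ge0 (mulr_ge0 (ler0n R 2) C10) C30) m2k; lra.
Qed.

(* In the angular coordinate theta a geodesic r(theta) satisfies
   W(r)'' = - m'/m, where W is an antiderivative of - 1/m^2. *)
Lemma radial_potential : exists W : R -> R,
  (forall r, 0 < r -> is_derive r 1 W (- (m r ^+ 2)^-1)) /\
  (forall r, 0 < r -> W r <= slope_ratio r).
Proof.
(* The substitution [r = exp x] reduces a primitive on the half-line to one on R. *)
pose g (x : R) := - (expR x / m (expR x) ^+ 2).
have cg : continuous g.
  move=> x; have ce := @continuous_expR R x.
  have cm : {for x, continuous (fun y => m (expR y))}.
    exact: (continuous_comp ce (@cont_m _ _ Hm _)).
  apply: cvgN; apply: cvgM; first exact: ce.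
  by apply: cvgV; [rewrite expf_neq0 // m_neq0 // expR_gt0|exact: (cvgM cm cm)].
have [H hH] := antiderivative cg.
pose W0 r := H (ln r).
have dW0 r : 0 < r -> is_derive r 1 W0 (- (m r ^+ 2)^-1).
  move=> r0; have d := dercomp (hH (ln r)) (is_derive1_ln r0).
  apply: der_eq d _; rewrite /g lnK ?posrE //.
  have n0 := m_neq0 r0; have rn : r != 0 by rewrite gt_eqF.
  by field; rewrite ?n0 ?rn.
pose B r := W0 r - slope_ratio r.
have dB r : 0 < r -> is_derive r 1 B (- ((1 - wronsk r) / m r ^+ 2)).
  move=> r0; have d1 := dW0 r r0; have d2 := der_slope_ratio r0.
  by rewrite /B; derc; field; exact: m_neq0.
have [C C0 hC] := wronsk_near0.
(* [B] is non-increasing with slope at least [- C] on [(0, 1]], so [B 1 + C] bounds it from above,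
   which gives [W <= m'/m]. *)
exists (fun r => W0 r - (B 1 + C)); split.
  by move=> r r0; have d := dW0 r r0; derc; ring.
move=> r r0; suff : B r <= B 1 + C by rewrite /B; lra.
have [r1|/ltW r1] := leP r 1.
  have := @der_lip _ B (fun x => - ((1 - wronsk x) / m x ^+ 2)) r 1 C r1.
  have cB x : 0 < x -> {for x, continuous B} by move=> x0; exact: der_cont (dB x x0).
  move=> /(_ (fun x h _ => dB x (lt_trans r0 h)) (fun x h _ => cB x (lt_le_trans r0 h))) h.
  have : `|B 1 - B r| <= C * (1 - r).
    apply: h => x rx x1; have x0 := lt_trans r0 rx.
    have m20 : 0 < m x ^+ 2 by rewrite exprn_gt0 // (m_gt0 Hm).
    rewrite normrN ger0_norm; last first.
      by rewrite divr_ge0 ?(ltW m20) // subr_ge0 wronsk_le1 // ltW.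
    by rewrite ler_pdivrMr //; apply: hC => //; exact: ltW.
  rewrite ler_norml => /andP[h1 _].
  by have : 0 <= C * r; [rewrite mulr_ge0 // ltW|clear -h1; lra].
suff : B r <= B 1 by clear -C0; lra.
rewrite -[leLHS]opprK -[leRHS]opprK lerN2.
have pos (x : R) : 1 <= x -> 0 < x by move=> h; exact: lt_le_trans h.
notypeclasses refine (@mono_le _ (fun x => - B x) (fun x => (1 - wronsk x) / m x ^+ 2) _ _ _ _ _ _); first by [].
- move=> x x1 _; have d := dB x (pos x (ltW x1)); by derc; ring.
- move=> x x1 _; exact: der_cont (derN (dB x (pos x x1))).
- move=> x x1 _; rewrite divr_ge0 ?sqr_ge0 // subr_ge0 wronsk_le1 //; exact/ltW/pos/ltW.
Qed.

Section Potential.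
Variable W : R -> R.
Hypothesis dW : forall r, 0 < r -> is_derive r 1 W (- (m r ^+ 2)^-1).

Lemma potential_decr r s : 0 < r -> r < s -> W s < W r.
Proof.
move=> r0 rs; rewrite -[ltRHS]opprK -[ltLHS]opprK ltrN2.
notypeclasses refine (@mono_lt _ (fun x => - W x) (fun x => (m x ^+ 2)^-1) _ _ _ _ _ _); first by [].
- move=> x rx _; have d := dW (lt_trans r0 rx); by derc; ring.
- move=> x rx _; exact: der_cont (derN (dW (lt_le_trans r0 rx))).
- by move=> x rx _; rewrite invr_gt0 exprn_gt0 // (m_gt0 Hm) // (lt_trans r0).
Qed.

(** For the difference [y] of [W(r)] along two geodesics, or along a geodesic and the critical
    parallel, this gives [y'' + y >= 0] in the angle wherever [y > 0]. *)
Lemma potential_slope_ratio r s : 0 < r -> r <= s -> slope_ratio r - slope_ratio s <= W r - W s.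
Proof.
move=> r0 rs; suff : slope_ratio s - W s >= slope_ratio r - W r by lra.
have pos x : r <= x -> 0 < x by exact: lt_le_trans.
have d x : r <= x -> is_derive x 1 (fun y => slope_ratio y - W y) ((1 - wronsk x) / m x ^+ 2).
  move=> rx; have x0 := pos x rx; have d1 := dW x0; have d2 := der_slope_ratio x0.
  by derc; field; exact: m_neq0.
apply: (@mono_le _ (fun x => slope_ratio x - W x) (fun x => (1 - wronsk x) / m x ^+ 2)) => //.
- by move=> x rx _; apply: d; exact: ltW.
- by move=> x rx _; exact: der_cont (d x rx).
- move=> x rx _; rewrite divr_ge0 ?sqr_ge0 // subr_ge0 wronsk_le1 //; exact/ltW/pos/ltW.
Qed.

Lemma potential_infty (w : R) : exists2 rho : R, 0 < rho & forall r, 0 < r -> r <= rho -> w < W r.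
Proof.
have [k k0 hk] := stretch_ub Hm ler01.
have k20 : 0 < k ^+ 2 by rewrite exprn_gt0.
(* On [(0, 1]] one has [m r <= k r], so [W] grows towards 0 at least like [1/(k^2 r)]. *)
have lb r : 0 < r -> r <= 1 -> W 1 - (k ^+ 2)^-1 + (k ^+ 2 * r)^-1 <= W r.
  move=> r0 r1; have pos x : r <= x -> 0 < x by exact: lt_le_trans.
  have kn : k != 0 by rewrite gt_eqF.
  have d x : r <= x -> is_derive x 1 (fun y => (k ^+ 2 * y)^-1 - W y) (- (k ^+ 2 * x ^+ 2)^-1 + (m x ^+ 2)^-1).
    move=> rx; have x0 := pos x rx; have d1 := dW x0; have xn : x != 0 by rewrite gt_eqF.
    have kx : k ^+ 2 * x != 0 by rewrite mulf_neq0 // expf_neq0.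
    by have n0 := m_neq0 x0; derc; field; rewrite xn n0 kn.
  suff : (k ^+ 2 * r)^-1 - W r <= (k ^+ 2 * 1)^-1 - W 1 by rewrite mulr1; lra.
  apply: (@mono_le _ (fun y => (k ^+ 2 * y)^-1 - W y) (fun x => - (k ^+ 2 * x ^+ 2)^-1 + (m x ^+ 2)^-1)) => //.
  - by move=> x rx _; apply: d; exact: ltW.
  - by move=> x rx _; exact: der_cont (d x rx).
  - move=> x rx x1; have x0 := pos x (ltW rx); rewrite addrC subr_ge0.
    have mx := m_gt0 Hm x0.
    rewrite lef_pV2 ?posrE ?mulr_gt0 ?exprn_gt0 //.
    rewrite -exprMn ler_sqr ?nnegrE ?(ltW mx) //; last by rewrite mulr_ge0 // ltW.
    by rewrite -(stretch_m Hm) mulrC ler_pM2r // hk // ltW.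
pose V := `|w - W 1 + (k ^+ 2)^-1| + 1; have V0 : 0 < V by rewrite ltr_wpDl.
pose rho := Num.min 1 (k ^+ 2 * V)^-1.
have kV : 0 < k ^+ 2 * V by rewrite mulr_gt0.
exists rho; first by rewrite lt_min ltr01 invr_gt0.
move=> r r0; rewrite le_min => /andP[r1 rV].
apply: lt_le_trans (lb r r0 r1).
have : V <= (k ^+ 2 * r)^-1.
  rewrite -[leLHS]invrK lef_pV2 ?posrE ?mulr_gt0 ?invr_gt0 //.
  have := ler_wpM2l (ltW k20) rV; rewrite (_ : k ^+ 2 * (k ^+ 2 * V)^-1 = V^-1) //.
  by field; rewrite !gt_eqF.
have := ler_norm (w - W 1 + (k ^+ 2)^-1); rewrite /V; clear; lra.
Qed.
End Potential.

Section NegativeCurvature.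
Hypothesis Hneg : exists r : R, 0 <= r /\ Gm m r < 0.
Hypothesis Hinf : exists2 c : R, 0 < c & \forall r \near +oo, c <= m r.

Lemma m2_eventually : exists d a : R, [/\ 0 < d, 0 < a & forall r, a <= r -> d <= m2 r].
Proof.
have [r0 [r00 hr0]] := Hneg; have [c c0 [M [_ hM]]] := Hinf.
pose k := - Gm m r0; have k0 : 0 < k by rewrite oppr_gt0.
pose a := Num.max 1 (Num.max r0 (M + 1)); exists (k * c), a; split.
- exact: mulr_gt0.
- by rewrite lt_max ltr01.
move=> r; rewrite !ge_max => /andP[r1 /andP[rr0 rM]].
have rp : 0 < r by lra.
have := Hv r00 rr0; rewrite {1}/Gm gt_eqF // -derivsE => h.
have mr : c <= m r by apply: hM; lra.
have mp := lt_le_trans c0 mr.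
have h2 : k * m r <= m2 r.
  rewrite -ler_pdivlMr //; rewrite mulNr in h; rewrite /k; lra.
by apply: le_trans h2; rewrite ler_pM2l.
Qed.

Lemma m1_eventually (K : R) : exists2 a : R, 0 < a & forall r, a <= r -> K <= m1 r.
Proof.
have [d [a [d0 a0 h]]] := m2_eventually.
exists (a + `|K - m1 a| / d); first by rewrite ltr_wpDr // divr_ge0 // ltW.
move=> r hr; have q0 : 0 <= `|K - m1 a| / d by rewrite divr_ge0 // ltW.
have ar : a <= r by lra.
have : d * a - m1 a >= d * r - m1 r.
  rewrite -[leRHS]opprK -[leLHS]opprK lerN2.
  notypeclasses refine (@mono_le _ (fun x => - (d * x - m1 x)) (fun x => m2 x - d) _ _ _ _ _ _); first by [].
  - by move=> x _ _; move: (der_m1 Hm x); move: (derivs m 1) (derivs m 2) => f g e; derc; ring.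
  - by move=> x _ _; apply: (@der_cont _ _ _ (m2 x - d)); move: (der_m1 Hm x); move: (derivs m 1) (derivs m 2) => f g e; derc; ring.
  - by move=> x ax _; rewrite subr_ge0 h // ltW.
have : `|K - m1 a| <= d * (r - a) by rewrite mulrC -ler_pdivrMr //; lra.
have := ler_norm (K - m1 a); lra.
Qed.

Lemma m_linear (K : R) : 0 <= K -> exists2 a : R, 0 < a &
  forall r s, a <= r -> r <= s -> m r + K * (s - r) <= m s.
Proof.
move=> K0; have [a a0 h] := m1_eventually K; exists a => // r s ar rs.
suff : m r - K * r <= m s - K * s by lra.
apply: (@mono_le _ (fun x => m x - K * x) (fun x => m1 x - K)) => //.
- by move=> x _ _; have e := der_m Hm x; derc; ring.
- by move=> x _ _; apply: (@der_cont _ _ _ (m1 x - K)); have e := der_m Hm x; derc; ring.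
- by move=> x rx _; rewrite subr_ge0 h // (le_trans ar) // ltW.
Qed.

Lemma m_unbounded (K : R) : exists2 a : R, 0 < a & forall r, a <= r -> K < m r.
Proof.
have [a a0 h] := m_linear ler01; exists (a + `|K|); first by rewrite ltr_wpDr.
move=> r hr; have n0 := normr_ge0 K; have := h a r (lexx _) ltac:(lra).
have := m_gt0 Hm a0; have := ler_norm K; lra.
Qed.

Lemma potential_bounded (W : R -> R) : (forall r, 0 < r -> is_derive r 1 W (- (m r ^+ 2)^-1)) ->
  exists w : R, forall r, 0 < r -> w <= W r.
Proof.
move=> dW; have [a a0 h] := m1_eventually 1.
(* Where [m' >= 1], the derivative of [1/m] is at most [- 1/m^2], so [W - 1/m] is non-decreasing. *)
exists (W a - (m a)^-1) => r r0; have ma := m_gt0 Hm a0.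
have [ra|ar] := ltP r a.
  have := potential_decr dW r0 ra; have : 0 < (m a)^-1 by rewrite invr_gt0.
  clear; lra.
have pos x : a <= x -> 0 < x by exact: lt_le_trans.
have d x : a <= x -> is_derive x 1 (fun y => W y - (m y)^-1) ((m1 x - 1) / m x ^+ 2).
  move=> ax; have x0 := pos x ax; have n0 := m_neq0 x0; have d1 := dW x x0; have d2 := der_m Hm x.
  by derc; field.
have : W a - (m a)^-1 <= W r - (m r)^-1.
  apply: (@mono_le _ (fun y => W y - (m y)^-1) (fun x => (m1 x - 1) / m x ^+ 2)) => //.
  - by move=> x ax _; apply: d; exact: ltW.
  - by move=> x ax _; exact: der_cont (d x ax).
  - by move=> x ax _; rewrite divr_ge0 ?sqr_ge0 // subr_ge0 h // ltW.
have : 0 < (m r)^-1 by rewrite invr_gt0 (m_gt0 Hm).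
clear; lra.
Qed.
End NegativeCurvature.

End VonMangoldtProfile.

(** * Minimal segments and poles *)

Section Compactness.
Variable R : realType.
Variable m : R -> R.
Hypothesis Hm : admissible_profile m.
Implicit Types (p q : R * R) (c : R -> R * R) (s t : R).
Notation D := (D m).

Lemma D_eq0 p q : D p q = 0 -> p = q.
Proof.
move=> d0; have K0 : 0 <= Num.max (enorm p) (enorm q) by rewrite le_max enorm_ge0.
have [k k0 hk] := D_bilip Hm K0.
have [||_] := hk p q; rewrite ?le_max ?lexx ?orbT // d0 mulr0 => h.
apply/esym/eqP; rewrite -subr_eq0 -enorm_eq0 eq_le h.
exact: enorm_ge0.
Qed.

(** If the length of a path exceeds the distance of its ends by little, all triangle inequalities
    along it are nearly sharp; the distance from the start is then an almost isometric
    coordinate. *)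
Lemma path_almost_geodesic c v S (a b : R) : C1data c v -> arclen m c v S ->
  forall x y, a <= x -> x <= b -> a <= y -> y <= b ->
  `|D (c x) (c y) - `|D (c a) (c x) - D (c a) (c y)| | <= S b - S a - D (c a) (c b).
Proof.
move=> hv hS.
suff main x y : a <= x -> x <= y -> y <= b ->
    `|D (c x) (c y) - `|D (c a) (c x) - D (c a) (c y)| | <= S b - S a - D (c a) (c b).
  move=> x y ax xb ay yb; have [xy|/ltW yx] := leP x y; first exact: main.
  by rewrite D_sym // (distrC (D (c a) (c x))); exact: main.
move=> ax xy yb.
have h1 := D_arclen Hm hv hS ax; have h2 := D_arclen Hm hv hS xy; have h3 := D_arclen Hm hv hS yb.
have t1 := D_tri Hm (c x) (c a) (c b); have t2 := D_tri Hm (c y) (c x) (c b).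
have t3 := D_tri Hm (c x) (c a) (c y); have t4 := D_tri Hm (c y) (c a) (c x).
have t5 := D_tri Hm (c y) (c a) (c b).
rewrite (D_sym Hm (c y) (c x)) in t4.
have [h|h] := ger0P (D (c a) (c x) - D (c a) (c y)); rewrite ler_norml; apply/andP; split; lra.
Qed.

Lemma path_at_distance c v S (a b s : R) : C1data c v -> arclen m c v S -> a <= b ->
  0 <= s -> s <= D (c a) (c b) -> exists x, [/\ a <= x, x <= b & D (c a) (c x) = s].
Proof.
move=> hv hS ab s0 sd; have D0 : D (c a) (c a) <= s by rewrite D_refl.
apply: (@ivt _ (fun x => D (c a) (c x)) a b s ab _ D0 sd) => x _ _; apply/contP => e e0.
have /contP := der_cont (hS x); move=> /(_ e e0) [d d0 hd]; exists d => // y yx.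
apply: le_lt_trans (hd y yx).
have t1 := D_tri Hm (c x) (c a) (c y); have t2 := D_tri Hm (c y) (c a) (c x).
rewrite (D_sym Hm (c y) (c x)) in t2.
have h : D (c x) (c y) <= `|S y - S x|.
  have [xy|/ltW xy] := leP x y.
    exact: le_trans (D_arclen Hm hv hS xy) (ler_norm _).
  by rewrite D_sym // distrC; exact: le_trans (D_arclen Hm hv hS xy) (ler_norm _).
by rewrite ler_norml; apply/andP; split; lra.
Qed.

(** Pointwise convergence suffices, since an isometry is tested on two times at once; so the
    approximating maps may be discontinuous. [J] holds the times at which they are asymptotically
    isometric, and [K] makes the product of the target squares compact. *)
Lemma isometry_limit (J : R -> Prop) (c_ : nat -> R -> R * R) (K : R -> R) :
  (forall s, 0 <= K s) -> (forall n s, enorm (c_ n s) <= K s) ->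
  (forall s t, J s -> J t -> forall e, 0 < e -> exists N, forall n, (N <= n)%N ->
     `|D (c_ n s) (c_ n t) - `|s - t| | <= e) ->
  exists c, (forall s t, J s -> J t -> D (c s) (c t) = `|s - t|) /\
    forall s p, (forall e, 0 < e -> exists N, forall n, (N <= n)%N -> D (c_ n s) p <= e) -> c s = p.
Proof.
move=> K0 hK hiso.
pose A (s : R) : set (R * R) := `[- K s, K s] `*` `[- K s, K s].
have cA s : compact (A s) by apply: compact_setX; exact: segment_compact.
have inA n s : A s (c_ n s).
  have := norm1_le_enorm (c_ n s); have := norm2_le_enorm (c_ n s); have := hK n s.
  by move=> h h2 h1; split; rewrite /= in_itv /= -ler_norml; exact: le_trans h.
have := tychonoff cA; set P := [set f : R -> R * R | forall i, A i (f i)] => cP.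
(* [f] is a cluster point of the tails of the sequence. *)
have [f [fP hf]] := cP (fun B : set (prod_topology (fun _ : R => (R * R)%type)) => \forall n \near \oo, B (c_ n))
   _ (nearW _ (fun n i => inA n i)).
have near2 s t (e : R) (Q : R * R -> R * R -> Prop) : 0 < e ->
    (exists N, forall n, (N <= n)%N -> Q (c_ n s) (c_ n t)) ->
    exists g1 g2, [/\ Q g1 g2, enorm (g1 - f s) <= e, enorm (g2 - f t) <= e,
       enorm g1 <= K s & enorm g2 <= K t].
  move=> e0 [N hN].
  have n1 : nbhs f (fun g : prod_topology (fun _ : R => (R * R)%type) => ball (f s) (e / 2) (g s)).
    exact: (@proj_continuous R (fun=> (R * R)%type) s f _ (nbhsx_ballx (f s) (e / 2) ltac:(lra))).
  have n2 : nbhs f (fun g : prod_topology (fun _ : R => (R * R)%type) => ball (f t) (e / 2) (g t)).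
    exact: (@proj_continuous R (fun=> (R * R)%type) t f _ (nbhsx_ballx (f t) (e / 2) ltac:(lra))).
  have [] := hf (fun g => [/\ Q (g s) (g t), enorm (g s) <= K s & enorm (g t) <= K t]) _ _ (filterI n1 n2).
    by exists N => // n /= Nn; split=> //; exact: hN.
  move=> g [[Qg gs gt] [b1 b2]]; exists (g s), (g t); split=> //.
    apply: le_trans (enorm_le_sum _) _; case: b1 => /= h1 h2.
    by rewrite /ball /= in h1 h2; rewrite distrC (distrC (g s).2); lra.
  apply: le_trans (enorm_le_sum _) _; case: b2 => /= h1 h2.
  by rewrite /ball /= in h1 h2; rewrite distrC (distrC (g t).2); lra.
have fK s : enorm (f s) <= K s + 1.
  have [g1 [_ [_ h _ hg _]]] := near2 s s 1 (fun _ _ => True) ltr01 (ex_intro _ 0%N (fun _ _ => I)).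
  by have := enormD (f s - g1) g1; rewrite subrK enormB; lra.
have close s (e : R) : 0 < e -> exists2 d, 0 < d & forall g, enorm g <= K s ->
    enorm (g - f s) <= d -> D (f s) g <= e.
  move=> e0; have K1 : 0 <= K s + 1 by rewrite addr_ge0.
  have [k k0 hk] := D_bilip Hm K1; exists (e / k); first by rewrite divr_gt0.
  move=> g gK; rewrite ler_pdivlMr // mulrC => h; apply: le_trans h.
  by have [] := hk (f s) g (fK s) (ler_wpDr ler01 gK).
exists f; split.
  move=> s t Js Jt; apply/eqP; rewrite -subr_eq0 -normr_eq0 eq_le normr_ge0 andbT.
  apply/ler_addgt0Pr => e e0; rewrite add0r; have e3 : 0 < e / 3 by lra.
  have [d1 d10 h1] := close s _ e3; have [d2 d20 h2] := close t _ e3.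
  have [N hN] := hiso s t Js Jt _ e3.
  have m0 : 0 < Num.min d1 d2 by rewrite lt_min d10.
  have [g1 [g2 [Q a1 a2 b1 b2]]] := near2 s t _ (fun x y => `|D x y - `|s - t| | <= e / 3) m0
    (ex_intro _ N hN).
  have [l1 l2] : Num.min d1 d2 <= d1 /\ Num.min d1 d2 <= d2 by rewrite !ge_min !lexx orbT.
  have k1 := h1 g1 b1 (le_trans a1 l1); have k2 := h2 g2 b2 (le_trans a2 l2).
  have t1 := D_tri Hm g1 (f s) (f t); have t2 := D_tri Hm g2 g1 (f t).
  have t3 := D_tri Hm (f s) g1 g2; have t4 := D_tri Hm (f t) (f s) g2.
  rewrite (D_sym Hm g2 (f t)) in t2; rewrite (D_sym Hm g1 (f s)) in t3.
  clear -Q t1 t2 t3 t4 k1 k2 e0; move: Q; rewrite !ler_norml => /andP[? ?]; apply/andP; split; lra.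
move=> s p hp; apply: D_eq0; apply/eqP; rewrite eq_le D_ge0 // andbT.
apply/ler_addgt0Pr => e e0; rewrite add0r; have e2 : 0 < e / 2 by lra.
have [d1 d10 h1] := close s _ e2; have [N hN] := hp _ e2.
have [g1 [g2 [Q a1 _ b1 _]]] := near2 s s _ (fun x _ => D x p <= e / 2) d10 (ex_intro _ N hN).
have k1 := h1 g1 b1 a1; have t1 := D_tri Hm g1 (f s) p; lra.
Qed.

Definition iso_on c (a b : R) := forall s t, a <= s -> s <= b -> a <= t -> t <= b ->
  D (c s) (c t) = `|s - t|.

Lemma inv_succ_le (e : R) : 0 < e -> exists N, forall n, (N <= n)%N -> n.+1%:R^-1 <= e.
Proof.
move=> ep; exists (Num.truncn e^-1) => n Nn.
rewrite -[leRHS]invrK lef_pV2 ?posrE ?invr_gt0 // ltW //.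
have ei : 0 <= e^-1 by rewrite invr_ge0 ltW.
have /andP[_ h] := truncn_itv ei; apply: lt_le_trans h _.
by rewrite ler_nat.
Qed.

Lemma minimal_segment p q : exists c, [/\ c 0 = p, c (D p q) = q & iso_on c 0 (D p q)].
Proof.
pose d := D p q; have d0 : 0 <= d by exact: D_ge0.
have step n : exists x : R -> R * R, [/\
    forall s t, 0 <= s -> s <= d -> 0 <= t -> t <= d -> `|D (x s) (x t) - `|s - t| | <= n.+1%:R^-1,
    forall s, enorm (x s) <= enorm p + d,
    D (x 0) p <= n.+1%:R^-1 & D (x d) q <= n.+1%:R^-1].
  have e0 : 0 < n.+1%:R^-1 :> R by rewrite invr_gt0.
  have [l [c [v [S [a [b [hv hS ab [ca cb El]]]]]]] hl] := D_adherent Hm p q e0.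
  (* The chosen time is one at distance [s] from [p]; outside [[0, d]] the default is the starting
     time, which keeps the map bounded. *)
  have ex s : exists t, a <= t /\ t <= b /\ (0 <= s -> s <= d -> D p (c t) = s) /\ D p (c t) <= d.
    have [/andP[s0 sd]|h] := boolP ((0 <= s) && (s <= d)).
      have := @path_at_distance c v S a b s hv hS ab s0; rewrite ca cb => /(_ sd) [t [h1 h2 h3]].
      by exists t; rewrite h3.
    exists a; rewrite lexx ca D_refl //; split=> //; split=> //; split=> // s0 sd.
    by move: h; rewrite s0 sd.
  have [tau htau] := choice ex; exists (fun s => c (tau s)).
  have main s t := path_almost_geodesic hv hS (let: conj h _ := htau s in h)
    (let: conj _ (conj h _) := htau s in h) (let: conj h _ := htau t in h)
    (let: conj _ (conj h _) := htau t in h).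
  rewrite ca cb -/d in main.
  have ld : S b - S a - d <= n.+1%:R^-1 by rewrite El lerBlDl; exact: ltW.
  split.
  - move=> s t s0 sd t0 td; have [_ [_ [hs _]]] := htau s; have [_ [_ [ht _]]] := htau t.
    by have := main s t; rewrite hs // ht // => h; exact: le_trans ld.
  - move=> s; have [_ [_ [_ h]]] := htau s; have := D_ge_radius Hm p (c (tau s)).
    by rewrite distrC => h2; have := ler_norm (enorm (c (tau s)) - enorm p); lra.
  - have [_ [_ [h _]]] := htau 0; have := h (lexx _) d0 => h0.
    by rewrite D_sym // h0 ltW.
  - have [at_ [tb [h _]]] := htau d; have hd := h d0 (lexx _).
    have := path_almost_geodesic hv hS at_ tb ab (lexx b); rewrite ca cb hd -/d subrr normr0 subr0.
    by move=> h2; apply: le_trans (ler_norm _) (le_trans h2 ld).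
have [x hx] := choice step.
have [|||c [hc hp]] := @isometry_limit (fun s => 0 <= s <= d) x (fun=> enorm p + d).
- by move=> s; rewrite addr_ge0 // enorm_ge0.
- by move=> n s; have [_ h _ _] := hx n; exact: h.
- move=> s t /andP[s0 sd] /andP[t0 td] e ep; have [N hN] := inv_succ_le ep.
  exists N => n Nn; have [h _ _ _] := hx n; apply: le_trans (h s t s0 sd t0 td) (hN n Nn).
exists c; split.
- apply: hp => e ep; have [N hN] := inv_succ_le ep; exists N => n Nn.
  by have [_ _ h _] := hx n; exact: le_trans h (hN n Nn).
- apply: hp => e ep; have [N hN] := inv_succ_le ep; exists N => n Nn.
  by have [_ _ _ h] := hx n; exact: le_trans h (hN n Nn).
- by move=> s t s0 sd t0 td; apply: hc; apply/andP.
Qed.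

Lemma iso_on_liso c (a b t : R) : iso_on c a b -> a < t -> t < b -> liso_at m c t.
Proof.
move=> h at_ tb; exists (Num.min (t - a) (b - t)); first by rewrite lt_min !subr_gt0 at_.
move=> s u; rewrite !lt_min !ltr_norml => /andP[/andP[? ?] /andP[? ?]] /andP[/andP[? ?] /andP[? ?]].
by apply: h; lra.
Qed.

(** Clamping the time turns a segment into a curve continuous on all of R, as the polar form
    requires. *)
Lemma iso_on_cont c (a b : R) : a <= b -> iso_on c a b ->
  let c' := fun t => c (Num.max a (Num.min t b)) in
  continuous (fun t => (c' t).1) /\ continuous (fun t => (c' t).2).
Proof.
move=> ab h; pose K := enorm (c a) + (b - a).
have K0 : 0 <= K by rewrite addr_ge0 ?enorm_ge0 // subr_ge0.
have [k k0 hk] := D_bilip Hm K0.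
have cK s : a <= s -> s <= b -> enorm (c s) <= K.
  move=> as_ sb; have := D_ge_radius Hm (c s) (c a); rewrite h ?lexx // (ger0_norm (_ : 0 <= s - a)) ?subr_ge0 //.
  by move=> h1; have := ler_norm (enorm (c s) - enorm (c a)); rewrite /K; lra.
have key t : a <= t -> t <= b -> forall e, 0 < e -> exists2 d, 0 < d &
    forall s, a <= s -> s <= b -> `|s - t| < d -> enorm (c s - c t) < e.
  move=> at_ tb e e0; exists (e / k); first by rewrite divr_gt0.
  move=> s as_ sb; rewrite ltr_pdivlMr // mulrC => hst; apply: le_lt_trans hst.
  by have [_] := hk (c t) (c s) (cK t at_ tb) (cK s as_ sb); rewrite h // distrC.
split.
  apply: (@clamp_cont _ (fun t => (c t).1)) => // t at_ tb e e0.
  have [d d0 hd] := key t at_ tb e e0; exists d => // s as_ sb st.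
  exact: le_lt_trans (norm1_le_enorm (c s - c t)) (hd s as_ sb st).
apply: (@clamp_cont _ (fun t => (c t).2)) => // t at_ tb e e0.
have [d d0 hd] := key t at_ tb e e0; exists d => // s as_ sb st.
exact: le_lt_trans (norm2_le_enorm (c s - c t)) (hd s as_ sb st).
Qed.

Lemma iso_on_clamp c (a b : R) : a <= b -> iso_on c a b ->
  iso_on (fun t => c (Num.max a (Num.min t b))) a b.
Proof. by move=> ab h s t *; rewrite !clamp_id //; exact: h. Qed.

End Compactness.

(** * Sturm comparison *)

Section Sturm.
Variable R : realType.
Implicit Types (x y s t : R).

(** Serves for a non-increasing quantity known only inside the interval, with continuous lower bound
    [A] and upper bound [B]. *)
Lemma le_at_ends (A B : R -> R) (a b : R) : a < b ->
  {for b, continuous A} -> {for a, continuous B} ->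
  (forall s t, a < s -> s < t -> t < b -> A t <= B s) -> A b <= B a.
Proof.
move=> ab /contP cA /contP cB h; apply/ler_addgt0Pr => e e0; have e2 : 0 < e / 2 by lra.
have [d1 d10 h1] := cA _ e2; have [d2 d20 h2] := cB _ e2.
pose k := Num.min (Num.min d1 d2) (b - a) / 3.
have k0 : 0 < k by rewrite divr_gt0 // !lt_min d10 d20 subr_gt0.
have [k1 [k2 k3]] : 3 * k <= d1 /\ 3 * k <= d2 /\ 3 * k <= b - a.
  rewrite /k (_ : 3 * (_ / 3) = Num.min (Num.min d1 d2) (b - a)); last by field.
  by rewrite !ge_min !lexx ?orbT.
have := h (a + k) (b - k) ltac:(clear -k0; lra) ltac:(clear -k0 k3; lra) ltac:(clear -k0; lra).
have := h1 (b - k); rewrite addrAC subrr add0r normrN gtr0_norm // => /(_ ltac:(lra)).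
have := h2 (a + k); rewrite addrAC subrr add0r gtr0_norm // => /(_ ltac:(lra)).
rewrite !ltr_norml => /andP[? ?] /andP[? ?] ?; lra.
Qed.

(* Sturm comparison with sine: a function with f'' + f >= 0 where it is positive
   cannot vanish at both ends of an interval shorter than pi. *)
Lemma sturm (D E F : R -> R) (l : R) : 0 < l -> l < pi -> D 0 = 0 -> D l = 0 ->
  (forall y, 0 <= y -> y <= l -> {for y, continuous D}) ->
  (forall y, 0 < y -> y < l -> is_derive y 1 D (E y)) ->
  (forall y, 0 < y -> y < l -> is_derive y 1 E (- F y)) ->
  (forall y, 0 < y -> y < l -> 0 < D y -> F y <= D y) ->
  forall y, 0 <= y -> y <= l -> D y <= 0.
Proof.
move=> l0 lpi D0 Dl cD dD dE hF y1 y10 y1l; rewrite leNgt; apply/negP => Dy1.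
(* A sine of frequency [k > 1], still with [k l < pi], shifted by [d] so as to be positive on all of
   [[0, l]]; the excess over frequency 1 makes the comparison strict. *)
pose k := (1 + pi / l) / 2; have pl : 1 < pi / l by rewrite ltr_pdivlMr // mul1r.
have k1 : 1 < k by rewrite /k; lra.
have kl : k * l < pi.
  by rewrite /k (_ : (1 + pi / l) / 2 * l = (l + pi) / 2); [lra|field; rewrite gt_eqF].
pose d := (pi - k * l) / 2; have d0 : 0 < d by rewrite /d; lra.
pose phi y := sin (k * y + d); pose psi y := k * cos (k * y + d).
have dphi y : is_derive y 1 phi (psi y) by rewrite /phi /psi; derc; ring.
have dpsi y : is_derive y 1 psi (- (k ^+ 2) * phi y) by rewrite /phi /psi; derc; ring.
have phi0 y : 0 <= y -> y <= l -> 0 < phi y.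
  move=> y0 yl; apply: sin_gt0_pi.
  have kp : 0 <= k by lra.
  have := ler_wpM2l kp yl; have := mulr_ge0 kp y0; rewrite /d => ? ?; lra.
pose q y := D y / phi y.
have cq y : 0 <= y -> y <= l -> {for y, continuous q}.
  move=> y0 yl; apply: cvgM; first exact: cD.
  by apply: cvgV; [rewrite gt_eqF // phi0|exact: der_cont (dphi y)].
have [y0 [y00 y0l hmax]] := evt_max (ltW l0) cq.
have q0 : 0 < q y0 by apply: lt_le_trans (hmax y1 y10 y1l); rewrite divr_gt0 // phi0.
have Dy0 : 0 < D y0 by move: q0; rewrite /q pmulr_lgt0 // invr_gt0 phi0.
have y0p : 0 < y0 by rewrite lt_neqAle y00 andbT; apply: contraTneq Dy0 => <-; rewrite D0 ltxx.
have y0m : y0 < l by rewrite lt_neqAle y0l andbT; apply: contraTneq Dy0 => ->; rewrite Dl ltxx.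
(* The Wronskian of [D] and [phi]. It vanishes at the maximum [y0] of the quotient but has positive
   derivative there, so the quotient would increase to the right of [y0]. *)
pose N y := E y * phi y - D y * psi y.
have dq y : 0 < y -> y < l -> is_derive y 1 q (N y / phi y ^+ 2).
  move=> h1 h2; have e1 := dD y h1 h2; have e2 := dphi y.
  have pn : phi y != 0 by rewrite gt_eqF // phi0 // ltW.
  by rewrite /q; derc; rewrite /N; field.
have N0 : N y0 = 0.
  have := der_max (_ : 0 < Num.min y0 (l - y0)) (dq y0 y0p y0m).
  rewrite lt_min y0p subr_gt0 y0m => /(_ isT) h.
  have : N y0 / phi y0 ^+ 2 = 0.
    apply: h => x; rewrite lt_min !ltr_norml => /andP[/andP[? ?] /andP[? ?]].
    by apply: hmax; lra.
  by move=> /eqP; rewrite mulf_eq0 invr_eq0 expf_eq0 /= (gt_eqF (phi0 _ y00 y0l)) orbF => /eqP.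
have dN : is_derive y0 1 N (phi y0 * (k ^+ 2 * D y0 - F y0)).
  have e1 := dD y0 y0p y0m; have e2 := dphi y0; have e3 := dE y0 y0p y0m; have e4 := dpsi y0.
  by rewrite /N; derc; ring.
move: dN; set a := phi y0 * _ => dN; have a0 : 0 < a.
  rewrite mulr_gt0 ?phi0 // subr_gt0; apply: le_lt_trans (hF y0 y0p y0m Dy0) _.
  rewrite ltr_pMl //; nra.
have a2 : 0 < a / 2 by lra.
have /derP := dN; move=> /(_ _ a2) [e e0 he].
have ly0 : 0 < l - y0 by rewrite subr_gt0.
have [h [h0 he1 hl1]] := two_bounds e0 ly0.
have : q y0 < q (y0 + h).
  apply: (@mono_lt _ q (fun y => N y / phi y ^+ 2)); first by rewrite ltrDl.
  - by move=> x x1 x2; apply: dq; clear -x1 x2 y0p hl1; lra.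
  - by move=> x x1 x2; apply: cq; clear -x1 x2 y0p hl1; lra.
  - move=> x x1 x2; have [x3 x4] : 0 <= x /\ x <= l by clear -x1 x2 y0p hl1; split; lra.
    rewrite divr_gt0 ?exprn_gt0 ?phi0 //.
    have := he x; rewrite N0 subr0 gtr0_norm ?subr_gt0 // => /(_ ltac:(clear -x2 he1; lra)).
    rewrite ler_norml => /andP[h1 _]; have xy : 0 < x - y0 by rewrite subr_gt0.
    have ax := mulr_gt0 xy a0; rewrite -subr_gt0 -/(N x); clear -h1 ax; lra.
have [h1 h2] : 0 <= y0 + h /\ y0 + h <= l by clear -y00 h0 hl1; split; lra.
by rewrite ltNge hmax.
Qed.
End Sturm.

(** * Geodesic arcs as functions of the angle *)

Section Arcs.
Variable R : realType.
Variable m : R -> R.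
Hypothesis Hm : admissible_profile m.
Hypothesis Hv : von_Mangoldt m.
Implicit Types (p q : R * R) (c : R -> R * R) (s t : R).
Notation D := (D m).
Notation liso_at := (liso_at m).
Notation clairaut := (clairaut m).
Notation m1 := (derivs m 1).
Notation f := (slope_ratio m).

(* A geodesic arc with Clairaut constant nu > 0 in polar coordinates (r, th);
   U = - r'/nu is the derivative of W(r) with respect to the angle. *)
Definition polar_arc (nu b : R) (r th U : R -> R) : Prop :=
  [/\ continuous r, forall t, 0 < r t, th 0 = 0 & [/\
      forall t, is_derive t 1 th (nu / m (r t) ^+ 2),
      forall t, 0 < t -> t < b -> is_derive t 1 r (- nu * U t),
      forall t, 0 < t -> t < b -> is_derive t 1 U (- (nu / m (r t) ^+ 2) * f (r t)) &
      forall t, 0 < t -> t < b -> U t ^+ 2 = (nu ^+ 2)^-1 - (m (r t) ^+ 2)^-1]].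

Lemma polar_arc_of c (b rho nu : R) : 0 < b -> 0 < nu ->
  continuous (fun t => (c t).1) -> continuous (fun t => (c t).2) ->
  (forall t, c t <> 0) -> (forall t, 0 < t -> t < b -> liso_at c t) ->
  (forall t, 0 < t -> t < b -> clairaut c t = nu) ->
  0 < rho -> c 0 = (rho, 0) ->
  exists th : R -> R, polar_arc nu b (fun t => enorm (c t)) th (fun t => - rvel c t / nu) /\
    forall t, 0 <= t -> t <= b -> c t = (enorm (c t) * cos (th t), enorm (c t) * sin (th t)).
Proof.
move=> b0 nu0 c1 c2 nz hl hnu rho0 ca.
have [th [th0 cth dth hth]] := liso_polar Hm b0 c1 c2 nz hl hnu rho0 ca.
have nn : nu != 0 by rewrite gt_eqF.
exists th; split; last exact: hth.
split; [move=> t; exact: (enorm_cont (c1 t) (c2 t))|move=> t; exact: (enorm_neq0 (nz t))|exact: th0|].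
split; first exact: dth.
- move=> t t0 tb; have d := liso_der_rad Hm (hl t t0 tb) (nz t); apply: der_eq d _; by field.
- move=> t t0 tb; have d := liso_radial Hm (hl t t0 tb) (nz t).
  have mn : m (enorm (c t)) != 0 by rewrite gt_eqF // (m_gt0 Hm) // enorm_neq0.
  by derc; rewrite /radial_acc (hnu t t0 tb) /slope_ratio; field; rewrite mn nn.
- move=> t t0 tb; have := liso_energy Hm (hl t t0 tb) (nz t); rewrite (hnu t t0 tb) => En.
  have mn : m (enorm (c t)) != 0 by rewrite gt_eqF // (m_gt0 Hm) // enorm_neq0.
  have -> : (- rvel c t / nu) ^+ 2 = rvel c t ^+ 2 / nu ^+ 2 by field.
  have -> : rvel c t ^+ 2 = 1 - nu ^+ 2 / m (enorm (c t)) ^+ 2 by rewrite -En; ring.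
  by field; rewrite mn nn.
Qed.

Variable W : R -> R.
Hypothesis dW : forall r : R, 0 < r -> is_derive r 1 W (- (m r ^+ 2)^-1).

Section OneArc.
Variables (nu b : R) (r th U : R -> R).
Hypothesis nu0 : 0 < nu.
Hypothesis harc : polar_arc nu b r th U.

Lemma arc_m_neq0 t : m (r t) != 0.
Proof. by case: harc => _ r0 _ _; rewrite gt_eqF // (m_gt0 Hm). Qed.

Lemma arc_speed_gt0 t : 0 < nu / m (r t) ^+ 2.
Proof. by case: harc => _ r0 _ _; rewrite divr_gt0 // exprn_gt0 // (m_gt0 Hm). Qed.

Lemma arc_der_th t : is_derive t 1 th (nu / m (r t) ^+ 2).
Proof. by case: harc => _ _ _ [h _ _ _]. Qed.

Lemma arc_cont_th : continuous th.
Proof. by move=> t; exact: der_cont (arc_der_th t). Qed.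

Lemma arc_th_lt s t : s < t -> th s < th t.
Proof.
move=> st; apply: (@mono_lt _ th (fun t => nu / m (r t) ^+ 2)) => // x _ _.
- exact: arc_der_th.
- exact: arc_cont_th.
- exact: arc_speed_gt0.
Qed.

Lemma arc_cont_W : continuous (fun t => W (r t)).
Proof.
case: harc => cr r0 _ _ t; exact: (continuous_comp (cr t) (der_cont (dW (r0 t)))).
Qed.

Lemma arc_der_W t : 0 < t -> t < b -> is_derive t 1 (fun s => W (r s)) (nu / m (r t) ^+ 2 * U t).
Proof.
case: harc => cr r0 _ [_ h _ _] t0 tb.
by apply: der_eq (dercomp (dW (r0 t)) (h t t0 tb)) _; field; exact: arc_m_neq0.
Qed.

Lemma arc_U_le t : 0 < t -> t < b -> `|U t| <= nu^-1.
Proof.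
case: harc => _ r0 _ [_ _ _ h] t0 tb.
rewrite -ler_sqr ?nnegrE ?invr_ge0 ?(ltW nu0) // real_normK ?num_real // h //.
by rewrite exprVn lerBlDr lerDl invr_ge0 sqr_ge0.
Qed.

(* The value at angle th1 predicted from time t by the equation W'' + W = 0. *)
Lemma arc_predict (w th1 : R) s t : 0 < s -> s <= t -> t < b ->
  (forall x, s < x -> x < t -> 0 <= (f (r x) - (W (r x) - w)) * sin (th1 - th x)) ->
  (W (r t) - w) * cos (th1 - th t) + U t * sin (th1 - th t) <=
  (W (r s) - w) * cos (th1 - th s) + U s * sin (th1 - th s).
Proof.
case: (harc) => _ r0 _ [_ _ dU _] s0 st tb hx.
pose Q x := - ((W (r x) - w) * cos (th1 - th x) + U x * sin (th1 - th x)).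
suff : Q s <= Q t by rewrite /Q lerN2.
have dQ x : s <= x -> x <= t -> is_derive x 1 Q
    (nu / m (r x) ^+ 2 * (f (r x) - (W (r x) - w)) * sin (th1 - th x)).
  move=> sx xt; have x0 := lt_le_trans s0 sx; have xb := le_lt_trans xt tb.
  have d1 := arc_der_W x0 xb; have d2 := dU x x0 xb; have d3 := arc_der_th x.
  by rewrite /Q; derc; ring.
notypeclasses refine (@mono_le _ Q (fun x => nu / m (r x) ^+ 2 * (f (r x) - (W (r x) - w)) * sin (th1 - th x)) _ _ _ _ _ _); first by [].
- by move=> x sx xt; apply: dQ; exact: ltW.
- by move=> x sx xt; exact: der_cont (dQ x sx xt).
- by move=> x sx xt; rewrite -mulrA mulr_ge0 ?hx // ltW // arc_speed_gt0.
Qed.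

(** The prediction for the angle pi is [- W (r 0)] at time 0 and only decreases as long as
    [W <= m'/m]. On reaching that angle the potential would be at most [- W (r 0)], which is below
    its infimum bound [w]. *)
Lemma arc_sweep_lt_pi (w : R) : 0 < b -> (forall x, 0 < x -> W x <= f x) ->
  (forall x, 0 < x -> w <= W x) -> - w < W (r 0) -> forall t, 0 <= t -> t <= b -> th t < pi.
Proof.
case: (harc) => cr r0 th0 _ b0 hf hw hp t t0 tb; rewrite ltNge; apply/negP => tpi.
have pi0 := pi_gt0 R; have thpi : th 0 <= pi by rewrite th0 ltW.
have [t1 [t10 t1t E1]] := ivt t0 (fun x _ _ => @arc_cont_th x) thpi tpi.
have {}t10 : 0 < t1.
  rewrite lt_neqAle t10 andbT; apply/negP => /eqP E; move: E1; rewrite -E th0.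
  by have := pi_gt0 R; lra.
have t1b := le_trans t1t tb.
have ccos : continuous (fun x => cos (th x)) by move=> x; exact: der_cont (dercos (arc_der_th x)).
have csin : continuous (fun x => sin (th x)) by move=> x; exact: der_cont (dersin (arc_der_th x)).
(* [U] is known only inside the interval; it is replaced by its bound [1/nu], and the factor
   [sin (th x)] makes this term vanish at both ends. *)
have cA x : {for x, continuous (fun x => - W (r x) * cos (th x) - nu^-1 * sin (th x))}.
  apply: cvgB; first by apply: cvgM; [apply: cvgN; exact: arc_cont_W|exact: ccos].
  by apply: cvgM; [exact: cvg_cst|exact: csin].
have cB x : {for x, continuous (fun x => - W (r x) * cos (th x) + nu^-1 * sin (th x))}.
  apply: cvgD; first by apply: cvgM; [apply: cvgN; exact: arc_cont_W|exact: ccos].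
  by apply: cvgM; [exact: cvg_cst|exact: csin].
have := le_at_ends t10 (cA t1) (cB 0); rewrite E1 th0 cospi sinpi cos0 sin0.
have sin_pos x : 0 < x -> x < t1 -> 0 <= sin (th x).
  move=> x0 xt; apply: sin_ge0_pi; rewrite -th0 -E1.
  by rewrite !ltW ?arc_th_lt.
move=> h; have : - W (r t1) * -1 - nu^-1 * 0 <= - W (r 0) * 1 + nu^-1 * 0.
  apply: h => s t' s0 st tt; have t'b := lt_le_trans tt t1b.
  have t'0 := lt_trans s0 st.
  have cp x : cos (pi - x) = - cos x :> R by rewrite cosB cospi sinpi mul0r addr0 mulN1r.
  have sp x : sin (pi - x) = sin x :> R by rewrite sinB cospi sinpi mul0r sub0r mulN1r opprK.
  have key : (W (r t') - 0) * cos (pi - th t') + U t' * sin (pi - th t') <=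
     (W (r s) - 0) * cos (pi - th s) + U s * sin (pi - th s).
    apply: arc_predict => //; first exact: ltW.
    move=> x sx xt; rewrite sp subr0 mulr_ge0 ?subr_ge0 ?hf //.
    by apply: sin_pos; [exact: lt_trans sx|exact: lt_trans tt].
  rewrite !cp !sp !subr0 in key.
  have P1 := sin_pos s s0 (lt_trans st tt); have P2 := sin_pos t' t'0 tt.
  have B1 := arc_U_le s0 (lt_trans st t'b); have B2 := arc_U_le t'0 t'b.
  move: B1 B2; rewrite !ler_norml => /andP[_ B1] /andP[B2 _].
  have G1 := ler_wpM2r P1 B1; have G2 := ler_wpM2r P2 B2.
  by lra.
have := hw _ (r0 t1); lra.
Qed.

End OneArc.

Lemma arc_inverse (nu b : R) (r th U : R -> R) : 0 < nu -> polar_arc nu b r th U ->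
  exists tau : R -> R, (forall t, tau (th t) = t) /\
    forall t, is_derive (th t) 1 tau (m (r t) ^+ 2 / nu).
Proof.
move=> nu0 ha; have inj s t : th s = th t -> s = t.
  move=> E; have [st|ts|//] := ltgtP s t.
    by have := arc_th_lt nu0 ha st; rewrite E ltxx.
  by have := arc_th_lt nu0 ha ts; rewrite E ltxx.
(* The default 0 concerns only angles outside the range of [th]. *)
pose tau y := xget 0 [set x | th x = y].
have tauK t : tau (th t) = t.
  by apply: inj; exact: (@xgetPex _ 0 [set x | th x = th t] (ex_intro _ t erefl)).
exists tau; split=> // t.
have -> : m (r t) ^+ 2 / nu = (nu / m (r t) ^+ 2)^-1 by rewrite invf_div.
apply: (@is_derive_inverse _ th).
- by exists 1; [exact: ltr01|move=> x _; exact: tauK].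
- by exists 1; [exact: ltr01|move=> x _; exact: (arc_cont_th ha)].
- exact: arc_der_th ha t.
- by rewrite gt_eqF // (arc_speed_gt0 nu0 ha).
Qed.

(** As a function of the angle, the difference of the two potentials vanishes at both ends, and
    Sturm comparison applies to it with either sign; so the radii agree. Then so do the derivatives
    [U], the constants [nu] by the energy identity, and the speeds [dt/dth], hence the durations. *)
Lemma arc_unique (nu1 b1 nu2 b2 : R) (r1 th1 U1 r2 th2 U2 : R -> R) :
  0 < nu1 -> 0 < nu2 -> 0 < b1 -> 0 < b2 ->
  polar_arc nu1 b1 r1 th1 U1 -> polar_arc nu2 b2 r2 th2 U2 ->
  r1 0 = r2 0 -> r1 b1 = r2 b2 -> th1 b1 = th2 b2 -> th1 b1 < pi -> b1 = b2.
Proof.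
move=> n1 n2 b10 b20 a1 a2 E0 Eb Et tpi.
have [tau1 [K1 dt1]] := arc_inverse n1 a1; have [tau2 [K2 dt2]] := arc_inverse n2 a2.
have [cr1 r10 th10 [_ _ dU1 eU1]] := a1; have [cr2 r20 th20 [_ _ dU2 eU2]] := a2.
set l := th1 b1 in tpi Et; have l0 : 0 < l by rewrite -th10; exact: (arc_th_lt n1 a1).
have onto1 y : 0 <= y -> y <= l -> exists t, [/\ 0 <= t, t <= b1 & th1 t = y].
  move=> y0 yl; apply: (ivt (ltW b10)) => //; last by rewrite th10.
  by move=> x _ _; exact: (arc_cont_th a1).
have onto2 y : 0 <= y -> y <= l -> exists t, [/\ 0 <= t, t <= b2 & th2 t = y].
  move=> y0 yl; apply: (ivt (ltW b20)); last by rewrite -Et.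
    by move=> x _ _; exact: (arc_cont_th a2).
  by rewrite th20.
have str (nu b : R) (r th U : R -> R) t : 0 < nu -> polar_arc nu b r th U -> 0 < b ->
    th 0 = 0 -> th b = l -> 0 < th t -> th t < l -> 0 < t /\ t < b.
  move=> n a b0 h0 hb h1 h2; split; rewrite ltNge; apply/negP.
    rewrite le_eqVlt => /predU1P[E|h]; first by move: h1; rewrite E h0 ltxx.
    by have := arc_th_lt n a h; rewrite h0; lra.
  rewrite le_eqVlt => /predU1P[E|h]; first by move: h2; rewrite -E hb ltxx.
  by have := arc_th_lt n a h; rewrite hb; lra.
pose w1 y := W (r1 (tau1 y)); pose w2 y := W (r2 (tau2 y)).
pose u1 y := U1 (tau1 y); pose u2 y := U2 (tau2 y).
have sp (nu b : R) (r th U : R -> R) t : 0 < nu -> polar_arc nu b r th U ->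
  nu / m (r t) ^+ 2 * (m (r t) ^+ 2 / nu) = 1.
  by move=> n a; have mn := arc_m_neq0 a t; field; rewrite mn gt_eqF.
have dw1 y : 0 < y -> y < l -> is_derive y 1 w1 (u1 y).
  move=> y0 yl; have [t [t0 tb E]] := onto1 y (ltW y0) (ltW yl). subst y.
  have [{}t0 {}tb] := str _ _ _ _ _ t n1 a1 b10 th10 erefl y0 yl.
  have h := arc_der_W a1 t0 tb; rewrite -{1}[t]K1 in h.
  apply: der_eq (dercomp h (dt1 t)) _; rewrite /u1 K1.
  by rewrite mulrAC (sp _ _ _ _ _ t n1 a1) mul1r.
have dw2 y : 0 < y -> y < l -> is_derive y 1 w2 (u2 y).
  move=> y0 yl; have [t [t0 tb E]] := onto2 y (ltW y0) (ltW yl); subst y.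
  have [{}t0 {}tb] := str _ _ _ _ _ t n2 a2 b20 th20 (esym Et) y0 yl.
  have h := arc_der_W a2 t0 tb; rewrite -{1}[t]K2 in h.
  apply: der_eq (dercomp h (dt2 t)) _; rewrite /u2 K2.
  by rewrite mulrAC (sp _ _ _ _ _ t n2 a2) mul1r.
have du1 y : 0 < y -> y < l -> is_derive y 1 u1 (- f (r1 (tau1 y))).
  move=> y0 yl; have [t [t0 tb E]] := onto1 y (ltW y0) (ltW yl); subst y.
  have [{}t0 {}tb] := str _ _ _ _ _ t n1 a1 b10 th10 erefl y0 yl.
  have h := dU1 t t0 tb; rewrite -{1}[t]K1 in h.
  apply: der_eq (dercomp h (dt1 t)) _; rewrite K1.
  by rewrite !mulNr mulrAC (sp _ _ _ _ _ t n1 a1) mul1r.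
have du2 y : 0 < y -> y < l -> is_derive y 1 u2 (- f (r2 (tau2 y))).
  move=> y0 yl; have [t [t0 tb E]] := onto2 y (ltW y0) (ltW yl); subst y.
  have [{}t0 {}tb] := str _ _ _ _ _ t n2 a2 b20 th20 (esym Et) y0 yl.
  have h := dU2 t t0 tb; rewrite -{1}[t]K2 in h.
  apply: der_eq (dercomp h (dt2 t)) _; rewrite K2.
  by rewrite !mulNr mulrAC (sp _ _ _ _ _ t n2 a2) mul1r.
have cw1 y : 0 <= y -> y <= l -> {for y, continuous w1}.
  move=> y0 yl; have [t [_ _ E]] := onto1 y y0 yl; subst y.
  apply: (@continuous_comp _ _ _ tau1 (fun x => W (r1 x))); first exact: der_cont (dt1 t).
  exact: (arc_cont_W a1).
have cw2 y : 0 <= y -> y <= l -> {for y, continuous w2}.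
  move=> y0 yl; have [t [_ _ E]] := onto2 y y0 yl; subst y.
  apply: (@continuous_comp _ _ _ tau2 (fun x => W (r2 x))); first exact: der_cont (dt2 t).
  exact: (arc_cont_W a2).
have z1 : tau1 0 = 0 by rewrite -th10 K1.
have z2 : tau2 0 = 0 by rewrite -th20 K2.
have e1 : tau1 l = b1 by rewrite K1.
have e2 : tau2 l = b2 by rewrite Et K2.
have ratio (x y : R) : 0 < x -> 0 < y -> 0 < W x - W y -> f x - f y <= W x - W y.
  move=> x0 y0 h; apply: (potential_slope_ratio Hm Hv dW) => //.
  rewrite leNgt; apply/negP => yx; have := potential_decr Hm dW y0 yx; lra.
have s12 y : 0 <= y -> y <= l -> w1 y - w2 y <= 0.
  apply: (@sturm _ (fun y => w1 y - w2 y) (fun y => u1 y - u2 y)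
    (fun y => f (r1 (tau1 y)) - f (r2 (tau2 y))) l l0 tpi).
  - by rewrite /w1 /w2 z1 z2 E0 subrr.
  - by rewrite /w1 /w2 e1 e2 Eb subrr.
  - by move=> x x0 xl; apply: cvgB; [exact: cw1|exact: cw2].
  - by move=> x x0 xl; have d1 := dw1 x x0 xl; have d2 := dw2 x x0 xl; derc.
  - by move=> x x0 xl; have d1 := du1 x x0 xl; have d2 := du2 x x0 xl; derc; ring.
  - by move=> x x0 xl; exact: ratio.
have s21 y : 0 <= y -> y <= l -> w2 y - w1 y <= 0.
  apply: (@sturm _ (fun y => w2 y - w1 y) (fun y => u2 y - u1 y)
    (fun y => f (r2 (tau2 y)) - f (r1 (tau1 y))) l l0 tpi).
  - by rewrite /w1 /w2 z1 z2 E0 subrr.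
  - by rewrite /w1 /w2 e1 e2 Eb subrr.
  - by move=> x x0 xl; apply: cvgB; [exact: cw2|exact: cw1].
  - by move=> x x0 xl; have d1 := dw1 x x0 xl; have d2 := dw2 x x0 xl; derc.
  - by move=> x x0 xl; have d1 := du1 x x0 xl; have d2 := du2 x x0 xl; derc; ring.
  - by move=> x x0 xl; exact: ratio.
have wE y : 0 <= y -> y <= l -> w1 y = w2 y.
  by move=> y0 yl; have := s12 y y0 yl; have := s21 y y0 yl; lra.
have rE y : 0 <= y -> y <= l -> r1 (tau1 y) = r2 (tau2 y).
  move=> y0 yl; have := wE y y0 yl; rewrite /w1 /w2 => E.
  have [h|h|//] := ltgtP (r1 (tau1 y)) (r2 (tau2 y)).
    by have := potential_decr Hm dW (r10 _) h; rewrite E ltxx.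
  by have := potential_decr Hm dW (r20 _) h; rewrite E ltxx.
have l20 : 0 < l / 2 by lra.
have l2l : l / 2 < l by lra.
have uE : u1 (l / 2) = u2 (l / 2).
  have d1 := dw1 _ l20 l2l; have d2 := dw2 _ l20 l2l.
  apply: (der_uniq d1); apply: der_near d2; exists (l / 2) => // y.
  rewrite ltr_norml => /andP[h1 h2]; apply/esym/wE; clear -h1 h2 l20 l2l; lra.
(* At the middle angle the radii and the values of [U] agree, and the energy identity then
   determines [nu ^+ 2]. *)
have nE : nu1 = nu2.
  have [t [t0 tb Ey1]] := onto1 _ (ltW l20) (ltW l2l).
  have [s [s0 sb Ey2]] := onto2 _ (ltW l20) (ltW l2l).
  have [{}t0 {}tb] : 0 < t /\ t < b1 by apply: (str _ _ _ _ _ t n1 a1); rewrite ?Ey1.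
  have [{}s0 {}sb] : 0 < s /\ s < b2 by apply: (str _ _ _ _ _ s n2 a2); rewrite ?Ey2.
  have := eU1 t t0 tb; have := eU2 s s0 sb; move: uE (rE _ (ltW l20) (ltW l2l)).
  rewrite /u1 /u2 -{1 3}Ey1 -Ey2 K1 K2 => -> ->  -> /(congr1 (fun x => x + (m (r2 s) ^+ 2)^-1)).
  rewrite !subrK => /invr_inj /eqP; rewrite eqf_sqr => /orP[/eqP //|/eqP E].
  by move: n2; rewrite E; lra.
have : tau1 l - tau2 l = tau1 0 - tau2 0.
  apply/esym/(@der0_cst _ (fun y => tau1 y - tau2 y)) => //; first exact: ltW.
    move=> y y0 yl; have [t [_ _ Ey1]] := onto1 y (ltW y0) (ltW yl).
    have [s [_ _ Ey2]] := onto2 y (ltW y0) (ltW yl).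
    have d1 := dt1 t; have d2 := dt2 s; rewrite Ey1 in d1; rewrite Ey2 in d2.
    have Er : r1 t = r2 s by have := rE y (ltW y0) (ltW yl); rewrite -{1}Ey1 -Ey2 K1 K2.
    by derc; rewrite nE Er subrr.
  move=> y y0 yl; have [t [_ _ Ey1]] := onto1 y y0 yl; have [s [_ _ Ey2]] := onto2 y y0 yl.
  have d1 := dt1 t; have d2 := dt2 s; rewrite Ey1 in d1; rewrite Ey2 in d2.
  by apply: cvgB; [exact: der_cont d1|exact: der_cont d2].
by rewrite e1 e2 z1 z2 subrr => /subr0_eq.
Qed.

End Arcs.

(** * Geodesics from points near the origin *)

Section Poles.
Variable R : realType.
Variable m : R -> R.
Hypothesis Hm : admissible_profile m.
Implicit Types (p q : R * R) (c : R -> R * R) (s t : R).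
Notation D := (D m).
Notation liso_at := (liso_at m).
Notation clairaut := (clairaut m).

Definition scal (a : R) p : R * R := (a * p.1, a * p.2).

Lemma D_line_le p s t : enorm p = 1 -> D (scal s p) (scal t p) <= `|s - t|.
Proof.
move=> p1; have key x y : x <= y -> D (scal x p) (scal y p) <= y - x.
  move=> xy; rewrite -[leRHS]mul1r.
  have hv : C1data (fun t => scal t p) (fun=> p).
    by split=> /= z; try exact: cst_continuous; derc; ring.
  apply: (D_le_speed Hm hv xy) => z _ _.
  rewrite -ler_sqr ?nnegrE ?gnorm_ge0 // sqr_gnorm expr1n gmE.
  have [->|z0] := eqVneq z 0.
    by rewrite /scal !mul0r enorm0 /stretch eqxx expr1n subrr mul1r !mul0r addr0 -sqr_enorm p1 expr1n.
  have -> : edot (scal z p) p = z by rewrite (_ : edot _ _ = z * edot p p); [rewrite -sqr_enorm p1 expr1n mulr1|rewrite /edot /=; ring].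
  rewrite /scal enormZ p1 mulr1 -sqr_enorm p1 expr1n.
  have : (z / `|z|) ^+ 2 = 1 by rewrite expr_div_n real_normK ?num_real // divff // expf_neq0.
  by move=> h; rewrite -mulrA -expr2 h; lra.
have [st|/ltW ts] := leP s t.
  by rewrite distrC ger0_norm ?subr_ge0 //; exact: key.
by rewrite ger0_norm ?subr_ge0 // D_sym //; exact: key.
Qed.

Lemma D_line p s t : enorm p = 1 -> 0 <= s * t -> D (scal s p) (scal t p) = `|s - t|.
Proof.
move=> p1 st; apply/eqP; rewrite eq_le D_line_le //=.
apply: le_trans (D_ge_radius Hm (scal s p) (scal t p)).
rewrite !enormZ p1 !mulr1.
rewrite -ler_sqr ?nnegrE // !real_normK ?num_real // !sqrrB !real_normK ?num_real //.
by rewrite -normrM (ger0_norm st).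
Qed.

Lemma liso_orth (a b sg : R) c t : a ^+ 2 + b ^+ 2 = 1 -> sg ^+ 2 = 1 ->
  liso_at c t -> liso_at (fun x => orth a b sg (c x)) t.
Proof.
by move=> ab sg1 [e e0 he]; exists e => // s u hs hu; rewrite D_orth // he.
Qed.

Lemma geodesic_orth (a b sg : R) c : a ^+ 2 + b ^+ 2 = 1 -> sg ^+ 2 = 1 ->
  geodesic m c -> geodesic m (fun x => orth a b sg (c x)).
Proof.
by move=> ab sg1 /(geodesicP Hm) h; apply/(geodesicP Hm) => t; exact: liso_orth.
Qed.

Lemma vel_orth (a b sg : R) c t : liso_at c t ->
  vel (fun x => orth a b sg (c x)) t = orth a b sg (vel c t).
Proof.
move=> hl; have [d1 d2 _ _] := liso_C1 Hm hl.
have e1 : is_derive t 1 (fun x => (orth a b sg (c x)).1) (orth a b sg (vel c t)).1.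
  change (is_derive t 1 (fun x => a * (c x).1 - sg * b * (c x).2) (a * (vel c t).1 - sg * b * (vel c t).2)).
  by derc; ring.
have e2 : is_derive t 1 (fun x => (orth a b sg (c x)).2) (orth a b sg (vel c t)).2.
  change (is_derive t 1 (fun x => b * (c x).1 + sg * a * (c x).2) (b * (vel c t).1 + sg * a * (vel c t).2)).
  by derc; ring.
rewrite {1}/vel !derive1E; have [_ ->] := e1; have [_ ->] := e2.
by rewrite -surjective_pairing.
Qed.

Lemma clairaut_orth (a b sg : R) c t : a ^+ 2 + b ^+ 2 = 1 -> sg ^+ 2 = 1 -> liso_at c t ->
  clairaut (fun x => orth a b sg (c x)) t = sg * clairaut c t.
Proof.
move=> ab sg1 hl; rewrite /clairaut vel_orth // enorm_orth //.
rewrite (_ : cross (orth a b sg (c t)) (orth a b sg (vel c t)) =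
  sg * (a ^+ 2 + b ^+ 2) * cross (c t) (vel c t)); last by rewrite /cross /orth /= ; move: (vel c t) => v; ring.
by rewrite ab mulr1 mulrCA mulrA.
Qed.

Lemma clairaut_neq0 c t : clairaut c t <> 0 -> c t <> 0.
Proof. by move=> h e; apply: h; rewrite /clairaut e /cross /= !mul0r subrr mulr0. Qed.

Lemma geodesic_le c s t : (forall x, liso_at c x) -> D (c s) (c t) <= `|s - t|.
Proof.
move=> hl; have key x y : x <= y -> D (c x) (c y) <= y - x.
  move=> xy; rewrite -[leRHS]mul1r; apply: (D_le_speed_local Hm (v := vel c) xy) => z _ _.
    exact: liso_C1 (hl z).
  by rewrite -ler_sqr ?nnegrE ?gnorm_ge0 // sqr_gnorm (liso_speed Hm (hl z)) expr1n.
have [st|/ltW ts] := leP s t.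
  by rewrite distrC ger0_norm ?subr_ge0 //; exact: key.
by rewrite ger0_norm ?subr_ge0 // D_sym //; exact: key.
Qed.

Lemma ray_from c : geodesic m c -> (forall s, 0 <= s -> D (c 0) (c s) = s) -> ray m c.
Proof.
move=> hg h; split=> // s t s0 t0; rewrite rdist_D //; congr EFin.
have hl := (geodesicP Hm c).1 hg.
apply/eqP; rewrite eq_le geodesic_le //=.
have t1 := D_tri Hm (c s) (c 0) (c t); have t2 := D_tri Hm (c t) (c 0) (c s).
rewrite (D_sym Hm (c t) (c s)) !h // in t1 t2.
by rewrite ler_norml; apply/andP; split; lra.
Qed.

(** Identities derived for interior times, such as that of a straight line, extend to the ends of a
    segment. *)
Lemma zero_at_end (f : R -> R) (a b : R) : continuous f -> a < b ->
  (forall t, a < t -> t < b -> f t = 0) -> f a = 0 /\ f b = 0.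
Proof.
move=> cf ab h; suff key x : a <= x -> x <= b -> f x = 0.
  by split; apply: key; rewrite ?lexx ?ltW.
move=> ax xb; apply/eqP; rewrite -normr_eq0 eq_le normr_ge0 andbT.
apply/ler_addgt0Pr => e e0; rewrite add0r.
have /contP := cf x; move=> /(_ e e0) [d d0 hd].
pose k := Num.min d (b - a) / 4.
have k0 : 0 < k by rewrite divr_gt0 // lt_min d0 subr_gt0.
have [kd kb] : 4 * k <= d /\ 4 * k <= b - a.
  rewrite /k (_ : 4 * (_ / 4) = Num.min d (b - a)); last by field.
  by rewrite !ge_min !lexx ?orbT.
have [xm|xm] := leP x ((a + b) / 2).
  have := hd (x + k); rewrite addrAC subrr add0r gtr0_norm // => /(_ ltac:(lra)).
  by rewrite h ?sub0r ?normrN; [exact: ltW|lra|lra].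
have := hd (x - k); rewrite addrAC subrr add0r normrN gtr0_norm // => /(_ ltac:(lra)).
by rewrite h ?sub0r ?normrN; [exact: ltW|lra|lra].
Qed.

Lemma minimal_segment_cont p q : exists c, [/\ c 0 = p, c (D p q) = q, iso_on m c 0 (D p q),
  continuous (fun t => (c t).1) & continuous (fun t => (c t).2)] /\
  forall t, c t = c (Num.max 0 (Num.min t (D p q))).
Proof.
have [c [c0 cd hc]] := minimal_segment Hm p q; have d0 := D_ge0 Hm p q.
have [k1 k2] := iso_on_cont Hm d0 hc.
exists (fun t => c (Num.max 0 (Num.min t (D p q)))); split; first split=> //.
- by rewrite clamp_id.
- by rewrite clamp_id.
- exact: iso_on_clamp.
- by move=> t; have [l1 l2] := clamp_itv t d0; rewrite (clamp_id l1 l2).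
Qed.

Hypothesis Hv : von_Mangoldt m.
Variable W : R -> R.
Hypothesis dW : forall r : R, 0 < r -> is_derive r 1 W (- (m r ^+ 2)^-1).
Hypothesis hWf : forall r : R, 0 < r -> W r <= slope_ratio m r.
Variable w : R.
Hypothesis hw : forall r : R, 0 < r -> w <= W r.

Lemma arc_of_curve c (d rho nu : R) : 0 < d ->
  continuous (fun t => (c t).1) -> continuous (fun t => (c t).2) ->
  (forall t, c t <> 0) -> (forall t, 0 < t -> t < d -> liso_at c t) ->
  (forall t, 0 < t -> t < d -> clairaut c t = nu) -> nu != 0 ->
  0 < rho -> c 0 = (rho, 0) ->
  exists (sg : R) (th U : R -> R), [/\ sg ^+ 2 = 1, polar_arc m `|nu| d (fun t => enorm (c t)) th U &
    forall t, 0 <= t -> t <= d ->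
      c t = (enorm (c t) * cos (th t), sg * (enorm (c t) * sin (th t)))].
Proof.
move=> d0 k1 k2 nz hl hnu nu0 rho0 c0; pose sg := Num.sg nu.
have sg1 : sg ^+ 2 = 1 by rewrite sqr_sg nu0.
have sgnu : sg * nu = `|nu| by rewrite /sg -normrEsg.
have e10 : 1 ^+ 2 + 0 ^+ 2 = 1 :> R by rewrite expr1n expr0n addr0.
pose c' t := orth 1 0 sg (c t).
have c'1 t : (c' t).1 = (c t).1 by rewrite /c' /orth /=; ring.
have c'2 t : (c' t).2 = sg * (c t).2 by rewrite /c' /orth /=; ring.
have c'n t : enorm (c' t) = enorm (c t) by exact: enorm_orth.
have [|||||||th [ha hth]] := @polar_arc_of _ _ Hm c' d rho `|nu| d0 _ _ _ _ _ _ rho0.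
- by rewrite normr_gt0.
- by rewrite (_ : (fun t => (c' t).1) = (fun t => (c t).1)) //; apply/funext.
- rewrite (_ : (fun t => (c' t).2) = (fun t => sg * (c t).2)); last exact/funext.
  by move=> t; apply: cvgM; [exact: cvg_cst|exact: k2].
- move=> t e; apply: (nz t); apply/eqP; rewrite -enorm_eq0 -c'n e; exact/eqP/enorm0.
- by move=> t t0 td; apply: liso_orth => //; exact: hl.
- by move=> t t0 td; rewrite /c' clairaut_orth ?hnu ?sgnu //; exact: hl.
- by rewrite [c' 0]surjective_pairing c'1 c'2 c0 mulr0.
exists sg, th, (fun t => - rvel c' t / `|nu|); split; first exact: sg1.
  by rewrite (_ : (fun t => enorm (c t)) = (fun t => enorm (c' t))) //; apply/funext.
move=> t t0 td; have E := hth t t0 td; rewrite c'n in E.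
rewrite [LHS]surjective_pairing -c'1; congr pair; first by rewrite E.
have : (c' t).2 = enorm (c t) * sin (th t) by rewrite E.
by rewrite c'2 => <-; rewrite mulrA -expr2 sg1 mul1r.
Qed.

(* As W(r) tends to infinity at 0, the condition - w < W rho holds for small rho;
   it keeps the sweep of the non-radial case below pi. *)
Lemma segment_cases (rho : R) q : 0 < rho -> - w < W rho -> q <> 0 -> q <> (rho, 0) ->
  let d := D (rho, 0) q in 0 < d /\
  ((exists t0 v, [/\ enorm v = 1, (rho, 0) = scal (- t0) v & q = scal (d - t0) v]) \/
   (exists (sg nu : R) (r th U : R -> R), [/\ sg ^+ 2 = 1 /\ 0 < nu, polar_arc m nu d r th U,
      r 0 = rho, r d = enorm q &
      [/\ 0 < th d, th d < pi & q = (enorm q * cos (th d), sg * (enorm q * sin (th d)))]])).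
Proof.
move=> rho0 hrho q0 qp d.
have d0 : 0 < d.
  rewrite lt_neqAle D_ge0 // andbT eq_sym; apply/negP => /eqP h.
  by apply: qp; apply/esym/(D_eq0 Hm).
split=> //.
have [c [[c0 cd hc k1 k2] ck]] := minimal_segment_cont (rho, 0) q.
rewrite -/d in cd hc ck.
have hl t : 0 < t -> t < d -> liso_at c t by move=> t0 td; exact: iso_on_liso hc t0 td.
have d2 : 0 < d / 2 by lra. have d2d : d / 2 < d by lra.
pose nu := clairaut c (d / 2).
have hnu t : 0 < t -> t < d -> clairaut c t = nu.
  by move=> t0 td; exact: (clairaut_cst Hm hl).
have [n0|n0] := eqVneq nu 0.
  left; have [t0 [v [v1 hvt]]] := liso_clairaut0_line Hm d0 hl (fun t a b => etrans (hnu t a b) n0).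
  exists t0, v.
  have ct (a : R) : continuous (fun t => (t - t0) * a : R).
    by move=> t; apply: (@der_cont _ _ _ a); derc; ring.
  have [a1 a2] : (c 0).1 - (0 - t0) * v.1 = 0 /\ (c d).1 - (d - t0) * v.1 = 0.
    apply: (@zero_at_end (fun t => (c t).1 - (t - t0) * v.1)) => //.
      by move=> t; apply: cvgB; [exact: k1|exact: ct].
    by move=> t ta tb; rewrite hvt //= subrr.
  have [b1 b2] : (c 0).2 - (0 - t0) * v.2 = 0 /\ (c d).2 - (d - t0) * v.2 = 0.
    apply: (@zero_at_end (fun t => (c t).2 - (t - t0) * v.2)) => //.
      by move=> t; apply: cvgB; [exact: k2|exact: ct].
    by move=> t ta tb; rewrite hvt //= subrr.
  rewrite -c0 -cd; split=> //.
    by rewrite [LHS]surjective_pairing (subr0_eq a1) (subr0_eq b1) sub0r.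
  by rewrite [LHS]surjective_pairing (subr0_eq a2) (subr0_eq b2).
have nz t : c t <> 0.
  have inn s : 0 <= s -> s <= d -> c s <> 0.
    rewrite le_eqVlt => /predU1P[<- _|s0].
      by rewrite c0 => /(congr1 fst) /= e; move: rho0; rewrite e ltxx.
    rewrite le_eqVlt => /predU1P[->|sd]; first by rewrite cd.
    by apply: clairaut_neq0; rewrite hnu //; apply/eqP.
  by rewrite ck; have [? ?] := clamp_itv t (ltW d0); exact: inn.
have [sg [th [U [sg1 ha hth]]]] := arc_of_curve d0 k1 k2 nz hl hnu n0 rho0 c0.
have n1 : 0 < `|nu| by rewrite normr_gt0.
have r0 : enorm (c 0) = rho.
  by rewrite c0 /enorm /edot /= mul0r addr0 -expr2 sqrtr_sqr gtr0_norm.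
right; exists sg, `|nu|, (fun t => enorm (c t)), th, U; split=> //; first by rewrite cd.
split.
- by case: (ha) => _ _ e _; rewrite -{1}e; exact: (arc_th_lt Hm n1 ha).
- by apply: (arc_sweep_lt_pi Hm dW n1 ha (w := w)) => //; rewrite ?r0 // ltW.
- by rewrite -{1}cd hth ?cd // ltW.
Qed.

(** For [x < 0] the radius gives no sharp bound. A minimal segment with [nu > 0] would end at an
    angle strictly between 0 and pi, thus off the axis; so the minimal segment is straight. *)
Lemma D_axis (rho x : R) : 0 < rho -> - w < W rho -> D (rho, 0) (x, 0) = `|rho - x|.
Proof.
move=> rho0 hrho; have e1 : enorm ((1, 0) : R * R) = 1.
  by rewrite /enorm /edot /= mul0r addr0 mulr1 sqrtr1.
have E (y : R) : (y, 0) = scal y (1, 0) :> R * R by rewrite /scal /= mulr1 mulr0.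
have [x0|x0] := leP 0 x.
  by rewrite (E rho) (E x) D_line // mulr_ge0 // ltW.
have [||_ [[t0 [v [v1 h1 h2]]]|[sg [nu [r [th [U [[sg1 _] _ _ _ [t0 tp h]]]]]]]]] :=
  segment_cases (q := (x, 0)) rho0 hrho.
- by move=> /(congr1 fst) /= e; move: x0; rewrite e ltxx.
- by move=> /(congr1 fst) /= e; lra.
- set d := D _ _ in h2 *; have d0 : 0 <= d by exact: D_ge0.
  have := congr1 fst h1; have := congr1 snd h1; have := congr1 fst h2.
  have := sqr_enorm v; rewrite v1 expr1n /edot /scal /= => n1 g1 g2 g3.
  have -> : rho - x = - d * v.1 by rewrite g1 g3; ring.
  have v20 : v.2 = 0.
    have /eqP := g2; rewrite eq_sym mulf_eq0 => /orP[/eqP e|/eqP //].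
    by move: rho0; rewrite g3 e mul0r ltxx.
  rewrite v20 mul0r addr0 in n1.
  have : `|v.1| ^+ 2 = 1 by rewrite real_normK ?num_real // expr2 -n1.
  move=> /eqP; rewrite sqrp_eq1 ?normr_ge0 // => /eqP nv.
  by rewrite normrM nv mulr1 normrN ger0_norm.
exfalso; have := congr1 snd h; rewrite /= => /eqP.
have s0 : 0 < sin (th (D (rho, 0) (x, 0))) by apply: sin_gt0_pi; rewrite t0 tp.
have xn : 0 < enorm ((x, 0) : R * R).
  by apply: enorm_neq0 => /(congr1 fst) /= e; move: x0; rewrite e ltxx.
rewrite eq_sym mulf_eq0 (gt_eqF (mulr_gt0 xn s0)) orbF => /eqP e.
by move: sg1; rewrite e expr0n /= => /eqP; rewrite eq_sym oner_eq0.
Qed.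

Lemma scal_orth (v : R * R) (a : R) : orth v.1 v.2 1 (a, 0) = scal a v.
Proof. by rewrite /orth /scal /=; congr pair; ring. Qed.

Lemma D_scal (v : R * R) (s t : R) : enorm v = 1 -> D (scal s v) (scal t v) = D (s, 0) (t, 0).
Proof.
move=> v1; rewrite -!scal_orth D_orth ?expr1n //.
by have := sqr_enorm v; rewrite v1 expr1n /edot !expr2.
Qed.

Lemma D_scal_axis (v : R * R) (s t : R) : enorm v = 1 -> (s != 0 -> - w < W `|s|) ->
  D (scal s v) (scal t v) = `|s - t|.
Proof.
move=> v1 hs; have [s0|s0|->] := ltgtP s 0; last by apply: D_line; rewrite // mul0r.
  have E (y : R) : scal y v = scal (- y) (- v.1, - v.2) by rewrite /scal /= !mulrNN.
  have nv : enorm (- v.1, - v.2) = 1 by rewrite -v1 -[RHS]enormN.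
  rewrite !E (D_scal _ _ nv).
  rewrite D_axis ?oppr_gt0 //; first by rewrite -opprD normrN.
  by have := hs; rewrite lt_eqF // ltr0_norm // => /(_ isT).
by rewrite D_scal // D_axis //; have := hs; rewrite gt_eqF // gtr0_norm // => /(_ isT).
Qed.

(** Away from the origin the radius shows minimality. Across the origin it follows from [D_axis],
    whose condition holds for small radii because [W] is unbounded at 0. *)
Lemma line_geodesic (v : R * R) (t0 : R) : enorm v = 1 -> geodesic m (fun t => scal (t - t0) v).
Proof.
move=> v1; apply/(geodesicP Hm) => t; have [e0|e0] := eqVneq (t - t0) 0.
  have [rho rho0 hr] := potential_infty Hm dW (- w); exists rho => // s u hs hu.
  rewrite D_scal_axis //; first by congr (`|_|); ring.
  move=> sn; apply: hr; first by rewrite normr_gt0.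
  by rewrite (_ : s - t0 = s - t) ?ltW //; rewrite -[RHS]addr0 -e0; ring.
exists `|t - t0|; first by rewrite normr_gt0.
move=> s u hs hu; rewrite D_line //; first by congr (`|_|); ring.
have [h|h] := ger0P (t - t0).
  move: hs hu; rewrite (ger0_norm h) !ltr_norml => /andP[? _] /andP[? _].
  by rewrite mulr_ge0 //; lra.
move: hs hu; rewrite (ltr0_norm h) !ltr_norml => /andP[_ ?] /andP[_ ?].
by rewrite mulr_le0 //; lra.
Qed.

(** The geodesic is compared with a minimal segment to its point [c s]: both sweep less than pi and
    end at the same point, so by [arc_unique] they have the same length. *)
Lemma geodesic_D_axis c (rho : R) : geodesic m c -> 0 < rho -> - w < W rho -> c 0 = (rho, 0) ->
  forall s, 0 <= s -> D (c 0) (c s) = s.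
Proof.
move=> hg rho0 hrho c0 s; rewrite le_eqVlt => /predU1P[<-|s0]; first by rewrite D_refl.
have hl := (geodesicP Hm c).1 hg; set nu := clairaut c 0.
have hnu t : - 1 - `|t| < t /\ t < 1 + `|t|.
  have := ler_norm t; have := ler_norm (- t); rewrite normrN; lra.
have {}hnu t : clairaut c t = nu.
  apply: (@clairaut_cst _ _ Hm c (- 1 - `|t|) (1 + `|t|)) => //; have := hnu t; have := hnu 0;
   have := normr_ge0 t; lra.
have [n0|n0] := eqVneq nu 0.
  have [t0 [v [v1 h]]] := @liso_clairaut0_line _ _ Hm c (-1) (s + 1) ltac:(lra)
    (fun t _ _ => hl t) (fun t _ _ => etrans (hnu t) n0).
  have h0 := h 0 ltac:(lra) ltac:(lra); have hs := h s ltac:(lra) ltac:(lra).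
  rewrite h0 hs -/(scal (0 - t0) v) -/(scal (s - t0) v) D_scal_axis //.
    by rewrite (_ : 0 - t0 - (s - t0) = - s); [rewrite normrN gtr0_norm|ring].
  move=> _; rewrite sub0r normrN; suff -> : `|t0| = rho by [].
  have : enorm (c 0) = `|t0| by rewrite h0 -/(scal (0 - t0) v) enormZ v1 mulr1 sub0r normrN.
  by move=> <-; rewrite c0 /enorm /edot /= mul0r addr0 -expr2 sqrtr_sqr gtr0_norm.
have nz t : c t <> 0 by apply: clairaut_neq0; rewrite hnu; exact/eqP.
have cc t := liso_cont Hm (hl t).
have [sg [th [U [sg1 ha hth]]]] := @arc_of_curve c s rho nu s0 (fun t => (cc t).1) (fun t => (cc t).2)
  nz (fun t _ _ => hl t) (fun t _ _ => hnu t) n0 rho0 c0.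
have n1 : 0 < `|nu| by rewrite normr_gt0.
have r0 : enorm (c 0) = rho.
  by rewrite c0 /enorm /edot /= mul0r addr0 -expr2 sqrtr_sqr gtr0_norm.
have th0 : th 0 = 0 by case: ha.
have ths : 0 < th s by rewrite -[X in X < _]th0; exact: (arc_th_lt Hm n1 ha).
have thp : th s < pi.
  by apply: (arc_sweep_lt_pi Hm dW n1 ha (w := w)) => //; rewrite ?r0 // ltW.
have sin_s : 0 < sin (th s) by apply: sin_gt0_pi; rewrite ths thp.
have E := hth s (ltW s0) (lexx s).
have sgn0 : sg != 0 by apply/eqP => z; move: sg1; rewrite z expr0n /= => /eqP; rewrite eq_sym oner_eq0.
have cs : 0 < enorm (c s) by exact: enorm_neq0.
have E2 : (c s).2 != 0 by rewrite E /= !mulf_neq0 // gt_eqF.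
rewrite c0; have [||d0 [[t0 [v [v1 h1 h2]]]|[sg' [nu' [r [th' [U' [[sg1' n1'] ha' r0' rd [t0 tp h]]]]]]]]] :=
  segment_cases (q := c s) rho0 hrho.
- exact: nz.
- by move=> e; move: E2; rewrite e eqxx.
- exfalso; have := congr1 snd h1; have := congr1 fst h1; rewrite /scal /= => g1 /eqP.
  rewrite eq_sym mulf_eq0 => /orP[/eqP t00|/eqP v20].
    by move: rho0; rewrite g1 t00 mul0r ltxx.
  by move: E2; rewrite h2 /scal /= v20 mulr0 eqxx.
set d := D _ _ in d0 ha' rd t0 tp h *.
(* Both sweeps lie in [[0, pi]], where the cosine determines the angle, whatever the orientations
   [sg] and [sg'] are. *)
have Ecos : cos (th s) = cos (th' d).
  apply: (mulfI (lt0r_neq0 cs)).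
  by have := congr1 fst E; have := congr1 fst h; rewrite /= => <- ->.
have Eth : th s = th' d by apply: cos_inj; rewrite ?in_itv /= ?ltW.
by apply/esym/(arc_unique Hm Hv dW n1 n1' s0 d0 ha ha') => //; rewrite ?r0 ?r0'.
Qed.

Lemma pole_of_potential p : (p <> 0 -> - w < W (enorm p)) -> pole m p.
Proof.
move=> hp c hg c0; apply: ray_from => //.
have hl := (geodesicP Hm c).1 hg; move=> s s0.
have [p0|/eqP p0] := eqVneq p 0.
  have hnu t : clairaut c t = 0.
    have -> : clairaut c t = clairaut c 0.
      apply: (@clairaut_cst _ _ Hm c (- 1 - `|t|) (1 + `|t|)) => //;
      have := ler_norm t; have := ler_norm (- t); rewrite normrN; lra.
    by rewrite /clairaut c0 p0 /cross /= !mul0r subrr mulr0.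
  have [t0 [v [v1 h]]] := @liso_clairaut0_line _ _ Hm c (-1) (s + 1) ltac:(lra)
    (fun t _ _ => hl t) (fun t _ _ => hnu t).
  have h0 := h 0 ltac:(lra) ltac:(lra); have hs := h s ltac:(lra) ltac:(lra).
  have t00 : 0 - t0 = 0.
    have : enorm (c 0) = `|0 - t0| by rewrite h0 -/(scal (0 - t0) v) enormZ v1 mulr1.
    by rewrite c0 p0 enorm0 => /esym/eqP; rewrite normr_eq0 => /eqP.
  rewrite h0 hs -/(scal (0 - t0) v) -/(scal (s - t0) v) D_line // t00 ?mul0r // sub0r normrN.
  by rewrite -[s - t0]addr0 -t00 ger0_norm; lra.
have r0 := enorm_neq0 p0; set rho := enorm p in hp r0.
have rn : rho != 0 by rewrite gt_eqF.
have ab : (p.1 / rho) ^+ 2 + (- (p.2 / rho)) ^+ 2 = 1.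
  rewrite sqrrN !expr_div_n -mulrDl; have := sqr_enorm p; rewrite /edot -!expr2 => <-.
  by rewrite divff // expf_neq0.
have s1 : 1 ^+ 2 = 1 :> R by rewrite expr1n.
rewrite -(D_orth Hm _ _ ab s1); have hg' := geodesic_orth ab s1 hg.
apply: (geodesic_D_axis hg' r0 (hp p0)) => //.
have := sqr_enorm p; rewrite -/rho /edot => E.
rewrite c0 /orth; congr pair; last by ring.
by apply: (mulIf rn); rewrite -expr2 E; field.
Qed.

End Poles.

(** * Lines and far points *)

Section Lines.
Variable R : realType.
Variable m : R -> R.
Hypothesis Hm : admissible_profile m.
Hypothesis Hv : von_Mangoldt m.
Implicit Types (p q : R * R) (c : R -> R * R) (s t : R).
Notation D := (D m).
Notation liso_at := (liso_at m).
Notation clairaut := (clairaut m).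

Section Funnel.
Variable k : R.
Hypothesis k0 : 0 < k.
Hypothesis hk : forall r, k <= r -> 2 * (r - k) <= m r.

Definition funnel p : R := (enorm p - k) * ((p.1 ^+ 2 - p.2 ^+ 2) / enorm p ^+ 2).

(* Where m >= 2 (r - k), the function (r - k) cos (2 theta) is 1-Lipschitz. *)
Lemma arclen_funnel c v S (a b : R) : C1data c v -> arclen m c v S -> a <= b ->
  (forall t, a <= t -> t <= b -> k <= enorm (c t)) ->
  funnel (c a) - funnel (c b) <= S b - S a.
Proof.
move=> hv hS ab far; have kp := k0.
pose rd t := edot (c t) (v t) / enorm (c t).
pose dF t := - (rd t * (((c t).1 ^+ 2 - (c t).2 ^+ 2) / enorm (c t) ^+ 2)
  + (enorm (c t) - k) * - (2 * (2 * (c t).1 * (c t).2 / enorm (c t) ^+ 2) *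
     (cross (c t) (v t) / enorm (c t) ^+ 2))).
have := @arclen_ge _ m c v S (fun t => - funnel (c t)) dF a b hS ab.
rewrite opprK addrC; apply.
  move=> t at_ tb; have nz : c t <> 0.
    by move=> e; have := far t at_ tb; rewrite e enorm0; lra.
  have r0 : enorm (c t) != 0 by rewrite gt_eqF // enorm_neq0.
  have [d1 d2 _ _] := hv; have {}d1 := d1 t; have {}d2 := d2 t; have d3 := der_enorm nz d1 d2.
  have := sqr_enorm (c t); rewrite /funnel /dF /rd /cross /edot in d3 *.
  move: d1 d2 d3 r0; move: (v t) => [v1 v2] /=.
  set x := (fun s => (c s).1); set y := (fun s => (c s).2); set r := (fun s => enorm (c s)).
  rewrite -/(x t) -/(y t) -/(r t) => d1 d2 d3 r0 E.
  have r2 : r t ^+ 2 != 0 by rewrite expf_neq0.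
  change (is_derive t 1 (fun s => - ((r s - k) * ((x s ^+ 2 - y s ^+ 2) / r s ^+ 2)))
   (- ((x t * v1 + y t * v2) / r t * ((x t ^+ 2 - y t ^+ 2) / r t ^+ 2) +
     (r t - k) * - (2 * (2 * x t * y t / r t ^+ 2) * ((x t * v2 - y t * v1) / r t ^+ 2))))).
  derc; have E4 : 2 * (2 * x t * y t / r t ^+ 2) * ((x t * v2 - y t * v1) / r t ^+ 2) =
    2 * (x t ^+ 2 - y t ^+ 2) * (x t * v1 + y t * v2) / r t ^+ 4 -
    2 * (x t * v1 - y t * v2) * (x t * x t + y t * y t) / r t ^+ 4 by field.
  by rewrite E4 -E; field.
move=> t at_ tb; have kr := far t at_ tb; have nz : c t <> 0.
  by move=> e; rewrite e enorm0 in kr; lra.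
have r0 := enorm_neq0 nz; have rn : enorm (c t) != 0 by rewrite gt_eqF.
apply: le_trans (ler_norm _) _; rewrite -ler_sqr ?nnegrE ?gnorm_ge0 // sqr_gnorm.
rewrite real_normK ?num_real // gm_polar // -/(rd t) /dF.
have hm := hk kr; have m0 := m_gt0 Hm r0; move: (sqr_enorm (c t)); rewrite /edot.
set w := cross (c t) (v t); set A := rd t; set x := (c t).1; set y := (c t).2.
move: hm m0 r0 rn kr; set r := enorm (c t); set M := m r => hm m0 r0 rn kr E.
have -> : (M / r ^+ 2 * w) ^+ 2 = M ^+ 2 * (w / r ^+ 2) ^+ 2 by field.
have : ((x ^+ 2 - y ^+ 2) / r ^+ 2) ^+ 2 + (2 * x * y / r ^+ 2) ^+ 2 = 1.
  by apply: (mulIf (expf_neq0 4 rn)); rewrite mul1r (_ : r ^+ 4 = (r ^+ 2) ^+ 2);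
    [rewrite E; field; rewrite -E expf_neq0|ring].
set al := _ / r ^+ 2; set be := 2 * x * y / r ^+ 2; set z := w / r ^+ 2 => AB.
have h4 : 4 * (r - k) ^+ 2 <= M ^+ 2 by nra.
have h5 : 4 * (r - k) ^+ 2 * z ^+ 2 <= M ^+ 2 * z ^+ 2 by rewrite ler_wpM2r // sqr_ge0.
have : (A * al - 2 * (r - k) * z * be) ^+ 2 + (A * be + 2 * (r - k) * z * al) ^+ 2 =
  (A ^+ 2 + 4 * (r - k) ^+ 2 * z ^+ 2) * (al ^+ 2 + be ^+ 2) by ring.
rewrite AB mulr1; have := sqr_ge0 (A * be + 2 * (r - k) * z * al).
rewrite (_ : - (A * al + _) = - (A * al - 2 * (r - k) * z * be)); last by ring.
rewrite sqrrN; move: (_ ^+ 2) ((A * al - _) ^+ 2) h5 => X Y; clear; lra.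
Qed.

(** [funnel] is [|p| - k] on the first axis and [k - |q|] on the second, which settles paths outside
    the disk. A path entering the disk is long enough by the radius alone. *)
Lemma D_axes p q : p.2 = 0 -> q.1 = 0 -> enorm p + enorm q - 2 * k <= D p q.
Proof.
move=> p2 q1; have kp := k0; apply: (D_ge Hm) => l [c [v [S [a [b [hv hS ab [ca cb <-]]]]]]].
have [far|/existsNP [t /not_implyP [at_ /not_implyP [tb /negP]]]] :=
  pselect (forall t, a <= t -> t <= b -> k <= enorm (c t)).
  have := arclen_funnel hv hS ab far; rewrite /funnel ca cb p2 q1 expr0n subr0 sub0r.
  have pn : enorm p ^+ 2 != 0.
    by rewrite expf_neq0 // gt_eqF // -ca; apply: lt_le_trans k0 (far _ _ _).
  have qn : enorm q ^+ 2 != 0.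
    by rewrite expf_neq0 // gt_eqF // -cb; apply: lt_le_trans k0 (far _ _ _).
  have -> : p.1 ^+ 2 = enorm p ^+ 2 by rewrite sqr_enorm /edot p2; ring.
  have -> : q.2 ^+ 2 = enorm q ^+ 2 by rewrite sqr_enorm /edot q1; ring.
  by rewrite mulNr !divff //; lra.
rewrite -ltNge => ht.
have := arclen_radius hv hS at_; have := arclen_radius hv hS tb; rewrite ca cb.
by rewrite !ler_norml => /andP[_ ?] /andP[? _]; lra.
Qed.

Lemma long_segment (n : R) (e : R) : 0 < e -> e <= 1 -> exists x : R -> R * R,
  (forall s t, `|s| <= n - (2 * k + 2) -> `|t| <= n - (2 * k + 2) ->
     `|D (x s) (x t) - `|s - t| | <= e) /\
  forall s, enorm (x s) <= 2 * k + 2 + `|s|.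
Proof.
move=> e0 e1; have kp := k0.
have [n0|n0] := ltP n 0.
  exists (fun=> 0); split=> [s t h _|s]; first by exfalso; have := normr_ge0 s; lra.
  by rewrite enorm0; have := normr_ge0 s; lra.
pose p : R * R := (n, 0); pose q : R * R := (- n, 0).
have [l [c [v [S [a [b [hv hS ab [ca cb El]]]]]]] hl] := D_adherent Hm p q e0.
have pn : enorm p = n by rewrite /enorm /edot /= mul0r addr0 -expr2 sqrtr_sqr ger0_norm.
have qn : enorm q = n.
  by rewrite /enorm /edot /= mul0r addr0 -expr2 sqrtr_sqr normrN ger0_norm.
have Dpq : D p q <= 2 * n.
  have e1n : enorm ((1, 0) : R * R) = 1 by rewrite /enorm /edot /= mul0r addr0 mulr1 sqrtr1.
  have := D_line_le Hm n (- n) e1n; rewrite /scal /= !mulr1 !mulr0 -/p -/q opprK.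
  by rewrite ger0_norm; lra.
have [d1 _ _ _] := hv.
(* The path crosses the second axis at some [z]; [D_axes] on both parts, against a total length
   below [2 n + 1], gives [|z| <= 2 k + 1]. *)
have [t0 [at0 t0b z1]] : exists t, [/\ a <= t, t <= b & (c t).1 = 0].
  have g1 : - (c a).1 <= 0 by rewrite ca oppr_le0.
  have g2 : 0 <= - (c b).1 by rewrite cb opprK.
  have [t [h1 h2 h3]] := ivt ab (fun t _ _ => cvgN (der_cont (d1 t))) g1 g2.
  by exists t; split=> //; apply/eqP; rewrite -oppr_eq0; exact/eqP.
set z := c t0 in z1.
have l1 := D_arclen Hm hv hS at0; have l2 := D_arclen Hm hv hS t0b.
rewrite -/z ca cb in l1 l2.
have g1 := @D_axes p z erefl z1; have g2 := @D_axes q z erefl z1.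
rewrite pn in g1; rewrite qn in g2; rewrite (D_sym Hm q z) in g2.
have zb : enorm z <= 2 * k + 1 by lra.
have zpos := enorm_ge0 z.
have [r1 r2] : n - enorm z <= D p z /\ n - enorm z <= D z q.
  have := D_ge_radius Hm p z; have := D_ge_radius Hm z q; rewrite pn qn.
  by rewrite !ler_norml; clear => /andP[? ?] /andP[? ?]; split; lra.
(* Time is counted from [z]: the point at time [s] has distance [D p z + s] from [p]. Other times
   get the default [t0]. *)
have ex s : exists t, a <= t /\ t <= b /\ D z (c t) <= `|s| + 1 /\
    (`|s| <= n - (2 * k + 2) -> D p (c t) = D p z + s).
  have [sn|sn] := leP `|s| (n - (2 * k + 2)).
    have := sn; rewrite ler_norml => /andP[s1 s2].
    have f1 : 0 <= D p z + s by lra.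
    have f2 : D p z + s <= D (c a) (c b) by rewrite ca cb; lra.
    have [t [h1 h2 h3]] := path_at_distance Hm hv hS ab f1 f2.
    exists t; rewrite ca in h3; split=> //; split=> //; split=> //.
    have := path_almost_geodesic Hm hv hS at0 t0b h1 h2; rewrite ca cb -/z h3.
    rewrite (_ : D p z - (D p z + s) = - s); last by ring.
    by rewrite normrN ler_norml => /andP[_ ?]; lra.
  have h1 : 0 <= `|s| + 1 by have := normr_ge0 s; lra.
  by exists t0; rewrite -/z (D_refl Hm); split=> //; split=> //; split=> // h; lra.
have [tau htau] := choice ex; exists (fun s => c (tau s)); split.
  move=> s t sn tn; have [a1 [b1 [_ /(_ sn) E1]]] := htau s.
  have [a2 [b2 [_ /(_ tn) E2]]] := htau t.
  have := path_almost_geodesic Hm hv hS a1 b1 a2 b2; rewrite ca cb E1 E2.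
  rewrite (_ : D p z + s - (D p z + t) = s - t); last by ring.
  by move=> h; apply: le_trans h _; clear -hl El; lra.
move=> s; have [_ [_ [h _]]] := htau s; have := D_ge_radius Hm z (c (tau s)).
by rewrite ler_norml => /andP[? _]; lra.
Qed.

Lemma line_ex : exists l : R -> R * R, forall s t, D (l s) (l t) = `|s - t|.
Proof.
have step n : exists x : R -> R * R,
    (forall s t, `|s| <= n%:R - (2 * k + 2) -> `|t| <= n%:R - (2 * k + 2) ->
       `|D (x s) (x t) - `|s - t| | <= n.+1%:R^-1) /\
    forall s, enorm (x s) <= 2 * k + 2 + `|s|.
  by apply: long_segment; rewrite ?invr_gt0 // invf_le1 // ler1n.
have [x hx] := choice step.
have [|||l [hl _]] := @isometry_limit _ m Hm (fun=> True) x (fun s => 2 * k + 2 + `|s|).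
- by move=> s; have := normr_ge0 s; have := k0; lra.
- by move=> n s; have [_] := hx n; exact.
- move=> s t _ _ e e0; have [N1 hN1] := inv_succ_le e0.
  (* Beyond this index both [s] and [t] lie in the range where [x n] is almost isometric. *)
  pose B := 2 * k + 2 + `|s| + `|t|; exists (maxn N1 (Num.truncn B).+1) => n.
  rewrite geq_max => /andP[n1 n2].
  have B0 : 0 <= B by rewrite /B; have := k0; have := normr_ge0 s; have := normr_ge0 t; lra.
  have nB : B < n%:R.
    have /andP[_ h] := truncn_itv B0; apply: lt_le_trans h _; by rewrite ler_nat.
  have [h _] := hx n; apply: le_trans (h s t _ _) (hN1 n n1).
    by move: nB; rewrite /B; have := normr_ge0 t; lra.
  by move: nB; rewrite /B; have := normr_ge0 s; lra.
by exists l => s t; exact: hl.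
Qed.
End Funnel.

Hypothesis Hneg : exists r : R, 0 <= r /\ Gm m r < 0.
Hypothesis Hinf : exists2 c : R, 0 < c & \forall r \near +oo, c <= m r.

Lemma line_exists : exists l : R -> R * R, forall s t, D (l s) (l t) = `|s - t|.
Proof.
(* The slope 2 matches the factor 2 in the derivative of cos (2 theta). *)
have [k k0 h] := m_linear Hm Hv Hneg Hinf (ltac:(lra) : 0 <= 2 :> R).
apply: (@line_ex k k0) => r kr; have := h k r (lexx _) kr; have := m_gt0 Hm k0; lra.
Qed.

End Lines.

(** * Rays from far points *)

Section FarRays.
Variable R : realType.
Variable m : R -> R.
Hypothesis Hm : admissible_profile m.
Implicit Types (p q v w : R * R) (c l : R -> R * R) (s t : R).
Notation D := (D m).
Notation liso_at := (liso_at m).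
Notation clairaut := (clairaut m).

Lemma gm_polar2 p v w : p <> 0 -> gm m p v w =
  (edot p v / enorm p) * (edot p w / enorm p) +
  (m (enorm p) / enorm p ^+ 2) ^+ 2 * (cross p v * cross p w).
Proof.
move=> p0; have h1 := gm_polar Hm (v + w) p0; have h2 := gm_polar Hm v p0; have h3 := gm_polar Hm w p0.
rewrite gm_sqrD h2 h3 in h1; apply: (mulfI (_ : (2 : R) != 0)); first by rewrite pnatr_eq0.
have e1 : edot p (v + w) = edot p v + edot p w by rewrite /edot /=; ring.
have e2 : cross p (v + w) = cross p v + cross p w by rewrite /cross /=; ring.
rewrite e1 e2 in h1; move: h1; move: (gm m p v w) (edot p v) (edot p w) (cross p v) (cross p w).
move=> g a b x y h.
have -> : 2 * g = (a / enorm p) ^+ 2 + (m (enorm p) / enorm p ^+ 2 * x) ^+ 2 + 2 * g +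
   ((b / enorm p) ^+ 2 + (m (enorm p) / enorm p ^+ 2 * y) ^+ 2) -
   (a / enorm p) ^+ 2 - (m (enorm p) / enorm p ^+ 2 * x) ^+ 2 -
   (b / enorm p) ^+ 2 - (m (enorm p) / enorm p ^+ 2 * y) ^+ 2 by ring.
by rewrite h; ring.
Qed.

Lemma orth_between p q : p <> 0 -> enorm p = enorm q -> exists a b : R,
  a ^+ 2 + b ^+ 2 = 1 /\ orth a b 1 p = q.
Proof.
move=> p0 pq; have r0 := enorm_neq0 p0; have rn : enorm p != 0 by rewrite gt_eqF.
have E1 := sqr_enorm p; have E2 := sqr_enorm q; rewrite -pq in E2.
exists (edot p q / enorm p ^+ 2), (cross p q / enorm p ^+ 2); split.
  have -> : (edot p q / enorm p ^+ 2) ^+ 2 + (cross p q / enorm p ^+ 2) ^+ 2 =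
    edot p p * edot q q / (enorm p ^+ 2 * enorm p ^+ 2).
    by rewrite /edot /cross; field.
  by rewrite -E1 -E2 divff // !mulf_neq0 // expf_neq0.
rewrite [RHS]surjective_pairing /orth; congr pair.
  rewrite (_ : _ - _ = q.1 * edot p p / enorm p ^+ 2); last by rewrite /edot /cross; field.
  by rewrite -E1 mulfK // expf_neq0.
rewrite (_ : _ + _ = q.2 * edot p p / enorm p ^+ 2); last by rewrite /edot /cross; field.
by rewrite -E1 mulfK // expf_neq0.
Qed.

Lemma liso_all_clairaut c : (forall t, liso_at c t) -> forall s t, clairaut c s = clairaut c t.
Proof.
move=> hl s t; have := ler_norm t; have := ler_norm (- t); have := ler_norm s.
have := ler_norm (- s); have := normr_ge0 s; have := normr_ge0 t; rewrite !normrN => *.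
by apply: (@clairaut_cst _ _ Hm c (- 1 - `|t| - `|s|) (1 + `|t| + `|s|)) => //; lra.
Qed.

Lemma D_le_enorm p q : D p q <= enorm p + enorm q.
Proof.
have key x : D 0 x <= enorm x.
  have [->|/eqP x0] := eqVneq x 0; first by rewrite D_refl // enorm0.
  have r0 := enorm_neq0 x0; have rn : enorm x != 0 by rewrite gt_eqF.
  pose u := scal (enorm x)^-1 x.
  have u1 : enorm u = 1 by rewrite enormZ normrV ?unitfE // ger0_norm ?enorm_ge0 // mulVf.
  have := D_line_le Hm 0 (enorm x) u1.
  rewrite (_ : scal 0 u = 0); last by rewrite /scal !mul0r.
  rewrite (_ : scal (enorm x) u = x); last first.
    by rewrite [RHS]surjective_pairing /u /scal /= !mulrA divff // !mul1r.
  by rewrite sub0r normrN (ger0_norm (enorm_ge0 _)).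
by apply: le_trans (D_tri Hm 0 p q) _; rewrite (D_sym Hm p 0) lerD.
Qed.

Lemma shift_ray c s : (forall x y, D (c x) (c y) = `|x - y|) -> ray m (fun t => c (s + t)).
Proof.
move=> h; have E x y : D (c (s + x)) (c (s + y)) = `|x - y|.
  by rewrite h; congr (`|_|); ring.
split; last by move=> x y _ _; rewrite (rdist_D Hm) E.
by apply/(geodesicP Hm) => t; exists 1; rewrite ?ltr01.
Qed.

Lemma ray_orth (a b sg : R) c : a ^+ 2 + b ^+ 2 = 1 -> sg ^+ 2 = 1 ->
  ray m c -> ray m (fun x => orth a b sg (c x)).
Proof.
move=> ab sg1 [hg h]; split; first exact: geodesic_orth.
by move=> s t s0 t0; rewrite rdist_D // D_orth // -rdist_D // h.
Qed.

Lemma ray_liso c t : ray m c -> liso_at c t.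
Proof. by case=> /(geodesicP Hm) h _; exact: h. Qed.

(* By the energy identity the radial speed does not vanish where m > |nu|; were
   it positive at a first crossing, the radius would have a critical maximum. *)
Lemma line_incoming l (nu a rho : R) : (forall s t, D (l s) (l t) = `|s - t|) ->
  (forall t, clairaut l t = nu) -> (forall r, a <= r -> `|nu| < m r) ->
  0 < a -> a <= rho -> enorm (l 0) < rho ->
  exists t, enorm (l t) = rho /\ rvel l t < 0.
Proof.
move=> hl hnu hm a0 arho l0.
have li t : liso_at l t by exists 1; rewrite ?ltr01.
have cr t : {for t, continuous (fun s => enorm (l s))} by exact: liso_cont_rad (li t).
have T0 : - (rho + enorm (l 0)) <= 0 by have := enorm_ge0 (l 0); lra.
have far : rho <= enorm (l (- (rho + enorm (l 0)))).
  have := D_le_enorm (l (- (rho + enorm (l 0)))) (l 0); rewrite hl subr0 ler0_norm //; lra.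
have nz t : rho <= enorm (l t) -> l t <> 0 by move=> h e; move: h; rewrite e enorm0; lra.
have vn t : rho <= enorm (l t) -> rvel l t != 0.
  move=> h; have En := liso_energy Hm (li t) (nz t h); apply/eqP => v0.
  move: En; rewrite v0 expr0n add0r hnu; have hh := hm _ (le_trans arho h).
  have mp : 0 < m (enorm (l t)) by apply: le_lt_trans hh.
  move=> /(congr1 (fun x => x * m (enorm (l t)) ^+ 2)).
  rewrite mul1r divfK ?expf_neq0 ?gt_eqF // => E.
  have : `|nu| ^+ 2 < m (enorm (l t)) ^+ 2 by rewrite ltr_sqr ?nnegrE // ltW.
  by rewrite real_normK ?num_real // E ltxx.
have g1 : - enorm (l (- (rho + enorm (l 0)))) <= - rho by rewrite lerN2.
have g2 : - rho <= - enorm (l 0) by rewrite lerN2 ltW.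
have [t1 [_ t10 E1]] := ivt T0 (fun t _ _ => cvgN (cr t)) g1 g2.
have {}E1 : enorm (l t1) = rho by apply: oppr_inj.
exists t1; split=> //; rewrite lt_neqAle vn ?E1 //=; rewrite leNgt; apply/negP => vp.
have {}t10 : t1 < 0.
  rewrite lt_neqAle t10 andbT; apply/negP => /eqP e; by move: l0; rewrite -e E1 ltxx.
have dr t : rho <= enorm (l t) -> is_derive t 1 (fun s => enorm (l s)) (rvel l t).
  by move=> h; exact: liso_der_rad (li t) (nz t h).
have [t2 [h1 h2 hmax]] := evt_max (ltW t10) (fun t _ _ => cr t).
have v2 : 0 < rvel l t1 / 2 by lra.
have rt1 : rho <= enorm (l t1) by rewrite E1.
have /derP := dr t1 rt1; move=> /(_ _ v2) [d d0 hd].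
have t1n : 0 < - t1 by rewrite oppr_gt0.
have [h [h0 hd1 ht1]] := two_bounds d0 t1n.
have big : rho < enorm (l (t1 + h)).
  have := hd (t1 + h); rewrite (_ : t1 + h - t1 = h); last by ring.
  rewrite gtr0_norm // => /(_ hd1); rewrite E1 ler_norml => /andP[hh _].
  have := mulr_gt0 h0 vp; clear -hh; lra.
have r2 : rho < enorm (l t2) by apply: lt_le_trans big (hmax _ _ _); lra.
have t21 : t1 < t2.
  by rewrite lt_neqAle h1 andbT; apply/negP => /eqP e; move: r2; rewrite -e E1 ltxx.
have t20 : t2 < 0.
  by rewrite lt_neqAle h2 andbT; apply/negP => /eqP e; move: r2; rewrite e; lra.
have k0 : 0 < Num.min (t2 - t1) (- t2) by rewrite lt_min subr_gt0 t21 oppr_gt0.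
have : rvel l t2 = 0.
  apply: (der_max k0 (dr t2 (ltW r2))) => x.
  rewrite lt_min !ltr_norml => /andP[/andP[h3 h4] /andP[h5 h6]]; apply: hmax; clear -h3 h4 h5 h6; lra.
by apply/eqP/vn/ltW.
Qed.

Hypothesis Hv : von_Mangoldt m.
Hypothesis Hneg : exists r : R, 0 <= r /\ Gm m r < 0.
Hypothesis Hinf : exists2 c : R, 0 < c & \forall r \near +oo, c <= m r.

Lemma radial_line_geodesic v (t0 : R) : enorm v = 1 -> geodesic m (fun t => scal (t - t0) v).
Proof.
have [W [dW hWf]] := radial_potential Hm Hv; have [w hw] := potential_bounded Hm Hv Hneg Hinf dW.
by move=> v1; exact: (line_geodesic Hm dW hWf hw).
Qed.

Lemma poles_near_origin : exists2 e : R, 0 < e & forall q, enorm q <= e -> pole m q.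
Proof.
have [W [dW hWf]] := radial_potential Hm Hv; have [w hw] := potential_bounded Hm Hv Hneg Hinf dW.
have [rho rho0 hrho] := potential_infty Hm dW (- w); exists rho => // q qr.
apply: (pole_of_potential Hm Hv dW hWf hw) => q0; apply: hrho => //; exact: enorm_neq0.
Qed.

Lemma vel_scal v (t0 t : R) : vel (fun s => scal (s - t0) v) t = v.
Proof.
rewrite (@C1data_vel _ _ (fun=> v)) //.
by split=> /= s; try exact: cst_continuous; rewrite /scal /=; derc; ring.
Qed.

Lemma meridian_ray v (rho : R) : enorm v = 1 -> 0 <= rho -> ray m (fun t => scal (t - - rho) v).
Proof.
move=> v1 r0; apply: (ray_from Hm); first exact: radial_line_geodesic.
move=> s s0; rewrite D_line // ?mulr_ge0 //; [|lra|lra].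
by rewrite (_ : _ - _ = - s); [rewrite normrN ger0_norm|ring].
Qed.

Lemma unit_scal q : q <> 0 -> exists2 u, enorm u = 1 & q = scal (enorm q) u.
Proof.
move=> q0; have rn : enorm q != 0 by rewrite gt_eqF // enorm_neq0.
exists (scal (enorm q)^-1 q).
  by rewrite enormZ normrV ?unitfE // ger0_norm ?enorm_ge0 // mulVf.
by rewrite [LHS]surjective_pairing /scal /= !mulrA divff // !mul1r.
Qed.

Lemma gm_rvel q c : c 0 = q -> q <> 0 -> gm m q (vel c 0) (- q) = - (enorm q * rvel c 0).
Proof.
move=> c0 q0; rewrite gm_polar2 //; have r0 := enorm_neq0 q0.
have -> : cross q (- q) = 0 by rewrite /cross /=; ring.
have -> : edot q (- q) = - enorm q ^+ 2 by rewrite sqr_enorm /edot /=; ring.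
by rewrite /rvel c0; field; rewrite gt_eqF.
Qed.

Lemma Aset_ray c : c 0 <> 0 -> ray m c -> rvel c 0 < 0 -> Aset m (c 0).
Proof.
move=> c0 hc v0; split=> //; exists c; split=> //.
by rewrite gm_rvel // oppr_gt0 pmulr_rlt0 // enorm_neq0.
Qed.

(** For C, a vector that does not point inward is served by the outward meridian. An inward vector
    is served by the incoming part of the line or by its mirror image in the meridian of [q],
    whichever has angular component of matching sign. *)
Lemma far_points : exists B : R, forall q, B < enorm q -> Aset m q /\ Cset m q.
Proof.
have [l hl] := line_exists Hm Hv Hneg Hinf.
have li t : liso_at l t by exists 1; rewrite ?ltr01.
pose nu := clairaut l 0; have hnu t : clairaut l t = nu by exact: liso_all_clairaut.
have [a a0 hm] := m_unbounded Hm Hv Hneg Hinf `|nu|.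
exists (Num.max a (enorm (l 0))) => q; rewrite gt_max => /andP[aq lq].
have q0 : q <> 0 by move=> e; move: aq; rewrite e enorm0; lra.
have [t [Et vt]] := line_incoming hl hnu hm a0 (ltW aq) lq.
have lt0 : l t <> 0 by move=> e; move: Et; rewrite e enorm0; lra.
have [a1 [b1 [ab1 E1]]] := orth_between lt0 Et.
have s11 : 1 ^+ 2 = 1 :> R by rewrite expr1n.
have s12 : (- 1) ^+ 2 = 1 :> R by rewrite sqrrN expr1n.
pose c1 s := orth a1 b1 1 (l (t + s)).
have ray1 : ray m c1 by apply: ray_orth => //; exact: shift_ray.
have c10 : c1 0 = q by rewrite /c1 addr0.
have vc1 : vel c1 0 = orth a1 b1 1 (vel l t).
  rewrite (vel_orth Hm) //; last by apply: ray_liso; exact: shift_ray.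
  congr orth; have [d1 d2 _ _] := liso_C1 Hm (li t).
  have ds : is_derive (0 : R) 1 (fun s => t + s) 1 by derc; ring.
  rewrite -[in X in is_derive X](addr0 t) in d1; rewrite -[in X in is_derive X](addr0 t) in d2.
  have e1 := dercomp d1 ds; have e2 := dercomp d2 ds.
  by rewrite {1}/vel !derive1E; have [_ ->] := e1; have [_ ->] := e2; rewrite !mulr1 -surjective_pairing.
have rv1 : edot q (vel c1 0) = enorm q * rvel l t.
  by rewrite vc1 -[X in edot X _]E1 edot_orth // /rvel Et mulrCA divff ?mulr1 // gt_eqF // enorm_neq0.
have rq := enorm_neq0 q0.
split.
  rewrite -c10; apply: Aset_ray => //; first by rewrite c10.
  by rewrite /rvel c10 rv1 mulrAC divff ?mul1r // gt_eqF.
move=> v v1; have [av|av] := leP 0 (edot q v).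
  have [u u1 Eu] := unit_scal q0; exists (fun s => scal (s - - enorm q) u); split.
  - exact: meridian_ray (enorm_ge0 _).
  - by rewrite sub0r opprK -Eu.
  rewrite vel_scal gm_polar2 //.
  have -> : cross q u = 0 by rewrite Eu /cross /scal /=; ring.
  have -> : edot q u = enorm q.
    rewrite {1}Eu (_ : edot _ _ = enorm q * edot u u); last by rewrite /edot /scal /=; ring.
    by rewrite -sqr_enorm u1 expr1n mulr1.
  by rewrite !mulr0 addr0 divff ?gt_eqF // mulr1 divr_ge0 // ltW.
have main c : ray m c -> c 0 = q -> edot q (vel c 0) = enorm q * rvel l t ->
    0 <= cross q v * cross q (vel c 0) ->
    exists c, [/\ ray m c, c 0 = q & 0 <= gm m q v (vel c 0)].
  move=> h1 h2 h3 h4; exists c; split=> //; rewrite gm_polar2 // h3 addr_ge0 //.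
    rewrite (_ : enorm q * _ / _ = rvel l t); last by field; rewrite gt_eqF.
    by rewrite mulr_le0 // ?(ltW vt) // pmulr_lle0 ?invr_gt0 // ltW.
  by rewrite mulr_ge0 // sqr_ge0.
have [h|h] := leP 0 (cross q v * cross q (vel c1 0)); first exact: main h.
(* Cosine and sine of twice the polar angle of [q], so that [orth A B (-1)] is the reflection fixing
   [q]. *)
pose A := (q.1 ^+ 2 - q.2 ^+ 2) / enorm q ^+ 2; pose B := 2 * q.1 * q.2 / enorm q ^+ 2.
have rn : enorm q != 0 by rewrite gt_eqF.
have Eq := sqr_enorm q; rewrite /edot -!expr2 in Eq.
have AB : A ^+ 2 + B ^+ 2 = 1.
  have -> : A ^+ 2 + B ^+ 2 = (q.1 ^+ 2 + q.2 ^+ 2) ^+ 2 / (enorm q ^+ 2) ^+ 2 by rewrite /A /B; field.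
  by rewrite -Eq divff // !expf_neq0.
have Rq : orth A B (- 1) q = q.
  rewrite [RHS]surjective_pairing /orth; congr pair.
    have -> : A * q.1 - -1 * B * q.2 = q.1 * (q.1 ^+ 2 + q.2 ^+ 2) / enorm q ^+ 2.
      by rewrite /A /B; field.
    by rewrite -Eq mulfK // expf_neq0.
  have -> : B * q.1 + -1 * A * q.2 = q.2 * (q.1 ^+ 2 + q.2 ^+ 2) / enorm q ^+ 2.
    by rewrite /A /B; field.
  by rewrite -Eq mulfK // expf_neq0.
have vc2 : vel (fun s => orth A B (- 1) (c1 s)) 0 = orth A B (- 1) (vel c1 0).
  by rewrite (vel_orth Hm) //; exact: ray_liso.
apply: (main (fun s => orth A B (- 1) (c1 s))).
- exact: ray_orth.
- by rewrite c10.
- by rewrite vc2 -[in LHS]Rq edot_orth.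
rewrite vc2; have -> : cross q (orth A B (- 1) (vel c1 0)) = - cross q (vel c1 0).
  rewrite -{1}Rq; move: (vel c1 0) => x.
  have -> : cross (orth A B (-1) q) (orth A B (-1) x) = - (A ^+ 2 + B ^+ 2) * cross q x.
    by rewrite /cross /orth /=; ring.
  by rewrite AB; ring.
by rewrite mulrN oppr_ge0 ltW.
Qed.

End FarRays.

(** * The critical parallel *)

Section Corners.
Variable R : realType.
Variable m : R -> R.
Hypothesis Hm : admissible_profile m.
Implicit Types (p q v : R * R) (c e : R -> R * R) (s t : R).
Notation D := (D m).
Notation liso_at := (liso_at m).
Notation clairaut := (clairaut m).

(** A 1-Lipschitz curve whose ends are as far apart as its duration leaves no slack to any of its
    parts. *)
Lemma iso_on_of_ends c (a b : R) : a <= b ->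
  (forall s t, a <= s -> s <= t -> t <= b -> D (c s) (c t) <= t - s) ->
  b - a <= D (c a) (c b) -> iso_on m c a b.
Proof.
move=> ab hle hab; have key s t : a <= s -> s <= t -> t <= b -> D (c s) (c t) = t - s.
  move=> as_ st tb; apply/eqP; rewrite eq_le hle //=.
  have h1 := hle a s (lexx _) as_ (le_trans st tb).
  have h2 := hle t b (le_trans as_ st) tb (lexx _).
  have t1 := D_tri Hm (c s) (c a) (c b); have t2 := D_tri Hm (c t) (c s) (c b); lra.
move=> s t as_ sb at_ tb; have [st|/ltW ts] := leP s t.
  by rewrite key // distrC ger0_norm // subr_ge0.
by rewrite D_sym // key // ger0_norm // subr_ge0.
Qed.

Lemma iso_on_lip c (a b s t : R) : iso_on m c a b -> a <= s -> s <= t -> t <= b ->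
  D (c s) (c t) <= t - s.
Proof.
move=> h as_ st tb; rewrite h ?(le_trans st) ?(le_trans as_) //.
by rewrite distrC ger0_norm // subr_ge0.
Qed.

Lemma lip_concat c e (a b x : R) : c x = e x ->
  (forall s t, a <= s -> s <= t -> t <= x -> D (c s) (c t) <= t - s) ->
  (forall s t, x <= s -> s <= t -> t <= b -> D (e s) (e t) <= t - s) ->
  let k t := if t <= x then c t else e t in
  forall s t, a <= s -> s <= t -> t <= b -> D (k s) (k t) <= t - s.
Proof.
move=> ce hc he k s t as_ st tb; rewrite /k.
have [sx|xs] := leP s x; have [tx|xt] := leP t x.
- exact: hc.
- have h1 := hc s x as_ sx (lexx _); have h2 := he x t (lexx _) (ltW xt) tb.
  by have := D_tri Hm (c x) (c s) (e t); rewrite -ce in h2; clear ce; lra.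
- by have := lt_le_trans xs (le_trans st tx); rewrite ltxx.
- by apply: he => //; exact: ltW.
Qed.

Lemma vel_near c e t (d : R) : 0 < d -> (forall s, `|s - t| < d -> c s = e s) ->
  vel c t = vel e t.
Proof.
move=> d0 h; rewrite /vel !derive1E; congr pair; apply: near_eq_derive; rewrite ?oner_neq0 //;
  by exists d => // s /=; rewrite distrC => hs; rewrite h.
Qed.

Lemma clairaut_near c e t (d : R) : 0 < d -> (forall s, `|s - t| < d -> c s = e s) ->
  clairaut c t = clairaut e t.
Proof.
move=> d0 h; rewrite /clairaut h ?subrr ?normr0 //; congr (_ * cross _ _).
exact: vel_near d0 h.
Qed.

(* Reflecting the part before a second point on the axis again gives a
   minimal curve, so the Clairaut constant equals its opposite. *)
Lemma axis_corner c (d x : R) : iso_on m c 0 d -> 0 < x -> x < d ->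
  (c 0).2 = 0 -> (c x).2 = 0 -> clairaut c x = 0.
Proof.
move=> hc x0 xd c0 cx; have e10 : 1 ^+ 2 + 0 ^+ 2 = 1 :> R by rewrite expr1n expr0n addr0.
have s12 : (- 1) ^+ 2 = 1 :> R by rewrite sqrrN expr1n.
pose c' t := orth 1 0 (- 1) (c t).
have fix_axis p : p.2 = 0 -> orth 1 0 (- 1) p = p.
  by move=> p2; rewrite [RHS]surjective_pairing /orth p2; congr pair; ring.
have d0 : 0 <= d by lra.
pose k t := if t <= x then c' t else c t.
have hk : iso_on m k 0 d.
  apply: iso_on_of_ends => //.
    apply: lip_concat.
    - exact: fix_axis.
    - by move=> s t s0 st tx; rewrite D_orth //; apply: (iso_on_lip hc) => //; lra.
    - by move=> s t s0 st tx; apply: (iso_on_lip hc) => //; lra.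
  have -> : k 0 = c 0 by rewrite /k (ltW x0) /c' fix_axis.
  have -> : k d = c d by rewrite /k leNgt xd.
  rewrite hc ?lexx //.
  by rewrite !sub0r normrN ger0_norm // subr0.
have hl t : 0 < t -> t < d -> liso_at c t by move=> ? ?; exact: (iso_on_liso hc).
have hl' t : 0 < t -> t < d -> liso_at k t by move=> ? ?; exact: (iso_on_liso hk).
have x2 : 0 < x / 2 by lra. have x2d : x / 2 < d by lra.
have y2 : 0 < (x + d) / 2 by lra. have y2d : (x + d) / 2 < d by lra.
have E1 : clairaut k (x / 2) = - clairaut c (x / 2).
  rewrite (@clairaut_near _ c' _ (x / 2)) //.
    by rewrite clairaut_orth // ?mulN1r //; exact: hl.
  by move=> s; rewrite ltr_norml => /andP[h1 h2]; rewrite /k ifT //; lra.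
have E2 : clairaut k ((x + d) / 2) = clairaut c ((x + d) / 2).
  have dx : 0 < (d - x) / 2 by lra.
  apply: (clairaut_near dx) => s; rewrite ltr_norml => /andP[h1 h2].
  by rewrite /k ifF //; apply/negbTE; rewrite -ltNge; lra.
have E3 := clairaut_cst Hm hl' x2 x2d y2 y2d.
have E4 := clairaut_cst Hm hl x2 x2d y2 y2d; have E5 := clairaut_cst Hm hl x2 x2d x0 xd.
have : clairaut c (x / 2) = - clairaut c (x / 2) by rewrite {1}E4 -E2 -E3.
by rewrite -E5; move: (clairaut c (x / 2)) => u; clear; lra.
Qed.

Lemma first_zero (f : R -> R) (a b : R) : a <= b ->
  (forall x, a <= x -> x <= b -> {for x, continuous f}) -> 0 < f a -> f b <= 0 ->
  exists z, [/\ a < z, z <= b, f z = 0 & forall x, a <= x -> x < z -> 0 < f x].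
Proof.
move=> ab cf fa fb; pose S := [set s | [/\ a <= s, s <= b & forall x, a <= x -> x <= s -> 0 < f x]].
have Sa : S a by split=> // x ax xa; rewrite (_ : x = a) //; apply/eqP; rewrite eq_le ax xa.
have hS : has_sup S by split; [exists a|exists b => s []].
pose z := sup S; have az : a <= z by exact: (ub_le_sup hS.2 Sa).
have zb : z <= b by apply: ge_sup => [|s []//]; exists a.
have pos x : a <= x -> x < z -> 0 < f x.
  move=> ax xz; have zx : 0 < z - x by rewrite subr_gt0.
  have [s [as_ sb hs] ] := sup_adherent zx hS; rewrite -/z => h.
  by apply: hs => //; lra.
have fz0 : f z = 0.
  have [neg|ps|//] := ltgtP (f z) 0.
    exfalso; have az' : a < z.
      by rewrite lt_neqAle az andbT; apply/negP => /eqP e; move: neg; rewrite -e; lra.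
    have n2 : 0 < - f z by lra.
    have /contP := cf z az zb; move=> /(_ _ n2) [d d0 hd].
    have az0 : 0 < z - a by rewrite subr_gt0.
    have [k [k0 kd ka]] := two_bounds d0 az0.
    have := hd (z - k); rewrite addrAC subrr add0r normrN gtr0_norm // => /(_ kd).
    have az2 : a <= z - k by lra. have zk : z - k < z by lra.
    by have := pos _ az2 zk; rewrite ltr_norml => ? /andP[? ?]; lra.
  exfalso; have /contP := cf z az zb; move=> /(_ _ ps) [d d0 hd].
  have zb' : z < b.
    by rewrite lt_neqAle zb andbT; apply/negP => /eqP e; move: ps; rewrite e; lra.
  have bz0 : 0 < b - z by rewrite subr_gt0.
  have [k [k0 kd ka]] := two_bounds d0 bz0.
  have : S (z + k).
    split; [lra|lra|move=> x ax xk]; have [xz|zx] := ltP x z; first exact: pos.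
    have := hd x; rewrite ger0_norm ?subr_ge0 // => /(_ ltac:(lra)).
    by rewrite ltr_norml => /andP[? _]; lra.
  by move=> /(ub_le_sup hS.2); rewrite -/z; lra.
exists z; split=> //; rewrite lt_neqAle az andbT; apply/negP => /eqP e.
by move: fa; rewrite e fz0 ltxx.
Qed.

Lemma cont_pos_near (f : R -> R) (x : R) : {for x, continuous f} -> 0 < f x ->
  exists2 d : R, 0 < d & forall y, `|y - x| < d -> 0 < f y.
Proof.
move=> /contP cf fx; have [d d0 hd] := cf _ fx; exists d => // y hy.
by have := hd y hy; rewrite ltr_norml => /andP[? _]; lra.
Qed.

End Corners.

(** * Rays starting on the first critical parallel *)

Section CriticalParallel.
Variable R : realType.
Variable m : R -> R.
Hypothesis Hm : admissible_profile m.
Hypothesis Hv : von_Mangoldt m.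
Implicit Types (p q v : R * R) (c e : R -> R * R) (r s t x : R).
Notation D := (D m).
Notation liso_at := (liso_at m).
Notation clairaut := (clairaut m).
Notation m1 := (derivs m 1).
Notation m2 := (derivs m 2).
Variable r1 : R.
Hypothesis r10 : 0 < r1.
Hypothesis mr1 : m1 r1 = 0.
Hypothesis m1_pos : forall r, 0 <= r -> r < r1 -> 0 < m1 r.
Notation M := (m r1).

Lemma critical_m_gt0 : 0 < M. Proof. exact: m_gt0. Qed.

Lemma m_le_critical r : 0 <= r -> r <= r1 -> m r <= M.
Proof.
move=> r0; rewrite le_eqVlt => /predU1P[->//|rr].
apply: (@mono_le _ m m1) => //; first exact: ltW.
- by move=> x _ _; exact: der_m.
- by move=> x _ _; exact: cont_m.
- by move=> x rx xr; apply/ltW/m1_pos => //; apply: le_trans r0 (ltW rx).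
Qed.

Lemma m_lt_critical r : 0 <= r -> r < r1 -> m r < M.
Proof.
move=> r0 rr; apply: (@mono_lt _ m m1) => //.
- by move=> x _ _; exact: der_m.
- by move=> x _ _; exact: cont_m.
- by move=> x rx xr; apply: m1_pos => //; apply: le_trans r0 (ltW rx).
Qed.

(** The function [(m'^2 - 1)/m^2] has derivative [2 m' (1 - wronsk)/m^3], non-negative before [r1],
    and equals [- 1/M^2] at [r1]. Equality holds on the round sphere. *)
Lemma critical_energy r : 0 < r -> r <= r1 -> m1 r ^+ 2 + (m r / M) ^+ 2 <= 1.
Proof.
move=> r0 rr; have Mn : M != 0 by rewrite gt_eqF // critical_m_gt0.
pose g x := (m1 x ^+ 2 - 1) / m x ^+ 2.
have dg (x : R) : 0 < x -> is_derive x 1 g (2 * m1 x / m x ^+ 3 * (1 - wronsk m x)).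
  move=> x0; have e1 := der_m Hm x; have e2 := der_m1 Hm x.
  have mn : m x != 0 by rewrite gt_eqF // (m_gt0 Hm).
  have mn2 : m x ^+ 2 != 0 by rewrite expf_neq0.
  rewrite /g /wronsk; move: (derivs m 1) (derivs m 2) e1 e2 => a b e1 e2.
  by derc; field.
have : g r <= g r1.
  apply: (@mono_le _ g (fun x => 2 * m1 x / m x ^+ 3 * (1 - wronsk m x))) => //.
  - by move=> x rx _; apply: dg; exact: lt_trans rx.
  - by move=> x rx _; apply: der_cont (dg x _); exact: lt_le_trans rx.
  - move=> x rx xr; have x0 := lt_trans r0 rx.
    rewrite mulr_ge0 ?subr_ge0 ?(wronsk_le1 Hm Hv) ?ltW // divr_gt0 ?exprn_gt0 ?(m_gt0 Hm) //.
    by rewrite mulr_gt0 // m1_pos // ltW.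
rewrite /g mr1 expr0n sub0r; have mp := m_gt0 Hm r0; have mn : m r != 0 by rewrite gt_eqF.
rewrite ler_pdivrMr ?exprn_gt0 // mulNr mul1r expr_div_n mulNr (mulrC _^-1) => h; lra.
Qed.

(** By [critical_energy] the function [asin (m/M)] grows at rate at most [1/M], and it has to climb
    from 0 to pi/2. *)
Lemma critical_radius_ge : pi * M <= 2 * r1.
Proof.
rewrite leNgt; apply/negP => h; have rp := r10; have M0 := critical_m_gt0.
have Mn : M != 0 by rewrite gt_eqF.
have a0 : 0 < r1 / M by rewrite divr_gt0.
have api : r1 / M < pi / 2 by rewrite ltr_pdivrMr // mulrAC ltr_pdivlMr //; lra.
have pi0 := pi_gt0 R.
pose y r := m r / M.
have y1 (r : R) : 0 <= r -> r < r1 -> 0 <= y r < 1.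
  move=> r0 rr; rewrite /y ltr_pdivrMr // mul1r m_lt_critical // andbT.
  move: r0; rewrite le_eqVlt => /predU1P[<-|r0]; first by rewrite (m_0 Hm) mul0r.
  by rewrite divr_ge0 // ltW // (m_gt0 Hm).
have dy (r : R) : is_derive r 1 y (m1 r / M).
  have e1 := der_m Hm r; rewrite /y; move: (derivs m 1) e1 => b e1; by derc; field.
have yb (r : R) : 0 <= r -> r < r1 -> -1 < y r < 1.
  by move=> r0 rr; have /andP[? ->] := y1 r r0 rr; rewrite andbT; lra.
pose dA r := (Num.sqrt (1 - y r ^+ 2))^-1 * (m1 r / M).
have dasin (r : R) : 0 <= r -> r < r1 -> is_derive r 1 (fun r => asin (y r)) (dA r).
  move=> r0 rr; have := yb r r0 rr; move=> hy.
  by apply: der_eq (dercomp (is_derive1_asin hy) (dy r)) _.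
(* As [asin] is not differentiable at 1, the bound is proved before [r1] only; it keeps [m/M] below
   a constant less than 1, against continuity at [r1]. *)
have key (s : R) : 0 < s -> s < r1 -> y s <= sin (r1 / M).
  move=> s0 sr; have /andP[ys ys1] := y1 s (ltW s0) sr.
  have ysin : -1 <= y s <= 1 by apply/andP; split; lra.
  have A1 : asin (y s) <= s / M.
    have : 0 / M - asin (y 0) <= s / M - asin (y s).
      have dF (r : R) : 0 <= r -> r < r1 -> is_derive r 1 (fun r => r / M - asin (y r)) (M^-1 - dA r).
        by move=> r0 rr; have e1 := dasin r r0 rr; derc; ring.
      apply: (@mono_le _ (fun r => r / M - asin (y r)) (fun r => M^-1 - dA r)); first exact: ltW.
      - by move=> x x0 xs; apply: dF; [exact: ltW|exact: lt_trans sr].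
      - by move=> x x0 xs; apply: der_cont (dF x x0 _); exact: le_lt_trans sr.
      - move=> x x0 xs; have xr := lt_trans xs sr; have /andP[yx0 yx1] := y1 x (ltW x0) xr.
        have E := critical_energy x0 (ltW xr); rewrite -/(y x) in E.
        have q0 : 0 < 1 - y x ^+ 2 by nra.
        have S0 : 0 < Num.sqrt (1 - y x ^+ 2) by rewrite sqrtr_gt0.
        have mp := m1_pos (ltW x0) xr.
        have S1 : m1 x <= Num.sqrt (1 - y x ^+ 2).
          by rewrite -ler_sqr ?nnegrE ?(ltW S0) ?(ltW mp) // sqr_sqrtr ?(ltW q0) //; lra.
        rewrite subr_ge0 /dA mulrA ler_pdivrMr // mulVf //.
        by rewrite mulrC ler_pdivrMr // mul1r.
    rewrite mul0r sub0r {1}/y (m_0 Hm) mul0r.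
    have -> : asin (0 : R) = 0.
      rewrite -[in LHS]sin0 sinK // in_itv /=; apply/andP; split; lra.
    by rewrite oppr0; lra.
  have A2 : asin (y s) < r1 / M.
    by apply: le_lt_trans A1 _; rewrite ltr_pM2r ?invr_gt0.
  rewrite -[y s](asinK (_ : y s \in `[(-1), 1])) ?in_itv //=.
  have ag := asin_geNpi2 ysin.
  by apply/ltW; rewrite ltr_sin // in_itv /=; apply/andP; split; lra.
have s1 : sin (r1 / M) < 1.
  have cp : 0 < cos (r1 / M) by apply: cos_gt0_pihalf; apply/andP; split; lra.
  have := cos2Dsin2 (r1 / M); have := sin_le1 (r1 / M).
  rewrite le_eqVlt => /predU1P[->|//]; rewrite expr1n => E; exfalso; nra.
have e0 : 0 < 1 - sin (r1 / M) by lra.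
have /contP := der_cont (dy r1); move=> /(_ _ e0) [d d0 hd].
have [k [k0 kd ka]] := two_bounds d0 r10.
have := hd (r1 - k); rewrite addrAC subrr add0r normrN gtr0_norm // => /(_ kd).
have rk : 0 < r1 - k by lra. have rk1 : r1 - k < r1 by lra.
by have := key _ rk rk1; rewrite {3}/y divff // ltr_norml => ? /andP[? _]; lra.
Qed.

(* Otherwise half of the parallel followed by the outward meridian would be a
   minimal curve with a jump of the Clairaut constant. *)
Lemma no_diametral_ray : ~ (forall t, 0 <= t -> D (r1, 0) (r1 - t, 0) = t).
Proof.
move=> h; have M0 := critical_m_gt0; have Mn : M != 0 by rewrite gt_eqF.
have rn : r1 != 0 by rewrite gt_eqF.
have pi0 := pi_gt0 R; pose l := pi * M; have l0 : 0 < l by rewrite mulr_gt0.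
pose c t : R * R := (r1 * cos (t / M), r1 * sin (t / M)).
pose v t : R * R := (- (r1 / M * sin (t / M)), r1 / M * cos (t / M)).
have hv : C1data c v.
  split=> t.
  - by rewrite /c /v /=; derc; ring.
  - by rewrite /c /v /=; derc; ring.
  - apply: (@der_cont _ _ _ (- (r1 / M / M * cos (t / M)))); rewrite /v /=; derc; ring.
  - apply: (@der_cont _ _ _ (- (r1 / M / M * sin (t / M)))); rewrite /v /=; derc; ring.
have cn t : enorm (c t) = r1.
  rewrite /enorm (_ : edot _ _ = r1 ^+ 2 * (cos (t / M) ^+ 2 + sin (t / M) ^+ 2)).
    by rewrite cos2Dsin2 mulr1 sqrtr_sqr gtr0_norm.
  by rewrite /edot /=; ring.
have cz t : c t <> 0 by move=> E; have := cn t; rewrite E enorm0 => E2; move: r10; rewrite -E2 ltxx.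
have crs t : cross (c t) (v t) = r1 ^+ 2 / M.
  rewrite (_ : cross _ _ = r1 ^+ 2 / M * (cos (t / M) ^+ 2 + sin (t / M) ^+ 2)).
    by rewrite cos2Dsin2 mulr1.
  by rewrite /cross /=; field.
have spd t : gnorm m (c t) (v t) = 1.
  have g0 := gnorm_ge0 m (c t) (v t).
  have : gnorm m (c t) (v t) ^+ 2 = 1.
    rewrite sqr_gnorm // gm_polar // cn crs (_ : edot _ _ = 0); last by rewrite /edot /=; ring.
    by rewrite mul0r expr0n add0r; field; rewrite rn Mn.
  by move=> /eqP; rewrite sqrp_eq1 // => /eqP.
have lip1 s t : 0 <= s -> s <= t -> t <= l -> D (c s) (c t) <= t - s.
  move=> _ st _; rewrite -[leRHS]mul1r; apply: (D_le_speed Hm hv st) => x _ _.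
  by rewrite spd.
pose u : R * R := (-1, 0).
have u1 : enorm u = 1 by rewrite /enorm /edot /= mul0r addr0 mulrNN mulr1 sqrtr1.
pose e t := scal (t - (l - r1)) u.
have lip2 s t : l <= s -> s <= t -> t <= l + 1 -> D (e s) (e t) <= t - s.
  move=> _ st _; apply: le_trans (D_line_le Hm _ _ u1) _.
  rewrite (_ : _ - _ = s - t); last by ring.
  by rewrite distrC ger0_norm // subr_ge0.
have ce : c l = e l.
  rewrite /c /e /scal /= /l mulfK // cospi sinpi; congr pair; ring.
have lip := lip_concat Hm ce lip1 lip2; set k := (fun t => _) in lip.
have k0 : k 0 = (r1, 0).
  by rewrite /k (ltW l0) /c mul0r cos0 sin0 mulr1 mulr0.
have kl : k l = (- r1, 0).
  by rewrite /k lexx /c /l mulfK // cospi sinpi mulr0 mulrN1.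
(* The diametral ray puts the antipodal points at distance [2 r1], half of the parallel joins them
   with length [l = pi M], and [pi M <= 2 r1]. *)
have l2 : l = 2 * r1.
  have := lip 0 l (lexx _) (ltW l0) ltac:(lra); rewrite k0 kl subr0.
  have rp := r10; have := h (2 * r1) ltac:(lra); rewrite (_ : r1 - 2 * r1 = - r1); last by ring.
  move=> ->; have := critical_radius_ge; rewrite -/l; lra.
have kend : k (l + 1) = (r1 - (l + 1), 0).
  rewrite /k ifF; last by apply/negbTE; rewrite -ltNge; lra.
  by rewrite /e /scal /= l2; congr pair; ring.
have hk : iso_on m k 0 (l + 1).
  apply: iso_on_of_ends => //; first lra.
  by rewrite k0 kend h ?subr0 //; lra.
have hl t : 0 < t -> t < l + 1 -> liso_at k t by move=> ? ?; exact: (iso_on_liso hk).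
have h20 : 0 < 2^-1 :> R by lra.
have l20 : 0 < l / 2 by lra. have l2l : l / 2 < l + 1 by lra.
have l30 : 0 < l + 2^-1 by lra. have l31 : l + 2^-1 < l + 1 by lra.
(* The Clairaut constant is positive on the parallel and 0 on the meridian. *)
have := clairaut_cst Hm hl l20 l2l l30 l31.
rewrite (@clairaut_near _ m k c _ _ l20); last first.
  by move=> s; rewrite ltr_norml => /andP[h1 h2]; rewrite /k ifT //; lra.
rewrite (@clairaut_near _ m k e _ _ h20); last first.
  move=> s; rewrite ltr_norml => /andP[h1 h2]; rewrite /k ifF //.
  by apply/negbTE; rewrite -ltNge; lra.
rewrite /clairaut (C1data_vel hv) vel_scal cn crs.
have -> : cross (e (l + 2^-1)) u = 0 by rewrite /cross /e /scal /=; ring.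
rewrite mulr0 /stretch (negbTE rn) => /eqP; rewrite gt_eqF //.
by rewrite mulr_gt0 // ?exprn_gt0 ?divr_gt0 ?exprn_gt0.
Qed.

Section Inward.
Variable c : R -> R * R.
Variable nu : R.
Hypothesis c_ray : ray m c.
Hypothesis nu0 : 0 < nu.
Hypothesis hnu : forall t, clairaut c t = nu.
Hypothesis c0 : c 0 = (r1, 0).

Lemma inward_nz t : c t <> 0.
Proof. by apply: (@clairaut_neq0 _ m); rewrite hnu; apply/eqP; rewrite gt_eqF. Qed.

Lemma inward_rad t : is_derive t 1 (fun s => enorm (c s)) (rvel c t).
Proof. exact: (liso_der_rad Hm (ray_liso Hm t c_ray) (@inward_nz t)). Qed.

Lemma inward_rad0 : enorm (c 0) = r1.
Proof. by rewrite c0 /enorm /edot /= mul0r addr0 -expr2 sqrtr_sqr gtr0_norm. Qed.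

Lemma ray_far t : 0 <= t -> t <= enorm (c t) + r1.
Proof.
move=> t0; have [_ /(_ t 0 t0 (lexx _))] := c_ray; rewrite (rdist_D Hm) subr0 ger0_norm // => -[E].
by rewrite -{1}E -inward_rad0; exact: D_le_enorm.
Qed.

(* m - M vanishes to second order at r1, so the energy identity makes the
   radial speed at most linear in r - r1, and r - r1 vanishes identically. *)
Lemma tangential_bounded : rvel c 0 = 0 -> forall t, 0 <= t -> `|enorm (c t) - r1| < r1 / 2.
Proof.
move=> v0; have rp := r10; have M0 := critical_m_gt0; have Mn : M != 0 by rewrite gt_eqF.
have li t := ray_liso Hm t c_ray.
have nuM : nu ^+ 2 = M ^+ 2.
  have := liso_energy Hm (li 0) (@inward_nz 0); rewrite v0 expr0n add0r hnu inward_rad0.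
  by move=> /(congr1 (fun x => x * M ^+ 2)); rewrite mul1r divfK // expf_neq0.
have r20 : 0 < r1 / 2 by lra.
have r2b : r1 / 2 <= 2 * r1 by lra.
have [B B0 hB] := m_sqr_taylor Hm r20 r2b.
have r23 : r1 / 2 <= 3 / 2 * r1 by lra.
have cm x : r1 / 2 <= x -> x <= 3 / 2 * r1 -> {for x, continuous m} by move=> _ _; exact: cont_m.
have [z [z1 z2 hz]] := evt_min r23 cm.
have z0 : 0 < z by lra. have mz := m_gt0 Hm z0.
pose C := 1 + B / m z ^+ 2.
pose x t := enorm (c t) - r1.
have dx t : is_derive t 1 x (rvel c t) by have e1 := inward_rad t; rewrite /x; derc; ring.
have cx t := der_cont (dx t).
have speed t : `|x t| <= r1 / 2 -> rvel c t ^+ 2 <= B / m z ^+ 2 * x t ^+ 2.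
  move=> h; have rt : enorm (c t) = r1 + x t by rewrite /x; ring.
  move: (h); rewrite ler_norml => /andP[h1 h2].
  have r0 := enorm_neq0 (@inward_nz t); have mp := m_gt0 Hm r0.
  have mn : m (enorm (c t)) != 0 by rewrite gt_eqF.
  have En := liso_energy Hm (li t) (@inward_nz t); rewrite hnu nuM in En.
  have -> : rvel c t ^+ 2 = (m (enorm (c t)) ^+ 2 - M ^+ 2) / m (enorm (c t)) ^+ 2.
    have -> : rvel c t ^+ 2 = 1 - M ^+ 2 / m (enorm (c t)) ^+ 2 by rewrite -En; ring.
    by field.
  have := hB r1 (x t) ltac:(lra) ltac:(lra) h; rewrite -rt mr1 mulr0 mulr0 subr0.
  move=> hh; have h3 := le_trans (ler_norm _) hh.
  have m2p : 0 < m (enorm (c t)) ^+ 2 by rewrite exprn_gt0.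
  rewrite ler_pdivrMr //; apply: le_trans h3 _.
  have h4 : m z ^+ 2 <= m (enorm (c t)) ^+ 2.
    by rewrite ler_sqr ?nnegrE ?(ltW mz) ?(ltW mp) //; apply: hz; rewrite rt; lra.
  have mz2 : 0 < m z ^+ 2 by rewrite exprn_gt0.
  have -> : B / m z ^+ 2 * x t ^+ 2 * m (enorm (c t)) ^+ 2 =
    B * x t ^+ 2 * (m (enorm (c t)) ^+ 2 / m z ^+ 2) by field; rewrite gt_eqF.
  apply: ler_peMr; first by rewrite mulr_ge0 ?sqr_ge0.
  by rewrite ler_pdivlMr // mul1r.
(* Gronwall: [2 x x' <= x^2 + x'^2 <= C x^2], so [g] is non-increasing from the value 0. *)
pose g t := x t ^+ 2 * expR (- (C * t)).
have dg t : is_derive t 1 g ((2 * x t * rvel c t - C * x t ^+ 2) * expR (- (C * t))).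
  have e1 := dx t; have e2 : is_derive t 1 (fun t => expR (- (C * t))) (- C * expR (- (C * t))).
    have e3 : is_derive t 1 (fun t => - (C * t)) (- C) by derc; ring.
    by apply: der_eq (dercomp (is_derive_expR _) e3) _; ring.
  by rewrite /g; derc; ring.
have gron t : 0 <= t -> (forall s, 0 < s -> s < t -> `|x s| <= r1 / 2) -> x t = 0.
  move=> t0 h; have : - g 0 <= - g t.
    notypeclasses refine (@mono_le _ (fun t => - g t)
      (fun t => - ((2 * x t * rvel c t - C * x t ^+ 2) * expR (- (C * t)))) _ _ _ _ _ _); first by [].
    - by move=> s _ _; exact: (derN (dg s)).
    - move=> s _ _; have e1 := dg s; apply: cvgN; exact: der_cont e1.
    - move=> s s0 st; rewrite -mulNr mulr_ge0 ?expR_ge0 //.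
      have := speed s (h s s0 st); rewrite /C; have := sqr_ge0 (x s - rvel c s).
      by move: (B / _) (rvel c s) (x s) => k a b; nra.
  rewrite {1}/g /x inward_rad0 subrr expr0n mul0r oppr0 oppr_ge0 => h2.
  have : x t ^+ 2 <= 0 by move: h2; rewrite /g pmulr_lle0 // expR_gt0.
  by move=> h3; apply/eqP; rewrite -sqrf_eq0 eq_le h3 sqr_ge0.
move=> t t0; rewrite ltNge; apply/negP => big.
have cf s : {for s, continuous (fun s => r1 / 2 - `|x s|)}.
  apply: cvgB; first exact: cvg_cst.
  by apply: cvg_norm; exact: cx.
have x0 : x 0 = 0 by rewrite /x inward_rad0 subrr.
have [||z' [z0' z't fz hz']] := first_zero t0 (fun s _ _ => cf s).
- by rewrite x0 normr0 subr0.
- by rewrite subr_le0.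
have : x z' = 0.
  apply: gron; first exact: ltW.
  by move=> s s0 sz; have := hz' s (ltW s0) sz; rewrite subr_gt0 => /ltW.
by move=> E; move: fz; rewrite E normr0 subr0; lra.
Qed.

Lemma not_tangential : rvel c 0 <> 0.
Proof.
(* At time [4 r1] the ray is at distance [4 r1] from its start, which is too far for two points of
   radius at most [3 r1 / 2]. *)
move=> v0; have rp := r10; have h := tangential_bounded v0 (ltac:(lra) : 0 <= 4 * r1).
have := @ray_far (4 * r1) ltac:(lra); move: h; rewrite ltr_norml => /andP[_ ?]; lra.
Qed.

(* In terms of the angle, y = W(r) - W(r1) satisfies y'' + y >= 0 while r < r1,
   so an inward geodesic cannot return to the parallel before sweeping pi. *)
Lemma inward_stays (b : R) (th : R -> R) : rvel c 0 < 0 -> 0 < b ->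
  polar_arc m nu b (fun t => enorm (c t)) th (fun t => - rvel c t / nu) ->
  forall t, 0 < t -> t < b -> th t < pi -> enorm (c t) < r1.
Proof.
move=> v0 b0 ha t t0 tb tp; rewrite ltNge; apply/negP => rt; have rp := r10.
have [W [dW hWf]] := radial_potential Hm Hv.
have cr s : {for s, continuous (fun s => enorm (c s))} := der_cont (inward_rad s).
have v2 : 0 < - rvel c 0 / 2 by lra.
have /derP := inward_rad 0; move=> /(_ _ v2) [d d0 hd].
have near0 s : 0 < s -> s < d -> enorm (c s) < r1.
  move=> s0 sd; have := hd s; rewrite inward_rad0 subr0 gtr0_norm // => /(_ sd).
  rewrite ler_norml => /andP[_ h]; have nv : 0 < - rvel c 0 by lra.
  by have := mulr_gt0 s0 nv; lra.
have [a [a0 ad at_]] := two_bounds d0 t0.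
have cf s : {for s, continuous (fun s => r1 - enorm (c s))}.
  by apply: cvgB; [exact: cvg_cst|exact: cr].
have [||z [az zt fz hz]] := first_zero (ltW at_) (fun s _ _ => cf s).
- by rewrite subr_gt0 near0.
- by rewrite subr_le0.
have rz : enorm (c z) = r1 by lra.
have z0 : 0 < z by lra. have zb : z < b by lra.
have inside s : 0 < s -> s < z -> enorm (c s) < r1.
  move=> s0 sz; have [sa|as_] := leP a s; last by apply: near0 => //; lra.
  by have := hz s sa sz; lra.
have th_lt := arc_th_lt Hm nu0 ha; have th0 : th 0 = 0 by case: ha.
have thz : th z < pi.
  by move: zt; rewrite le_eqVlt => /predU1P[->//|/th_lt h]; exact: lt_trans tp.
have thz0 : 0 < th z by rewrite -[X in X < _]th0; exact: th_lt.
pose U s := - rvel c s / nu; pose y s := W (enorm (c s)) - W r1.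
(* The value of [y] at the angle [th z] predicted from time [s]. It is positive at time 0 because
   the start is inward, whereas [y] vanishes at [z]. *)
pose Phi s := y s * cos (th z - th s) + U s * sin (th z - th s).
have cth s : {for s, continuous (fun s => th z - th s)}.
  by apply: cvgB; [exact: cvg_cst|exact: (arc_cont_th ha)].
have cPhi : {for 0, continuous Phi}.
  apply: cvgD; apply: cvgM.
  - by apply: cvgB; [exact: (arc_cont_W dW ha)|exact: cvg_cst].
  - exact: (@continuous_comp _ _ _ (fun s => th z - th s) cos 0 (cth 0) (@continuous_cos _ _)).
  - apply: cvgM; last exact: cvg_cst.
    by apply: cvgN; exact: (liso_cont_rvel Hm (ray_liso Hm 0 c_ray) (@inward_nz 0)).
  - exact: (@continuous_comp _ _ _ (fun s => th z - th s) sin 0 (cth 0) (@continuous_sin _ _)).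
have Phi0 : 0 < Phi 0.
  rewrite /Phi /y /U inward_rad0 subrr mul0r add0r th0 subr0 mulr_gt0 ?divr_gt0 //; first lra.
  by apply: sin_gt0_pi; rewrite thz0 thz.
have [d' d'0 hd'] := cont_pos_near cPhi Phi0.
have [s [s0 sd sz]] := two_bounds d'0 z0.
have Ps : 0 < Phi s by apply: hd'; rewrite subr0 gtr0_norm.
have cosE u : cos (u - pi) = - cos u :> R by rewrite cosB cospi sinpi mulr0 addr0 mulrN1.
have sinE u : sin (u - pi) = - sin u :> R by rewrite sinB cospi sinpi mulr0 subr0 mulrN1.
have Eu x : th z - pi - th x = (th z - th x) - pi by ring.
(* Subtracting pi from the target angle flips the sign of the sine, as the sign of [m'/m - y] is
   here the opposite one; the result is [Phi s <= 0]. *)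
have := arc_predict Hm dW nu0 ha (w := W r1) (th1 := th z - pi) s0 (ltW sz) zb.
rewrite !Eu !cosE !sinE subrr cos0 sin0 rz subrr mul0r oppr0 mulr0 addr0.
have cond x : s < x -> x < z ->
    0 <= (slope_ratio m (enorm (c x)) - (W (enorm (c x)) - W r1)) * sin (th z - pi - th x).
  move=> sx xz; have x0 : 0 < x by exact: lt_trans s0 sx.
  rewrite Eu sinE mulrN -mulNr mulr_ge0 //.
    have rx := inside x x0 xz; have r0 := enorm_neq0 (@inward_nz x).
    have := potential_slope_ratio Hm Hv dW r0 (ltW rx).
    by rewrite {2}/slope_ratio mr1 mul0r subr0 => ?; lra.
  have h1 := th_lt _ _ xz; have h2 := th_lt _ _ x0; rewrite th0 in h2.
  by apply: sin_ge0_pi; apply/andP; split; lra.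
move=> /(_ cond); move: Ps; rewrite /Phi /y /U => ? ?; lra.
Qed.

Lemma not_inward : ~ rvel c 0 < 0.
Proof.
move=> v0; have rp := r10; have pi0 := pi_gt0 R; have M0 := critical_m_gt0; have n0 := nu0.
have Mn : M != 0 by rewrite gt_eqF. have nn : nu != 0 by rewrite gt_eqF.
(* Inside the parallel [m <= M], so the angular speed is at least [nu / M^2] and an angle pi is
   swept before time [b]. *)
pose b := pi * M ^+ 2 / nu + 1.
have b1 : 0 < b - 1 by rewrite /b addrK divr_gt0 // mulr_gt0 // exprn_gt0.
have b0 : 0 < b + 1 by lra.
have li t := ray_liso Hm t c_ray.
have [th [ha hth]] := polar_arc_of Hm b0 nu0 (fun t => (liso_cont Hm (li t)).1)
  (fun t => (liso_cont Hm (li t)).2) (@inward_nz) (fun t _ _ => li t) (fun t _ _ => hnu t) r10 c0.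
have th_lt := arc_th_lt Hm nu0 ha; have th0 : th 0 = 0 by case: ha.
have thb : pi <= th b.
  rewrite leNgt; apply/negP => tp.
  have inside t : 0 < t -> t < b -> enorm (c t) < r1.
    move=> t0 tb; apply: (inward_stays v0 b0 ha t0); first lra.
    by apply: lt_trans tp; exact: th_lt.
  have : th 0 - nu / M ^+ 2 * 0 <= th b - nu / M ^+ 2 * b.
    have dF t : is_derive t 1 (fun t => th t - nu / M ^+ 2 * t)
      (nu / m (enorm (c t)) ^+ 2 - nu / M ^+ 2).
      by have e1 := arc_der_th ha t; derc; ring.
    apply: (@mono_le _ (fun t => th t - nu / M ^+ 2 * t)
      (fun t => nu / m (enorm (c t)) ^+ 2 - nu / M ^+ 2)); first lra.
    - by move=> t _ _; exact: der_cont (dF t).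
    - move=> t t0 tb; have r0 := enorm_neq0 (@inward_nz t); have mp := m_gt0 Hm r0.
      rewrite subr_ge0 ler_pM2l // lef_pV2 ?posrE ?exprn_gt0 //.
      rewrite ler_sqr ?nnegrE ?(ltW mp) ?(ltW M0) // m_le_critical ?enorm_ge0 // ltW //.
      exact: inside.
  rewrite th0 mulr0 subr0 subr_ge0 leNgt => /negP; apply.
  apply: lt_trans tp _; rewrite /b (_ : _ * _ = pi + nu / M ^+ 2).
    by rewrite ltrDl divr_gt0 // exprn_gt0.
  by field; rewrite nn Mn.
have b0' : 0 <= b by lra. have pi0' : th 0 <= pi by rewrite th0 ltW.
have [T [T0 Tb ET]] := ivt b0' (fun x _ _ => @arc_cont_th _ _ _ _ _ _ _ ha x) pi0' thb.
have {}T0 : 0 < T.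
  rewrite lt_neqAle T0 andbT; apply/negP => /eqP e.
  by move: ET; rewrite -e th0 => e2; move: pi0; rewrite -e2 ltxx.
have iso : iso_on m c 0 (T + 1).
  move=> s t s0 _ t0 _; have [_ /(_ s t s0 t0)] := c_ray; rewrite (rdist_D Hm) => h.
  by case: h.
have cT : (c T).2 = 0 by rewrite hth ?(ltW T0) /= ?ET ?sinpi ?mulr0 //; lra.
have c02 : (c 0).2 = 0 by rewrite c0.
(* At angle pi the ray is back on its axis of symmetry and, being minimal beyond that point, would
   have Clairaut constant 0. *)
have := axis_corner Hm iso T0 ltac:(lra) c02 cT; rewrite hnu => e.
by move: n0; rewrite e ltxx.
Qed.
End Inward.

Lemma critical_ray_outward c : ray m c -> enorm (c 0) = r1 -> 0 < rvel c 0.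
Proof.
move=> hc e0; rewrite ltNge; apply/negP => v0; have rp := r10.
have z0 : c 0 <> 0 by move=> e; move: rp; rewrite -e0 e enorm0 ltxx.
have pe : enorm (c 0) = enorm ((r1, 0) : R * R).
  by rewrite e0 /enorm /edot /= mul0r addr0 -expr2 sqrtr_sqr gtr0_norm.
have [a [b [ab E]]] := orth_between z0 pe.
have s11 : 1 ^+ 2 = 1 :> R by rewrite expr1n.
have rvE (a' b' sg : R) c' : a' ^+ 2 + b' ^+ 2 = 1 -> sg ^+ 2 = 1 -> ray m c' ->
    rvel (fun t => orth a' b' sg (c' t)) 0 = rvel c' 0.
  move=> h1 h2 h3; rewrite /rvel (vel_orth Hm) ?edot_orth ?enorm_orth //.
  exact: ray_liso.
pose c1 t := orth a b 1 (c t); have hc1 : ray m c1 by exact: ray_orth.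
have v1 : rvel c1 0 <= 0 by rewrite rvE.
have li t := ray_liso Hm t hc1.
pose nu := clairaut c1 0; have hnu t : clairaut c1 t = nu by exact: liso_all_clairaut.
have [n0|n0] := eqVneq nu 0.
  (* A straight ray that does not point outward has [t1 = r1] and direction [(-1, 0)]. *)
  apply: no_diametral_ray => t t0.
  have g1 : -1 < t + 1 by lra.
  have [t1 [u [u1 h]]] := liso_clairaut0_line Hm g1 (fun t _ _ => li t)
    (fun t _ _ => etrans (hnu t) n0).
  have h0 := h 0 ltac:(lra) ltac:(lra); have ht := h t ltac:(lra) ltac:(lra).
  have d01 : 0 < 1 :> R by lra.
  have vu : vel c1 0 = u.
    rewrite -[RHS](vel_scal u t1 0); apply: (vel_near d01) => s.
    by rewrite subr0 ltr_norml => /andP[? ?]; apply: h; lra.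
  have t1E : t1 = r1.
    have : enorm (c1 0) = `|t1|.
      by rewrite h0 -/(scal (0 - t1) u) enormZ u1 mulr1 sub0r normrN.
    have : rvel c1 0 = - t1 / enorm (c1 0).
      rewrite /rvel vu h0 (_ : edot _ u = - t1 * edot u u); last by rewrite /edot /=; ring.
      by rewrite -sqr_enorm u1 expr1n mulr1.
    rewrite /c1 enorm_orth // e0 => E1 E2.
    have : 0 <= t1.
      move: v1; rewrite -[c1]/(fun t => orth a b 1 (c t)) E1 mulNr oppr_le0 pmulr_lge0 //.
      by rewrite invr_gt0.
    by move=> h1; rewrite E2 ger0_norm.
  have u2 : u = (-1, 0).
    have E0 : c1 0 = (r1, 0) by exact: E.
    have rn : r1 != 0 by rewrite gt_eqF.
    rewrite [LHS]surjective_pairing; have := congr1 fst h0; have := congr1 snd h0.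
    rewrite E0 t1E /= sub0r => g2 g3; congr pair; apply: (mulfI rn).
      by rewrite mulrN1 {2}g3; ring.
    by rewrite mulr0 -oppr0 {1}g2; ring.
  have [_ /(_ 0 t (lexx _) t0)] := hc1; rewrite (rdist_D Hm) sub0r normrN (ger0_norm t0) => -[].
  have -> : c1 0 = (r1, 0) by exact: E.
  by rewrite ht t1E u2 /= (_ : (t - r1) * -1 = r1 - t) ?mulr0 //; ring.
pose sg := Num.sg nu; have sg1 : sg ^+ 2 = 1 by rewrite sqr_sg n0.
have e10 : 1 ^+ 2 + 0 ^+ 2 = 1 :> R by rewrite expr1n expr0n addr0.
pose c2 t := orth 1 0 sg (c1 t); have hc2 : ray m c2 by exact: ray_orth.
have nup : 0 < `|nu| by rewrite normr_gt0.
have hnu2 t : clairaut c2 t = `|nu|.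
  by rewrite /c2 (clairaut_orth Hm) // hnu [RHS]normrEsg.
have c20 : c2 0 = (r1, 0).
  by rewrite /c2 /c1 E /orth /=; congr pair; ring.
have := v1; rewrite -(rvE 1 0 sg c1 e10 sg1 hc1) -/c2 le_eqVlt => /predU1P[h|h].
  exact: (not_tangential hc2 nup hnu2 c20).
exact: (not_inward hc2 nup hnu2 c20).
Qed.

End CriticalParallel.

(** * Total curvature and connectedness *)

Section Curvature.
Variable R : realType.
Variable m : R -> R.
Hypothesis Hm : admissible_profile m.
Hypothesis Hv : von_Mangoldt m.
Hypothesis Hneg : exists r : R, 0 <= r /\ Gm m r < 0.
Hypothesis Hinf : exists2 c : R, 0 < c & \forall r \near +oo, c <= m r.
Notation mu := (@lebesgue_measure R).
Notation m2 := (derivs m 2).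

Lemma Gm_m (r : R) : 0 <= r -> Gm m r * m r = - m2 r.
Proof.
rewrite le_eqVlt => /predU1P[<-|r0]; first by rewrite (m_0 Hm) mulr0 (m2_0 Hm) oppr0.
by rewrite /Gm gt_eqF // -derivsE divfK // gt_eqF // (m_gt0 Hm).
Qed.

(** The integrand is [- m'']. Beyond [a] it is at most [- d], so its negative part has infinite
    integral, while its positive part lives on [[0, a]], where it is bounded. *)
Lemma total_curvature_Ny : total_curvature m = -oo%E.
Proof.
have [d [a [d0 a0 hd]]] := m2_eventually Hv Hneg Hinf.
pose F (r : R) : \bar R := (- m2 r)%:E.
have cF : continuous (fun r => - m2 r).
  by move=> x; apply: cvgN; exact: der_cont (der_m2 Hm x).
have mF (D : set R) : measurable_fun D F.
  apply/measurable_EFinP/(@measurable_funS _ _ _ _ setT) => //.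
  exact: continuous_measurable_fun.
rewrite /total_curvature (_ : (\int[mu]_(r in `[0%R, +oo[) _)%E = -oo%E); last first.
  rewrite (@eq_integral _ _ _ mu _ F); last first.
    by move=> x; rewrite inE /= in_itv /= andbT => x0; rewrite Gm_m.
  rewrite integralE.
  have -> : (\int[mu]_(x in `[0%R, +oo[) F^\- x = +oo)%E.
    apply/eqP; rewrite -leye_eq.
    have h1 : (\int[mu]_(x in `[a, +oo[) d%:E <= \int[mu]_(x in `[a, +oo[) F^\- x)%E.
      apply: ge0_le_integral => //.
      - by move=> x _; rewrite lee_fin ltW.
      - exact: (measurable_funeneg (mF _)).
      - move=> x; rewrite /= in_itv /= andbT => ax.
        by rewrite funenegE le_max; apply/orP; left; rewrite lee_fin opprK hd.
    have h2 : (\int[mu]_(x in `[a, +oo[) d%:E = +oo)%E.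
      by rewrite integral_cst //= lebesgue_measure_itv /= ltry gt0_muley ?lte_fin.
    rewrite h2 in h1.
    apply: le_trans h1 _; apply: ge0_subset_integral => //.
      exact: (measurable_funeneg (mF _)).
    by apply: subset_itvr; rewrite bnd_simp ltW.
  have : (\int[mu]_(x in `[0%R, +oo[) F^\+ x < +oo)%E.
    have -> : (\int[mu]_(x in `[0%R, +oo[) F^\+ x = \int[mu]_(x in `[0%R, a]) F^\+ x)%E.
      rewrite integral_mkcond [RHS]integral_mkcond; apply: eq_integral => x _.
      rewrite !patchE !mem_setE !in_itv /= andbT.
      have [x0|x0] := leP 0 x; have [xa|xa] := leP x a => //=.
      rewrite funeposE /F max_r // lee_fin oppr_le0.
      by apply: le_trans (ltW d0) (hd _ (ltW xa)).
    have iF : mu.-integrable `[0%R, a] F.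
      apply: continuous_compact_integrable; first exact: segment_compact.
      exact: continuous_subspaceT.
    by apply: integral_funepos_lt_pinfty.
  case: (integral _ _ _) => // r _.
by rewrite gt0_muleNy // lte_fin mulr_gt0 // pi_gt0.
Qed.

End Curvature.

(** * The sets A and C on both sides of the critical parallel *)

Section Connectedness.
Variable R : realType.
Variable m : R -> R.
Hypothesis Hm : admissible_profile m.
Hypothesis Hv : von_Mangoldt m.
Hypothesis Hneg : exists r : R, 0 <= r /\ Gm m r < 0.
Hypothesis Hinf : exists2 c : R, 0 < c & \forall r \near +oo, c <= m r.
Implicit Types (p q v : R * R) (r : R).

Lemma continuous_enorm : continuous (@enorm R).
Proof.
move=> p; rewrite /continuous_at /enorm; apply: continuous_cvg; first exact: sqrt_continuous.
by apply: cvgD; apply: cvgM; solve [exact: cvg_fst|exact: cvg_snd].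
Qed.

Lemma connected_enorm (A : set (R * R)) p q (r : R) : connected A -> A p -> A q ->
  enorm p < r -> r < enorm q -> exists2 x, A x & enorm x = r.
Proof.
move=> cA Ap Aq pr rq.
have : connected (@enorm R @` A).
  by apply: connected_continuous_connected => //; apply: continuous_subspaceT; exact: continuous_enorm.
move=> /connected_intervalP h.
have [|||x Ax E] := h (enorm p) (enorm q) _ _ r.
- by exists p.
- by exists q.
- by rewrite !ltW.
by exists x.
Qed.

Section FirstZero.
Variable r1 : R.
Hypothesis r10 : 0 < r1.
Hypothesis out : forall c, ray m c -> enorm (c 0) = r1 -> 0 < rvel c 0.

Lemma critical_notin_Aset q : enorm q = r1 -> ~ Aset m q.
Proof.
move=> qr [q0 [c [hc c0]]]; rewrite gm_rvel // oppr_gt0.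
have := @out c hc; rewrite c0 => /(_ qr) v0; rewrite ltNge => /negP; apply.
by rewrite mulr_ge0 ?enorm_ge0 // ltW.
Qed.

Lemma critical_notin_Cset q : enorm q = r1 -> ~ Cset m q.
Proof.
move=> qr h; have rp := r10.
have q0 : q <> 0 by move=> e; move: rp; rewrite -qr e enorm0 ltxx.
have r0 := enorm_neq0 q0; have rn : enorm q != 0 by rewrite gt_eqF.
(* The inward unit vector: some ray from [q] would make an angle at most pi/2 with it, but all rays
   from [q] point strictly outward. *)
pose v := scal (enorm q)^-1 (- q).
have gv w : gm m q v w = - (edot q w / enorm q).
  rewrite gm_polar2 // (_ : cross q v = 0); last by rewrite /cross /v /scal /=; ring.
  rewrite (_ : edot q v = - (enorm q)^-1 * edot q q); last by rewrite /edot /v /scal /=; ring.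
  by rewrite -sqr_enorm; field.
have ev : edot q v = - enorm q.
  rewrite (_ : edot q v = - (enorm q)^-1 * edot q q); last by rewrite /edot /v /scal /=; ring.
  by rewrite -sqr_enorm; field.
have [|c [hc c0]] := h v; first by rewrite gv ev mulNr opprK divff.
rewrite gv oppr_ge0; have := @out c hc; rewrite c0 => /(_ qr); rewrite /rvel c0.
by rewrite ltNge => /negP.
Qed.

(** At a pole other than the origin the geodesic through the origin is a ray, and it starts
    inward. *)
Lemma Aset_near : exists2 q, Aset m q & enorm q < r1.
Proof.
have [e e0 he] := poles_near_origin Hm Hv Hneg Hinf; have rp := r10.
have [rho [h0 he1 hr]] := two_bounds e0 r10.
pose u : R * R := (-1, 0).
have u1 : enorm u = 1 by rewrite /enorm /edot /= mul0r addr0 mulrNN mulr1 sqrtr1.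
pose c t := scal (t - rho) u.
have cn : enorm (c 0) = rho by rewrite enormZ u1 mulr1 sub0r normrN gtr0_norm.
exists (c 0); last by rewrite cn.
apply: (Aset_ray Hm).
- by move=> E; move: h0; rewrite -cn E enorm0 ltxx.
- apply: (he (c 0)) => //; first by rewrite cn ltW.
  exact: radial_line_geodesic.
rewrite /rvel vel_scal cn.
rewrite (_ : edot _ _ = - rho); last by rewrite /edot /c /scal /u /=; ring.
by rewrite mulNr divff ?gt_eqF // oppr_lt0.
Qed.

Lemma Cset_origin : Cset m 0.
Proof.
move=> v; have E w : gm m 0 v w = edot v w by rewrite /gm eqxx.
rewrite E => v1; exists (fun t => scal (t - - 0) v); split.
- apply: (meridian_ray Hm Hv Hneg Hinf) => //.
  by rewrite /enorm v1 sqrtr1.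
- by rewrite oppr0 subr0 /scal !mul0r.
by rewrite vel_scal E v1.
Qed.

Lemma far_exists : exists q, [/\ Aset m q, Cset m q & r1 < enorm q].
Proof.
have [B hB] := far_points Hm Hv Hneg Hinf; have rp := r10.
pose q : R * R := (`|B| + r1 + 1, 0); have B0 := normr_ge0 B.
have qn : enorm q = `|B| + r1 + 1.
  by rewrite /enorm /edot /= mul0r addr0 -expr2 sqrtr_sqr ger0_norm //; lra.
have [] := hB q; first by rewrite qn; have := ler_norm B; lra.
by move=> h1 h2; exists q; split=> //; rewrite qn; lra.
Qed.

Lemma not_connected_A_C : ~ connected (Aset m) /\ ~ connected (Cset m).
Proof.
have [q [qA qC qr]] := far_exists; split=> h.
  have [p pA pr] := Aset_near.
  have [x xA xr] := connected_enorm h pA qA pr qr; exact: critical_notin_Aset xA.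
have o1 : enorm (0 : R * R) < r1 by rewrite enorm0.
have [x xC xr] := connected_enorm h Cset_origin qC o1 qr; exact: critical_notin_Cset xC.
Qed.
End FirstZero.

End Connectedness.

Theorem theorem1p9 (R : realType) (m : R -> R) :
  admissible_profile m -> von_Mangoldt m ->
  (exists r : R, 0 <= r /\ Gm m r < 0) ->
  (exists2 c : R, 0 < c & \forall r \near +oo, c <= m r) ->
  [/\ (exists l : R -> R * R, line m l) /\ total_curvature m = -oo%E,
      (exists r : R, 0 < r /\ derive1 m r = 0) ->
          ~ connected (Aset m) /\ ~ connected (Cset m),
      (exists B : R, forall q : R * R, ~ Aset m q -> enorm q <= B)
    & exists2 e : R, 0 < e & forall q : R * R, enorm q <= e -> pole m q].
Proof.
move=> Hm Hv Hneg Hinf; split.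
- split; last exact: total_curvature_Ny.
  have [l hl] := line_exists Hm Hv Hneg Hinf; exists l; split.
    by apply/(geodesicP Hm) => t; exists 1; rewrite ?ltr01.
  by move=> s t; rewrite (rdist_D Hm) hl.
- move=> [b [b0 mb]].
  have m1b : derivs m 1 b <= 0 by rewrite derivsE /= mb.
  have m10 : 0 < derivs m 1 0 by rewrite (m1_0 Hm).
  (* The first zero is taken because [m'] must be positive at all smaller radii. *)
  have [r1 [r10 _ mr1 pos]] := first_zero (ltW b0)
    (fun x _ _ => der_cont (der_m1 Hm x)) m10 m1b.
  apply: (not_connected_A_C Hm Hv Hneg Hinf r10) => c.
  exact: (critical_ray_outward Hm Hv r10 mr1 pos).
- have [B hB] := far_points Hm Hv Hneg Hinf; exists B => q nA.
  by rewrite leNgt; apply/negP => /hB [].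
exact: poles_near_origin.
Qed.
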